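(* Let $P=\{p_1,\dots,p_n\}\subset\mathbb{R}^2$, $n\ge 3$, be in general position. There is a choice of real numbers $f=(f_{ij})_{1\le i<j\le n}$ such that the polyhedron $\bar X_f(P)$ of constrained expansions has the following properties. 1. $\bar X_f(P)$ is a simple polyhedron of dimension $2n-3$, and the map $K\mapsto E(K)$ is an inclusion-reversing bijection between the nonempty faces of $\bar X_f(P)$ and the pointed non-crossing graphs embedded on $P$. In particular: (a) the vertices of $\bar X_f(P)$ are in bijection with the pointed pseudo-triangulations of $P$; (b) the bounded edges of $\bar X_f(P)$ correspond to pointed pseudo-triangulations with one interior (non-convex-hull) edge removed, i.e. to flips between pointed pseudo-triangulations; (c) the extreme rays (unbounded edges) of $\bar X_f(P)$ correspond to pointed pseudo-triangulations with one convex hull edge removed. 2. The face $X_f(P)$ is bounded (a polytope) and contains all vertices of $\bar X_f(P)$; it is the unique maximal bounded face of $\bar X_f(P)$, and its 1-skeleton is isomorphic to the graph of flips between pointed pseudo-triangulations of $P$.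
   Context: A point set in $\mathbb{R}^2$ is in general position if no three of its points are collinear. A graph embedded on $P$ has vertex set $P$ and straight-segment edges; it is non-crossing if edges meet only at common endpoints; it is pointed at a vertex $p$ if some angle at $p$ between consecutive incident edges is strictly larger than $\pi$ (vertices of degree $\le 1$ count as pointed), and pointed if pointed at every vertex. A pseudo-triangle is a simple polygon with exactly three convex vertices. A pseudo-triangulation of $P$ is a non-crossing graph on $P$ whose edges partition the convex hull of $P$ into pseudo-triangles; it is pointed if the graph is pointed. Two pointed pseudo-triangulations are related by a flip if one is obtained from the other by removing one interior edge (an edge not on the convex hull boundary) and inserting a different edge. An infinitesimal motion is $v=(v_1,\dots,v_n)\in(\mathbb{R}^2)^n$. Label points so that $p_1,p_2$ have different $y$-coordinates and impose the normalization $v_1^1=v_1^2=v_2^1=0$ (superscripts denote coordinates). For $f=(f_{ij})$, the polyhedron of constrained expansions $\bar X_f(P)$ is the set of normalized $v$ with $\langle p_i-p_j, v_i-v_j\rangle\ge f_{ij}$ for all $1\le i<j\le n$. For a face $K$ (or a point $v$), $E(K)$ (resp. $E(v)$) is the set of pairs $ij$ whose inequality holds with equality on all of $K$ (resp. at $v$), viewed as a graph embedded on $P$. $X_f(P)$ is the subset of $\bar X_f(P)$ where the inequalities for all convex hull edges $ij$ of $P$ hold with equality. *)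

(* Defs.v *)
From Stdlib Require List.
From HB Require Import structures.
From mathcomp Require Import all_boot all_order all_algebra.
From mathcomp Require Import all_classical all_reals all_analysis.
Set Implicit Arguments. Unset Strict Implicit. Unset Printing Implicit Defensive.
Import Order.TTheory GRing.Theory Num.Theory.
Import numFieldNormedType.Exports.
Local Open Scope ring_scope.

Section PlaneGeometry.
Variable R : realType.
Implicit Types a b c x y : (R * R)%type.

(* orient a b c > 0 iff (a,b,c) is a counterclockwise triple *)
Definition orient a b c : R :=
  (b.1 - a.1) * (c.2 - a.2) - (b.2 - a.2) * (c.1 - a.1).

Definition in_seg a b x : Prop :=
  exists t : R, 0 <= t <= 1 /\ x = (a.1 + t * (b.1 - a.1), a.2 + t * (b.2 - a.2)).

Definition bounded_plane (S : set (R * R)) : Prop :=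
  exists M : R, forall y, S y -> `|y.1| <= M /\ `|y.2| <= M.

Definition pvtx (s : seq (R * R)) (i : nat) := nth (0, 0) s (i %% size s).

Definition on_side (s : seq (R * R)) (i : nat) x := in_seg (pvtx s i) (pvtx s i.+1) x.

Definition simple_polygon (s : seq (R * R)) : Prop :=
  (3 <= size s)%N /\ uniq s /\
  forall i j, (i < size s)%N -> (j < size s)%N -> i <> j ->
    forall x, on_side s i x -> on_side s j x ->
      (j = (i.+1 %% size s)%N /\ x = pvtx s j) \/
      (i = (j.+1 %% size s)%N /\ x = pvtx s i).

Definition poly_boundary (s : seq (R * R)) : set (R * R) :=
  fun x => exists i, (i < size s)%N /\ on_side s i x.

Definition poly_interior (s : seq (R * R)) : set (R * R) :=
  fun x => ~ poly_boundary s x /\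
    bounded_plane (connected_component (fun y => ~ poly_boundary s y) x).

(* the vertex i is convex: the interior angle at it is smaller than pi, i.e. near
   the vertex the interior lies strictly on one side of a line through it *)
Definition convex_vertex (s : seq (R * R)) (i : nat) : Prop :=
  exists (c : R * R) (eps : R), 0 < eps /\
    forall x, poly_interior s x ->
      `|x.1 - (pvtx s i).1| < eps -> `|x.2 - (pvtx s i).2| < eps ->
      0 < c.1 * (x.1 - (pvtx s i).1) + c.2 * (x.2 - (pvtx s i).2).

Definition pseudo_triangle (s : seq (R * R)) : Prop :=
  simple_polygon s /\
  count (fun i => `[< convex_vertex s i >]) (iota 0 (size s)) = 3%N.

End PlaneGeometry.

Section PointSets.
Variables (R : realType) (n : nat) (p : 'I_n -> (R * R)%type).

Definition general_position : Prop :=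
  forall i j k : 'I_n, i != j -> j != k -> i != k -> orient (p i) (p j) (p k) != 0.

(* A graph embedded on P: a set of pairs (i,j) with i < j, standing for the
   straight segment [p_i, p_j]. *)
Definition graph_on (G : {set 'I_n * 'I_n}) : Prop :=
  forall e, e \in G -> (e.1 < e.2)%N.

Definition adj (G : {set 'I_n * 'I_n}) (k l : 'I_n) : bool :=
  ((k, l) \in G) || ((l, k) \in G).

Definition non_crossing (G : {set 'I_n * 'I_n}) : Prop :=
  forall e e', e \in G -> e' \in G -> e != e' ->
    forall x, in_seg (p e.1) (p e.2) x -> in_seg (p e'.1) (p e'.2) x ->
      exists k : 'I_n, ((k == e.1) || (k == e.2)) && ((k == e'.1) || (k == e'.2))
                       /\ x = p k.

(* pointed at p_k: degree <= 1, or there are consecutive (in ccw order) incident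
   edges k-a, k-b such that the ccw angle from k-a to k-b is > pi
   (orient < 0) and no incident edge lies strictly inside that angle *)
Definition pointed_at (G : {set 'I_n * 'I_n}) (k : 'I_n) : Prop :=
  (#|[set l | adj G k l]| <= 1)%N \/
  exists a b : 'I_n, adj G k a /\ adj G k b /\ a != b /\
    orient (p k) (p a) (p b) < 0 /\
    forall c, adj G k c -> 0 <= orient (p k) (p b) (p c) /\ 0 <= orient (p k) (p c) (p a).

Definition pointed (G : {set 'I_n * 'I_n}) : Prop := forall k, pointed_at G k.

Definition pointed_noncrossing (G : {set 'I_n * 'I_n}) : Prop :=
  graph_on G /\ non_crossing G /\ pointed G.

Definition conv_hull : set (R * R) :=
  fun x => exists w : 'I_n -> R, (forall i, 0 <= w i) /\ \sum_i w i = 1 /\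
    x = (\sum_i w i * (p i).1, \sum_i w i * (p i).2).

Definition hull_edge (i j : 'I_n) : Prop :=
  i != j /\
  ((forall k, k != i -> k != j -> 0 < orient (p i) (p j) (p k)) \/
   (forall k, k != i -> k != j -> orient (p i) (p j) (p k) < 0)).

Definition regions (G : {set 'I_n * 'I_n}) : set (R * R) :=
  fun x => conv_hull x /\ (forall k, x <> p k) /\
           (forall e, e \in G -> ~ in_seg (p e.1) (p e.2) x).

Definition pseudo_triangulation (G : {set 'I_n * 'I_n}) : Prop :=
  graph_on G /\ non_crossing G /\
  forall x, regions G x ->
    exists s : seq (R * R), (forall y, y \in s -> exists k, y = p k) /\
      pseudo_triangle s /\
      connected_component (regions G) x = poly_interior s.

Definition ppt (G : {set 'I_n * 'I_n}) : Prop := pseudo_triangulation G /\ pointed G.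

Definition flip (T T' : {set 'I_n * 'I_n}) : Prop :=
  exists e e', e \in T /\ ~ hull_edge e.1 e.2 /\ e' \notin T /\ T' = e' |: (T :\ e).

(* a motion is an n x 2 matrix: row i is v_i, column ord0 / ord_max = x / y *)
Definition ipm (v : 'M[R]_(n, 2)) (i j : 'I_n) : R :=
  ((p i).1 - (p j).1) * (v i ord0 - v j ord0) +
  ((p i).2 - (p j).2) * (v i ord_max - v j ord_max).

Definition labeled_y : Prop :=
  forall i j : 'I_n, val i = 0%N -> val j = 1%N -> (p i).2 != (p j).2.

Definition normalized (v : 'M[R]_(n, 2)) : Prop :=
  forall i : 'I_n, (val i = 0%N -> v i ord0 = 0 /\ v i ord_max = 0) /\
                   (val i = 1%N -> v i ord0 = 0).

Definition Xbar (f : 'I_n -> 'I_n -> R) : set 'M[R]_(n, 2) :=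
  fun v => normalized v /\ forall i j : 'I_n, (i < j)%N -> f i j <= ipm v i j.

Definition Xhull (f : 'I_n -> 'I_n -> R) : set 'M[R]_(n, 2) :=
  fun v => Xbar f v /\ forall i j : 'I_n, (i < j)%N -> hull_edge i j -> ipm v i j = f i j.

Definition Etight (f : 'I_n -> 'I_n -> R) (K : set 'M[R]_(n, 2)) : {set 'I_n * 'I_n} :=
  [set e : 'I_n * 'I_n | `[< (e.1 < e.2)%N /\ forall v, K v -> ipm v e.1 e.2 = f e.1 e.2 >] ].

End PointSets.

Section Polyhedra.
Variables (R : realType) (n m : nat).
Local Notation M := 'M[R]_(n, m).

Definition lin (c x : M) : R := \sum_i \sum_j c i j * x i j.

(* faces: intersections with supporting hyperplanes (the whole set included) *)
Definition is_face (Q K : set M) : Prop :=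
  exists (c : M) (d : R), (forall x, Q x -> lin c x <= d) /\
    K = (fun x => Q x /\ lin c x = d).

Definition nonempty_face (Q K : set M) : Prop := is_face Q K /\ exists x, K x.

Definition aff_indep (s : seq M) : bool :=
  if s is x :: s' then free [seq y - x | y <- s'] else false.

Definition affdim (S : set M) (k : nat) : Prop :=
  (exists s : seq M, size s = k.+1 /\ (forall x, x \in s -> S x) /\ aff_indep s) /\
  (forall s : seq M, (forall x, x \in s -> S x) -> aff_indep s -> (size s <= k.+1)%N).

Definition bounded_set_M (S : set M) : Prop :=
  exists B : R, forall x, S x -> forall i j, `|x i j| <= B.

Definition is_vertex (Q : set M) (v : M) : Prop := is_face Q (fun x => x = v).

Definition simple_polyhedron (Q : set M) (d : nat) : Prop :=
  affdim Q d /\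
  forall v, is_vertex Q v ->
    exists Fs : seq (set M), List.NoDup Fs /\ size Fs = d /\
      forall F, (is_face Q F /\ affdim F d.-1 /\ F v) <-> List.In F Fs.

Definition skel_adj (Q : set M) (u v : M) : Prop :=
  u <> v /\ exists F, is_face Q F /\ affdim F 1 /\ F u /\ F v.

End Polyhedra.

(* Main.v *)
(* An equilibrium stress w of the complete graph on P has a Maxwell lifting: a compactly supported
   piecewise linear function whose crease along e is w_e. If the edges with w_e < 0 form a pointed
   non-crossing graph, the lifting has no positive local maximum, hence is nonpositive. Taking for
   f_e the sum, over finitely many sample points, of the contribution of a unit stress on e to the
   lifting, sum_e w_e f_e becomes a sum of values of the lifting, hence negative unless w = 0.
   By Farkas' lemma this makes every pointed non-crossing graph the tight set of some point of the
   polyhedron and makes these graphs stress-free (so |G| <= 2n-3 and faces have dimension 2n-3-|G|),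
   while a crossing or a non-pointed vertex among tight edges carries a stress on four points that
   contradicts the inequality.

   It remains to see that pointed pseudo-triangulations are the pointed non-crossing graphs with
   2n-3 edges. Winding numbers give the Jordan theorem for the cycles of a plane graph. If an edge
   could be added to a pseudo-triangulation, it would be a chord of a face, and both parts have at
   least three corners; by pointedness the face would have at least four. Conversely, in a graph
   with 2n-3 edges, Laman's count |E(U)| <= 2|U|-3 gives 2-connectivity, so the faces are bounded by
   cycles; circulations show that there are at least n-2 faces, each with at least three corners,
   whereas pointedness allows at most sum_k (deg k - 1) = 3n-6 corners in all. *)
Require Import Defs.
From HB Require Import structures.
From mathcomp Require Import all_boot all_order all_algebra.
From mathcomp Require Import all_classical all_reals all_analysis.
From mathcomp Require Import ring lra zify.
Import Order.TTheory GRing.Theory Num.Theory.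
Import numFieldNormedType.Exports.
Set Implicit Arguments. Unset Strict Implicit. Unset Printing Implicit Defensive.
Local Open Scope ring_scope.
Local Open Scope classical_set_scope.

(** * Winding numbers *)

Section Crossing.
Variable R : realType.
Implicit Types a b c d x y : (R * R)%type.

(** The weights and the plane topology rest on one tool. The torques of an equilibrium stress about
    a point [x] form a circulation, and its winding number about [x] is the lifting at [x];
    circulations along cycles of a graph give the Jordan theorem. Both need winding numbers that do
    not depend on the direction of the ray, because each local argument picks its own generic
    direction. An explicit formula for [f] is avoided: only the strict sign of sum_e w_e f_e
    matters, and strictness needs sample points at which the lifting of a nonzero stress cannot
    vanish everywhere. Three collinear points across each edge suffice, since the second difference
    of the lifting there recovers w_e up to a nonzero factor. Boundedness needs a separate argument:
    an expansive motion that keeps the lengths of all hull edges is rigid, so the face where the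
    hull edges are tight has no recession direction. A hull edge can be added to every pointed
    non-crossing graph, hence lies in each one with 2n-3 edges. This puts all vertices on that face
    and singles out the removal of a hull edge as the source of the rays. *)

Definition side d x a : R := d.1 * (a.2 - x.2) - d.2 * (a.1 - x.1).

Definition cross a b : R := a.1 * b.2 - a.2 * b.1.
Definition dot a b : R := a.1 * b.1 + a.2 * b.2.
Definition perp a : R * R := (- a.2, a.1).
Definition vec x y : R * R := (y.1 - x.1, y.2 - x.2).
Definition step x (t : R) d : R * R := (x.1 + t * d.1, x.2 + t * d.2).

(* The ray is closed on its left and open on its right, so that a segment ending on
   the ray is counted consistently with its neighbours. *)
Definition cr d x a b : R :=
  if [&& side d x a < 0, 0 <= side d x b & 0 < orient x a b] then 1
  else if [&& side d x b < 0, 0 <= side d x a & orient x a b < 0] then -1 else 0.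

Lemma in_seg_l a b : in_seg a b a.
Proof. by exists 0; rewrite lexx ler01 !mul0r !addr0; split => //; case: a. Qed.

Lemma in_seg_r a b : in_seg a b b.
Proof.
exists 1; rewrite lexx ler01 !mul1r; split => //.
by case: a b => [a1 a2] [b1 b2] /=; congr pair; ring.
Qed.

Lemma in_segC a b x : in_seg a b x -> in_seg b a x.
Proof.
case=> t [/andP[t0 t1] ->]; exists (1 - t); split; first by apply/andP; split; lra.
by congr pair; ring.
Qed.

(** As [x] is on the line of [a] and [b] but not between them, [b - x] is a positive multiple of
    [a - x], and [side] is linear in this vector. *)
Lemma colinear_same_side x a b d : orient x a b = 0 -> ~ in_seg a b x ->
  (0 <= side d x a) = (0 <= side d x b).
Proof.
move=> o0 nseg.
case: a b d x o0 nseg => [a1 a2] [b1 b2] [d1 d2] [x1 x2]; rewrite /orient /side /= => o0 nseg.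
set q1 := a1 - x1 in o0 *; set q2 := a2 - x2 in o0 *.
set r1 := b1 - x1 in o0 *; set r2 := b2 - x2 in o0 *.
have Q : q1 * q1 + q2 * q2 > 0.
  rewrite lt_neqAle; apply/andP; split; last by nra.
  apply/eqP => q0; apply: nseg.
  have [q10 q20] : q1 = 0 /\ q2 = 0 by split; nra.
  exists 0; split; first by rewrite lexx ler01.
  by congr pair; rewrite /=; move: q10 q20; rewrite /q1 /q2; lra.
have S : q1 * r1 + q2 * r2 > 0.
  rewrite ltNge; apply/negP => s0; apply: nseg.
  set Q2 := q1 * q1 + q2 * q2 in Q; set s := q1 * r1 + q2 * r2 in s0.
  have D : Q2 - s > 0 by lra.
  (* For this t the convex combination (1 - t) q + t r of the two parallel vectors vanishes. *)
  exists (Q2 / (Q2 - s)); split.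
    apply/andP; split; first by apply: divr_ge0; lra.
    by rewrite ler_pdivrMr //; lra.
  have K : q1 * r2 = q2 * r1 by lra.
  have E1 : q1 * s = Q2 * r1 by rewrite /Q2 /s; ring: K.
  have E2 : q2 * s = Q2 * r2 by rewrite /Q2 /s; ring: K.
  have Dn : Q2 - s != 0 by rewrite gt_eqF.
  have A1 : a1 = x1 + q1 by rewrite /q1; ring.
  have A2 : a2 = x2 + q2 by rewrite /q2; ring.
  have B1 : b1 = x1 + r1 by rewrite /r1; ring.
  have B2 : b2 = x2 + r2 by rewrite /r2; ring.
  clearbody q1 q2 r1 r2 Q2 s.
  congr pair => /=; apply: (mulIf Dn); rewrite mulrDl [Q2 / _ * _ * _]mulrAC divfK //.
    by rewrite A1 B1; ring: E1.
  by rewrite A2 B2; ring: E2.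
have E : (q1 * q1 + q2 * q2) * (d1 * r2 - d2 * r1) = (q1 * r1 + q2 * r2) * (d1 * q2 - d2 * q1).
  have K : q1 * r2 = q2 * r1 by lra.
  ring: K.
by rewrite -[RHS](pmulr_rge0 _ Q) E pmulr_rge0.
Qed.

(* Rotating the ray from d to d' changes the crossings by the endpoints in the swept cone. *)
Lemma cr_rotate d d' x a b : 0 < cross d d' -> ~ in_seg a b x ->
  cr d' x a b - cr d x a b =
  ((0 <= side d x a) && (side d' x a < 0))%:R - ((0 <= side d x b) && (side d' x b < 0))%:R.
Proof.
move=> dd nseg.
have E : cross d d' * orient x a b = side d x a * side d' x b - side d x b * side d' x a.
  by rewrite /cross /orient /side; ring.
have [oz|on0] := eqVneq (orient x a b) 0.
  rewrite /cr oz !ltxx !andbF subrr.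
  by rewrite !ltNge !(colinear_same_side _ oz nseg) subrr.
rewrite /cr; move: E on0 dd.
move: (side d x a) (side d x b) (side d' x a) (side d' x b) (orient x a b) (cross d d').
move=> A B A' B' o D E on0 D0.
case: (ltP A 0) => hA; case: (ltP B 0) => hB; case: (ltP A' 0) => hA'; case: (ltP B' 0) => hB'; rewrite /= ?subrr //;
  case: (ltgtP o 0) => ho; rewrite ?ho ?eqxx // in on0 *; rewrite /=; try lra; exfalso; nra.
Qed.

(** Used to exclude crossings: an edge inside a half-plane cannot be hit by a ray that leaves this
    half-plane. *)
Lemma cr_hit d x a b : cr d x a b != 0 -> exists s, 0 < s /\ in_seg a b (step x s d).
Proof.
have gen A B : (A.1 - x.1, A.2 - x.2) != 0 -> side d x A < 0 -> 0 <= side d x B -> 0 < orient x A B ->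
    exists s, 0 < s /\ in_seg A B (step x s d).
  move=> _ hA hB ho.
  have D : 0 < side d x B - side d x A by lra.
  exists (orient x A B / (side d x B - side d x A)); split; first exact: divr_gt0.
  exists (- side d x A / (side d x B - side d x A)); split.
    apply/andP; split; first by apply: divr_ge0; lra.
    by rewrite ler_pdivrMr //; lra.
  have Dn : side d x B - side d x A != 0 by rewrite gt_eqF.
  have K u v : (u / (side d x B - side d x A) * v) * (side d x B - side d x A) = u * v.
    by rewrite mulrAC divfK.
  by rewrite /step; congr pair; apply: (mulIf Dn); rewrite !mulrDl !K /orient /side; ring.
have gen' A B : side d x A < 0 -> 0 <= side d x B -> 0 < orient x A B ->
    exists s, 0 < s /\ in_seg A B (step x s d).
  move=> hA hB ho; apply: gen => //.
  apply/eqP => -[e1 e2]; move: hA; rewrite /side e1 e2; lra.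
rewrite /cr; case: and3P => [[hA hB ho] _|_]; first exact: gen'.
case: and3P => [[hA hB ho] _|_]; last by rewrite eqxx.
have [s [s0 /in_segC hs]] : exists s, 0 < s /\ in_seg b a (step x s d).
  by apply: gen' => //; move: ho; rewrite /orient; lra.
by exists s.
Qed.

End Crossing.

(** * Neighbourhoods, segments and rays in the plane *)

Section PlaneTopology.
Variable R : realType.
Implicit Types x y a b d : (R * R)%type.

(** Square boxes are the neighbourhoods that [convex_vertex] uses; they are also convex, which the
    connectedness arguments exploit. *)
Lemma near_planeP x (P : set (R * R)) :
  (\forall y \near x, P y) <->
  exists2 e : R, 0 < e & forall y, `|y.1 - x.1| < e -> `|y.2 - x.2| < e -> P y.
Proof.
split.
  case/nbhs_ballP => e e0 eP; exists e => // y h1 h2; apply: eP; split => /=; rewrite -ball_normE /ball_ /= distrC //.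
case=> e e0 eP; apply/nbhs_ballP; exists e => // y [] /=.
by rewrite -!ball_normE /ball_ /= => h1 h2; apply: eP; rewrite distrC.
Qed.

Lemma affine_continuous (a b c : R) : continuous (fun y : R * R => a + b * y.1 + c * y.2 : R).
Proof.
move=> y; apply: cvgD; first apply: cvgD; first exact: cvg_cst.
  by apply: cvgM; [exact: cvg_cst|exact: cvg_fst].
by apply: cvgM; [exact: cvg_cst|exact: cvg_snd].
Qed.

Lemma near_affine_gt0 x (f : R * R -> R) (a b c : R) : (forall y, f y = a + b * y.1 + c * y.2) ->
  0 < f x -> \forall y \near x, 0 < f y.
Proof.
move=> fE; have -> : f = (fun y : R * R => a + b * y.1 + c * y.2) by apply/funext.
by move=> f0; exact: (cvgr_gt _ (@affine_continuous a b c x) _ f0).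
Qed.

Lemma sideE d y a : side d y a = (d.1 * a.2 - d.2 * a.1) + d.2 * y.1 + (- d.1) * y.2.
Proof. by rewrite /side; ring. Qed.

Lemma orientE y a b :
  orient y a b = (a.1 * b.2 - a.2 * b.1) + (a.2 - b.2) * y.1 + (b.1 - a.1) * y.2.
Proof. by rewrite /orient; ring. Qed.

Lemma near_sgr x (f : R * R -> R) (a b c : R) : (forall y, f y = a + b * y.1 + c * y.2) ->
  f x != 0 -> \forall y \near x, ((0 < f y) = (0 < f x)) /\ ((f y < 0) = (f x < 0)).
Proof.
move=> fE; rewrite neq_lt => /orP[fx|fx].
  have fx' : 0 < - f x by rewrite oppr_gt0.
  have fE' y : - f y = - a + (- b) * y.1 + (- c) * y.2 by rewrite fE; ring.
  apply: filterS (near_affine_gt0 fE' fx') => y; rewrite oppr_gt0 => h.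
  by rewrite /= h fx; split => //; rewrite !ltNge (ltW h) (ltW fx).
apply: filterS (near_affine_gt0 fE fx) => y h.
by rewrite /= h fx; split => //; rewrite !ltNge (ltW h) (ltW fx).
Qed.

(** If [x] lies on the line of the segment, [orient] may change sign nearby, but then both ends are
    on the same side of the ray and no crossing occurs. *)
Lemma cr_near d x a b : ~ in_seg a b x -> side d x a != 0 -> side d x b != 0 ->
  \forall y \near x, cr d y a b = cr d x a b.
Proof.
move=> nseg sa sb.
have Na := near_sgr (fun y => sideE d y a) sa.
have Nb := near_sgr (fun y => sideE d y b) sb.
have [oz|on0] := eqVneq (orient x a b) 0.
  have S := colinear_same_side d oz nseg.
  apply: filterS2 Na Nb => y [_ ha] [_ hb].
  rewrite /cr ![0 <= _]leNgt ha hb oz ltxx !andbF.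
  by move: S; rewrite ![0 <= _]leNgt => /negb_inj ->; case: (side d x b < 0).
have No := near_sgr (fun y => orientE y a b) on0.
apply: filterS3 Na Nb No => y [_ ha] [_ hb] [ho ho'].
by rewrite /cr ![0 <= _]leNgt ha hb ho ho'.
Qed.

Lemma near_step x d (P : set (R * R)) : (\forall y \near x, P y) ->
  \forall t \near (0 : R)^'+, P (step x t d) /\ P (step x (- t) d).
Proof.
case/near_planeP => e e0 eP.
have D : 0 < `|d.1| + `|d.2| + 1 by rewrite ltr_wpDl // addr_ge0.
apply: filterS2 (nbhs_right_gt (0 : R)) (nbhs_right_lt (divr_gt0 e0 D)) => t t0.
rewrite ltr_pdivlMr // => te.
have A : t * `|d.1| < e.
  by apply: le_lt_trans te; rewrite ler_pM2l //; have := normr_ge0 d.2; lra.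
have B : t * `|d.2| < e.
  by apply: le_lt_trans te; rewrite ler_pM2l //; have := normr_ge0 d.1; lra.
split; apply: eP; rewrite /step /= addrAC subrr add0r normrM ?normrN (gtr0_norm t0) ?A ?B //.
Qed.

Definition seg_map a b (t : R) : R * R := (a.1 + t * (b.1 - a.1), a.2 + t * (b.2 - a.2)).

Lemma seg_map_continuous a b : continuous (seg_map a b).
Proof.
have L (u v : R) : continuous (fun t : R => u + t * v : R).
  by move=> t; apply: cvgD; [exact: cvg_cst|apply: cvgM; [exact: cvg_id|exact: cvg_cst]].
by move=> t; exact: cvg_pair (@L a.1 (b.1 - a.1) t) (@L a.2 (b.2 - a.2) t).
Qed.

Lemma in_segE a b : (in_seg a b : set (R * R)) = seg_map a b @` `[0, 1].
Proof.
apply/seteqP; split => x /=.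
  by case=> t [t01 ->]; exists t => //; rewrite in_itv.
by case=> t; rewrite in_itv /= => t01 <-; exists t.
Qed.

Lemma in_seg_closed a b : closed (in_seg a b : set (R * R)).
Proof.
rewrite in_segE.
apply: compact_closed; first exact: norm_hausdorff.
apply: continuous_compact; last exact: segment_compact.
exact/continuous_subspaceT/seg_map_continuous.
Qed.

Lemma near_not_in_seg a b x : ~ in_seg a b x -> \forall y \near x, ~ in_seg a b y.
Proof.
move=> nx; have : open (~` (in_seg a b : set (R * R))) by rewrite openC; exact: in_seg_closed.
by rewrite openE => /(_ x nx).
Qed.

Lemma connected_in_seg a b : connected (in_seg a b : set (R * R)).
Proof.
rewrite in_segE.
apply: connected_continuous_connected; first exact: segment_connected.
exact/continuous_subspaceT/seg_map_continuous.
Qed.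

Lemma seg_component a b (A : set (R * R)) : (forall z, in_seg a b z -> A z) ->
  connected_component A a b.
Proof.
move=> sA; exists (in_seg a b); last exact: in_seg_r.
by split; [exact: in_seg_l | exact: sA | exact: connected_in_seg].
Qed.

End PlaneTopology.

(** * Winding numbers of circulations: invariance, local constancy and jumps *)

Section Winding.
Variables (R : realType) (n : nat) (p : 'I_n -> (R * R)%type).
Implicit Types (c : 'I_n * 'I_n -> R) (x y m d u : (R * R)%type) (e : 'I_n * 'I_n).

(* The quantification over potentials g is Kirchhoff's law in weak form. *)
Definition circ c : Prop := forall g : 'I_n -> R, \sum_e c e * (g e.1 - g e.2) = 0.

Definition wind d c x : R := \sum_e c e * cr d x (p e.1) (p e.2).

Definition off c x : Prop := forall e, c e != 0 -> ~ in_seg (p e.1) (p e.2) x.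

Definition generic d x : Prop := forall i, p i != x -> side d x (p i) != 0.

Lemma dot_gt0 d : d != 0 -> 0 < dot d d.
Proof.
case: d => d1 d2 dn; rewrite /dot /= lt_neqAle; apply/andP; split; last by nra.
apply/eqP => e0; move/eqP: dn; apply.
have [-> ->] : d1 = 0 /\ d2 = 0 by split; nra.
by [].
Qed.

(** By [cr_rotate] the change along an edge is the difference of a potential at its ends, the
    indicator of the swept cone, so Kirchhoff's law cancels the total. *)
Lemma wind_rotate c x d d' : circ c -> off c x -> 0 < cross d d' -> wind d' c x = wind d c x.
Proof.
move=> cc oc dd; apply/eqP; rewrite -subr_eq0; apply/eqP.
rewrite -(cc (fun i => ((0 <= side d x (p i)) && (side d' x (p i) < 0))%:R)) -sumrB.
apply: eq_bigr => e _; rewrite -mulrBr.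
have [->|cn] := eqVneq (c e) 0; first by rewrite !mul0r.
by rewrite (cr_rotate dd (oc e cn)).
Qed.

(** Parallel directions, whose cross product vanishes, are compared through [perp d]. *)
Lemma wind_dir c x d d' : circ c -> off c x -> d != 0 -> d' != 0 -> wind d' c x = wind d c x.
Proof.
move=> cc oc dn dn'; have [h|h|h] := ltgtP 0 (cross d d').
- exact: wind_rotate.
- by apply/esym/wind_rotate => //; move: h; rewrite /cross; lra.
have dd := dot_gt0 dn; have dd' := dot_gt0 dn'.
have E : dot d d * dot d' d' = dot d d' * dot d d' + cross d d' * cross d d'.
  by rewrite /dot /cross; ring.
have r : wind (perp d) c x = wind d c x.
  by apply: wind_rotate => //; move: dd; rewrite /cross /perp /dot /=; lra.
rewrite -r; have [k|k|k] := ltgtP 0 (dot d d').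
- by apply/esym/wind_rotate => //; move: k; rewrite /cross /perp /dot /=; lra.
- by apply/wind_rotate => //; move: k; rewrite /cross /perp /dot /=; lra.
by move: E; rewrite -h -k; nra.
Qed.

(** The ray in direction [- u] leaves the half-plane that contains all edges and meets none of
    them. *)
Lemma wind_halfplane c x d u : circ c -> off c x -> d != 0 -> u != 0 ->
  (forall e, c e != 0 -> 0 <= dot u (vec x (p e.1)) /\ 0 <= dot u (vec x (p e.2))) ->
  wind d c x = 0.
Proof.
move=> cc oc dn un H.
have un' : - u != 0 by rewrite oppr_eq0.
rewrite (wind_dir cc oc un' dn); apply: big1 => e _.
have [->|cn] := eqVneq (c e) 0; first by rewrite mul0r.
have [->|] := eqVneq (cr (- u) x (p e.1) (p e.2)) 0; first by rewrite mulr0.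
case/cr_hit => s [s0 [t [/andP[t0 t1] [E1 E2]]]]; exfalso.
have [h1 h2] := H e cn; have := dot_gt0 un.
move: E1 E2 h1 h2; rewrite /dot /vec /=; set a := p e.1; set b := p e.2 => E1 E2 h1 h2 uu.
have E1' : a.1 - x.1 = - s * u.1 - t * (b.1 - a.1) by lra.
have E2' : a.2 - x.2 = - s * u.2 - t * (b.2 - a.2) by lra.
have K1 : 0 <= (1 - t) * (u.1 * (a.1 - x.1) + u.2 * (a.2 - x.2)) by apply: mulr_ge0 => //; lra.
have K2 : 0 <= t * (u.1 * (b.1 - x.1) + u.2 * (b.2 - x.2)) by apply: mulr_ge0.
have K : (1 - t) * (u.1 * (a.1 - x.1) + u.2 * (a.2 - x.2)) + t * (u.1 * (b.1 - x.1) + u.2 * (b.2 - x.2))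
  = - s * (u.1 * u.1 + u.2 * u.2).
  have -> : b.1 - x.1 = (a.1 - x.1) + (b.1 - a.1) by ring.
  have -> : b.2 - x.2 = (a.2 - x.2) + (b.2 - a.2) by ring.
  by rewrite E1' E2'; ring.
have := mulr_gt0 s0 uu; lra.
Qed.

(** For each point other than [x] the side is an affine function of t that does not vanish
    identically, so it has no zero for small t > 0. *)
Lemma near_generic d x : d != 0 ->
  \forall t \near (0 : R)^'+, generic (step d t (perp d)) x /\ step d t (perp d) != 0.
Proof.
move=> dn.
have N : \forall t \near (0 : R)^'+, step d t (perp d) != 0.
  apply: filterS (nbhs_right_gt (0 : R)) => t t0; apply/eqP => E.
  have := dot_gt0 dn; have : dot d (step d t (perp d)) = 0 by rewrite E /dot /= !mulr0 addr0.
  by rewrite /dot /step /perp /=; lra.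
suff H : \forall t \near (0 : R)^'+, forall i, p i != x -> side (step d t (perp d)) x (p i) != 0.
  exact: filterI H N.
apply: filter_forall => i.
have [->|pn] := eqVneq (p i) x; first exact: nearW.
have vn : vec x (p i) != 0.
  apply: contra_neq pn; case: (p i) (x) => [a1 a2] [x1 x2] [] /=; rewrite /vec /= => h1 h2.
  by congr pair; lra.
set A := side d x (p i); set B := dot d (vec x (p i)).
have E t : side (step d t (perp d)) x (p i) = A - t * B by rewrite /side /A /B /step /perp /dot /vec /side /=; ring.
have [A0|An] := eqVneq A 0.
  have Bn : B != 0.
    apply/eqP => B0; have := dot_gt0 dn; have := dot_gt0 vn.
    have : dot d d * dot (vec x (p i)) (vec x (p i)) = A * A + B * B.
      by rewrite /A /B /side /dot /vec /=; ring.
    by rewrite A0 B0; nra.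
  apply: filterS (nbhs_right_gt (0 : R)) => t t0 _; rewrite E A0 sub0r oppr_eq0.
  by rewrite mulf_neq0 // gt_eqF.
have Bp : 0 < `|B| + 1 by rewrite ltr_wpDl.
have An0 : 0 < `|A| by rewrite normr_gt0.
apply: filterS2 (nbhs_right_gt (0 : R)) (nbhs_right_lt (divr_gt0 An0 Bp)) => t t0.
rewrite ltr_pdivlMr // => h _; rewrite E subr_eq0; apply/eqP => E'.
by move: h; rewrite E' normrM (gtr0_norm t0); lra.
Qed.

Lemma generic_ex d x : d != 0 -> exists2 d', generic d' x & d' != 0.
Proof. by move=> dn; have [t [g h]] := @filter_ex _ _ (at_right_proper_filter (0 : R)) _ (near_generic x dn); exists (step d t (perp d)). Qed.

Lemma near_forall_dart T (F : set_system T) (P : 'I_n * 'I_n -> set T) : Filter F ->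
  (forall e, \forall x \near F, P e x) -> \forall x \near F, forall e, P e x.
Proof. by move=> FF H; exact: (@filter_forall _ ('I_n * 'I_n)%type). Qed.

Lemma near_off c x : off c x -> \forall y \near x, off c y.
Proof.
move=> oc; suff : \forall y \near x, forall e, c e != 0 -> ~ in_seg (p e.1) (p e.2) y by [].
apply: (@near_forall_dart _ (nbhs x) (fun e y => c e != 0 -> ~ in_seg (p e.1) (p e.2) y)) => e.
have [c0|cn] := eqVneq (c e) 0; first by apply: nearW.
by apply: filterS (near_not_in_seg (oc e cn)).
Qed.

Lemma wind_near_generic c x d : off c x -> generic d x ->
  \forall y \near x, wind d c y = wind d c x.
Proof.
move=> oc gd.
have : \forall y \near x, forall e, c e != 0 -> cr d y (p e.1) (p e.2) = cr d x (p e.1) (p e.2).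
  apply: (@near_forall_dart _ (nbhs x) (fun e y => c e != 0 -> cr d y (p e.1) (p e.2) = cr d x (p e.1) (p e.2))) => e.
  have [c0|cn] := eqVneq (c e) 0; first by apply: nearW.
  have ns := oc e cn.
  have h1 : side d x (p e.1) != 0.
    by apply: gd; apply/eqP => E; apply: ns; rewrite -E; exact: in_seg_l.
  have h2 : side d x (p e.2) != 0.
    by apply: gd; apply/eqP => E; apply: ns; rewrite -E; exact: in_seg_r.
  exact: filterS (cr_near ns h1 h2).
apply: filterS => y H; apply: eq_bigr => e _.
by have [->|cn] := eqVneq (c e) 0; [rewrite !mul0r|rewrite H].
Qed.

(** Crossing numbers are locally constant only in a generic direction; the statement for [d] follows
    by switching to such a direction and back. *)
Lemma wind_near c x d : circ c -> off c x -> d != 0 -> \forall y \near x, off c y /\ wind d c y = wind d c x.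
Proof.
move=> cc oc dn; have [d' gd dn'] := generic_ex x dn.
apply: filterS2 (near_off oc) (wind_near_generic oc gd) => y oy E; split => //.
by rewrite (wind_dir cc oy dn' dn) E (wind_dir cc oc dn dn').
Qed.

Lemma wind_connected c d (A : set (R * R)) x y : circ c -> d != 0 -> connected A ->
  (forall z, A z -> off c z) -> A x -> A y -> wind d c y = wind d c x.
Proof.
move=> cc dn cA oA Ax Ay.
pose B := A `&` [set z | wind d c z = wind d c x].
suff : B = A by move=> E; move: Ay; rewrite -E => -[].
apply: cA; first by exists x.
  exists [set z | off c z /\ wind d c z = wind d c x].
    rewrite openE => z [oz E]; rewrite /interior.
    by apply: filterS (wind_near cc oz dn) => w [ow Ew]; split => //; rewrite Ew.
  by apply/seteqP; split => z [Az] /=; [split => //; split => //; exact: oA|case].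
exists (~` [set z | off c z /\ wind d c z <> wind d c x]).
  rewrite closedC openE => z [oz E]; rewrite /interior.
  by apply: filterS (wind_near cc oz dn) => w [ow Ew]; split => //; rewrite Ew.
apply/seteqP; split => z [Az] /=; first by move=> E; split => // -[].
by move=> H; split => //; apply: contrapT => E; apply: H; split => //; exact: oA.
Qed.

Definition only c (e0 : 'I_n * 'I_n) m : Prop :=
  forall e, e != e0 -> c e != 0 -> ~ in_seg (p e.1) (p e.2) m.

(** The other edges miss [m] and contribute a constant near [m]. The ray from m - t d still has to
    cross [e0], the one from m + t d is already past it; the last hypothesis says that [e0] runs
    from right to left of the ray, which fixes the sign. *)
Lemma wind_jump c e0 m d : generic d m -> (forall i, p i != m) -> in_seg (p e0.1) (p e0.2) m ->
  only c e0 m -> 0 < cross d (vec (p e0.1) (p e0.2)) ->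
  \forall t \near (0 : R)^'+, [/\ off c (step m (- t) d), off c (step m t d) &
    wind d c (step m (- t) d) - wind d c (step m t d) = c e0].
Proof.
move=> gd pm [tau [tau01 mE]] om; set k := p e0.1 in mE *; set l := p e0.2 in mE *; set D := cross _ _ => D0.
pose c' e := if e == e0 then 0 else c e.
have oc' : off c' m.
  by move=> e; rewrite /c'; case: ifP => [_|/negbT en]; [rewrite eqxx|exact: om].
have N : \forall y \near m, off c' y /\ wind d c' y = wind d c' m.
  by apply: filterS2 (near_off oc') (wind_near_generic oc' gd).
have om0 : orient m k l = 0 by rewrite mE /orient /=; ring.
have sk : side d m k = - tau * D by rewrite mE /side /D /cross /vec /=; ring.
have sl : side d m l = (1 - tau) * D by rewrite mE /side /D /cross /vec /=; ring.
have tau0 : 0 < tau < 1.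
  have := gd _ (pm e0.1); have := gd _ (pm e0.2); rewrite -/k -/l sk sl.
  case/andP: tau01 => t0 t1; rewrite !mulf_eq0 !negb_or => /andP[h1 _] /andP[h2 _].
  rewrite !lt_neqAle t0 t1 !andbT; apply/andP; split.
    by apply: contraNneq h2 => <-; rewrite oppr0.
  by apply: contraNneq h1 => ->; rewrite subrr.
case/andP: tau0 => t0 t1.
have sideE' t a : side d (step m t d) a = side d m a by rewrite /side /step /=; ring.
have oE t : orient (step m t d) k l = - t * D.
  by rewrite -[RHS]add0r -om0 /orient /step /D /cross /vec /=; ring.
have W t : wind d c (step m t d) = wind d c' (step m t d) + c e0 * cr d (step m t d) k l.
  rewrite /wind (bigD1 e0) //= [in RHS](bigD1 e0) //= /c' eqxx mul0r add0r addrC; congr (_ + _).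
  by apply: eq_bigr => e /negbTE ->.
have ofc t : t != 0 -> off c' (step m t d) -> off c (step m t d).
  move=> tn oo e cn; have [ee|en] := eqVneq e e0; last first.
    by apply: oo; rewrite /c' (negbTE en).
  rewrite ee => -[s [_ E]]; have : orient (step m t d) k l = 0 by rewrite E /orient /=; ring.
  by rewrite oE => /eqP; rewrite mulf_eq0 oppr_eq0 (negbTE tn) /= gt_eqF.
apply: filterS2 (nbhs_right_gt (0 : R)) (near_step d N) => t tp [[f1 w1] [f2 w2]].
split; [by apply: ofc => //; rewrite oppr_eq0 gt_eqF|by apply: ofc => //; rewrite gt_eqF|].
rewrite !W w1 w2 /cr !sideE' !oE sk sl opprK.
have K1 : - tau * D < 0 by rewrite mulNr oppr_lt0 mulr_gt0.
have K2 : 0 < (1 - tau) * D by rewrite mulr_gt0 // subr_gt0.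
have K3 : 0 < t * D by rewrite mulr_gt0.
rewrite K1 (ltW K2) K3 /= mulNr oppr_gt0 oppr_lt0 K3 !ltNge (ltW K3) (ltW K2) /=.
by ring.
Qed.

End Winding.

(** * Maxwell liftings and the choice of the weights *)

Section GeneralPosition.
Variables (R : realType) (n : nat) (p : 'I_n -> (R * R)%type).
Hypotheses (n3 : (3 <= n)%N) (gp : general_position p).

Lemma exists_third (i j : 'I_n) : exists k, (k != i) && (k != j).
Proof.
have : (0 < #|~: [set i; j]|)%N.
  by rewrite cardsCs finset.setCK card_ord subn_gt0 (leq_trans _ n3) // ltnS cards2; case: (i != j).
by case/card_gt0P => k; rewrite !inE negb_or => ?; exists k.
Qed.

(** Two coinciding points would be collinear with any third one. *)
Lemma gp_inj : injective p.
Proof.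
move=> i j pij; apply/eqP/negPn/negP => ij.
have [k /andP[ki kj]] := exists_third i j.
have : orient (p i) (p j) (p k) != 0 by apply: gp => //; rewrite eq_sym.
by rewrite -pij /orient !subrr !mul0r subrr eqxx.
Qed.

Lemma gp_in_seg i j k : i != j -> in_seg (p i) (p j) (p k) -> k = i \/ k = j.
Proof.
move=> ij [t [_ E]]; have [|ki] := eqVneq k i; first by left.
have [|kj] := eqVneq k j; first by right.
have /eqP[] : orient (p i) (p j) (p k) != 0 by apply: gp => //; rewrite eq_sym.
by rewrite E /orient /=; ring.
Qed.

End GeneralPosition.

(** * The lifting of a stress: continuity and second differences *)

Section Lifting.
Variables (R : realType) (n : nat) (p : 'I_n -> (R * R)%type).
Implicit Types (w : 'I_n * 'I_n -> R) (x y q r d u : (R * R)%type) (e : 'I_n * 'I_n).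
Local Notation segm e := (in_seg (p e.1) (p e.2)).
Local Notation ori x e := (orient x (p e.1) (p e.2)).
Local Notation crs d x e := (cr d x (p e.1) (p e.2)).

(** Equilibrium in weak form: it is tested on all motions at once instead of being stated vertex by
    vertex. *)
Definition stress w : Prop := forall v : 'M[R]_(n, 2), \sum_e w e * ipm p v e.1 e.2 = 0.

Definition torque w x e : R := w e * ori x e.

(* Testing equilibrium on the motion i |-> g i * perp (p i - x) gives Kirchhoff's law
   for the torques about x. *)
Lemma torque_circ w x : stress w -> circ (torque w x).
Proof.
move=> sw g; pose v : 'M[R]_(n, 2) := \matrix_(i, j)
  if j == ord0 then g i * ((p i).2 - x.2) else - (g i * ((p i).1 - x.1)).
apply: etrans (sw v); apply: eq_bigr => -[i j] _.
rewrite /torque /= -mulrA; congr (_ * _); rewrite /ipm !mxE /= /orient /=; ring.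
Qed.

Lemma orient_in_seg (a b x : R * R) : in_seg a b x -> orient x a b = 0.
Proof. by case=> t [_ ->]; rewrite /orient /=; ring. Qed.

(** An edge through [x] has no torque about [x]. Hence the lifting is a meaningful winding number at
    every point, also on edges and at vertices. *)
Lemma torque_off w x : off p (torque w x) x.
Proof. by move=> e /eqP tn s; apply: tn; rewrite /torque (orient_in_seg s) mulr0. Qed.

(* Maxwell's lifting of the stress: piecewise linear, with crease w e along the edge e. *)
Definition zlift w x : R := wind p (1, 0) (torque w x) x.

(** The free choice of [d] allows a ray that is generic at the point under study. *)
Lemma zliftE w d x : stress w -> d != 0 -> zlift w x = \sum_e w e * (ori x e * crs d x e).
Proof.
move=> sw dn; have d0n : ((1, 0) : R * R) != 0 by apply/eqP => -[] /eqP; rewrite oner_eq0.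
rewrite /zlift (wind_dir (torque_circ x sw) (@torque_off w x) dn d0n).
by apply: eq_bigr => e _; rewrite /torque mulrA.
Qed.

Lemma ori_cr_ge0 d x (a b : R * R) : 0 <= orient x a b * cr d x a b.
Proof.
rewrite /cr; case: and3P => [[_ _ h]|_]; first by rewrite mulr1 ltW.
by case: and3P => [[_ _ h]|_]; rewrite ?mulr0 // mulrN1 oppr_ge0 ltW.
Qed.

Lemma norm_ori_cr_le d x (a b : R * R) : `|orient x a b * cr d x a b| <= `|orient x a b|.
Proof.
rewrite normrM /cr; case: ifP => _; first by rewrite normr1 mulr1.
by case: ifP => _; rewrite ?normrN ?normr1 ?normr0 ?mulr1 ?mulr0.
Qed.

(** For an edge through [q] the crossing number jumps, but [orient] vanishes at [q], so the product
    is still continuous there. *)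
Lemma near_ori_cr q d e : generic p d q ->
  \forall y \near q, `|ori q e * crs d q e - ori y e * crs d y e| <= `|ori q e - ori y e|.
Proof.
move=> gd; have [s|ns] := pselect (segm e q).
  have H y : `|ori q e * crs d q e - ori y e * crs d y e| <= `|ori q e - ori y e|.
    by rewrite (orient_in_seg s) mul0r !sub0r !normrN; exact: norm_ori_cr_le.
  exact: (@nearW _ (nbhs q) _ _ H).
have h1 : side d q (p e.1) != 0.
  by apply: gd; apply/eqP => E; apply: ns; rewrite -E; exact: in_seg_l.
have h2 : side d q (p e.2) != 0.
  by apply: gd; apply/eqP => E; apply: ns; rewrite -E; exact: in_seg_r.
apply: filterS (cr_near ns h1 h2) => y ->.
rewrite -mulrBl normrM -[leRHS]mulr1; apply: ler_wpM2l => //.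
by rewrite /cr; case: ifP => _; [|case: ifP => _]; rewrite ?normrN ?normr1 ?normr0.
Qed.

Lemma zlift_continuous w : stress w -> continuous (zlift w).
Proof.
move=> sw q; have d0n : ((1, 0) : R * R) != 0 by apply/eqP => -[] /eqP; rewrite oner_eq0.
have [d gd dn] := generic_ex p q d0n.
have -> : zlift w = (fun x => \sum_e w e * (ori x e * crs d x e)) by apply/funext => x; exact: zliftE.
have E : forall e, (fun y => ori y e * crs d y e) @ q --> (ori q e * crs d q e).
  move=> e; apply/cvgrPdist_lt => eps eps0.
  have oc : (fun y => ori y e : R) @ q --> (ori q e : R).
    have -> : (fun y => ori y e) = (fun y => ((p e.1).1 * (p e.2).2 - (p e.1).2 * (p e.2).1)
        + ((p e.1).2 - (p e.2).2) * y.1 + ((p e.2).1 - (p e.1).1) * y.2).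
      by apply/funext => y; rewrite orientE.
    by rewrite orientE; exact: affine_continuous.
  move/cvgrPdist_lt : oc => /(_ eps eps0) oc.
  by apply: filterS2 oc (near_ori_cr e gd) => y h1 h2; exact: le_lt_trans h2 h1.
have F e : (fun y => w e * (ori y e * crs d y e)) @ q --> w e * (ori q e * crs d q e).
  by apply: cvgM; [exact: cvg_cst|exact: E].
elim: (index_enum _) => [|e s IH].
  have -> : (fun x => \sum_(e <- [::]) w e * (ori x e * crs d x e)) = (fun=> 0).
    by apply/funext => y; rewrite big_nil.
  exact: cvg_cst.
have -> : (fun x => \sum_(i <- e :: s) w i * (ori x i * crs d x i)) =
    (fun x => w e * (ori x e * crs d x e) + \sum_(i <- s) w i * (ori x i * crs d x i)).
  by apply/funext => y; rewrite big_cons.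
by apply: cvgD; [exact: F|exact: IH].
Qed.

Lemma zlift_halfplane w x u : stress w -> u != 0 -> (forall i, 0 <= dot u (vec x (p i))) ->
  zlift w x = 0.
Proof.
move=> sw un H; have d0n : ((1, 0) : R * R) != 0 by apply/eqP => -[] /eqP; rewrite oner_eq0.
exact: (wind_halfplane (torque_circ x sw) (@torque_off w x) d0n un).
Qed.

(* The edges that miss q contribute an affine function near q. *)
Lemma zlift_second_difference q d r : generic p d q -> d != 0 ->
  \forall t \near (0 : R)^'+, forall w, stress w -> zlift w (step q t r) + zlift w (step q (- t) r) - 2 * zlift w q =
    \sum_(e | `[< segm e q >]) w e *
      (ori (step q t r) e * crs d (step q t r) e + ori (step q (- t) r) e * crs d (step q (- t) r) e).
Proof.
move=> gd dn.
have N : \forall y \near q, forall e, ~ segm e q -> crs d y e = crs d q e.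
  apply: (@near_forall_dart n _ (nbhs q) (fun e y => ~ segm e q -> crs d y e = crs d q e)) => e.
  have [s|ns] := pselect (segm e q); first by apply: nearW.
  have h1 : side d q (p e.1) != 0.
    by apply: gd; apply/eqP => E; apply: ns; rewrite -E; exact: in_seg_l.
  have h2 : side d q (p e.2) != 0.
    by apply: gd; apply/eqP => E; apply: ns; rewrite -E; exact: in_seg_r.
  by apply: filterS (cr_near ns h1 h2).
apply: filterS (near_step r N) => t [N1 N2] w sw.
rewrite !(zliftE _ sw dn) mulr_sumr -big_split -sumrB /= [RHS]big_mkcond /=; apply: eq_bigr => e _.
case: asboolP => [s|ns].
  by rewrite (orient_in_seg s) mul0r !mulr0 subr0 mulrDr.
by rewrite N1 // N2 // /orient /step /=; ring.
Qed.

(** Only edges through [q] enter the second difference. Those of positive weight contribute a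
    non-negative amount, because [orient] and [cr] have the same sign, and the hypothesis removes
    those of negative weight. *)
Lemma zlift_midpoint w q d r : stress w -> generic p d q -> d != 0 ->
  (forall e t, w e < 0 -> segm e q -> t != 0 -> ori (step q t r) e * crs d (step q t r) e = 0) ->
  \forall t \near (0 : R)^'+, 2 * zlift w q <= zlift w (step q t r) + zlift w (step q (- t) r).
Proof.
move=> sw gd dn H.
apply: filterS2 (nbhs_right_gt (0 : R)) (zlift_second_difference r gd dn) => t t0 E.
rewrite -subr_ge0 E //; apply: sumr_ge0 => e /asboolP s; have tn : t != 0 by rewrite gt_eqF.
have [w0|w0] := ltP (w e) 0; last by apply: mulr_ge0 => //; apply: addr_ge0; exact: ori_cr_ge0.
by rewrite !H ?oppr_eq0 // addr0 mulr0.
Qed.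

End Lifting.

(** * The maximum principle for liftings *)

Section MaximumPrinciple.
Variables (R : realType) (n : nat) (p : 'I_n -> (R * R)%type).
Hypotheses (n3 : (3 <= n)%N) (gp : general_position p).
Variables (w : 'I_n * 'I_n -> R) (G : {set 'I_n * 'I_n}).
Hypotheses (sw : stress p w) (wG : forall e, w e < 0 -> e \in G) (gG : graph_on G)
  (ncG : non_crossing p G)
  (uG : forall k, exists2 u, u != 0 & forall l, adj G k l -> 0 < dot u (vec (p k) (p l))).

(** The direction is chosen so that no edge of negative weight contributes. At a vertex, [r] is
    parallel to the boundary of the half-plane that contains its edges in [G], and the rays leave
    this half-plane. In the interior of an edge of [G], [r] runs along that edge. Elsewhere no edge
    of negative weight passes through [q]. *)
Lemma midpoint_direction q : exists r, r != 0 /\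
  \forall t \near (0 : R)^'+, 2 * zlift p w q <= zlift p w (step q t r) + zlift p w (step q (- t) r).
Proof.
have d0n : ((1, 0) : R * R) != 0 by apply/eqP => -[] /eqP; rewrite oner_eq0.
have [[k pk]|nk] := pselect (exists k, p k = q).
  have [u un uP] := uG k.
  have un' : - u != 0 by rewrite oppr_eq0.
  have [t [g dn]] := @filter_ex _ _ (at_right_proper_filter (0 : R)) _ (near_generic p q un').
  exists (perp u); split.
    apply: contra_neq un; case: (u) => u1 u2 [] /= h1 h2; congr pair => //.
    by apply/eqP; rewrite -oppr_eq0 h1.
  apply: (zlift_midpoint sw g dn) => e s w0 se sn.
  have [->|] := eqVneq (cr (step (- u) t (perp (- u))) (step q s (perp u)) (p e.1) (p e.2)) 0.
    by rewrite mulr0.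
  case/cr_hit => c [c0 hit]; exfalso.
  have eG := wG w0; have e12 : e.1 != e.2 by rewrite neq_ltn (gG eG).
  have D : forall j, j = e.1 \/ j = e.2 -> 0 <= dot u (vec q (p j)).
    have H l : adj G k l -> 0 <= dot u (vec q (p l)) by rewrite -pk => /uP /ltW.
    have Z : 0 <= dot u (vec q (p k)) by rewrite pk /dot /vec !subrr !mulr0 addr0.
    have aG : adj G e.1 e.2 by rewrite /adj -surjective_pairing eG.
    have aG' : adj G e.2 e.1 by rewrite /adj -surjective_pairing eG orbT.
    by rewrite -pk in se; case: (gp_in_seg gp e12 se) => kE j [] ->; rewrite -?kE //; apply: H; rewrite kE.
  case: hit => tt [/andP[tt0 tt1] [E1 E2]].
  have D1 := D _ (or_introl erefl); have D2 := D _ (or_intror erefl).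
  have uu := dot_gt0 un.
  have := mulr_ge0 tt0 D2; have := mulr_ge0 (_ : 0 <= 1 - tt) D1.
  rewrite subr_ge0 tt1 => /(_ isT) K1 K2.
  have K : (1 - tt) * dot u (vec q (p e.1)) + tt * dot u (vec q (p e.2)) = - c * dot u u.
    move: E1 E2; rewrite /dot /vec /=; set a := p e.1; set b := p e.2 => E1 E2.
    transitivity (u.1 * (a.1 + tt * (b.1 - a.1) - q.1) + u.2 * (a.2 + tt * (b.2 - a.2) - q.2)); first by ring.
    by rewrite -E1 -E2; ring.
  have := mulr_gt0 c0 uu; lra.
have npk k : p k != q by apply/eqP => E; apply: nk; exists k.
have [d gd dn] := generic_ex p q d0n.
have [[e [eG se]]|ne] := pselect (exists e, e \in G /\ in_seg (p e.1) (p e.2) q); last first.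
  exists (1, 0); split => //; apply: (zlift_midpoint sw gd dn) => e t w0 se _.
  by case: ne; exists e; split => //; exact: wG.
exists (vec (p e.1) (p e.2)); split.
  apply/eqP => -[] h1 h2; have := gG eG; rewrite (_ : e.1 = e.2) ?ltnn //.
  by apply: (gp_inj n3 gp); apply: injective_projections; lra.
apply: (zlift_midpoint sw gd dn) => e' t w0 se' _.
have -> : e' = e.
  apply/eqP/negPn/negP => ne; have [k [_ qk]] := ncG (wG w0) eG ne se' se.
  by move: (npk k); rewrite qk eqxx.
suff -> : orient (step q t (vec (p e.1) (p e.2))) (p e.1) (p e.2) = 0 by rewrite mul0r.
by have := orient_in_seg se; rewrite /orient /step /vec /=; lra.
Qed.

(* Maximizing zlift + eta |y|^2 instead of zlift makes every maximum strict. *)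
Lemma zlift_le0 x : zlift p w x <= 0.
Proof.
rewrite leNgt; apply/negP => z0; set m := zlift p w x in z0.
pose M := \sum_i (`|(p i).1| + `|(p i).2|).
have M0 : 0 <= M by apply: sumr_ge0 => i _; exact: addr_ge0.
have pM i : `|(p i).1| <= M /\ `|(p i).2| <= M.
  have : `|(p i).1| + `|(p i).2| <= M.
    by rewrite /M (bigD1 i) //= lerDl; apply: sumr_ge0 => j _; exact: addr_ge0.
  have := normr_ge0 (p i).1; have := normr_ge0 (p i).2; lra.
(* Outside the box all points lie in a half-plane seen from [y], so the lifting has support in the
   box. *)
have box y : zlift p w y != 0 -> `|y.1| <= M /\ `|y.2| <= M.
  move=> zy; split; rewrite leNgt; apply/negP => My; move/eqP: zy; apply.
    apply: (@zlift_halfplane _ _ _ _ _ (- y.1, 0) sw) => [|i].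
      by apply/eqP => -[/eqP]; rewrite oppr_eq0 -normr_eq0 gt_eqF //; lra.
    have [h _] := pM i; move: h My; rewrite /dot /vec /= !ler_norml => /andP[h1 h2].
    by case: (ger0P y.1) => h My; nra.
  apply: (@zlift_halfplane _ _ _ _ _ (0, - y.2) sw) => [|i].
    by apply/eqP => -[/eqP]; rewrite oppr_eq0 -normr_eq0 gt_eqF //; lra.
  have [_ h] := pM i; move: h My; rewrite /dot /vec /= !ler_norml => /andP[h1 h2].
  by case: (ger0P y.2) => h My; nra.
(* On the box |y|^2 is at most M * M + M * M, so the perturbation stays below [m] and the lifting is
   still positive where [g] is maximal. *)
pose eta := m / (2 * (M * M + M * M + 1)).
have MM : 0 < M * M + M * M + 1 by nra.
have eta0 : 0 < eta by rewrite divr_gt0 // mulr_gt0.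
pose g y := zlift p w y + eta * dot y y.
have gc : continuous g.
  move=> y; apply: cvgD; first exact: zlift_continuous.
  apply: cvgM; first exact: cvg_cst.
  by apply: cvgD; apply: cvgM; (exact: cvg_fst || exact: cvg_snd).
pose A : set (R * R) := `[- M, M] `*` `[- M, M].
have AE y : (y \in A) = (`|y.1| <= M) && (`|y.2| <= M).
  by apply/idP/idP; rewrite inE /A /setX /= !in_itv /= !ler_norml; [case=> -> -> | case/andP].
have Ax : x \in A by rewrite AE; have [|-> ->] := box x => //; rewrite gt_eqF.
have Ac : compact A by apply: compact_setX; exact: segment_compact.
have [|c cA cmax] := @compact_EVT_max _ R g A _ Ac (continuous_subspaceT gc).
  by exists x; move: Ax; rewrite inE.
have cz : 0 < zlift p w c.
  have := cmax x Ax; rewrite /g -/m => h.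
  have : dot c c <= M * M + M * M.
    by move: cA; rewrite AE /dot !ler_norml => /andP[/andP[? ?] /andP[? ?]]; apply: lerD; nra.
  have xx : 0 <= dot x x by rewrite /dot; nra.
  have e1 := mulr_ge0 (ltW eta0) xx.
  move=> /(ler_wpM2l (ltW eta0)) cc.
  have : eta * (M * M + M * M) < m.
    have E : eta * (2 * (M * M + M * M + 1)) = m by rewrite divfK // mulf_neq0 // gt_eqF.
    have : 0 <= eta * (M * M + M * M) by apply: mulr_ge0; [exact: ltW|nra].
    lra.
  lra.
have [r [rn rP]] := midpoint_direction c.
have zpos : \forall y \near c, 0 < zlift p w y by exact: (cvgr_gt _ (@zlift_continuous _ _ _ _ sw c) _ cz).
have [t [t0 [t1 [t2 t3]]]] := @filter_ex _ _ (at_right_proper_filter (0 : R)) _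
  (filterI (nbhs_right_gt (0 : R)) (filterI rP (near_step r zpos))).

move: t1; apply/negP; rewrite -ltNge.
have B y : 0 < zlift p w y -> g y <= g c.
  by move=> zy; apply: cmax; rewrite AE; have [|-> ->] := box y => //; rewrite gt_eqF.
have := B _ t2; have := B _ t3; rewrite /g => h1 h2.
(* The quadratic term has a positive second difference in every direction, whereas that of [g] at
   its maximum is at most zero. *)
have E : dot (step c t r) (step c t r) + dot (step c (- t) r) (step c (- t) r) - 2 * dot c c = 2 * (t * t * dot r r).
  by rewrite /dot /step /=; ring.
have : 0 < eta * (t * t * dot r r) by rewrite mulr_gt0 // mulr_gt0 ?mulr_gt0 // dot_gt0.
nra.
Qed.

End MaximumPrinciple.

(** A vertex of maximal out-degree is a source: a vertex [c] beating it would, in the absence of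
    3-cycles, also beat everything that it beats, and so have larger out-degree. *)
Lemma tournament_source (T : finType) (N : {set T}) (r : rel T) : N != finset.set0 ->
  (forall a b, a \in N -> b \in N -> a != b -> r a b || r b a) ->
  (forall a b, r a b -> ~~ r b a) ->
  (forall a b c, a \in N -> b \in N -> c \in N -> ~ [/\ r a b, r b c & r c a]) ->
  exists2 a, a \in N & forall c, c \in N -> c != a -> r a c.
Proof.
case/set0Pn => x0 x0N tot asym no3.
pose out a := #|[set c in N | r a c]|.
have [a aN amax] := @arg_maxnP _ x0 (mem N) out x0N.
have {}aN : a \in N := aN.
exists a => // c cN ca; apply/negPn/negP => nac.
have rca : r c a by have := tot _ _ cN aN ca; rewrite (negbTE nac) orbF.
have := amax c cN; apply/negP; rewrite -ltnNge; apply: proper_card; apply/properP; split.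
  apply/fintype.subsetP => b; rewrite !inE => /andP[bN rab]; rewrite bN /=; apply/negPn/negP => ncb.
  have bc : c != b by apply: contraNneq nac => ->.
  have := tot _ _ cN bN bc; rewrite (negbTE ncb) /= => rbc.
  by apply: (no3 a b c).
by exists a; rewrite !inE aN ?rca //=; apply/negP => h; have := asym _ _ h; rewrite h.
Qed.

(** * Pointedness as a half-plane condition *)

Section Pointedness.
Variables (R : realType) (n : nat) (p : 'I_n -> (R * R)%type).
Hypotheses (n3 : (3 <= n)%N) (gp : general_position p).
Implicit Types (i j k l : 'I_n) (G : {set 'I_n * 'I_n}) (N : {set 'I_n}).
Local Notation o k i j := (orient (p k) (p i) (p j)).

Lemma orient_neq0 k i j : k != i -> k != j -> i != j -> o k i j != 0.
Proof. by move=> ki kj ij; apply: gp. Qed.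

Lemma orient_swap (a b c : R * R) : orient a c b = - orient a b c.
Proof. by rewrite /orient; ring. Qed.

Lemma orient_rot (a b c : R * R) : orient b c a = orient a b c.
Proof. by rewrite /orient; ring. Qed.

(** The excluded triples are those that wind around [p k], that is, whose triangle contains [p k] in
    its interior. *)
Definition no_triple k N : Prop := forall a b c, a \in N -> b \in N -> c \in N ->
  ~ [/\ 0 < o k a b, 0 < o k b c & 0 < o k c a].

Lemma no_triple_source k N : k \notin N -> N != finset.set0 -> no_triple k N ->
  (exists2 a, a \in N & forall c, c \in N -> c != a -> 0 < o k a c) /\
  (exists2 b, b \in N & forall c, c \in N -> c != b -> 0 < o k c b).
Proof.
move=> kN N0 nt.
have kn a : a \in N -> k != a by move=> aN; apply: contraNneq kN => ->.
have as1 a b : 0 < o k a b -> ~~ (0 < o k b a).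
  by move=> h; rewrite -leNgt orient_swap oppr_le0 ltW.
have tot a b : a \in N -> b \in N -> a != b -> (0 < o k a b) || (0 < o k b a).
  move=> aN bN ab; have := orient_neq0 (kn _ aN) (kn _ bN) ab.
  by rewrite neq_lt (orient_swap (p k) (p a) (p b)) oppr_gt0 orbC.
split; first by apply: (@tournament_source _ N (fun a b => 0 < o k a b)).
apply: (@tournament_source _ N (fun a b => 0 < o k b a)) => //.
- by move=> a b aN bN ab; rewrite orbC; exact: tot.
- by move=> a b; exact: as1.
- by move=> a b c aN bN cN [h1 h2 h3]; apply: (nt a c b).
Qed.

Definition halfplane k N : Prop :=
  exists2 u, u != 0 & forall l, l \in N -> 0 < dot u (vec (p k) (p l)).

(** The three orientations are, up to scaling, the barycentric weights of [p k] in the triangle;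
    being positive they exclude that all three vertices lie strictly on one side of a line through
    [p k]. *)
Lemma halfplane_no_triple k N : halfplane k N -> no_triple k N.
Proof.
case=> u un H a b c /H ha /H hb /H hc [oab obc oca].
have : o k b c * dot u (vec (p k) (p a)) + o k c a * dot u (vec (p k) (p b)) +
   o k a b * dot u (vec (p k) (p c)) = 0 by rewrite /dot /vec /orient /=; ring.
have := mulr_gt0 obc ha; have := mulr_gt0 oca hb; have := mulr_gt0 oab hc; lra.
Qed.

Lemma vec_neq0 k l : k != l -> vec (p k) (p l) != 0.
Proof.
move=> kl; apply: contra_neq kl => -[h1 h2]; apply: (gp_inj n3 gp).
by apply: injective_projections; lra.
Qed.

(** The normal of the line through first and last neighbour works: its product with the vector to
    [p c] is the sum of the two orientations of the hypothesis. If [a] and [b] coincide, general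
    position leaves no other element in [N]. *)
Lemma source_sink_halfplane k a b N : k \notin N -> a \in N -> b \in N ->
  (a != b -> 0 < o k a b) ->
  (forall c, c \in N -> 0 <= o k a c /\ 0 <= o k c b) -> halfplane k N.
Proof.
move=> kN aN bN ab H; have ka : k != a by apply: contraNneq kN => ->.
have kb : k != b by apply: contraNneq kN => ->.
have [E|nab] := eqVneq a b.
  exists (vec (p k) (p a)); first exact: vec_neq0.
  move=> c cN; have [] := H c cN; rewrite -E (orient_swap _ (p a)) => h1 h2.
  have [->|ca] := eqVneq c a; first exact/dot_gt0/vec_neq0.
  have kc : k != c by apply: contraNneq kN => ->.
  have := orient_neq0 ka kc (_ : a != c); rewrite eq_sym => /(_ ca).
  by rewrite (_ : o k a c = 0) ?eqxx //; lra.
have {}ab := ab nab.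
set u := perp (vec (p b) (p a)).
have uE c : dot u (vec (p k) (p c)) = o k a c + o k c b.
  by rewrite /u /dot /perp /vec /orient /=; ring.
have uc c : c \in N -> 0 < dot u (vec (p k) (p c)).
  move=> cN; rewrite uE; have [h1 h2] := H c cN.
  have [->|ca] := eqVneq c a; first by move: ab; rewrite /orient; lra.
  have kc : k != c by apply: contraNneq kN => ->.
  have := orient_neq0 ka kc (_ : a != c); rewrite eq_sym => /(_ ca); lra.
exists u => //; apply/eqP => u0; have := uc _ aN; rewrite u0 /dot /= !mul0r; lra.
Qed.

Lemma no_tripleP k N : k \notin N -> no_triple k N <-> halfplane k N.
Proof.
move=> kN; split; last exact: halfplane_no_triple.
have [->|N0] := eqVneq N finset.set0.
  move=> _; exists (1, 0); first by apply/eqP => -[] /eqP; rewrite oner_eq0.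
  by move=> l; rewrite inE.
move=> nt; have [[a aN ha] [b bN hb]] := no_triple_source kN N0 nt.
apply: (@source_sink_halfplane k a b N) => // [ab|c cN]; first by apply: ha => //; rewrite eq_sym.
have oo x : o k x x = 0 by rewrite /orient; ring.
split; first by have [->|ca] := eqVneq c a; [rewrite oo|rewrite ltW // ha].
by have [->|ca] := eqVneq c b; [rewrite oo|rewrite ltW // hb].
Qed.

Lemma halfplane_card2 k N : k \notin N -> (#|N| <= 2)%N -> halfplane k N.
Proof.
move=> kN N2; apply/(no_tripleP kN) => a b c aN bN cN [h1 h2 h3].
have oo x : o k x x = 0 by rewrite /orient; ring.
have ab : a != b by apply: contraTneq h1 => ->; rewrite oo ltxx.
have bc : b != c by apply: contraTneq h2 => ->; rewrite oo ltxx.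
have ca : c != a by apply: contraTneq h3 => ->; rewrite oo ltxx.
move: N2; apply/negP; rewrite -ltnNge.
have <- : #|a |: [set b; c]| = 3%N by rewrite cardsU1 cards2 !inE negb_or ab bc (eq_sym a) ca.
by apply: subset_leq_card; apply/fintype.subsetP => x; rewrite !inE => /or3P[] /eqP->.
Qed.

Definition nbr G k : {set 'I_n} := [set l | adj G k l].

Lemma nbr_irr G k : graph_on G -> k \notin nbr G k.
Proof. by move=> gG; rewrite inE /adj orbb; apply/negP => /gG; rewrite ltnn. Qed.

Lemma adjC G k l : adj G k l = adj G l k.
Proof. by rewrite /adj orbC. Qed.

(** The reflex angle of [pointed_at] extends counterclockwise from the last neighbour, the sink, to
    the first one, the source. The half-plane form is inherited by subgraphs and is the one used
    below. *)
Lemma pointed_atP G k : graph_on G -> pointed_at p G k <-> halfplane k (nbr G k).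
Proof.
move=> gG; have kN := nbr_irr k gG; split.
  case=> [d1|[a [b [ka [kb [ab [oab H]]]]]]]; first by apply: halfplane_card2 => //; exact: leq_trans d1 _.
  apply: (@source_sink_halfplane k b a) => //; rewrite ?inE //.
    by move=> _; rewrite orient_swap; lra.
  by move=> c; rewrite inE => /H.
move=> h; have nt := halfplane_no_triple h.
have [d1|d1] := leqP #|nbr G k| 1; [by left|right].
have N0 : nbr G k != finset.set0 by rewrite -card_gt0 (leq_trans _ d1).
have [[a aN ha] [b bN hb]] := no_triple_source kN N0 nt.
have oo x : o k x x = 0 by rewrite /orient; ring.
have ab : b != a.
  apply: contraTneq d1 => E; rewrite -leqNgt -(cards1 a); apply: subset_leq_card.
  apply/fintype.subsetP => c cN; rewrite inE; apply/negPn/negP => ca.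
  have := ha _ cN ca; have := hb c cN; rewrite E ca => /(_ isT).
  by rewrite orient_swap; lra.
exists b, a; move: (aN) (bN); rewrite !inE => -> ->; do 3 (split => //); split.
  by rewrite orient_swap oppr_lt0; apply: ha.
move=> c cG; have cN : c \in nbr G k by rewrite inE.
split; first by have [->|ca] := eqVneq c a; [rewrite oo|rewrite ltW // ha].
by have [->|ca] := eqVneq c b; [rewrite oo|rewrite ltW // hb].
Qed.

Lemma halfplane_sub k N N' : N \subset N' -> halfplane k N' -> halfplane k N.
Proof. by move=> /fintype.subsetP s [u un H]; exists u => // l /s /H. Qed.

Lemma nbr_sub G G' k : G \subset G' -> nbr G k \subset nbr G' k.
Proof.
move=> /fintype.subsetP s; apply/fintype.subsetP => l; rewrite !inE /adj.
by case/orP => /s ->; rewrite ?orbT.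
Qed.

Lemma pnc_sub G G' : G \subset G' -> pointed_noncrossing p G' -> pointed_noncrossing p G.
Proof.
move=> s [gG' [nG' pG']]; have s' := fintype.subsetP s.
have gG : graph_on G by move=> e /s'; exact: gG'.
split => //; split; first by move=> e e' /s' h /s' h'; exact: nG'.
by move=> k; apply/pointed_atP => //; apply: halfplane_sub (nbr_sub k s) _; apply/pointed_atP.
Qed.

Lemma seg_share k a b x : k != a -> k != b -> a != b ->
  in_seg (p k) (p a) x -> in_seg (p k) (p b) x -> x = p k.
Proof.
move=> ka kb ab [t [_ E]] [s [_ E']].
have : s * o k a b = 0.
  have := congr1 fst E; have := congr1 snd E; rewrite E' /= => h1 h2.
  transitivity (((p a).1 - (p k).1) * (s * ((p b).2 - (p k).2)) - ((p a).2 - (p k).2) * (s * ((p b).1 - (p k).1))).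
    by rewrite /orient; ring.
  have -> : s * ((p b).2 - (p k).2) = t * ((p a).2 - (p k).2) by lra.
  have -> : s * ((p b).1 - (p k).1) = t * ((p a).1 - (p k).1) by lra.
  by ring.
move/eqP; rewrite mulf_eq0 (negbTE (orient_neq0 ka kb ab)) orbF => /eqP s0.
by rewrite E' s0 !mul0r !addr0 -surjective_pairing.
Qed.

End Pointedness.

(** * Equilibrium stresses from affine dependencies *)

Section AffineDependencies.
Variables (R : realType) (n : nat) (p : 'I_n -> (R * R)%type).
Implicit Types (u : 'I_n -> R).

Lemma sum_lt_pairs (F : 'I_n -> 'I_n -> R) :
  (forall i j, F i j = F j i) -> (forall i, F i i = 0) ->
  (\sum_(e : 'I_n * 'I_n) if (e.1 < e.2)%N then F e.1 e.2 else 0) * 2 = \sum_i \sum_j F i j.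
Proof.
move=> Fs F0; rewrite -(pair_bigA _ (fun i j : 'I_n => if (i < j)%N then F i j else 0)) /=.
rewrite mulr_natr mulr2n [X in _ + X]exchange_big -big_split /=; apply: eq_bigr => i _.
rewrite -big_split /=; apply: eq_bigr => j _.
by have [ij|ij|/val_inj ->] := ltngtP i j; rewrite ?addr0 ?add0r ?F0 // Fs.
Qed.

(** The restriction to sorted pairs lets each edge carry its stress once, in the orientation
    required by [graph_on]. *)
Definition dependency_stress u (e : 'I_n * 'I_n) : R :=
  if (e.1 < e.2)%N then u e.1 * u e.2 else 0.

(* An affine dependency u of the points gives the equilibrium stress u_i u_j. *)
Lemma dependency_stressP u : \sum_i u i = 0 -> \sum_i u i * (p i).1 = 0 ->
  \sum_i u i * (p i).2 = 0 -> stress p (dependency_stress u).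
Proof.
move=> U0 U1 U2 v; apply: (@mulIf _ (2 : R)); first by rewrite pnatr_eq0.
rewrite mul0r; pose F i j := u i * u j * ipm p v i j.
have -> : \sum_e dependency_stress u e * ipm p v e.1 e.2 =
    \sum_(e : 'I_n * 'I_n) if (e.1 < e.2)%N then F e.1 e.2 else 0.
  by apply: eq_bigr => e _; rewrite /dependency_stress; case: ifP => _; rewrite ?mul0r.
rewrite sum_lt_pairs; last first.
- by move=> i; rewrite /F /ipm !subrr !mulr0 addr0 mulr0.
- by move=> i j; rewrite /F /ipm; ring.
pose A := \sum_j u j * v j ord0; pose B := \sum_j u j * v j ord_max.
pose C := \sum_j u j * ((p j).1 * v j ord0 + (p j).2 * v j ord_max).
have inner i : \sum_j F i j = C * u i - A * (u i * (p i).1) - B * (u i * (p i).2).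
  transitivity (\sum_j (u i * ((p i).1 * v i ord0 + (p i).2 * v i ord_max) * u j
     - u i * v i ord0 * (u j * (p j).1) - u i * v i ord_max * (u j * (p j).2)
     + u i * (u j * ((p j).1 * v j ord0 + (p j).2 * v j ord_max))
     - u i * (p i).1 * (u j * v j ord0) - u i * (p i).2 * (u j * v j ord_max))).
    by apply: eq_bigr => j _; rewrite /F /ipm; ring.
  rewrite !big_split /= !sumrN -!mulr_sumr U0 U1 U2 -/A -/B -/C; ring.
under eq_bigr do rewrite inner.
by rewrite !big_split /= !sumrN -!mulr_sumr U0 U1 U2; ring.
Qed.

Lemma sum_delta (a : 'I_n) (la : R) (f : 'I_n -> R) : \sum_i ((i == a)%:R * la) * f i = la * f a.
Proof.
rewrite (bigD1 a) //= eqxx mul1r big1 ?addr0 // => i /negbTE ->.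
by rewrite !mul0r.
Qed.

Definition dep4 (a b c d : 'I_n) (la lb lc ld : R) (i : 'I_n) : R :=
  (i == a)%:R * la + (i == b)%:R * lb + (i == c)%:R * lc + (i == d)%:R * ld.

Lemma sum_dep4 a b c d la lb lc ld (f : 'I_n -> R) :
  \sum_i dep4 a b c d la lb lc ld i * f i = la * f a + lb * f b + lc * f c + ld * f d.
Proof.
rewrite -!sum_delta -!big_split /=; apply: eq_bigr => i _; rewrite /dep4; ring.
Qed.

Lemma dep4_stress a b c d la lb lc ld : la + lb + lc + ld = 0 ->
  la * (p a).1 + lb * (p b).1 + lc * (p c).1 + ld * (p d).1 = 0 ->
  la * (p a).2 + lb * (p b).2 + lc * (p c).2 + ld * (p d).2 = 0 ->
  stress p (dependency_stress (dep4 a b c d la lb lc ld)).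
Proof.
move=> h0 h1 h2; apply: dependency_stressP; rewrite ?sum_dep4 //.
transitivity (\sum_i dep4 a b c d la lb lc ld i * 1); first by apply: eq_bigr => i _; rewrite mulr1.
by rewrite (@sum_dep4 a b c d la lb lc ld (fun=> 1)) !mulr1.
Qed.

End AffineDependencies.

Lemma sorted_pair_eq n (i j : 'I_n) (e e' : 'I_n * 'I_n) : (e.1 < e.2)%N -> (e'.1 < e'.2)%N ->
  e = (i, j) \/ e = (j, i) -> e' = (i, j) \/ e' = (j, i) -> e = e'.
Proof. by move=> h h' [] E [] E'; move: h h'; rewrite E E' //= => /ltnW; rewrite leqNgt => /negP. Qed.

(** * Four-point stresses at a crossing and at a non-pointed vertex *)

Section Obstructions.
Variables (R : realType) (n : nat) (p : 'I_n -> (R * R)%type).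
Hypotheses (n3 : (3 <= n)%N) (gp : general_position p).
Local Notation segm e := (in_seg (p e.1) (p e.2)).

(* A stress that would be positive on edges of T only and negative on a convex position. *)
Definition obstruction (T : {set 'I_n * 'I_n}) : Prop := exists w G,
  [/\ stress p w, (forall e, w e != 0 -> (e.1 < e.2)%N), pointed_noncrossing p G &
  [/\ forall e, w e < 0 -> e \in G, (exists e, w e != 0) & (forall e, 0 < w e -> e \in T)]].

(** The crossing of ab with the line cd puts [a] and [b] strictly on opposite sides of that line.
    The segments ac and bd stay on these sides and reach the line only at [c] and at [d]. *)
Lemma convex_quad_disjoint (a b c d : 'I_n) (t s : R) x : a != c -> a != d -> b != c -> b != d -> c != d ->
  0 < t < 1 ->
  (1 - t) * (p a).1 + t * (p b).1 = (1 - s) * (p c).1 + s * (p d).1 ->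
  (1 - t) * (p a).2 + t * (p b).2 = (1 - s) * (p c).2 + s * (p d).2 ->
  in_seg (p a) (p c) x -> in_seg (p b) (p d) x -> False.
Proof.
move=> ac ad bc bd cd /andP[t0 t1] h1 h2 [u [/andP[u0 u1] E]] [v [/andP[v0 v1] E']].
have A0 := orient_neq0 gp ac ad cd; have B0 := orient_neq0 gp bc bd cd.
set A := orient _ _ _ in A0; set B := orient _ _ _ in B0.
have e1 : (1 - t) * A + t * B = 0.
  transitivity (orient ((1 - t) * (p a).1 + t * (p b).1, (1 - t) * (p a).2 + t * (p b).2) (p c) (p d)).
    by rewrite /A /B /orient /=; ring.
  by rewrite h1 h2 /orient /=; ring.
have e2 : (1 - u) * A = (1 - v) * B.
  transitivity (orient x (p c) (p d)); first by rewrite E /A /orient /=; ring.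
  by rewrite E' /B /orient /=; ring.
have [uE vE] : u = 1 /\ v = 1.
  have K : (1 - u) * t * B + (1 - v) * (1 - t) * B = 0.
    have -> : (1 - v) * (1 - t) * B = (1 - t) * ((1 - v) * B) by ring.
    by rewrite -e2; transitivity ((1 - u) * ((1 - t) * A + t * B)); [ring|rewrite e1 mulr0].
  have {}K : (1 - u) * t + (1 - v) * (1 - t) = 0.
    by apply: (mulIf B0); rewrite mul0r mulrDl.
  by split; nra.
have : p c = p d.
  by apply: injective_projections; have := congr1 fst E; have := congr1 snd E; rewrite E' uE vE /=; lra.
by move/(gp_inj n3 gp)/eqP; rewrite (negbTE cd).
Qed.

(** The two expressions of the crossing point give the dependency (1 - t) a + t b = (1 - s) c + s d.
    Its stress is positive on the two crossing edges, which are in [T], and negative on the four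
    sides of the quadrilateral. The sides do not cross and each vertex has at most two of them, so
    they form a pointed graph. *)
Lemma crossing_obstruction T : graph_on T -> ~ non_crossing p T -> obstruction T.
Proof.
move=> gT nc; have [e [e' [x [eT e'T ee' [se se' H]]]]] : exists e e' x,
   [/\ e \in T, e' \in T, e != e' & [/\ segm e x, segm e' x &
     forall k, ((k == e.1) || (k == e.2)) && ((k == e'.1) || (k == e'.2)) -> x <> p k]].
  apply: contrapT => N; apply: nc => e e' eT e'T ee' x s s'; apply: contrapT => N'.
  by apply: N; exists e, e', x; split => //; split => // k h xk; apply: N'; exists k.
case: e e' eT e'T ee' se se' H => [a b] [c d] /= abT cdT ne sab scd H.
have := gT _ abT; have := gT _ cdT; rewrite /= => cd' ab'.
have ab : a != b by rewrite neq_ltn ab'.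
have cd : c != d by rewrite neq_ltn cd'.
have share k l m : k != l -> k != m -> in_seg (p k) (p l) x -> in_seg (p k) (p m) x ->
    ((k == a) || (k == b)) && ((k == c) || (k == d)) -> l = m.
  move=> kl km s1 s2 K; apply/eqP/negPn/negP => lm.
  exact: H K (seg_share gp kl km lm s1 s2).
have ba : b != a by rewrite eq_sym.
have dc : d != c by rewrite eq_sym.
have ac : a != c.
  apply/eqP => E; move/eqP: ne; apply; congr pair => //.
  by apply: (share a); rewrite ?E ?eqxx //= -E.
have bd : b != d.
  apply/eqP => E; move/eqP: ne; apply; congr pair => //.
  by apply: (share b); rewrite ?E ?eqxx ?orbT //; [rewrite -E|rewrite -E; exact: in_segC|exact: in_segC].
have ad : a != d.
  apply/eqP => E; suff : b = c by move=> F; move: ab' cd'; rewrite E F => /ltnW; rewrite leqNgt => /negP.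
  by apply: (share a); rewrite ?E ?eqxx ?orbT //; [rewrite -E|rewrite -E|exact: in_segC].
have bc : b != c.
  apply/eqP => E; suff : a = d by move=> F; move: ab' cd'; rewrite E F => /ltnW; rewrite leqNgt => /negP.
  by apply: (share b); rewrite ?E ?eqxx ?orbT //; [rewrite -E|rewrite -E; exact: in_segC].
case: (sab) => t [/andP[t0 t1] xE]; case: (scd) => s [/andP[s0 s1] xE'].
have open_ y (i j k l : 'I_n) : k != i -> k != j -> i != j -> in_seg (p i) (p j) y -> y <> p k.
  by move=> ki kj ij sg yk; rewrite yk in sg; case: (gp_in_seg gp ij sg) => E; [rewrite E eqxx in ki|rewrite E eqxx in kj].
have {t0 t1} t01 : 0 < t < 1.
  rewrite !lt_neqAle t0 t1 !andbT; apply/andP; split; apply/eqP => tE.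
    by apply: (open_ x c d a) scd _ => //; rewrite xE -tE !mul0r !addr0 -surjective_pairing.
  apply: (open_ x c d b) scd _ => //; rewrite xE tE !mul1r; apply: injective_projections => /=; lra.
have {s0 s1} s01 : 0 < s < 1.
  rewrite !lt_neqAle s0 s1 !andbT; apply/andP; split; apply/eqP => tE.
    by apply: (open_ x a b c) sab _ => //; rewrite 1?eq_sym // xE' -tE !mul0r !addr0 -surjective_pairing.
  apply: (open_ x a b d) sab _ => //; rewrite 1?eq_sym // xE' tE !mul1r; apply: injective_projections => /=; lra.
have h1 : (1 - t) * (p a).1 + t * (p b).1 = (1 - s) * (p c).1 + s * (p d).1.
  by have := congr1 fst xE; rewrite {1}xE' /=; lra.
have h2 : (1 - t) * (p a).2 + t * (p b).2 = (1 - s) * (p c).2 + s * (p d).2.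
  by have := congr1 snd xE; rewrite {1}xE' /=; lra.
pose u := dep4 a b c d (1 - t) t (- (1 - s)) (- s).
have ua : u a = 1 - t by rewrite /u /dep4 eqxx (negbTE ab) (negbTE ac) (negbTE ad) !mul0r mul1r ?addr0 ?add0r.
have ub : u b = t by rewrite /u /dep4 eqxx (negbTE ba) (negbTE bc) (negbTE bd) !mul0r mul1r ?addr0 ?add0r.
have uc : u c = - (1 - s) by rewrite /u /dep4 eqxx (eq_sym c a) (eq_sym c b) (negbTE ac) (negbTE bc) (negbTE cd) !mul0r mul1r ?addr0 ?add0r.
have ud : u d = - s by rewrite /u /dep4 eqxx (eq_sym d a) (eq_sym d b) (negbTE ad) (negbTE bd) (negbTE dc) !mul0r mul1r ?addr0 ?add0r.
case/andP: t01 => t0 t1; case/andP: s01 => r0 r1.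
have upos i : 0 < u i -> i = a \/ i = b.
  have [->|ia] := eqVneq i a; first by left.
  have [->|ib] := eqVneq i b; first by right.
  have [->|ic] := eqVneq i c; first by rewrite uc => h; exfalso; move: h; apply/negP; rewrite -leNgt; lra.
  have [->|id] := eqVneq i d; first by rewrite ud => h; exfalso; move: h; apply/negP; rewrite -leNgt; lra.
  by rewrite /u /dep4 (negbTE ia) (negbTE ib) (negbTE ic) (negbTE id) !mul0r !addr0 ltxx.
have uneg i : u i < 0 -> i = c \/ i = d.
  have [->|ia] := eqVneq i a; first by rewrite ua => h; exfalso; move: h; apply/negP; rewrite -leNgt; lra.
  have [->|ib] := eqVneq i b; first by rewrite ub => h; exfalso; move: h; apply/negP; rewrite -leNgt; lra.
  have [->|ic] := eqVneq i c; first by left.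
  have [->|id] := eqVneq i d; first by right.
  by rewrite /u /dep4 (negbTE ia) (negbTE ib) (negbTE ic) (negbTE id) !mul0r !addr0 ltxx.
pose w := dependency_stress u.
pose G := [set e | w e < 0]%SET.
have GP e : e \in G -> (e.1 < e.2)%N /\ exists i j, [/\ u i > 0, u j < 0 & (e = (i, j)) \/ (e = (j, i))].
  rewrite inE /w /dependency_stress; case: ifP => e12 h; last by rewrite ltxx in h.
  split => //.
  have [u1|u1|u1] := ltgtP (u e.1) 0; last by rewrite u1 mul0r ltxx in h.
    by exists e.2, e.1; split; [nra|done|right; exact: surjective_pairing].
  by exists e.1, e.2; split; [done|nra|left; exact: surjective_pairing].
exists w, G; split.
- by apply: dep4_stress; [ring|lra|lra].
- by move=> e; rewrite /w /dependency_stress; case: ifP => // _ /eqP.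
- split; first by move=> e /GP[].
  split=> [e1 e2 /GP[lt1 [i [j [ui uj E1]]]] /GP[lt2 [k [l [uk ul E2]]]] ne12 y s1 s2|k].
    have {}s1 : in_seg (p i) (p j) y by case: E1 s1 => -> //= /in_segC.
    have {}s2 : in_seg (p k) (p l) y by case: E2 s2 => -> //= /in_segC.
    have ij : i != j by apply: contraTneq ui => ->; rewrite -leNgt ltW.
    have kl : k != l by apply: contraTneq uk => ->; rewrite -leNgt ltW.
    have [ik|ik] := eqVneq i k.
      exists i; rewrite -ik in kl s2 E2; split.
        by case: E1 => ->; case: E2 => ->; rewrite /= eqxx ?orbT.
      apply: (seg_share gp ij kl) s1 s2; apply/eqP => jl; rewrite -jl in E2.
      by move/eqP: ne12; apply; exact: sorted_pair_eq lt1 lt2 E1 E2.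
    have [jl|jl] := eqVneq j l.
      exists j; rewrite -jl in kl s2 E2; split.
        by case: E1 => ->; case: E2 => ->; rewrite /= eqxx ?orbT.
      by apply: (seg_share gp _ _ ik (in_segC s1) (in_segC s2)); rewrite eq_sym.
    exfalso; have t' : 0 < 1 - t < 1 by apply/andP; split; lra.
    have Hab := convex_quad_disjoint ac ad bc bd cd (_ : 0 < t < 1) h1 h2; rewrite t0 t1 in Hab.
    have Hba := @convex_quad_disjoint a b d c t (1 - s) y ad ac bd bc dc.
    case: (upos i ui) => Ei; case: (upos k uk) => Ek; (try by rewrite Ei Ek eqxx in ik);
    case: (uneg j uj) => Ej; case: (uneg l ul) => El; (try by rewrite Ej El eqxx in jl);
      rewrite Ei Ej in s1; rewrite Ek El in s2.
    - exact: Hab _ isT s1 s2.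
    - by apply: Hba s1 s2; rewrite ?t0 ?t1 //; lra.
    - by apply: Hba s2 s1; rewrite ?t0 ?t1 //; lra.
    - exact: Hab _ isT s2 s1.
  have gG : graph_on G by move=> e /GP[].
  apply/(pointed_atP n3 gp k gG)/(halfplane_card2 n3 gp); first exact: nbr_irr.
  pose S := if 0 < u k then [set c; d]%SET else [set a; b]%SET.
  apply: leq_trans (_ : #|S| <= 2)%N; last by rewrite /S; case: ifP => _; rewrite cards2; case: eqP.
  apply: subset_leq_card; apply/fintype.subsetP => l; rewrite inE => al.
  have : u k * u l < 0 /\ u k != 0.
    have K i j : 0 < u i -> u j < 0 -> [/\ u i * u j < 0, u j * u i < 0, u i != 0 & u j != 0].
      by move=> ui uj; split; [rewrite pmulr_rlt0|rewrite nmulr_rlt0|rewrite gt_eqF|rewrite lt_eqF].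
    by case/orP: al => /GP[_ [i [j [ui uj E]]]]; have [k1 k2 k3 k4] := K i j ui uj; case: E => -[-> ->].
  rewrite /S; case: (ltP 0 (u k)) => uk [ukl uk0]; rewrite !inE.
    have /uneg[->|->] : u l < 0 by rewrite -(pmulr_rlt0 _ uk).
      by rewrite eqxx.
    by rewrite eqxx orbT.
  have uk' : u k < 0 by rewrite lt_neqAle uk0.
  have /upos[->|->] : 0 < u l by rewrite -(nmulr_rlt0 _ uk').
    by rewrite eqxx.
  by rewrite eqxx orbT.
- split; first by move=> e; rewrite inE.
    exists (a, b); rewrite /w /dependency_stress /= ab' ua ub mulf_neq0 // gt_eqF //; lra.
  move=> e; rewrite /w /dependency_stress; case: ifP => [e12|]; last by rewrite ltxx.
  move=> pos; have [u1|u1|u1] := ltgtP (u e.1) 0; last by rewrite u1 mul0r ltxx in pos.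
    have u2 : u e.2 < 0 by nra.
    suff -> : e = (c, d) by [].
    apply: (@sorted_pair_eq _ c d) => //; last by left.
    by case: (e) (uneg _ u1) (uneg _ u2) e12 => i j /= [] -> [] ->; rewrite ?ltnn //; [left|right].
  have u2 : 0 < u e.2 by nra.
  suff -> : e = (a, b) by [].
  apply: (@sorted_pair_eq _ a b) => //; last by left.
  by case: (e) (upos _ u1) (upos _ u2) e12 => i j /= [] -> [] ->; rewrite ?ltnn //; [left|right].
Qed.

(** Three neighbours wind around [k]. The stress of these four points, with the sign reversed, is
    positive on the three edges at [k], which are in [T], and negative on the surrounding triangle,
    which is pointed and non-crossing. *)
Lemma unpointed_obstruction T : graph_on T -> ~ pointed p T -> obstruction T.
Proof.
move=> gT np; have [k nk] : exists k, ~ halfplane p k (nbr T k).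
  by apply: contrapT => N; apply: np => k; apply/(pointed_atP n3 gp k gT); apply: contrapT => h; apply: N; exists k.
have [a [b [c [aN bN cN [oab obc oca]]]]] : exists a b c, [/\ a \in nbr T k, b \in nbr T k, c \in nbr T k &
    [/\ 0 < orient (p k) (p a) (p b), 0 < orient (p k) (p b) (p c) & 0 < orient (p k) (p c) (p a)]].
  apply: contrapT => N; apply: nk; apply/(no_tripleP n3 gp); first exact: nbr_irr.
  by move=> a b c aN bN cN h; apply: N; exists a, b, c.
have oo x : orient (p k) x x = 0 by rewrite /orient; ring.
have ab : a != b by apply: contraTneq oab => ->; rewrite oo ltxx.
have bc : b != c by apply: contraTneq obc => ->; rewrite oo ltxx.
have ca : c != a by apply: contraTneq oca => ->; rewrite oo ltxx.
have kN l : l \in nbr T k -> k != l by move=> lN; apply: contraNneq (nbr_irr k gT) => {1}->.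
have ka := kN _ aN; have kb := kN _ bN; have kc := kN _ cN.
set la := orient _ _ _ in oca; set lb := orient _ _ _ in oab; set lc := orient _ _ _ in obc.
(* Each corner receives the area of the triangle spanned by [k] and the two other corners:
   barycentric coordinates of [p k] without normalization. *)
pose u := dep4 a b c k lc la lb (- (lc + la + lb)).
have ua : u a = lc by rewrite /u /dep4 eqxx (negbTE ab) (eq_sym a c) (negbTE ca) (eq_sym a k) (negbTE ka) !mul0r mul1r ?addr0 ?add0r.
have ub : u b = la by rewrite /u /dep4 eqxx (eq_sym b a) (negbTE ab) (negbTE bc) (eq_sym b k) (negbTE kb) !mul0r mul1r ?addr0 ?add0r.
have uc : u c = lb by rewrite /u /dep4 eqxx (negbTE ca) (eq_sym c b) (negbTE bc) (eq_sym c k) (negbTE kc) !mul0r mul1r ?addr0 ?add0r.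
have uk : u k = - (lc + la + lb) by rewrite /u /dep4 eqxx (negbTE ka) (negbTE kb) (negbTE kc) !mul0r mul1r ?addr0 ?add0r.
have upos i : 0 < u i -> [\/ i = a, i = b | i = c].
  have [->|ia] := eqVneq i a; first by constructor 1.
  have [->|ib] := eqVneq i b; first by constructor 2.
  have [->|ic] := eqVneq i c; first by constructor 3.
  have [->|id] := eqVneq i k; first by rewrite uk => h; exfalso; move: h; apply/negP; rewrite -leNgt; lra.
  by rewrite /u /dep4 (negbTE ia) (negbTE ib) (negbTE ic) (negbTE id) !mul0r !addr0 ltxx.
have uneg i : u i < 0 -> i = k.
  have [->|ia] := eqVneq i a; first by rewrite ua => h; exfalso; move: h; apply/negP; rewrite -leNgt; lra.
  have [->|ib] := eqVneq i b; first by rewrite ub => h; exfalso; move: h; apply/negP; rewrite -leNgt; lra.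
  have [->|ic] := eqVneq i c; first by rewrite uc => h; exfalso; move: h; apply/negP; rewrite -leNgt; lra.
  have [->|id] := eqVneq i k; first by [].
  by rewrite /u /dep4 (negbTE ia) (negbTE ib) (negbTE ic) (negbTE id) !mul0r !addr0 ltxx.
pose w e := - dependency_stress u e.
pose G := [set e | w e < 0]%SET.
have GP e : e \in G -> [/\ (e.1 < e.2)%N, 0 < u e.1 & 0 < u e.2].
  rewrite inE /w /dependency_stress oppr_lt0; case: ifP => e12; last by rewrite ltxx.
  move=> pos; have [u1|u1|u1] := ltgtP (u e.1) 0; last by rewrite u1 mul0r ltxx in pos.
    have u2 : u e.2 < 0 by nra.
    by move: e12; rewrite (uneg _ u1) (uneg _ u2) ltnn.
  by split => //; nra.
have gG : graph_on G by move=> e /GP[].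
exists w, G; split.
- have sd : stress p (dependency_stress u).
    by apply: dep4_stress; rewrite ?/lc ?/la ?/lb /orient; ring.
  move=> v; rewrite -[RHS]oppr0 -[in RHS](sd v) -sumrN; apply: eq_bigr => e _.
  by rewrite /w mulNr.
- by move=> e; rewrite /w /dependency_stress oppr_eq0; case: ifP => // _ /eqP.
- split => //; split=> [e1 e2 /GP[lt1 v1 v2] /GP[lt2 v3 v4] ne12 y s1 s2|i].
    have share i j l : i != j -> i != l -> 
        (e1 = (i, j) \/ e1 = (j, i)) -> (e2 = (i, l) \/ e2 = (l, i)) ->
        exists k0, ((k0 == e1.1) || (k0 == e1.2)) && ((k0 == e2.1) || (k0 == e2.2)) /\ y = p k0.
      move=> ij il E1 E2; exists i; split.
        by case: E1 => ->; case: E2 => ->; rewrite /= eqxx ?orbT.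
      have jl : j != l.
        by apply/eqP => jl; rewrite -jl in E2; move/eqP: ne12; apply; exact: sorted_pair_eq lt1 lt2 E1 E2.
      apply: (seg_share gp ij il jl); first by case: E1 s1 => -> //= /in_segC.
      by case: E2 s2 => -> //= /in_segC.
    have n1 : e1.1 != e1.2 by rewrite neq_ltn lt1.
    have n2 : e2.1 != e2.2 by rewrite neq_ltn lt2.
    have n1' : e1.2 != e1.1 by rewrite eq_sym.
    have n2' : e2.2 != e2.1 by rewrite eq_sym.
    have P1 := surjective_pairing e1; have P2 := surjective_pairing e2.
    have [E|d1] := eqVneq e1.1 e2.1.
      apply: (share e1.1 e1.2 e2.2 n1 _ (or_introl P1)); first by rewrite E.
      by left; rewrite E.
    have [E|d2] := eqVneq e1.1 e2.2.
      apply: (share e1.1 e1.2 e2.1 n1 _ (or_introl P1)); first by rewrite E.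
      by right; rewrite E.
    have [E|d3] := eqVneq e1.2 e2.1.
      apply: (share e1.2 e1.1 e2.2 n1' _ (or_intror P1)); first by rewrite E.
      by left; rewrite E.
    have [E|d4] := eqVneq e1.2 e2.2.
      apply: (share e1.2 e1.1 e2.1 n1' _ (or_intror P1)); first by rewrite E.
      by right; rewrite E.
    exfalso; move: n1 n2 d1 d2 d3 d4 {n1' n2' P1 P2}.
    by case: (upos _ v1) => ->; case: (upos _ v2) => ->; rewrite ?eqxx //; case: (upos _ v3) => ->; rewrite ?eqxx //;
      case: (upos _ v4) => ->; rewrite ?eqxx.
  apply/(pointed_atP n3 gp i gG)/(halfplane_card2 n3 gp); first exact: nbr_irr.
  have [ui|ui] := ltP 0 (u i); last first.
    rewrite (_ : nbr G i = finset.set0) ?cards0 //; apply/finset.setP => l; rewrite !inE.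
    by apply/negP => /orP[] /GP[_ /= h1 h2]; lra.
  have sub : nbr G i \subset [set a; b; c]%SET :\ i.
    apply/fintype.subsetP => l lN; have li : l != i by apply/eqP => li; move: (nbr_irr i gG); rewrite -{1}li lN.
    have /upos : 0 < u l by move: lN; rewrite inE => /orP[] /GP[].
    by rewrite !inE li => -[] ->; rewrite eqxx ?orbT.
  apply: leq_trans (subset_leq_card sub) _.
  have iS : i \in [set a; b; c]%SET by rewrite !inE; case: (upos _ ui) => ->; rewrite eqxx ?orbT.
  have S3 : (#|[set a; b; c]%SET| <= 3)%N.
    by apply: leq_trans (leq_card_setU _ _) _; rewrite cards1 cards2; case: (a != b).
  by move: S3; rewrite (cardsD1 i) iS.
- split; first by move=> e; rewrite inE.
    have [lt|lt|/val_inj E] := ltngtP a b; last by rewrite E eqxx in ab.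
      by exists (a, b); rewrite /w /dependency_stress /= lt oppr_eq0 ua ub mulf_neq0 // gt_eqF.
    by exists (b, a); rewrite /w /dependency_stress /= lt oppr_eq0 ua ub mulf_neq0 // gt_eqF.
  move=> e; rewrite /w /dependency_stress oppr_gt0; case: ifP => [e12|]; last by rewrite ltxx.
  have adjT l : l \in nbr T k -> (k < l)%N -> (k, l) \in T.
    by rewrite inE => /orP[] // /gT /= /ltnW; rewrite leqNgt => /negP.
  have adjT' l : l \in nbr T k -> (l < k)%N -> (l, k) \in T.
    by rewrite inE => /orP[] // /gT /= /ltnW; rewrite leqNgt => /negP.
  have NP l : 0 < u l -> l \in nbr T k by case/upos => ->.
  move=> neg; have [u1|u1|u1] := ltgtP (u e.1) 0; last by rewrite u1 mul0r ltxx in neg.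
    have u2 : 0 < u e.2 by nra.
    have ek := uneg _ u1; rewrite [e]surjective_pairing ek; apply: adjT; first exact: NP.
    by rewrite -ek.
  have u2 : u e.2 < 0 by nra.
  have ek := uneg _ u2; rewrite [e]surjective_pairing ek; apply: adjT'; first exact: NP.
  by rewrite -ek.
Qed.

Lemma not_pnc_obstruction T : graph_on T -> ~ pointed_noncrossing p T -> obstruction T.
Proof.
move=> gT nT; have [nc|nc] := pselect (non_crossing p T); last exact: crossing_obstruction.
by apply: unpointed_obstruction => // pT; apply: nT.
Qed.

End Obstructions.

(** * Sample points and the choice of the weights *)

Section ValidWeights.
Variables (R : realType) (n : nat) (p : 'I_n -> (R * R)%type).
Hypotheses (n3 : (3 <= n)%N) (gp : general_position p).
Implicit Types (e : 'I_n * 'I_n) (w : 'I_n * 'I_n -> R).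
Local Notation segm e := (in_seg (p e.1) (p e.2)).

Definition sorted_support w : Prop := forall e, w e != 0 -> (e.1 < e.2)%N.

(** Close to an end [p k] of the edge only edges at [k] are present, and by general position they
    leave in different directions. *)
Lemma edge_interior_point e0 : (e0.1 < e0.2)%N -> exists q,
  [/\ segm e0 q, forall i, p i != q & forall e, (e.1 < e.2)%N -> e != e0 -> ~ segm e q].
Proof.
move=> lt0; set k := e0.1 in lt0 *; set l := e0.2 in lt0 *.
have kl : k != l by rewrite neq_ltn lt0.
have N : \forall y \near p k, forall e, ~ segm e (p k) -> ~ segm e y.
  apply: (@near_forall_dart n _ (nbhs (p k)) (fun e y => ~ segm e (p k) -> ~ segm e y)) => e.
  have [s|ns] := pselect (segm e (p k)); first by apply: nearW.
  by apply: filterS (near_not_in_seg ns).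
have vn := vec_neq0 n3 gp kl.
have [t [t0 [t1 [H _]]]] := @filter_ex _ _ (at_right_proper_filter (0 : R)) _
  (filterI (nbhs_right_gt (0 : R)) (filterI (nbhs_right_lt (ltr01 : 0 < (1 : R))) (near_step (vec (p k) (p l)) N))).
set q := step _ _ _ in H.
have qs : in_seg (p k) (p l) q by exists t; split=> //; apply/andP; split; exact: ltW.
have qk : q <> p k.
  move=> E; move/eqP: vn; apply; apply: injective_projections; have := congr1 fst E; have := congr1 snd E;
    rewrite /q /step /vec /=; nra.
have ql : q <> p l.
  move=> E; move/eqP: vn; apply; apply: injective_projections; have := congr1 fst E; have := congr1 snd E;
    rewrite /q /step /vec /=; nra.
exists q; split=> // [i|e lt ne s].
  apply/eqP => E; rewrite -E in qs; case: (gp_in_seg gp kl qs) => ik; rewrite ik in E.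
    exact: qk.
  exact: ql.
have [sk|nsk] := pselect (segm e (p k)); last exact: (H e nsk).
have e12 : e.1 != e.2 by rewrite neq_ltn lt.
case: (gp_in_seg gp e12 sk) => kE.
  have km : e.2 != l by apply: contra_neq ne => m; rewrite [e]surjective_pairing [e0]surjective_pairing -kE m.
  by rewrite -kE in s e12; apply: qk; apply: (seg_share gp kl e12 _ qs s); rewrite eq_sym.
have km : e.1 != l by apply: contraTneq lt => ->; rewrite -kE -leqNgt ltnW.
by apply: qk; rewrite -kE in s e12; apply: (seg_share gp kl _ _ qs (in_segC s)); rewrite eq_sym.
Qed.

Lemma left_direction a b q : a != b -> exists d,
  [/\ generic p d q, d != 0 & 0 < cross d (vec (p a) (p b))].
Proof.
move=> ab; have vn := vec_neq0 n3 gp ab; set v := vec _ _ in vn *.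
have dn : ((v.2, - v.1) : R * R) != 0.
  apply: contra_neq vn; case: (v) => v1 v2 [] /= h1 h2; congr pair => //.
  by apply/eqP; rewrite -oppr_eq0 h2.
have [t [g d']] := @filter_ex _ _ (at_right_proper_filter (0 : R)) _ (near_generic p q dn).
exists (step (v.2, - v.1) t (perp (v.2, - v.1))); split => //.
have := dot_gt0 vn; rewrite /cross /step /perp /dot /=; nra.
Qed.

(** Across an interior point of [e0] that lies on no other edge, the second difference of the
    lifting is [w e0] times a nonzero factor. The three points involved are chosen before [w], which
    is what allows one [f] for all stresses. *)
Lemma sample_points e0 : (e0.1 < e0.2)%N -> exists s : seq (R * R), forall w, stress p w ->
  sorted_support w -> (forall x, x \in s -> zlift p w x = 0) -> w e0 = 0.
Proof.
move=> lt0; have [q [qs qp qo]] := edge_interior_point lt0.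
have kl : e0.1 != e0.2 by rewrite neq_ltn lt0.
have [d [gd dn D0]] := left_direction q kl.
(* For the indicator flow of [e0], [wind_jump] says that the crossing numbers of [e0] from its two
   sides differ by 1. *)
pose c e := (e == e0)%:R : R.
have oc : only p c e0 q by move=> e /negbTE ne; rewrite /c ne eqxx.
have J := wind_jump gd qp qs oc D0.
have [t [t0 [[_ _ Jt] H]]] := @filter_ex _ _ (at_right_proper_filter (0 : R)) _
  (filterI (nbhs_right_gt (0 : R)) (filterI J (zlift_second_difference d gd dn))).
exists [:: q; step q t d; step q (- t) d] => w sw ss z0.
have := H w sw; rewrite !z0 ?inE ?eqxx ?orbT // mulr0 addr0 subr0 => /esym.
rewrite (bigD1 e0) /=; last exact/asboolP.
rewrite big1 ?addr0 => [|e /andP[/asboolP se ne]]; last first.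
  have [->|wn] := eqVneq (w e) 0; first by rewrite mul0r.
  by case: (qo e (ss _ wn) ne).
have WE y : wind p d c y = cr d y (p e0.1) (p e0.2).
  rewrite /wind (bigD1 e0) //= /c eqxx mul1r big1 ?addr0 // => e /negbTE ->; exact: mul0r.
have oE s : orient (step q s d) (p e0.1) (p e0.2) = - s * cross d (vec (p e0.1) (p e0.2)).
  by rewrite -[RHS]add0r -(orient_in_seg qs) /orient /step /cross /vec /=; ring.
move: Jt; rewrite !WE /c eqxx !oE => Jt.
set A := cr _ _ _ _ in Jt *; set B := cr d (step q t d) _ _ in Jt *; set D := cross _ _ in D0 *.
move/eqP; rewrite mulf_eq0 => /orP[/eqP //|/eqP E].
have : t * D * (A - B) = 0 by rewrite -E; ring.
by move/eqP; rewrite Jt mulr1 mulf_eq0 !gt_eqF.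
Qed.

Definition sample_weight (s : seq (R * R)) (i j : 'I_n) : R :=
  \sum_(x <- s) orient x (p i) (p j) * cr (1, 0) x (p i) (p j).

Lemma sum_sample_weight w s :
  \sum_e w e * sample_weight s e.1 e.2 = \sum_(x <- s) zlift p w x.
Proof.
rewrite /sample_weight; under eq_bigr do rewrite mulr_sumr.
by rewrite exchange_big; apply: eq_bigr => x _; apply: eq_bigr => e _; rewrite /torque mulrA.
Qed.

(* By the maximum principle the left-hand side is a sum of values of a nonpositive lifting,
   sampled at enough points to detect a nonzero stress. *)
Lemma valid_weights : exists f : 'I_n -> 'I_n -> R, forall w G, stress p w -> sorted_support w ->
  pointed_noncrossing p G -> (forall e, w e < 0 -> e \in G) -> (exists e, w e != 0) ->
  \sum_e w e * f e.1 e.2 < 0.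
Proof.
have [F FP] := choice (fun e0 : {e : 'I_n * 'I_n | (e.1 < e.2)%N} => sample_points (svalP e0)).
pose s := flatten (map F (enum (predT : pred {e : 'I_n * 'I_n | (e.1 < e.2)%N}))).
exists (sample_weight s) => w G sw ss [gG [ncG pG]] wG [e we].
have uG k : exists2 u, u != 0 & forall l, adj G k l -> 0 < dot u (vec (p k) (p l)).
  have [u un H] := (pointed_atP n3 gp k gG).1 (pG k).
  by exists u => // l kl; apply: H; rewrite inE.
have z0 := zlift_le0 n3 gp sw wG gG ncG uG.
rewrite sum_sample_weight lt_neqAle; apply/andP; split; last by rewrite big_seq; apply: sumr_le0.
rewrite -oppr_eq0 -sumrN psumr_eq0 => [|x _]; last by rewrite oppr_ge0.
apply/negP => /allP H; move/eqP: (we); apply.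
apply: (FP (exist _ e (ss _ we)) w sw ss) => x xF.
apply/eqP; rewrite -oppr_eq0; apply: H; apply/flattenP; exists (F (exist _ e (ss _ we))) => //.
by rewrite map_f // mem_enum.
Qed.

End ValidWeights.

(** * Linear inequalities and the faces of the polyhedron *)

Section Farkas.
Variables (R : realFieldType) (I J : finType).
Implicit Types (x : I -> R) (mu nu : {ffun J -> R}).

Lemma between_seqs (L U : seq R) : (forall l u, l \in L -> u \in U -> l <= u) ->
  exists z, (forall l, l \in L -> l <= z) /\ (forall u, u \in U -> z <= u).
Proof.
elim: L => [|l L IH] H.
  elim: U {H} => [|u U [z [_ hz]]]; first by exists 0.
  exists (Num.min u z); split => // v; rewrite inE => /predU1P[->|/hz h]; first by rewrite ge_min lexx.
  by rewrite ge_min h orbT.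
have [l' u' h1 h2|z [hL hU]] := IH; first by apply: H => //; rewrite inE h1 orbT.
exists (Num.max l z); split => [k|u hu].
  by rewrite inE => /predU1P[->|/hL h]; rewrite le_max ?lexx // h orbT.
by rewrite ge_max hU // H // mem_head.
Qed.

Variables (a : J -> I -> R) (b : J -> R).

Definition comb_coef mu i : R := \sum_j mu j * a j i.
Definition comb_rhs mu : R := \sum_j mu j * b j.

Let lincomb (s t : R) mu nu : {ffun J -> R} := [ffun j => s * mu j + t * nu j].

Lemma comb_coef_lin s t mu nu i :
  comb_coef (lincomb s t mu nu) i = s * comb_coef mu i + t * comb_coef nu i.
Proof. by rewrite /comb_coef !mulr_sumr -big_split; apply: eq_bigr => j _; rewrite ffunE /=; ring. Qed.

Lemma comb_rhs_lin s t mu nu :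
  comb_rhs (lincomb s t mu nu) = s * comb_rhs mu + t * comb_rhs nu.
Proof. by rewrite /comb_rhs !mulr_sumr -big_split; apply: eq_bigr => j _; rewrite ffunE /=; ring. Qed.

(* Fourier-Motzkin elimination of the variables in r; a constraint is represented by the
   vector mu of multipliers that produces it from the original ones. *)
Lemma fourier_motzkin (r : seq I) (s : seq {ffun J -> R}) : uniq r ->
  (forall mu, mu \in s -> forall j, 0 <= mu j) ->
  (exists x, forall mu, mu \in s -> comb_rhs mu <= \sum_(i <- r) comb_coef mu i * x i) \/
  (exists mu, [/\ forall j, 0 <= mu j, 0 < comb_rhs mu &
     forall i, (i \in r) \/ (forall nu, nu \in s -> comb_coef nu i = 0) -> comb_coef mu i = 0]).
Proof.
elim: r s => [|k r IH] s /=.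
  move=> _ s0; have [/allP H|/allPn[mu mus]] := boolP (all (fun mu => comb_rhs mu <= 0) s).
    by left; exists (fun=> 0) => mu /H; rewrite big_nil.
  by rewrite -ltNge => h; right; exists mu; split => //; [exact: s0|move=> i [//|]; apply].
case/andP=> kr ur s0.
pose P := [seq mu <- s | 0 < comb_coef mu k]; pose N := [seq mu <- s | comb_coef mu k < 0].
pose Z := [seq mu <- s | comb_coef mu k == 0].
(* Constraints free of the variable [k] are kept; every constraint with positive coefficient is
   combined with every one with negative coefficient so that the variable cancels. *)
pose s' := Z ++ [seq lincomb (- comb_coef nu k) (comb_coef mu k) mu nu | mu <- P, nu <- N].
have s'P mu : mu \in s' -> (mu \in s /\ comb_coef mu k = 0) \/ exists m1 m2, [/\ m1 \in s, m2 \in s,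
   0 < comb_coef m1 k, comb_coef m2 k < 0 & mu = lincomb (- comb_coef m2 k) (comb_coef m1 k) m1 m2].
  rewrite mem_cat => /orP[|/allpairsP[[m1 m2] /= []]].
    by rewrite mem_filter => /andP[/eqP ? ?]; left.
  by rewrite !mem_filter => /andP[? ?] /andP[? ?] ->; right; exists m1, m2.
have s'0 mu : mu \in s' -> forall j, 0 <= mu j.
  case/s'P => [[/s0 //]|[m1 [m2 [h1 h2 c1 c2 ->]]] j]; rewrite ffunE addr_ge0 // mulr_ge0 ?s0 //; lra.
have [[x xP]|[mu [mu0 mub mui]]] := IH s' ur s'0; last first.
  right; exists mu; split => // i; rewrite inE => -[/predU1P[->|ir]|H].
  - apply: mui; right => nu /s'P[[]|[m1 [m2 [_ _ _ _ ->]]]] //.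
    by rewrite comb_coef_lin; ring.
  - by apply: mui; left.
  apply: mui; right => nu /s'P[[/H //]|[m1 [m2 [h1 h2 _ _ ->]]]].
  by rewrite comb_coef_lin !H // !mulr0 addr0.
pose S mu := \sum_(i <- r) comb_coef mu i * x i.
(* The bound that [mu] puts on the eliminated variable: a lower bound for members of [P], an upper
   bound for members of [N]. *)
pose bound mu := (comb_rhs mu - S mu) / comb_coef mu k.
have [l u /mapP[m1 m1P ->] /mapP[m2 m2N ->]|z [zL zU]] := @between_seqs (map bound P) (map bound N).
  have := m1P; have := m2N; rewrite !mem_filter => /andP[c2 h2] /andP[c1 h1].
  have := xP (lincomb (- comb_coef m2 k) (comb_coef m1 k) m1 m2) _.
  rewrite mem_cat (allpairs_f (fun m1 m2 => lincomb _ _ m1 m2)) ?orbT // => /(_ isT).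
  under eq_bigr do rewrite comb_coef_lin mulrDl -!mulrA.
  rewrite big_split /= -!mulr_sumr -/(S m1) -/(S m2) comb_rhs_lin /bound => h.
  rewrite ler_pdivrMr // mulrAC ler_ndivlMr //; nra.
left; exists (fun i => if i == k then z else x i) => mu mus.
rewrite big_cons eqxx.
rewrite (eq_big_seq (fun i => comb_coef mu i * x i)) => [|i ir]; last first.
  by case: eqP => // E; rewrite -E ir in kr.
rewrite -/(S mu); have [c|c|c] := ltgtP (comb_coef mu k) 0.
- have := zU (bound mu); rewrite map_f ?mem_filter ?c // => /(_ isT).
  by rewrite /bound ler_ndivlMr //; lra.
- have := zL (bound mu); rewrite map_f ?mem_filter ?c // => /(_ isT).
  by rewrite /bound ler_pdivrMr //; lra.
rewrite c mul0r add0r; apply: xP; rewrite mem_cat mem_filter c eqxx mus //.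
Qed.

Lemma farkas : (exists x, forall j, b j <= \sum_i a j i * x i) \/
  (exists mu : J -> R, [/\ forall j, 0 <= mu j, forall i, \sum_j mu j * a j i = 0 & 0 < \sum_j mu j * b j]).
Proof.
pose d (k : J) : {ffun J -> R} := [ffun j => (j == k)%:R].
have dE (g : J -> R) k : \sum_j d k j * g j = g k.
  rewrite (bigD1 k) //= big1 ?ffunE ?eqxx ?mul1r ?addr0 // => j /negbTE jk.
  by rewrite ffunE jk mul0r.
have [|[x xP]|[mu [mu0 mub mui]]] := @fourier_motzkin (enum I) (map d (enum J)) (enum_uniq _).
- by move=> mu /mapP[k _ ->] j; rewrite ffunE ler0n.
- left; exists x => j; have := xP (d j); rewrite map_f ?mem_enum // => /(_ isT).
  by rewrite /comb_rhs dE big_enum /=; under eq_bigr do rewrite /comb_coef dE.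
right; exists mu; split => // i; apply: mui; left; exact: mem_enum.
Qed.

End Farkas.

(** * Linear functionals on matrices, independence and affine dimension *)

Section LinearFunctionals.
Variables (R : realType) (n m : nat).
Local Notation M := 'M[R]_(n, m).
Implicit Types (c x y : M) (t : R).

Lemma linD c x y : lin c (x + y) = lin c x + lin c y.
Proof.
rewrite /lin -big_split; apply: eq_bigr => i _; rewrite -big_split; apply: eq_bigr => j _.
by rewrite mxE mulrDr.
Qed.

Lemma linZ c t x : lin c (t *: x) = t * lin c x.
Proof.
rewrite /lin mulr_sumr; apply: eq_bigr => i _; rewrite mulr_sumr; apply: eq_bigr => j _.
by rewrite mxE; ring.
Qed.

Lemma linC c x : lin c x = lin x c.
Proof. by apply: eq_bigr => i _; apply: eq_bigr => j _; rewrite mulrC. Qed.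

Lemma lin_delta i j x : lin (delta_mx i j) x = x i j.
Proof.
rewrite /lin (bigD1 i) //= (bigD1 j) //= mxE !eqxx mul1r !big1 ?addr0 // => [k /negbTE ki|k /negbTE ki].
  by rewrite big1 // => l _; rewrite mxE ki mul0r.
by rewrite mxE ki andbF mul0r.
Qed.

Lemma lin_sum (J : finType) (F : J -> M) (w : J -> R) x : lin (\sum_j w j *: F j) x = \sum_j w j * lin (F j) x.
Proof.
rewrite linC; elim/big_ind2: _ => [|y1 r1 y2 r2 <- <-|j _]; last by rewrite linZ linC.
  by rewrite -(scale0r 0) linZ mul0r.
by rewrite linD.
Qed.

Lemma farkas_lin (J : finType) (c : J -> M) (b : J -> R) :
  (exists x, forall j, b j <= lin (c j) x) \/
  (exists mu : J -> R, [/\ forall j, 0 <= mu j, (forall x, \sum_j mu j * lin (c j) x = 0) & 0 < \sum_j mu j * b j]).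
Proof.
pose a j (i : 'I_n * 'I_m) := c j i.1 i.2.
have [[x xP]|[mu [mu0 mua mub]]] := farkas a b.
  left; exists (\matrix_(i, j) x (i, j)) => j; apply: le_trans (xP j) _.
  rewrite /lin pair_bigA /=; rewrite le_eqVlt; apply/orP; left; apply/eqP.
  by apply: eq_bigr => -[i k] _; rewrite mxE.
right; exists mu; split => // x.
rewrite -lin_sum /lin big1 // => i _; rewrite big1 // => k _.
rewrite summxE; under eq_bigr do rewrite mxE.
by rewrite (mua (i, k)) mul0r.
Qed.

Section Independent.
Variables (J : finType) (c : J -> M).
Hypothesis indep : forall y : J -> R, (forall x, \sum_j y j * lin (c j) x = 0) -> forall j, y j = 0.

Let cr j : 'rV[R]_(n * m) := mxvec (c j).
Let A : 'M[R]_(#|J|, n * m) := \matrix_(j < #|J|) cr (enum_val j).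

Let lin_mxvec (y x : M) : lin y x = (mxvec y *m (mxvec x)^T) 0 0.
Proof.
rewrite mxE /lin pair_bigA (reindex _ (curry_mxvec_bij n m)) /=; apply: eq_bigr => -[i j] _ /=.
by rewrite !mxE !mxvecE.
Qed.

Let A_free : row_free A.
Proof.
apply: inj_row_free => v vA; apply/rowP => k; rewrite mxE.
pose y j := v 0 (enum_rank j).
rewrite -[k]enum_valK -/(y (enum_val k)); apply: indep => x.
rewrite -lin_sum lin_mxvec.
have -> : mxvec (\sum_j y j *: c j) = v *m A.
  rewrite linear_sum mulmx_sum_row (reindex _ (onW_bij _ (enum_val_bij J))) /=; apply: eq_bigr => j _.
  by rewrite rowK linearZ /y enum_valK.
by rewrite vA mul0mx mxE.
Qed.

Lemma independent_solve (b : J -> R) : exists x, forall j, lin (c j) x = b j.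
Proof.
have /row_freeP[B AB] := A_free.
exists (vec_mx (B *m \col_j b (enum_val j))^T) => j.
rewrite lin_mxvec vec_mxK trmxK mulmxA.
transitivity ((A *m B *m (\col_k b (enum_val k))) (enum_rank j) 0).
  rewrite !mxE; apply: eq_bigr => k _; congr (_ * _); rewrite !mxE; apply: eq_bigr => l _.
  by rewrite !mxE enum_rankK.
by rewrite AB mul1mx mxE enum_rankK.
Qed.

Definition eval_functionals x : 'cV[R]_#|J| := \col_j lin (c (enum_val j)) x.

Fact eval_functionals_linear : linear eval_functionals.
Proof. by move=> t x y; apply/colP => j; rewrite !mxE linD linZ. Qed.

HB.instance Definition _ := GRing.isLinear.Build R M 'cV[R]_#|J| _ eval_functionals eval_functionals_linear.

Definition null_space : {vspace M} := lker (linfun eval_functionals).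

Lemma mem_null_space x : x \in null_space <-> forall j, lin (c j) x = 0.
Proof.
rewrite memv_ker lfunE /=; split=> [/eqP/colP H j|H].
  by have := H (enum_rank j); rewrite !mxE enum_rankK.
by apply/eqP/colP => j; rewrite !mxE H.
Qed.

Lemma dim_null_space : (\dim null_space + #|J|)%N = (n * m)%N.
Proof.
have full : limg (linfun eval_functionals) = fullv.
  apply/vspaceP => b; rewrite memvf; have [x xP] := independent_solve (fun j => b (enum_rank j) 0).
  apply/memv_imgP; exists x; rewrite ?memvf // lfunE /=.
  by apply/colP => j; rewrite mxE xP enum_valK.
have := limg_ker_dim (linfun eval_functionals) fullv.
by rewrite capfv full !dimvf !dim_matrix mulr1.
Qed.

End Independent.

(** [S] need not contain the flat v0 + L, only a point in each of its directions: basis vectors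
    scaled by individual factors still form a basis. *)
Lemma affdim_flat (S : set M) (v0 : M) (L : {vspace M}) : S v0 ->
  (forall x, S x -> x - v0 \in L) ->
  (forall w, w \in L -> exists2 t, 0 < t & S (v0 + t *: w)) -> affdim S (\dim L).
Proof.
move=> Sv0 SL LS; split.
  have bL (i : 'I_(\dim L)) : exists t, 0 < t /\ S (v0 + t *: (vbasis L)`_i).
    have ib : (vbasis L)`_i \in L by apply/vbasis_mem/mem_nth; rewrite size_tuple.
    by have [t t0 St] := LS _ ib; exists t.
  have [t tP] := choice bL.
  pose X := [seq t i *: (vbasis L)`_i | i <- enum 'I_(\dim L)].
  have sX : size X = \dim L by rewrite size_map size_enum_ord.
  exists (v0 :: [seq v0 + x | x <- X]); split; first by rewrite /= size_map sX.
  split.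
    move=> x; rewrite inE => /predU1P[->//|/mapP[y /mapP[i _ ->] ->]].
    by have [] := tP i.
  rewrite /aff_indep -map_comp (eq_map (_ : _ =1 id)) => [|y]; last by rewrite /= addrAC subrr add0r.
  rewrite map_id /free sX eqn_leq; apply/andP; split; first by rewrite -[leqRHS]sX; exact: dim_span.
  apply: dimvS; rewrite -[X in (X <= _)%VS](span_basis (vbasisP L)); apply/span_subvP => y yb.
  have iy : (index y (vbasis L) < \dim L)%N by rewrite -[X in (_ < X)%N](size_tuple (vbasis L)) index_mem.
  have [ti _] := tP (Ordinal iy).
  rewrite -(nth_index 0 yb) -[y in nth _ _ y]/(val (Ordinal iy)).
  rewrite -[(vbasis L)`_ _]scale1r -(mulVf (_ : t (Ordinal iy) != 0)) ?gt_eqF // -scalerA.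
  by apply/memvZ/memv_span/map_f; rewrite mem_enum.
case=> [//|x s] sS; rewrite /aff_indep /free => /eqP fr.
rewrite /= ltnS -(size_map (fun y => y - x)) -fr; apply: dimvS; apply/span_subvP => _ /mapP[y ys ->].
have -> : y - x = (y - v0) - (x - v0) by rewrite opprB addrA subrK.
by apply: memvB; apply/SL/sS; rewrite inE ?ys ?eqxx ?orbT.
Qed.

Lemma affdim_uniq (S : set M) k k' : affdim S k -> affdim S k' -> k = k'.
Proof.
move=> [[s [ss [sS sa]]] H] [[s' [ss' [sS' sa']]] H'].
by apply/eqP; rewrite eqn_leq -ltnS -ss H' //= -ltnS -ss' H.
Qed.

End LinearFunctionals.

(** * Motions, tight constraints and faces *)

Section Motions.
Variables (R : realType) (n : nat) (p : 'I_n -> (R * R)%type).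
Hypotheses (n3 : (3 <= n)%N) (gp : general_position p) (lab : labeled_y p).
Implicit Types (v w x : 'M[R]_(n, 2)) (e : 'I_n * 'I_n) (T : {set 'I_n * 'I_n}) (t : R).
Local Notation im v e := (ipm p v e.1 e.2).

Let i0 : 'I_n := Ordinal (leq_trans (isT : (1 <= 3)%N) n3).
Let i1 : 'I_n := Ordinal (leq_trans (isT : (2 <= 3)%N) n3).

Lemma normalizedP v : normalized v <-> [/\ v i0 ord0 = 0, v i0 ord_max = 0 & v i1 ord0 = 0].
Proof.
split=> [H|[h1 h2 h3] i].
  by have [/(_ erefl)[]] := H i0; have [_ /(_ erefl)] := H i1.
split=> i_.
  by have -> : i = i0 by apply: val_inj.
by have -> : i = i1 by apply: val_inj.
Qed.

Lemma normalizedD v w : normalized v -> normalized w -> normalized (v + w).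
Proof.
move=> /normalizedP[h1 h2 h3] /normalizedP[k1 k2 k3]; apply/normalizedP.
by rewrite !mxE h1 h2 h3 k1 k2 k3 !addr0.
Qed.

Lemma normalizedZ t v : normalized v -> normalized (t *: v).
Proof. by move=> /normalizedP[h1 h2 h3]; apply/normalizedP; rewrite !mxE h1 h2 h3 !mulr0. Qed.

Lemma normalizedN v : normalized v -> normalized (- v).
Proof. by move=> h; rewrite -scaleN1r; exact: normalizedZ. Qed.

Lemma normalizedB v w : normalized v -> normalized w -> normalized (v - w).
Proof. by move=> h k; apply: normalizedD => //; exact: normalizedN. Qed.

Lemma ipmD v w i j : ipm p (v + w) i j = ipm p v i j + ipm p w i j.
Proof. by rewrite /ipm !mxE; ring. Qed.

Lemma ipmZ t v i j : ipm p (t *: v) i j = t * ipm p v i j.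
Proof. by rewrite /ipm !mxE; ring. Qed.

Lemma ipmN v i j : ipm p (- v) i j = - ipm p v i j.
Proof. by rewrite -scaleN1r ipmZ mulN1r. Qed.

Lemma ipmB v w i j : ipm p (v - w) i j = ipm p v i j - ipm p w i j.
Proof. by rewrite ipmD ipmN. Qed.

Lemma ipmC v i j : ipm p v i j = ipm p v j i.
Proof. by rewrite /ipm; ring. Qed.

Definition edge_mx e : 'M[R]_(n, 2) :=
  ((p e.1).1 - (p e.2).1) *: (delta_mx e.1 ord0 - delta_mx e.2 ord0) +
  ((p e.1).2 - (p e.2).2) *: (delta_mx e.1 ord_max - delta_mx e.2 ord_max).

Lemma lin_edge_mx e v : lin (edge_mx e) v = im v e.
Proof.
have B x y : lin v (x - y) = lin x v - lin y v.
  by rewrite linD -scaleN1r linZ mulN1r (linC v x) (linC v y).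
by rewrite linC /edge_mx linD !linZ !B !lin_delta.
Qed.

(** The velocity field of a translation by (a, b) combined with a rotation of angular speed s about
    the origin. *)
Definition rigid_motion (a b s : R) : 'M[R]_(n, 2) :=
  \matrix_(k, c) if c == ord0 then a - s * (p k).2 else b + s * (p k).1.

Lemma ipm_rigid_motion a b s i j : ipm p (rigid_motion a b s) i j = 0.
Proof. by rewrite /ipm !mxE /=; ring. Qed.

Lemma y01 : (p i1).2 - (p i0).2 != 0.
Proof. by rewrite subr_eq0 eq_sym; exact: lab. Qed.

(** Adding a rigid motion changes no edge length to first order. The rotation is solved from the
    velocity difference of the first two points, whose y-coordinates differ by [labeled_y]. *)
Lemma normalize v : exists w, normalized w /\ forall i j, ipm p w i j = ipm p v i j.
Proof.
pose s := (v i1 ord0 - v i0 ord0) / ((p i1).2 - (p i0).2).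
exists (v + rigid_motion (- v i0 ord0 + s * (p i0).2) (- v i0 ord_max - s * (p i0).1) s); split.
  apply/normalizedP; rewrite !mxE /=; split; [ring|ring|].
  have : s * ((p i1).2 - (p i0).2) = v i1 ord0 - v i0 ord0 by rewrite divfK // y01.
  lra.
by move=> i j; rewrite ipmD ipm_rigid_motion addr0.
Qed.

(** The complete graph is rigid: the normalization and the first bar fix two points, and any other
    point is held by two bars to them, which are not parallel. *)
Lemma normalized_rigid w : normalized w ->
  (forall e, (e.1 < e.2)%N -> im w e = 0) -> w = 0.
Proof.
move=> /normalizedP[h1 h2 h3] H.
have Hs i j : ipm p w i j = 0.
  have [ij|ij|/val_inj ->] := ltngtP i j; first exact: (H (i, j)).
    by rewrite ipmC (H (j, i)).
  by rewrite /ipm !subrr !mul0r addr0.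
have h4 : w i1 ord_max = 0.
  have := Hs i1 i0; rewrite /ipm h1 h2 h3 !subr0 mulr0 add0r => /eqP.
  by rewrite mulf_eq0 (negbTE y01) => /eqP.
apply/matrixP => k c; rewrite [RHS]mxE.
have [->|k0] := eqVneq k i0.
  by case: (eqVneq c ord0) => [->//|c0]; have -> : c = ord_max by apply: val_inj; case: c c0 => -[|[]].
have [->|k1] := eqVneq k i1.
  by case: (eqVneq c ord0) => [->//|c0]; have -> : c = ord_max by apply: val_inj; case: c c0 => -[|[]].
have o : orient (p k) (p i0) (p i1) != 0 by apply: gp.
have e0 := Hs k i0; have e1 := Hs k i1.
rewrite /ipm h1 h2 h3 h4 !subr0 in e0 e1.
have kx : w k ord0 = 0.
  apply: (mulIf o); rewrite mul0r; transitivity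
    (((p k).2 - (p i1).2) * (((p k).1 - (p i0).1) * w k ord0 + ((p k).2 - (p i0).2) * w k ord_max)
     - ((p k).2 - (p i0).2) * (((p k).1 - (p i1).1) * w k ord0 + ((p k).2 - (p i1).2) * w k ord_max)) => //.
    by rewrite /orient; ring.
  by rewrite e0 e1 !mulr0 subr0.
have ky : w k ord_max = 0.
  apply: (mulIf o); rewrite mul0r; transitivity
    (((p k).1 - (p i0).1) * (((p k).1 - (p i1).1) * w k ord0 + ((p k).2 - (p i1).2) * w k ord_max)
     - ((p k).1 - (p i1).1) * (((p k).1 - (p i0).1) * w k ord0 + ((p k).2 - (p i0).2) * w k ord_max)) => //.
    by rewrite /orient; ring.
  by rewrite e0 e1 !mulr0 subr0.
by case: (eqVneq c ord0) => [->//|c0]; have -> : c = ord_max by apply: val_inj; case: c c0 => -[|[]].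
Qed.

Definition stress_free T : Prop :=
  forall w : 'I_n * 'I_n -> R, stress p w -> (forall e, w e != 0 -> e \in T) -> forall e, w e = 0.

Section StressFree.
Variable T : {set 'I_n * 'I_n}.
Hypothesis sfT : stress_free T.

(** The three functionals of the normalization together with the bars of [T]; their common kernel is
    the space of normalized motions that preserve [T]. *)
Definition motion_functional (j : (bool + unit) + 'I_#|T|) : 'M[R]_(n, 2) :=
  match j with
  | inl (inl true) => delta_mx i0 ord0
  | inl (inl false) => delta_mx i0 ord_max
  | inl (inr _) => delta_mx i1 ord0
  | inr k => edge_mx (enum_val k)
  end.

(** In a vanishing combination, testing on translations and on a rotation kills the coefficients of
    the normalization. The rest is a stress supported on [T]. *)
Lemma motion_functional_indep (y : (bool + unit) + 'I_#|T| -> R) :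
  (forall x, \sum_j y j * lin (motion_functional j) x = 0) -> forall j, y j = 0.
Proof.
move=> H; pose W e := \sum_(k < #|T|) (enum_val k == e)%:R * y (inr k).
have WE (F : 'I_n * 'I_n -> R) : \sum_e W e * F e = \sum_(k < #|T|) y (inr k) * F (enum_val k).
  under eq_bigr do rewrite mulr_suml; rewrite exchange_big; apply: eq_bigr => k _.
  rewrite (bigD1 (enum_val k)) //= eqxx mul1r big1 ?addr0 // => e /negbTE ek.
  by rewrite eq_sym ek !mul0r.
have U (F : unit -> R) : \sum_i F i = F tt by rewrite (bigD1 tt) //= big1 ?addr0 // => -[].
have HE x : y (inl (inl true)) * x i0 ord0 + y (inl (inl false)) * x i0 ord_max +
    y (inl (inr tt)) * x i1 ord0 + \sum_e W e * im x e = 0.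
  apply: etrans (H x); rewrite (WE (fun e => im x e)) !big_sumType /= big_bool U !lin_delta; congr (_ + _).
  by apply: eq_bigr => k _; rewrite lin_edge_mx.
have Z a b s : \sum_e W e * im (rigid_motion a b s) e = 0.
  by apply: big1 => e _; rewrite ipm_rigid_motion mulr0.
have h1 := HE (rigid_motion 1 0 0); have h2 := HE (rigid_motion 0 1 0); have h3 := HE (rigid_motion 0 0 1).
rewrite !Z !mxE /= in h1 h2 h3.
have yu : y (inl (inr tt)) = 0.
  apply: (mulIf y01); rewrite mul0r.
  have e1 : y (inl (inl true)) = - y (inl (inr tt)) by lra.
  have e2 : y (inl (inl false)) = 0 by lra.
  by move: h3; rewrite e1 e2; lra.
have yt : y (inl (inl true)) = 0 by lra.
have yf : y (inl (inl false)) = 0 by lra.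
have W0 : forall e, W e = 0.
  apply: sfT => [v|e].
    by have := HE v; rewrite yu yt yf !mul0r !add0r.
  rewrite /W; apply: contraNT => eT; apply/eqP; apply: big1 => k _.
  have [ek|_] := eqVneq (enum_val k) e; last by rewrite mul0r.
  by rewrite -ek enum_valP in eT.
case=> [[[]|[]]|k] //; rewrite -(W0 (enum_val k)) /W (bigD1 k) //= eqxx mul1r big1 ?addr0 // => l lk.
by rewrite (inj_eq enum_val_inj) (negbTE lk) mul0r.
Qed.

Lemma motion_solve (b : 'I_n * 'I_n -> R) : exists2 w, normalized w & forall e, e \in T -> im w e = b e.
Proof.
have [x xP] := independent_solve motion_functional_indep
  (fun j => if j is inr k then b (enum_val k) else 0).
exists x.
  apply/normalizedP; have := xP (inl (inl true)); have := xP (inl (inl false)); have := xP (inl (inr tt)).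
  by rewrite /= !lin_delta.
by move=> e eT; have := xP (inr (enum_rank_in eT e)); rewrite /= enum_rankK_in // lin_edge_mx.
Qed.

Definition motion_space : {vspace 'M[R]_(n, 2)} := null_space motion_functional.

Lemma mem_motion_space w : w \in motion_space <-> normalized w /\ forall e, e \in T -> im w e = 0.
Proof.
rewrite mem_null_space; split=> [H|[/normalizedP[h1 h2 h3] H] [[[]|[]]|k]] /=; rewrite ?lin_delta //.
  split=> [|e eT].
    apply/normalizedP; have := H (inl (inl true)); have := H (inl (inl false)); have := H (inl (inr tt)).
    by rewrite /= !lin_delta.
  by have := H (inr (enum_rank_in eT e)); rewrite /= enum_rankK_in // lin_edge_mx.
by rewrite lin_edge_mx H // enum_valP.
Qed.

Lemma dim_motion_space : (\dim motion_space + #|T| = 2 * n - 3)%N.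
Proof.
have := dim_null_space motion_functional_indep; rewrite !card_sum card_bool card_unit card_ord mulnC => <-.
by rewrite [(2 + 1 + _)%N]addnC addnA addnK.
Qed.

End StressFree.

Variable f : 'I_n -> 'I_n -> R.
Hypothesis valid : forall (w : 'I_n * 'I_n -> R) G, stress p w -> sorted_support w ->
  pointed_noncrossing p G -> (forall e, w e < 0 -> e \in G) -> (exists e, w e != 0) ->
  \sum_e w e * f e.1 e.2 < 0.
Local Notation Q := (Xbar p f).
Local Notation fe e := (f e.1 e.2).
Implicit Types (G : {set 'I_n * 'I_n}).

Definition tight v : {set 'I_n * 'I_n} :=
  [set e : 'I_n * 'I_n | (e.1 < e.2)%N && (im v e == fe e)].

Lemma tightP v e : reflect ((e.1 < e.2)%N /\ im v e = fe e) (e \in tight v).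
Proof. by rewrite inE; apply: (iffP andP) => -[h /eqP]. Qed.

Lemma graph_on_tight v : graph_on (tight v).
Proof. by move=> e /tightP[]. Qed.

(** If the tight graph had an obstruction [w], pairing it with [v] would show that sum w f is minus
    the sum of [w] times the slacks. Positive weights sit on tight edges, so this is non-negative,
    against validity. *)
Lemma tight_pnc v : Q v -> pointed_noncrossing p (tight v).
Proof.
move=> [_ Qv]; apply: contrapT => /(not_pnc_obstruction n3 gp (@graph_on_tight v)).
case=> w [G [sw ss pG [wG wn wT]]]; have := valid sw ss pG wG wn; apply/negP; rewrite -leNgt.
rewrite -subr_le0 -[X in X - _](sw v) -sumrB; apply: sumr_le0 => e _.
rewrite -mulrBr; have [w0|w0|->] := ltgtP (w e) 0; last by rewrite mul0r.
  apply: mulr_le0_ge0; first exact: ltW.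
  by rewrite subr_ge0; apply/Qv/ss; rewrite lt_eqF.
by have /tightP[_ ->] := wT _ w0; rewrite subrr mulr0.
Qed.

(** Validity applies to [w] and to its negative, and would make both sums negative. *)
Lemma pnc_stress_free G : pointed_noncrossing p G -> stress_free G.
Proof.
move=> pG w sw wG; apply: contrapT => wn; have {}wn : exists e, w e != 0.
  by apply: contrapT => N; apply: wn => e; apply/eqP/negPn/negP => h; apply: N; exists e.
have gG := pG.1.
have h1 := valid sw (fun e we => gG _ (wG e we)) pG (fun e we => wG e (ltr0_neq0 we)) wn.
have sw' : stress p (fun e => - w e).
  by move=> v; under eq_bigr do rewrite mulNr; rewrite sumrN sw oppr0.
have := @valid (fun e => - w e) G sw' _ pG _ _.
have -> : \sum_e - w e * fe e = - \sum_e w e * fe e by rewrite -sumrN; apply: eq_bigr => e _; rewrite mulNr.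
rewrite oppr_lt0 => H; have := H _ _ _; rewrite ltNge (ltW h1) => K; apply: notF; apply: K.
- by move=> e; rewrite oppr_eq0 => /wG /gG.
- by move=> e; rewrite oppr_lt0 => we; apply: wG; rewrite gt_eqF.
by case: wn => e we; exists e; rewrite oppr_eq0.
Qed.

(** The system consists of all inequalities (flag [true]) and of the reversed ones for edges of [G]
    (flag [false]). A Farkas certificate of infeasibility is a stress that is negative only on [G]
    and has a positive sum with [f], which validity excludes. *)
Lemma tight_feasible G : pointed_noncrossing p G -> exists2 v, Q v & G \subset tight v.
Proof.
move=> pG; have gG := pG.1.
pose s (b : bool) : R := if b then 1 else -1.
pose act (j : bool * ('I_n * 'I_n)) := (j.2.1 < j.2.2)%N && (j.1 || (j.2 \in G)).
have [[x xP]|[mu [mu0 muA mub]]] := farkas_lin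
  (fun j : bool * ('I_n * 'I_n) => (if act j then s j.1 else 0) *: edge_mx j.2)
  (fun j => (if act j then s j.1 else 0) * fe j.2).
  have xP' j : act j -> s j.1 * fe j.2 <= s j.1 * im x j.2.
    by move=> aj; have := xP j; rewrite aj linC linZ linC lin_edge_mx.
  have [v [nv vx]] := normalize x.
  have Qv : Q v.
    by split=> // i j ij; rewrite vx; have := xP' (true, (i, j)); rewrite /act /= ij !mul1r; apply.
  exists v => //; apply/fintype.subsetP => e eG; apply/tightP; have e12 := gG e eG; split => //.
  apply/le_anti/andP; split; last exact: Qv.2.
  by rewrite vx; have := xP' (false, e); rewrite /act /= e12 eG !mulN1r lerN2; apply.
exfalso; pose w e := \sum_b mu (b, e) * (if act (b, e) then s b else 0).
have wE (F : 'I_n * 'I_n -> R) : \sum_e w e * F e = \sum_j mu j * ((if act j then s j.1 else 0) * F j.2).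
  transitivity (\sum_b \sum_e mu (b, e) * ((if act (b, e) then s b else 0) * F e)).
    by rewrite exchange_big; apply: eq_bigr => e _; rewrite mulr_suml; apply: eq_bigr => b _; rewrite mulrA.
  by rewrite pair_bigA; apply: eq_bigr => -[].
have sw : stress p w.
  move=> v; rewrite wE -[RHS](muA v); apply: eq_bigr => j _.
  by rewrite [in RHS]linC linZ linC lin_edge_mx.
have wb : 0 < \sum_e w e * fe e by rewrite wE.
have := @valid w G sw _ pG _ _; rewrite ltNge (ltW wb) => H; apply: notF; apply: H.
- move=> e; rewrite /w; apply: contraNT => e12; rewrite big1 // => b _.
  by rewrite /act (negbTE e12) mulr0.
- move=> e; rewrite /w; apply: contraTT => eG; rewrite -leNgt big_bool /act (negbTE eG) /= andbF mulr0 addr0.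
  by case: ifP => _; rewrite ?mulr1 ?mulr0.
apply: contrapT => N; move: wb; rewrite big1 ?ltxx // => e _.
by have [->|h] := eqVneq (w e) 0; [rewrite mul0r|case: N; exists e].
Qed.

Lemma near_feasible v w : Q v -> normalized w -> (forall e, e \in tight v -> 0 <= im w e) ->
  \forall t \near (0 : R)^'+, Q (v + t *: w) /\ tight (v + t *: w) = [set e in tight v | im w e == 0].
Proof.
move=> Qv nw H.
have N : \forall t \near (0 : R)^'+, forall e, (e.1 < e.2)%N -> e \notin tight v -> fe e < im (v + t *: w) e.
  apply: (@near_forall_dart n _ ((0 : R)^'+) (fun e t => (e.1 < e.2)%N -> e \notin tight v -> fe e < im (v + t *: w) e)) => e.
  have [|lt] := boolP ((e.1 < e.2)%N && (e \notin tight v)); last first.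
    by apply: nearW => t h1 h2; rewrite h1 h2 in lt.
  case/andP=> e12 et.
  have sl : 0 < im v e - fe e.
    rewrite subr_gt0 lt_neqAle Qv.2 // andbT eq_sym; apply: contraNneq et => E.
    by apply/tightP.
  have B : 0 < `|im w e| + 1 by rewrite ltr_wpDl.
  apply: filterS2 (nbhs_right_gt (0 : R)) (nbhs_right_lt (divr_gt0 sl B)) => t t0.
  rewrite ltr_pdivlMr // => h _ _; rewrite ipmD ipmZ.
  have : - `|im w e| <= im w e by rewrite lerNl ler_normr lexx orbT.
  by move=> k; have := ler_wpM2l (ltW t0) k; lra.
apply: filterS2 (nbhs_right_gt (0 : R)) N => t t0 Nt.
have T e : e \in tight v -> im (v + t *: w) e = fe e + t * im w e.
  by move=> /tightP[_ E]; rewrite ipmD ipmZ E.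
split.
  split; first by apply: normalizedD; [exact: Qv.1|exact: normalizedZ].
  move=> i j ij; have [et|et] := boolP ((i, j) \in tight v); last exact/ltW/(Nt (i, j)).
  have := T _ et; rewrite /= => ->; rewrite lerDl; apply: mulr_ge0; [exact: ltW|exact: (H (i, j))].
apply/finset.setP => e; apply/tightP/idP => [[e12 E]|].
  have et : e \in tight v by apply: contraT => /(Nt e e12); rewrite E ltxx.
  rewrite inE et; move: E; rewrite T // => E.
  have /eqP : t * im w e = 0 by lra.
  by rewrite mulf_eq0 gt_eqF.
rewrite inE => /andP[et /eqP E]; have /tightP[e12 _] := et; split => //.
by rewrite T // E mulr0 addr0.
Qed.

Lemma tight_exists G : pointed_noncrossing p G -> exists2 v, Q v & tight v = G.
Proof.
move=> pG; have [v0 Qv0 Gv0] := tight_feasible pG.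
have [w nw wE] := motion_solve (pnc_stress_free (tight_pnc Qv0)) (fun e => (e \notin G)%:R).
have [|t [Qt tE]] := @filter_ex _ _ (at_right_proper_filter (0 : R)) _ (near_feasible Qv0 nw _).
  by move=> e /wE ->; rewrite ler0n.
exists (v0 + t *: w) => //; rewrite tE; apply/finset.setP => e; rewrite inE.
have [et|et] := boolP (e \in tight v0); last first.
  by apply/esym; apply: contraNF et; exact: (fintype.subsetP Gv0).
by rewrite wE //=; case: (e \in G); rewrite ?eqxx ?oner_eq0.
Qed.

(** Ratio test: among the constraints that decrease along [w], the one with the smallest ratio of
    slack to speed becomes tight first. *)
Lemma ray_hit v w e0 : Q v -> normalized w -> (e0.1 < e0.2)%N -> im w e0 < 0 ->
  exists t e, [/\ 0 <= t, Q (v + t *: w), im w e < 0 & e \in tight (v + t *: w)].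
Proof.
move=> Qv nw e12 neg0.
pose P e := (e.1 < e.2)%N && (im w e < 0).
have P0 : P e0 by rewrite /P e12.
pose ratio e := (im v e - fe e) / - im w e.
case: (@arg_minP _ _ _ e0 P ratio P0) => e /andP[lt neg] emin.
exists (ratio e), e.
have nn : 0 < - im w e by rewrite oppr_gt0.
have r0 : 0 <= ratio e by apply: divr_ge0; [rewrite subr_ge0 Qv.2|exact: ltW].
split => //; last first.
  apply/tightP; split => //; rewrite ipmD ipmZ.
  have : ratio e * - im w e = im v e - fe e by rewrite divfK // gt_eqF.
  lra.
split; first by apply: normalizedD; [exact: Qv.1|exact: normalizedZ].
move=> i j ij; rewrite ipmD ipmZ; have Qij := Qv.2 i j ij.
have [nij|pij] := ltP (ipm p w i j) 0; last first.
  have := mulr_ge0 r0 pij; lra.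
have := emin (i, j); rewrite /P /= ij nij => /(_ isT).
rewrite {2}/ratio /= ler_pdivlMr ?oppr_gt0 //; lra.
Qed.

(** With fewer than 2n - 3 edges there is a nonzero normalized motion that preserves [G]. From a
    point whose tight set is [G], that motion or its negative is followed until a further inequality
    becomes tight; the enlarged tight graph is again pointed and non-crossing by [tight_pnc]. *)
Lemma extend_to_maximal G : pointed_noncrossing p G ->
  exists T, [/\ G \subset T, pointed_noncrossing p T & #|T| = (2 * n - 3)%N].
Proof.
have [k] := ubnP (2 * n - 3 - #|G|)%N; elim: k G => // k IH G Gk pG.
have sfG := pnc_stress_free pG; have dG := dim_motion_space sfG.
have [d0|d0] := posnP (\dim (motion_space G)).
  by exists G; split => //; rewrite -dG d0.
pose L := motion_space G.
have [w wL wn] : exists2 w, w \in L & w != 0.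
  by exists (vpick L); rewrite ?memv_pick // vpick0 -dimv_eq0 -lt0n.
have /mem_motion_space[nw w0] := wL.
have [v Qv tv] := tight_exists pG.
have [e1 e12 e1n] : exists2 e : 'I_n * 'I_n, (e.1 < e.2)%N & im w e != 0.
  apply: contrapT => N; move/eqP: wn; apply; apply: normalized_rigid => // e e12.
  by apply/eqP/negPn/negP => h; apply: N; exists e.
wlog neg : w nw w0 e1n {wL wn} / im w e1 < 0.
  move=> W; have [h|h|h] := ltgtP (im w e1) 0; last by rewrite h eqxx in e1n.
    exact: (W w).
  apply: (W (- w)); rewrite ?ipmN ?oppr_eq0 ?oppr_lt0 //; first exact: normalizedN.
  by move=> e eG; rewrite ipmN w0 ?oppr0.
have [t [e [t0 Qt en et]]] := ray_hit Qv nw e12 neg.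
have sub : G \subset tight (v + t *: w).
  apply/fintype.subsetP => e' eG; have := eG; rewrite -tv => /tightP[lt E].
  by apply/tightP; split => //; rewrite ipmD ipmZ E w0 // mulr0 addr0.
have eG : e \notin G by apply/negP => /w0 E; rewrite E ltxx in en.
have card : (#|G| < #|tight (v + t *: w)|)%N.
  by apply: proper_card; apply/properP; split => //; exists e.
have [|T [s1 s2 s3]] := IH (tight (v + t *: w)) _ (tight_pnc Qt).
  by rewrite -ltnS; apply: leq_trans Gk; rewrite ltnS ltn_sub2l // -dG -subn_gt0 addnK.
by exists T; split => //; exact: fintype.subset_trans sub s1.
Qed.

Definition face G : set 'M[R]_(n, 2) := fun v => Q v /\ forall e, e \in G -> im v e = fe e.

Lemma face_tight v : Q v -> face (tight v) v.
Proof. by move=> Qv; split => // e /tightP[]. Qed.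

(** The supporting functional is minus the sum of the constraints in [G]: it attains its bound only
    where each of them is tight. *)
Lemma is_face_face G G0 : graph_on G -> G0 \subset G -> is_face (face G0) (face G).
Proof.
move=> gG /fintype.subsetP sG.
exists (\sum_e (- (e \in G)%:R) *: edge_mx e), (- \sum_(e in G) fe e).
have E v : lin (\sum_e (- (e \in G)%:R) *: edge_mx e) v = - \sum_(e in G) im v e.
  rewrite lin_sum [in RHS]big_mkcond -sumrN; apply: eq_bigr => e _; rewrite lin_edge_mx.
  by case: (e \in G); rewrite ?mulN1r ?oppr0 ?mul0r.
split=> [v [Qv _]|].
  by rewrite E lerN2; apply: ler_sum => e /gG; exact: Qv.2.
apply/seteqP; split => v.
  move=> [Qv H]; split; first by split => // e /sG; exact: H.
  by rewrite E; congr (- _); apply: eq_bigr => e; exact: H.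
case=> -[Qv _]; rewrite E => /oppr_inj S; split => // e eG.
have := @psumr_eq0P _ _ (mem G) (fun e => im v e - fe e) _ _ e eG.
rewrite sumrB S subrr => H; apply/eqP; rewrite -subr_eq0; apply/eqP; apply: H => // e' e'G.
by rewrite subr_ge0 Qv.2 // gG.
Qed.

Lemma face0 : face finset.set0 = Q.
Proof. by apply/seteqP; split => v [] //; split => // e; rewrite inE. Qed.

Lemma Etight_face v : Q v -> Etight p f (face (tight v)) = tight v.
Proof.
move=> Qv; apply/finset.setP => e; rewrite inE; apply/asboolP/tightP.
  by case=> e12 H; split => //; apply: H; exact: face_tight.
by case=> e12 E; split => // x [_]; apply; apply/tightP.
Qed.

Lemma midpoint_tight v v' : Q v -> Q v' ->
  Q (2^-1 *: (v + v')) /\ tight (2^-1 *: (v + v')) = tight v :&: tight v'.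
Proof.
move=> Qv Qv'; have E e : im (2^-1 *: (v + v')) e = 2^-1 * (im v e + im v' e) by rewrite ipmZ ipmD.
have h2 : 0 < (2^-1 : R) by rewrite invr_gt0 ltr0n.
have h22 : 2^-1 * 2 = 1 :> R by rewrite mulVf // pnatr_eq0.
split.
  split; first by apply/normalizedZ/normalizedD; [exact: Qv.1|exact: Qv'.1].
  by move=> i j ij; rewrite (E (i, j)) /=; have := Qv.2 i j ij; have := Qv'.2 i j ij; lra.
apply/finset.setP => e; apply/tightP/idP; rewrite finset.in_setI.
  case=> e12; rewrite E => S; have := Qv.2 _ _ e12; have := Qv'.2 _ _ e12 => h3 h4.
  by apply/andP; split; apply/tightP; split => //; lra.
by case/andP=> /tightP[e12 e1] /tightP[_ e2]; split => //; rewrite E e1 e2; lra.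
Qed.

(* A face is determined by any of its points with the fewest tight constraints. *)
Lemma face_repr G0 K : graph_on G0 -> is_face (face G0) K -> (exists x, K x) ->
  exists v, [/\ K v, Q v, G0 \subset tight v & K = face (tight v)].
Proof.
move=> gG0; case=> c [d [cd KE]] [x0 Kx0].
have KQ x : K x -> face G0 x by rewrite KE => -[].
have half (r : R) : 2^-1 * (r + r) = r by lra.
have [v Kv vmin] : exists2 v, K v & forall v', K v' -> (#|tight v| <= #|tight v'|)%N.
  have ex : exists m, `[< exists2 x, K x & #|tight x| = m >] by exists #|tight x0|; apply/asboolP; exists x0.
  case: (ex_minnP ex) => m /asboolP[v Kv vm] mmin.
  by exists v => // v' Kv'; rewrite vm; apply: mmin; apply/asboolP; exists v'.
have [Qv Gv] := KQ v Kv.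
have lv : lin c v = d by move: Kv; rewrite KE => -[].
exists v; split => //.
  by apply/fintype.subsetP => e eG; apply/tightP; split; [exact: gG0|exact: Gv].
apply/seteqP; split => x.
  move=> Kx; have [Qx Gx] := KQ x Kx; split => // e et.
  have [Qm tm] := midpoint_tight Qv Qx.
  have Km : K (2^-1 *: (v + x)).
    rewrite KE; split; last first.
      rewrite linZ linD lv; have : lin c x = d by move: Kx; rewrite KE => -[].
      by move=> ->; exact: half.
    split => // e' e'G; by rewrite ipmZ ipmD Gv // Gx // half.
  have := vmin _ Km; rewrite tm => h.
  have /eqP E : tight v :&: tight x == tight v by rewrite eqEcard h finset.subsetIl.
  by move: et; rewrite -E finset.in_setI => /andP[_ /tightP[]].
case=> Qx tx; rewrite KE.
have Gx : face G0 x.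
  by split => // e eG; apply/tx/tightP; split; [exact: gG0|exact: Gv].
split => //.
(* From [v] one can go a little further away from [x] without leaving the polyhedron, because all
   constraints tight at [v] are tight at [x]. So [v] lies inside a segment ending at [x], and the
   functional, maximal at [v], is constant on it. *)
have [|t [t0 [Qt tE]]] := @filter_ex _ _ (at_right_proper_filter (0 : R)) _
   (filterI (nbhs_right_gt (0 : R)) (near_feasible Qv (normalizedB Qv.1 Qx.1) _)).
  by move=> e et; rewrite ipmB tx //; have /tightP[_ ->] := et; rewrite subrr.
have le1 := cd x Gx.
have E : lin c (v + t *: (v - x)) = d + t * (d - lin c x).
  by rewrite linD linZ -scaleN1r linD linZ lv; ring.
have : lin c (v + t *: (v - x)) <= d.
  apply: cd; split => // e eG; rewrite ipmD ipmZ ipmB Gv // Gx.2 // subrr mulr0 addr0 //.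
rewrite E gerDl pmulr_rle0 // subr_le0 => h.
by apply/le_anti/andP.
Qed.

End Motions.

(** * The convex hull and the statement for graphs with 2n-3 edges *)

Section Hull.
Variables (R : realType) (n : nat) (p : 'I_n -> (R * R)%type).
Hypotheses (n3 : (3 <= n)%N) (gp : general_position p).
Implicit Types (i j k l : 'I_n) (S : {set 'I_n}) (x u : (R * R)%type).
Local Notation o i j k := (orient (p i) (p j) (p k)).

Definition extreme S i : Prop := i \in S /\ halfplane p i (S :\ i).

(* [ccw_side S i j]: from i to j runs a counterclockwise edge of the convex hull of S. *)
Definition ccw_side S i j : bool :=
  [&& i \in S, j \in S, i != j & [forall k in S, (k != i) && (k != j) ==> (0 < o i j k)]].

Lemma ccw_sideP S i j : reflect
  [/\ i \in S, j \in S, i != j & forall k, k \in S -> k != i -> k != j -> 0 < o i j k] (ccw_side S i j).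
Proof.
apply: (iffP and4P) => -[h1 h2 h3 H]; split => //.
  by move=> k kS ki kj; have /forall_inP/(_ k kS) := H; rewrite ki kj.
by apply/forall_inP => k kS; apply/implyP => /andP[]; exact: H.
Qed.

(** A point of [S] farthest from the origin is extreme, with [- p i] as normal of its half-plane. *)
Lemma extreme_exists S : S != finset.set0 -> exists i, extreme S i.
Proof.
case/set0Pn => i0 i0S.
pose F i := dot (p i) (p i).
case: (@arg_maxP _ _ _ i0 (mem S) F i0S) => i iS imax.
exists i; split; first exact: iS.
have [E|/set0Pn[j0 j0S]] := eqVneq (S :\ i) finset.set0.
  by apply: (halfplane_card2 n3 gp); rewrite E ?inE ?cards0.
have H j : j \in S :\ i -> 0 < dot (- p i) (vec (p i) (p j)).
  rewrite !inE => /andP[ji jS]; have := imax j jS.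
  have := dot_gt0 (vec_neq0 n3 gp ji); rewrite /F /dot /vec /=; lra.
exists (- p i) => //; apply: contraTneq (H _ j0S) => ->.
by rewrite /dot /= !mul0r addr0 ltxx.
Qed.

Lemma extreme_sides S i : (2 <= #|S|)%N -> extreme S i ->
  (exists j, ccw_side S i j) /\ (exists j, ccw_side S j i).
Proof.
move=> S2 [iS h].
have iN : i \notin S :\ i by rewrite !inE eqxx.
have N0 : S :\ i != finset.set0 by rewrite -card_gt0; move: S2; rewrite (cardsD1 i) iS.
have [[a aN ha] [b bN hb]] := no_triple_source gp iN N0 (halfplane_no_triple h).
move: (aN) (bN); rewrite !inE => /andP[ai aS] /andP[bi bS].
split; [exists a|exists b]; apply/ccw_sideP; split => //; rewrite 1?eq_sym // => k kS ki kj.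
  by apply: ha => //; rewrite !inE ki.
by rewrite -(orient_rot (p b)); apply: hb => //; rewrite !inE kj.
Qed.

Lemma ccw_side_extreme S i j : ccw_side S i j -> extreme S i /\ extreme S j.
Proof.
case/ccw_sideP => iS jS ij H.
have oo k l : o k l l = 0 by rewrite /orient; ring.
have gen k l : k \in S -> (forall m, m \in S -> m != k -> m != l -> 0 < o i j m) ->
    o i j k = 0 -> o i j l = 0 -> extreme S k.
  move=> kS Hk k0 l0; split=> //; apply/(no_tripleP n3 gp); first by rewrite !inE eqxx.
  move=> a b c; rewrite !inE => /andP[ak aS] /andP[bk bS] /andP[ck cS] [oab obc oca].
  have X m : m \in S -> m != k -> (m = l) \/ 0 < o i j m.
    by move=> mS mk; have [->|ml] := eqVneq m l; [left|right; exact: Hk].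
  have X0 m : m \in S -> m != k -> 0 <= o i j m.
    by move=> mS mk; case: (X m mS mk) => [->|/ltW //]; rewrite l0.
  have D : o k b c * o i j a + o k c a * o i j b + o k a b * o i j c = 0.
    transitivity (o i j k * (o k b c + o k c a + o k a b)); last by rewrite k0 mul0r.
    by rewrite /orient; ring.
  have ha := mulr_ge0 (ltW obc) (X0 a aS ak).
  have hb := mulr_ge0 (ltW oca) (X0 b bS bk).
  have hc := mulr_ge0 (ltW oab) (X0 c cS ck).
  case: (X a aS ak) => [al|/(mulr_gt0 obc)]; last by lra.
  case: (X b bS bk) => [bl|/(mulr_gt0 oca)]; last by lra.
  by move: oab; rewrite al bl oo ltxx.
split.
  by apply: (gen i j) => //; rewrite /orient; ring.
apply: (gen j i) => //; first by move=> m mS mj mi; apply: H.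
by rewrite /orient; ring.
Qed.

Lemma ccw_side_asym S i j : (3 <= #|S|)%N -> ccw_side S i j -> ~~ ccw_side S j i.
Proof.
move=> S3 /ccw_sideP[iS jS ij H]; apply/negP => /ccw_sideP[_ _ _ H'].
have /set0Pn[k] : S :\ i :\ j != finset.set0.
  by rewrite -card_gt0; move: S3; rewrite (cardsD1 i) iS (cardsD1 j) !inE jS eq_sym ij.
rewrite !inE => /and3P[kj ki kS].
by have := H k kS ki kj; have := H' k kS kj ki; rewrite /orient; lra.
Qed.

(** An extreme point with its successor and predecessor on the hull. These supply the three corners
    that every cycle must have. *)
Lemma three_extremes S : (3 <= #|S|)%N ->
  exists i j k, [/\ extreme S i, extreme S j, extreme S k & [/\ i != j, j != k & i != k]].
Proof.
move=> S3; have S2 := ltnW S3.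
have [|i ei] := @extreme_exists S; first by rewrite -card_gt0 (ltn_trans _ S2).
have [[j ij] [k ki]] := extreme_sides S2 ei.
exists i, j, k; have [_ ej] := ccw_side_extreme ij; have [ek _] := ccw_side_extreme ki.
split=> //; have /ccw_sideP[_ _ nij _] := ij; have /ccw_sideP[_ _ nki _] := ki.
split=> //; last by rewrite eq_sym.
by apply/eqP => jk; move: (ccw_side_asym S3 ij); rewrite jk ki.
Qed.

Lemma hull_edgeP i j : hull_edge p i j <-> ccw_side finset.setT i j \/ ccw_side finset.setT j i.
Proof.
have sw k : o j i k = - o i j k by rewrite /orient; ring.
split.
  case=> ij [H|H]; [left|right]; apply/ccw_sideP; split; rewrite ?inE // 1?eq_sym // => k _ h1 h2.
    exact: H.
  by rewrite sw oppr_gt0; apply: H.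
case=> /ccw_sideP[_ _ ij H].
  by split=> //; left => k h1 h2; apply: H; rewrite ?inE.
split; first by rewrite eq_sym.
by right => k h1 h2; rewrite -oppr_gt0 -sw; apply: H; rewrite ?inE.
Qed.

(** The default value fixes the points that are not extreme, so that the map is injective on all
    indices and its orbits are cycles. *)
Definition hull_next i : 'I_n := odflt i [pick j | ccw_side finset.setT i j].

Lemma card_setT3 : (3 <= #|(finset.setT : {set 'I_n})|)%N.
Proof. by rewrite cardsT card_ord. Qed.

Lemma hull_nextP i : extreme finset.setT i -> ccw_side finset.setT i (hull_next i).
Proof.
move=> ei; rewrite /hull_next; case: pickP => //= N.
by have [[j]] := extreme_sides (ltnW card_setT3) ei; rewrite N.
Qed.

Lemma ccw_side_inj i i' j : ccw_side finset.setT i j -> ccw_side finset.setT i' j -> i = i'.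
Proof.
case/ccw_sideP => _ _ ij H /ccw_sideP[_ _ i'j H']; apply/eqP/negPn/negP => ii'.
have i'i : i' != i by rewrite eq_sym.
have := H _ (finset.in_setT _) i'i i'j; have := H' _ (finset.in_setT i) ii' ij.
by rewrite /orient; lra.
Qed.

Lemma hull_next_inj : injective hull_next.
Proof.
have E i j : ~ (exists k, ccw_side finset.setT i k) -> hull_next i = i.
  by move=> N; rewrite /hull_next; case: pickP => //= k h; case: N; exists k.
have X i : (exists k, ccw_side finset.setT i k) -> extreme finset.setT i.
  by case=> k /ccw_side_extreme[].
move=> i i'; have [hi|hi] := pselect (exists k, ccw_side finset.setT i k);
  have [hi'|hi'] := pselect (exists k, ccw_side finset.setT i' k).
- move=> h; have := hull_nextP (X _ hi); rewrite h => h1.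
  exact: ccw_side_inj h1 (hull_nextP (X _ hi')).
- move=> h; case: (hi'); have [_ ext] := ccw_side_extreme (hull_nextP (X _ hi)).
  rewrite (E i' i' hi') in h; rewrite h in ext; exists (hull_next i'); exact: hull_nextP.
- move=> h; case: (hi); have [_ ext] := ccw_side_extreme (hull_nextP (X _ hi')).
  rewrite (E i i hi) in h; rewrite -h in ext; exists (hull_next i); exact: hull_nextP.
by rewrite !E.
Qed.

Section Orbit.
Variable i0 : 'I_n.
Hypothesis ext0 : extreme finset.setT i0.

Lemma hull_orbit_side i : i \in orbit hull_next i0 -> ccw_side finset.setT i (hull_next i).
Proof.
move=> io; apply: hull_nextP; move: io; rewrite -fconnect_orbit => /iter_findex <-.
elim: (findex _ _ _) => //= m ext.
by have [] := ccw_side_extreme (hull_nextP ext).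
Qed.

Lemma hull_orbit_next i : i \in orbit hull_next i0 -> hull_next i \in orbit hull_next i0.
Proof.
rewrite -!fconnect_orbit => h; apply: connect_trans h _; exact: fconnect1.
Qed.

Lemma hull_orbit_prev i : i \in orbit hull_next i0 ->
  exists2 j, j \in orbit hull_next i0 & hull_next j = i.
Proof.
move=> io; exists (finv hull_next i); last exact: (f_finv hull_next_inj).
move: io; rewrite -!fconnect_orbit => h; apply: connect_trans h _; exact: fconnect_finv.
Qed.

(** The witness is the vertex of the hull cycle that is lowest in direction [u]. Since [x] lies left
    of both hull edges at it and the other ends of these edges are not lower, [x] is not lower
    either; equality would make both edges orthogonal to [u], hence collinear. *)
Lemma left_of_hull_surrounded x u : u != 0 ->
  (forall i, i \in orbit hull_next i0 -> 0 < orient (p i) (p (hull_next i)) x) ->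
  exists2 i, i \in orbit hull_next i0 & dot u (vec x (p i)) < 0.
Proof.
move=> un H; have o0 : i0 \in orbit hull_next i0 by rewrite -fconnect_orbit.
case: (@arg_minP _ _ _ i0 (mem (orbit hull_next i0)) (fun i => dot u (p i)) o0) => i io imin.
have {}io : i \in orbit hull_next i0 := io.
exists i => //; have [j jo ji] := hull_orbit_prev io.
have k_o := hull_orbit_next io; set k := hull_next i in k_o.
have h1 := H i io; have h2 := H j jo; rewrite ji -/k in h1 h2.
have mj := imin j jo; have mk := imin k k_o.
have /ccw_sideP[_ _ ik Hik] := hull_orbit_side io; rewrite -/k in ik Hik.
have ikS := hull_orbit_side io; have jiS := hull_orbit_side jo; rewrite ji in jiS.
have jk : j != k.
  apply/eqP => jk; have := ccw_side_asym card_setT3 jiS; rewrite jk /k ikS //.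
have ij : j != i by have /ccw_sideP[] := jiS.
have D0 := Hik j (finset.in_setT _) ij jk.
have E : o i k j * - dot u (vec x (p i)) =
   orient (p j) (p i) x * (dot u (p k) - dot u (p i)) + orient (p i) (p k) x * (dot u (p j) - dot u (p i)).
  by rewrite /dot /vec /orient /=; ring.
have p1 : 0 <= orient (p j) (p i) x * (dot u (p k) - dot u (p i)) by apply: mulr_ge0; [exact: ltW|rewrite subr_ge0].
have p2 : 0 <= orient (p i) (p k) x * (dot u (p j) - dot u (p i)) by apply: mulr_ge0; [exact: ltW|rewrite subr_ge0].
have nn : 0 <= - dot u (vec x (p i)).
  by have := addr_ge0 p1 p2; rewrite -E pmulr_rge0.
rewrite lt_neqAle -oppr_ge0 nn andbT; apply/eqP => Z.
rewrite Z oppr0 mulr0 in E.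
have z1 : dot u (p k) - dot u (p i) = 0.
  by apply: (mulfI (lt0r_neq0 h2)); rewrite mulr0; lra.
have z2 : dot u (p j) - dot u (p i) = 0.
  by apply: (mulfI (lt0r_neq0 h1)); rewrite mulr0; lra.
have : dot u u * o i k j = 0.
  transitivity (((p j).2 - (p i).2) * u.1 * (dot u (p k) - dot u (p i)) - ((p k).2 - (p i).2) * u.1 * (dot u (p j) - dot u (p i))
   - ((p j).1 - (p i).1) * u.2 * (dot u (p k) - dot u (p i)) + ((p k).1 - (p i).1) * u.2 * (dot u (p j) - dot u (p i))).
    by rewrite /dot /orient; ring.
  by rewrite z1 z2 !mulr0; ring.
by move/eqP; rewrite mulf_eq0 !gt_eqF // dot_gt0.
Qed.

(* An expansive motion that fixes the lengths of the hull edges turns them monotonically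
   along the hull, hence all by the same angular velocity. *)
Lemma expansive_hull_rigid (w : 'M[R]_(n, 2)) :
  (forall i j, 0 <= ipm p w i j) -> (forall i, i \in orbit hull_next i0 -> ipm p w i (hull_next i) = 0) ->
  forall i j, ipm p w i j = 0.
Proof.
move=> pos zero.
pose s := hull_next; pose D i := vec (p i) (p (s i)).
pose dw i : R * R := (w (s i) ord0 - w i ord0, w (s i) ord_max - w i ord_max).
(* The angular velocity of the hull edge that starts at [i]; as its length is preserved, its ends
   move relative to each other by [al i] times the edge turned by a right angle. *)
pose al i := dot (perp (D i)) (dw i) / dot (D i) (D i).
have Dn i : i \in orbit s i0 -> 0 < dot (D i) (D i).
  by move=> io; apply/dot_gt0/(vec_neq0 n3 gp); have /ccw_sideP[] := hull_orbit_side io.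
have dwE i : i \in orbit s i0 -> dw i = (- al i * (D i).2, al i * (D i).1).
  move=> io; have D0 := Dn i io; have Dz := lt0r_neq0 D0.
  have zi : dot (D i) (dw i) = 0.
    by have := zero i io; rewrite /ipm /dot /D /dw /vec /=; lra.
  have aD : al i * dot (D i) (D i) = dot (perp (D i)) (dw i) by rewrite divfK.
  move: (al i) aD => a aD; apply: injective_projections => /=; apply: (mulIf Dz).
    transitivity ((D i).1 * dot (D i) (dw i) - (D i).2 * dot (perp (D i)) (dw i)).
      by rewrite /dot /perp /=; ring.
    by rewrite zi -aD /dot /D /vec /=; ring.
  transitivity ((D i).2 * dot (D i) (dw i) + (D i).1 * dot (perp (D i)) (dw i)).
    by rewrite /dot /perp /=; ring.
  by rewrite zi -aD /dot /D /vec /=; ring.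
have mono i : i \in orbit s i0 -> al (s i) <= al i.
  move=> io; have jo := hull_orbit_next io; have ijS := hull_orbit_side io; have jkS := hull_orbit_side jo.
  have /ccw_sideP[_ _ ij Hij] := ijS; have /ccw_sideP[_ _ jk _] := jkS.
  have ki : s (s i) != i.
    by apply/eqP => E; have := ccw_side_asym card_setT3 ijS; rewrite -{2}E jkS.
  have o0 : 0 < o i (s i) (s (s i)) by apply: Hij; rewrite ?inE // eq_sym.
  have := pos i (s (s i)).
  (* The short diagonal over two consecutive hull edges may not shrink, which bounds the second
     angular velocity by the first. *)
  have -> : ipm p w i (s (s i)) = (al i - al (s i)) * o i (s i) (s (s i)).
    have [e1 e2] := dwE i io; have [e3 e4] := dwE _ jo.
    transitivity (((D i).1 + (D (s i)).1) * ((w (s i) ord0 - w i ord0) + (w (s (s i)) ord0 - w (s i) ord0)) +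
      ((D i).2 + (D (s i)).2) * ((w (s i) ord_max - w i ord_max) + (w (s (s i)) ord_max - w (s i) ord_max))).
      by rewrite /ipm /D /vec /=; ring.
    by rewrite e1 e2 e3 e4 /D /vec /orient /=; ring.
  by rewrite pmulr_lge0 // subr_ge0.
have io m : iter m s i0 \in orbit s i0 by rewrite -fconnect_orbit fconnect_iter.
have monoI (a b : nat) : (a <= b)%N -> al (iter b s i0) <= al (iter a s i0).
  elim: b => [|b IH]; first by rewrite leqn0 => /eqP->.
  rewrite leq_eqVlt => /predU1P[->//|ab]; exact: le_trans (mono _ (io b)) (IH ab).
have const i : i \in orbit s i0 -> al i = al i0.
  move=> iorb; have h := iorb; rewrite -fconnect_orbit in h; rewrite -(iter_findex h).
  apply/le_anti/andP; split; first exact: (monoI 0).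
  have lt := findex_max h; have := monoI _ _ (ltnW lt); rewrite iter_order //; exact: hull_next_inj.
(* The rigid motion with the common angular velocity that agrees with [w] at [i0]; after subtraction
   the whole hull cycle is at rest. *)
pose rho := rigid_motion p (w i0 ord0 + al i0 * (p i0).2) (w i0 ord_max - al i0 * (p i0).1) (al i0).
pose w' := w - rho.
have ipmE i j : ipm p w' i j = ipm p w i j by rewrite ipmB ipm_rigid_motion subr0.
have w'0 i : i \in orbit s i0 -> w' i ord0 = 0 /\ w' i ord_max = 0.
  rewrite -fconnect_orbit => /iter_findex <-; elim: (findex _ _ _) => [|m [h1 h2]] /=.
    by rewrite !mxE /=; split; ring.
  have [e1 e2] := dwE _ (io m); rewrite const // in e1 e2.
  move: h1 h2; rewrite !mxE /= => h1 h2; move: e1 e2; rewrite /D /vec /= => e1 e2; split; lra.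
have w'z k : w' k ord0 = 0 /\ w' k ord_max = 0.
  have [/w'0 //|ko] := boolP (k \in orbit s i0).
  (* A remaining point in motion would approach some vertex of the resting hull cycle. *)
  pose u : R * R := (- w' k ord0, - w' k ord_max).
  have [u0|un] := eqVneq u 0; first by move: u0 => -[h1 h2]; split; lra.
  have [|i iorb] := @left_of_hull_surrounded (p k) u un.
    move=> i iorb; have /ccw_sideP[_ _ _ H] := hull_orbit_side iorb; apply: H; rewrite ?inE //.
      by apply: contraNneq ko => ->.
    by apply: contraNneq ko => ->; exact: hull_orbit_next.
  have := pos k i; rewrite -ipmE /ipm; have [-> ->] := w'0 i iorb.
  by rewrite /u /dot /vec /= !subr0; lra.
by move=> i j; rewrite -ipmE /ipm; have [-> ->] := w'z i; have [-> ->] := w'z j; ring.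
Qed.

End Orbit.

End Hull.

Lemma In_mem (T : eqType) (x : T) (s : seq T) : List.In x s <-> x \in s.
Proof.
elim: s => //= y s IH; rewrite inE; split=> [[->|/IH ->]|/predU1P[->|/IH]]; rewrite ?eqxx ?orbT //; [by left|by right].
Qed.

Lemma NoDup_map (T : eqType) (U : Type) (g : T -> U) (s : seq T) : uniq s ->
  {in s &, injective g} -> List.NoDup [seq g x | x <- s].
Proof.
elim: s => [|x s IH] /=; first by constructor.
case/andP=> xs us gi; constructor; last by apply: IH => // y z ys zs; apply: gi; rewrite inE ?ys ?zs orbT.
move=> /List.in_map_iff[y [gxy /In_mem ys]]; move: xs; rewrite -(gi y x) ?ys ?inE ?eqxx ?ys ?orbT //.
Qed.

(** * The face structure of the polyhedron *)

Section Polyhedron.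
Variables (R : realType) (n : nat) (p : 'I_n -> (R * R)%type).
Hypotheses (n3 : (3 <= n)%N) (gp : general_position p) (lab : labeled_y p).
Variable f : 'I_n -> 'I_n -> R.
Hypothesis valid : forall (w : 'I_n * 'I_n -> R) G, stress p w -> sorted_support w ->
  pointed_noncrossing p G -> (forall e, w e < 0 -> e \in G) -> (exists e, w e != 0) ->
  \sum_e w e * f e.1 e.2 < 0.
Implicit Types (v w x : 'M[R]_(n, 2)) (e : 'I_n * 'I_n) (T G : {set 'I_n * 'I_n}) (K : set 'M[R]_(n, 2)).
Local Notation Q := (Xbar p f).
Local Notation tight := (tight p f).
Local Notation face := (face p f).
Local Notation im v e := (ipm p v e.1 e.2).
Local Notation pnc := (pointed_noncrossing p).
Local Notation d := (2 * n - 3)%N.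

Lemma d3 : (3 <= d)%N.
Proof. by have := leq_mul (leqnn 2) n3 => h; rewrite leq_subRL //; exact: leq_trans h. Qed.

Lemma card_pnc G : pnc G -> (#|G| <= d)%N.
Proof. by move=> pG; rewrite -(dim_motion_space n3 lab (pnc_stress_free valid pG)) leq_addl. Qed.

Lemma affdim_face v : Q v -> affdim (face (tight v)) (d - #|tight v|).
Proof.
move=> Qv; have sf := pnc_stress_free valid (tight_pnc n3 gp valid Qv).
rewrite -(dim_motion_space n3 lab sf) addnK; apply: (@affdim_flat _ _ _ _ v); first exact: face_tight.
  move=> x [Qx tx]; apply/mem_motion_space; split; first by apply: (normalizedB n3); [exact: Qx.1|exact: Qv.1].
  by move=> e et; rewrite ipmB tx //; have /tightP[_ ->] := et; rewrite subrr.
move=> w /mem_motion_space[nw wz].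
have [|t [t0 [Qt tE]]] := @filter_ex _ _ (at_right_proper_filter (0 : R)) _
   (filterI (nbhs_right_gt (0 : R)) (near_feasible n3 Qv nw _)); first by move=> e /wz ->.
exists t => //; split => // e et; rewrite ipmD ipmZ wz // mulr0 addr0.
by have /tightP[] := et.
Qed.

Lemma affdim_set1 v : affdim (fun x : 'M[R]_(n, 2) => x = v) 0.
Proof.
have : affdim (fun x : 'M[R]_(n, 2) => x = v) (\dim (0%VS : {vspace 'M[R]_(n, 2)})).
  apply: (@affdim_flat _ _ _ _ v) => // [x ->|w]; first by rewrite subrr mem0v.
  by rewrite memv0 => /eqP->; exists 1; rewrite ?ltr01 // scaler0 addr0.
by rewrite dimv0.
Qed.

Lemma face_set1 v : Q v -> #|tight v| = d -> face (tight v) = (fun x => x = v).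
Proof.
move=> Qv tv; have sf := pnc_stress_free valid (tight_pnc n3 gp valid Qv).
have := dim_motion_space n3 lab sf; rewrite tv => /eqP.
rewrite -[X in _ == X]add0n eqn_add2r dimv_eq0 => /eqP L0.
apply/seteqP; split=> [x [Qx tx]|x ->]; last exact: face_tight.
apply/eqP; rewrite -subr_eq0 -memv0 -L0; apply/mem_motion_space.
split; first by apply: (normalizedB n3); [exact: Qx.1|exact: Qv.1].
by move=> e et; rewrite ipmB tx //; have /tightP[_ ->] := et; rewrite subrr.
Qed.

Lemma vertexP G0 v : graph_on G0 ->
  is_vertex (face G0) v <-> [/\ Q v, G0 \subset tight v & #|tight v| = d].
Proof.
move=> g0; split=> [vv|[Qv sG tv]].
  have [v' [-> Qv sG KE]] := face_repr n3 g0 vv (ex_intro _ v erefl); split => //.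
  have A := affdim_face Qv; rewrite -KE in A.
  have := affdim_uniq A (affdim_set1 v) => /eqP; rewrite subn_eq0 => h; apply/eqP.
  by rewrite eqn_leq h andbT; apply: card_pnc; exact: (tight_pnc n3 gp valid).
by rewrite /is_vertex -(face_set1 Qv tv); apply: is_face_face => //; exact: graph_on_tight.
Qed.

Lemma vertexQP v : is_vertex Q v <-> Q v /\ #|tight v| = d.
Proof.
have g0 : graph_on (finset.set0 : {set 'I_n * 'I_n}) by move=> e; rewrite inE.
rewrite -[in X in is_vertex X](face0 p f); split=> [/(vertexP _ g0)[]//|[Qv tv]].
by apply/(vertexP _ g0); split => //; exact: finset.sub0set.
Qed.

Lemma faceP K : nonempty_face Q K -> exists v, [/\ Q v, K = face (tight v) & Etight p f K = tight v].
Proof.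
case=> Kf Kn; have g0 : graph_on (finset.set0 : {set 'I_n * 'I_n}) by move=> e; rewrite inE.
rewrite -(face0 p f) in Kf; have [v [Kv Qv _ KE]] := face_repr n3 g0 Kf Kn.
by exists v; split => //; rewrite KE Etight_face.
Qed.

Lemma face_of_pnc G : pnc G -> [/\ nonempty_face Q (face G), Etight p f (face G) = G &
  exists2 v, Q v & tight v = G].
Proof.
move=> pG; have [v Qv tv] := tight_exists n3 gp lab valid pG.
split; [split|by rewrite -tv Etight_face|by exists v].
  by rewrite -(face0 p f); apply: is_face_face; [exact: pG.1|exact: finset.sub0set].
by exists v; rewrite -tv; exact: face_tight.
Qed.

Lemma pnc0 : pnc (finset.set0 : {set 'I_n * 'I_n}).
Proof.
split; first by move=> e; rewrite inE.
split; first by move=> e e'; rewrite inE.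
by move=> k; left; rewrite eq_card0 // => l; rewrite !inE /adj !inE.
Qed.

Definition hull_edges : {set 'I_n * 'I_n} := [set e : 'I_n * 'I_n | (e.1 < e.2)%N && `[< hull_edge p e.1 e.2 >]].

Lemma hull_edgesP e : reflect ((e.1 < e.2)%N /\ hull_edge p e.1 e.2) (e \in hull_edges).
Proof. by rewrite inE; apply: (iffP andP) => -[h /asboolP]. Qed.

(** All points lie on one side of a hull edge. So another edge meets it at most at a common end, and
    at its own ends it belongs to no triple of neighbours that winds around the vertex. *)
Lemma add_hull_edge T e : pnc T -> e \in hull_edges -> pnc (e |: T).
Proof.
move=> [gT [nT pT]] /hull_edgesP[e12 eh].
have [i [j [ijS ije]]] : exists i j, ccw_side p finset.setT i j /\ ((i = e.1 /\ j = e.2) \/ (i = e.2 /\ j = e.1)).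
  by case/(hull_edgeP p): eh => h; [exists e.1, e.2|exists e.2, e.1]; split => //; [left|right].
have /ccw_sideP[_ _ ij H0] := ijS.
have H k : k != i -> k != j -> 0 < orient (p i) (p j) (p k) by move=> h1 h2; apply: H0; rewrite ?inE.
have oi : orient (p i) (p j) (p i) = 0 by rewrite /orient; ring.
have oj : orient (p i) (p j) (p j) = 0 by rewrite /orient; ring.
have H' k : 0 <= orient (p i) (p j) (p k).
  have [->|ki] := eqVneq k i; first by rewrite oi.
  by have [->|kj] := eqVneq k j; [rewrite oj|rewrite ltW // H].
have g' : graph_on (e |: T) by move=> e'; rewrite !inE => /predU1P[->//|/gT].
have cross_ e' (x : R * R) : e' \in T -> e' != e -> in_seg (p e.1) (p e.2) x -> in_seg (p e'.1) (p e'.2) x ->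
    exists k, ((k == e.1) || (k == e.2)) && ((k == e'.1) || (k == e'.2)) /\ x = p k.
  move=> e'T ne se [t [/andP[t0 t1] E]].
  have xe : orient (p i) (p j) x = 0.
    by case: ije => -[-> ->]; [|move/in_segC in se]; case: se => s [_ ->]; rewrite /orient /=; ring.
  have S : (1 - t) * orient (p i) (p j) (p e'.1) + t * orient (p i) (p j) (p e'.2) = 0.
    by rewrite -[RHS]xe E /orient /=; ring.
  have u0 : 0 <= 1 - t by lra.
  have z1 := mulr_ge0 u0 (H' e'.1); have z2 := mulr_ge0 t0 (H' e'.2).
  have [hi|n1] := boolP ((e'.1 == i) || (e'.1 == j)).
    have n2 : 0 < orient (p i) (p j) (p e'.2).
      have lt' := gT _ e'T; have ne12 : e'.1 != e'.2 by rewrite neq_ltn lt'.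
      apply: H; apply/eqP => E2; case/orP: hi => /eqP hi.
      - by rewrite hi E2 eqxx in ne12.
      - case: ije => -[h1 h2]; rewrite hi E2 h1 h2 in lt' ne; last by move: ne; rewrite [e]surjective_pairing [e']surjective_pairing hi E2 h1 h2 eqxx.
        by move: lt'; rewrite ltnNge ltnW.
      - case: ije => -[h1 h2]; rewrite hi E2 h1 h2 in lt' ne; first by move: ne; rewrite [e]surjective_pairing [e']surjective_pairing hi E2 h1 h2 eqxx.
        by move: lt'; rewrite ltnNge ltnW.
      by rewrite hi E2 eqxx in ne12.
    have t00 : t = 0 by apply: (mulIf (lt0r_neq0 n2)); rewrite mul0r; lra.
    exists e'.1; rewrite eqxx /= andbT; split; last by rewrite E t00 !mul0r !addr0 -surjective_pairing.
    by case/orP: hi => /eqP->; case: ije => -[h1 h2]; rewrite ?h1 ?h2 eqxx ?orbT.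
  move: n1; rewrite negb_or => /andP[/H h /h n1].
  have t11 : t = 1 by apply/eqP; rewrite eq_sym -subr_eq0; apply/eqP/(mulIf (lt0r_neq0 n1)); rewrite mul0r; lra.
  have n2 : orient (p i) (p j) (p e'.2) = 0 by move: S; rewrite t11; lra.
  exists e'.2; rewrite eqxx orbT andbT; split; last first.
    by rewrite E t11; apply: injective_projections => /=; lra.
  have : (e'.2 == i) || (e'.2 == j).
    by apply: contraT; rewrite negb_or => /andP[/H k /k]; rewrite n2 ltxx.
  by case/orP => /eqP->; case: ije => -[h1 h2]; rewrite ?h1 ?h2 eqxx ?orbT.
split=> //; split.
  move=> e1 e2; rewrite !inE => /predU1P[->|h1] /predU1P[->|h2] ne x s1 s2.
  - by rewrite eqxx in ne.
  - by apply: cross_ => //; rewrite eq_sym.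
  - by have [k [h3 h4]] := cross_ e1 x h1 ne s2 s1; exists k; rewrite andbC.
  exact: nT.
move=> k; apply/(pointed_atP n3 gp k g')/(no_tripleP n3 gp); first exact: nbr_irr.
have nt := halfplane_no_triple ((pointed_atP n3 gp k gT).1 (pT k)).
have key l : l \in nbr (e |: T) k -> [\/ l \in nbr T k, k = i /\ l = j | k = j /\ l = i].
  rewrite inE /adj !inE; case/orP => /orP[/eqP E|h].
  - by case: ije => -[-> ->]; rewrite -E; [constructor 2|constructor 3].
  - by constructor 1; rewrite /adj h.
  - by case: ije => -[-> ->]; rewrite -E; [constructor 3|constructor 2].
  by constructor 1; rewrite /adj h orbT.
have second l m : k = i -> l = j -> ~ 0 < orient (p k) (p m) (p l).
  by move=> -> ->; rewrite orient_swap; have := H' m; lra.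
have first_ l m : k = j -> l = i -> ~ 0 < orient (p k) (p l) (p m).
  by move=> -> ->; have := H' m; rewrite /orient; lra.
move=> a b c /key ha /key hb /key hc [oab obc oca].
case: ha => [ha|[k1 k2]|[k1 k2]]; [|exact: second oca|exact: first_ oab].
case: hb => [hb|[k1 k2]|[k1 k2]]; [|exact: second oab|exact: first_ obc].
case: hc => [hc|[k1 k2]|[k1 k2]]; [|exact: second obc|exact: first_ oca].
exact: nt ha hb hc _.
Qed.

Lemma hull_sub_maximal T : pnc T -> #|T| = d -> hull_edges \subset T.
Proof.
move=> pT Td; apply/fintype.subsetP => e eh; apply: contraT => eT.
by have := card_pnc (add_hull_edge pT eh); rewrite cardsU1 eT Td ltnn.
Qed.

Lemma hull_pnc : pnc hull_edges.
Proof.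
have [T [_ pT Td]] := extend_to_maximal n3 gp lab valid pnc0.
by apply: (pnc_sub n3 gp _ pT); exact: hull_sub_maximal.
Qed.

Lemma Xhull_face : Xhull p f = face hull_edges.
Proof.
apply/seteqP; split=> x [Qx H]; split => //; first by move=> e /hull_edgesP[]; exact: H.
by move=> i j ij h; apply: (H (i, j)); apply/hull_edgesP.
Qed.

Lemma no_recession w : normalized w -> (forall e, (e.1 < e.2)%N -> 0 <= im w e) ->
  (forall e, e \in hull_edges -> im w e = 0) -> w = 0.
Proof.
move=> nw pos zero; apply: (normalized_rigid n3 gp lab nw) => e _.
have [|i0 e0] := @extreme_exists _ _ p n3 gp finset.setT.
  by rewrite -card_gt0 cardsT card_ord (leq_trans _ n3).
apply: (expansive_hull_rigid n3 gp e0) => [i j|i /(hull_orbit_side n3 gp e0) h].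
  have [ij|ij|/val_inj ->] := ltngtP i j; first exact: (pos (i, j)).
    by rewrite ipmC; exact: (pos (j, i)).
  by rewrite /ipm !subrr !mul0r addr0.
have /ccw_sideP[_ _ nij _] := h.
have [ij|ij|/val_inj E] := ltngtP i (hull_next p i).
- by apply: (zero (i, hull_next p i)); apply/hull_edgesP; split => //; apply/hull_edgeP; left.
- by rewrite ipmC; apply: (zero (hull_next p i, i)); apply/hull_edgesP; split => //; apply/hull_edgeP; right.
by rewrite -E eqxx in nij.
Qed.

(* Farkas: since the recession cone is trivial, each coordinate is bounded by a
   nonnegative combination of the constraints. *)
Lemma Xhull_bounded : bounded_set_M (face hull_edges).
Proof.
pose i0 : 'I_n := Ordinal (leq_trans (isT : (1 <= 3)%N) n3).
pose i1 : 'I_n := Ordinal (leq_trans (isT : (2 <= 3)%N) n3).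
pose sg (b : bool) : R := if b then 1 else -1.
have coord (i : 'I_n) (c : 'I_2) (s : R) : s != 0 -> exists B, forall x, face hull_edges x -> s * x i c <= B.
  move=> sn; pose J := option (bool * ((bool + unit) + ('I_n * 'I_n)))%type.
  pose act (b : bool) e := (e.1 < e.2)%N && (b || (e \in hull_edges)).
  pose C (j : J) : 'M[R]_(n, 2) := match j with
    | None => s *: delta_mx i c
    | Some (b, inl (inl true)) => sg b *: delta_mx i0 ord0
    | Some (b, inl (inl false)) => sg b *: delta_mx i0 ord_max
    | Some (b, inl (inr _)) => sg b *: delta_mx i1 ord0
    | Some (b, inr e) => (if act b e then sg b else 0) *: edge_mx p e
    end.
  have lZ (t : R) (y x : 'M[R]_(n, 2)) : lin (t *: y) x = t * lin y x by rewrite linC linZ linC.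
  have [[w wP]|[mu [mu0 muC mub]]] := farkas_lin C (fun j => (j == None)%:R).
    (* A solution of the homogeneous system would be a recession direction along which the chosen
       coordinate grows. *)
    exfalso; have w1 : 1 <= s * w i c by have := wP None; rewrite /= lZ lin_delta.
    suff w0 : w = 0 by move: w1; rewrite w0 mxE mulr0 ler10.
    apply: no_recession.
    - apply/(normalizedP n3); split.
      + have := wP (Some (true, inl (inl true))); have := wP (Some (false, inl (inl true))).
        by rewrite /= !lZ !lin_delta /= => h1 h2; lra.
      + have := wP (Some (true, inl (inl false))); have := wP (Some (false, inl (inl false))).
        by rewrite /= !lZ !lin_delta /= => h1 h2; lra.
      have := wP (Some (true, inl (inr tt))); have := wP (Some (false, inl (inr tt))).
      by rewrite /= !lZ !lin_delta /= => h1 h2; lra.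
    - by move=> e e12; have := wP (Some (true, inr e)); rewrite /= lZ lin_edge_mx /act e12 mul1r.
    move=> e eh; have /hull_edgesP[e12 _] := eh.
    have := wP (Some (true, inr e)); have := wP (Some (false, inr e)).
    by rewrite /= !lZ !lin_edge_mx /act e12 eh /= => h1 h2; lra.
  have muN : 0 < mu None.
    by move: mub; rewrite (bigD1 None) //= ?eqxx mulr1 big1 ?addr0 // => -[j|//] _; rewrite mulr0.
  pose g (j : J) : R := if j is Some (b, inr e) then (if act b e then sg b else 0) * f e.1 e.2 else 0.
  exists (- (\sum_(j | j != None) mu j * g j) / mu None) => x [Qx hx].
  rewrite ler_pdivlMr // mulrC.
  have := muC x; rewrite (bigD1 None) //= lZ lin_delta => E.
  have : \sum_(j | j != None) mu j * g j <= \sum_(j | j != None) mu j * lin (C j) x.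
    apply: ler_sum => j jN; apply: ler_wpM2l => //.
    have /(normalizedP n3)[z1 z2 z3] := Qx.1.
    case: j jN => [[b [[[]|[]]|e]]|] //= _; rewrite lZ ?lin_delta ?z1 ?z2 ?z3 ?mulr0 //.
    rewrite lin_edge_mx; case: ifP => [/andP[e12 bh]|]; last by rewrite !mul0r.
    case: b bh => /= bh; first by rewrite !mul1r; exact: Qx.2.
    by rewrite hx.
  by lra.
have [B BP] : exists B, forall (j : bool * ('I_n * 'I_2)) x, face hull_edges x -> sg j.1 * x j.2.1 j.2.2 <= B.
  have sgn b : sg b != 0 by case: b; rewrite /sg ?oppr_eq0 oner_eq0.
  have [F FP] := choice (fun j : bool * ('I_n * 'I_2) => coord j.2.1 j.2.2 (sg j.1) (sgn j.1)).
  exists (\sum_j `|F j|) => j x fx; apply: le_trans (FP j x fx) _.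
  apply: le_trans (ler_norm _) _; rewrite (bigD1 j) //= lerDl; exact: sumr_ge0.
exists B => x fx i j; rewrite ler_norml; apply/andP; split.
  by have := BP (false, (i, j)) x fx; rewrite /= mulN1r lerNl.
by have := BP (true, (i, j)) x fx; rewrite /= mul1r.
Qed.

(** The motion that opens only [h] never meets another constraint: there the tight graph would have
    2n - 3 edges without the hull edge [h], against [hull_sub_maximal]. So the whole ray stays in
    the face. *)
Lemma hull_ray_unbounded T h : pnc T -> #|T| = d -> h \in T -> h \in hull_edges ->
  ~ bounded_set_M (face (T :\ h)).
Proof.
move=> pT Td hT hh [B HB]; have sf := pnc_stress_free valid pT.
have [v Qv tv] := tight_exists n3 gp lab valid pT.
have [w nw wE] := motion_solve n3 lab sf (fun e => (e == h)%:R).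
have wn : w != 0.
  by apply/eqP => w0; have := wE h hT; rewrite w0 eqxx /ipm !mxE !subrr !mulr0 addr0 => /esym/eqP; rewrite oner_eq0.
have fray t : Q (v + t *: w) -> face (T :\ h) (v + t *: w).
  move=> Qt; split => // e; rewrite !inE => /andP[eh eT]; rewrite ipmD ipmZ wE // (negbTE eh) mulr0 addr0.
  by have := eT; rewrite -tv => /tightP[].
have [[e [e12 neg]]|N] := pselect (exists e, (e.1 < e.2)%N /\ im w e < 0).
  have [t [e' [t0 Qt en et]]] := ray_hit n3 Qv nw e12 neg.
  have e'T : e' \notin T.
    by apply/negP => /wE E; move: en; rewrite E; case: (e' == h); rewrite ?ltr10 ?ltxx.
  have sub : e' |: (T :\ h) \subset tight (v + t *: w).
    apply/fintype.subsetP => e2; rewrite in_setU1 => /predU1P[->//|e2T]; apply/tightP.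
    by split; [apply: pT.1; move: e2T; rewrite !inE => /andP[]|exact: (fray t Qt).2].
  have pt := tight_pnc n3 gp valid Qt.
  have dt : #|tight (v + t *: w)| = d.
    apply/eqP; rewrite eqn_leq card_pnc //=; apply: leq_trans (subset_leq_card sub).
    by rewrite cardsU1 !inE (negbTE e'T) andbF /= -Td (cardsD1 h T) hT.
  have /fintype.subsetP/(_ h hh)/tightP[_] := hull_sub_maximal pt dt.
  rewrite ipmD ipmZ wE // eqxx mulr1.
  have := hT; rewrite -{1}tv => /tightP[_ ->] => E.
  have t00 : t = 0 by lra.
  by move: et; rewrite t00 scale0r addr0 tv (negbTE e'T).
have wp e : (e.1 < e.2)%N -> 0 <= im w e by move=> e12; rewrite leNgt; apply/negP => h'; apply: N; exists e.
have Qt t : 0 <= t -> Q (v + t *: w).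
  move=> t0; split; first by apply: (normalizedD n3); [exact: Qv.1|exact: (normalizedZ n3)].
  move=> i j ij; rewrite ipmD ipmZ; apply: le_trans (Qv.2 i j ij) _.
  by rewrite lerDl mulr_ge0 // (wp (i, j)).
have [i [j wij]] : exists i j, w i j != 0.
  apply: contrapT => N'; move/eqP: wn; apply; apply/matrixP => i j; rewrite mxE.
  by apply/eqP/negPn/negP => h'; apply: N'; exists i, j.
have B0 : 0 <= B by have := HB _ (fray 0 (Qt 0 (lexx _))) i j; exact: le_trans (normr_ge0 _).
pose t := (2 * B + 1) / `|w i j|.
have w0 : 0 < `|w i j| by rewrite normr_gt0.
have t0 : 0 <= t by apply: divr_ge0 => //; lra.
have h1 := HB _ (fray t (Qt t t0)) i j; have h2 := HB _ (fray 0 (Qt 0 (lexx _))) i j.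
have := ler_normB ((v + t *: w) i j) ((v + 0 *: w) i j).
rewrite !mxE mul0r addr0 addrAC subrr add0r normrM (ger0_norm t0) /t divfK ?gt_eqF //.
by move: h1 h2; rewrite !mxE mul0r addr0 /t; lra.
Qed.

(** A face on which some hull edge is not tight contains the ray of a maximal graph minus that edge;
    all other faces lie in the bounded face of the hull edges. *)
Lemma bounded_faceP K : nonempty_face Q K -> bounded_set_M K <-> hull_edges \subset Etight p f K.
Proof.
case/faceP => v [Qv -> ->]; split=> [bK|/fintype.subsetP s].
  apply/fintype.subsetP => h hh; apply: contraT => ht; exfalso.
  have [T [sT pT Td]] := extend_to_maximal n3 gp lab valid (tight_pnc n3 gp valid Qv).
  have hT := fintype.subsetP (hull_sub_maximal pT Td) h hh.
  apply: (hull_ray_unbounded pT Td hT hh); case: bK => B HB; exists B => x [Qx tx]; apply: HB; split => // e et.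
  by apply: tx; rewrite !inE (fintype.subsetP sT) // andbT; apply: contraNneq ht => <-.
have [B HB] := Xhull_bounded; exists B => x [Qx tx]; apply: HB; split => // e /s; exact: tx.
Qed.

(** This equivalence is proved at the end. Taking it as a hypothesis keeps the polyhedral part apart
    from the topology of the plane. *)
Hypothesis pptP : forall T, ppt p T <-> pnc T /\ #|T| = d.

Lemma affdim_nonempty_face K k : nonempty_face Q K -> affdim K k <-> k = (d - #|Etight p f K|)%N.
Proof.
by case/faceP => v [Qv -> ->]; split=> [h|->]; [exact: affdim_uniq h (affdim_face Qv)|exact: affdim_face].
Qed.

Lemma card_Etight K : nonempty_face Q K -> pnc (Etight p f K) /\ (#|Etight p f K| <= d)%N.
Proof.
by case/faceP => v [Qv _ ->]; have h := tight_pnc n3 gp valid Qv; split => //; exact: card_pnc.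
Qed.

Lemma edge_faceP K : nonempty_face Q K -> affdim K 1 <->
  exists T e, [/\ ppt p T, e \in T & Etight p f K = T :\ e].
Proof.
move=> Kf; rewrite affdim_nonempty_face //; have [pK cK] := card_Etight Kf; split=> [E|[T [e [/pptP[pT Td] eT ->]]]].
  have [T [sT pT Td]] := extend_to_maximal n3 gp lab valid pK.
  have : #|T :\: Etight p f K| = 1%N by rewrite cardsD (finset.setIidPr sT) Td -E.
  move/eqP/cards1P => [e eE]; have : e \in T :\: Etight p f K by rewrite eE set11.
  rewrite finset.in_setD => /andP[eK eT]; exists T, e; split => //; first exact/pptP.
  apply/finset.setP => e'; rewrite finset.in_setD1.
  have : (e' \in T :\: Etight p f K) = (e' == e) by rewrite eE finset.in_set1.
  rewrite finset.in_setD; have := fintype.subsetP sT e'.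
  by case: (e' \in Etight p f K) => /= [/(_ isT) eT' <-|_ ->]; [rewrite eT'|rewrite andNb].
by move: Td; rewrite (cardsD1 e) eT => <-; rewrite addnK.
Qed.

Lemma polyhedron_structure :
  let E := Etight p f in
  let X := Xhull p f in
  simple_polyhedron Q d /\
  (forall K, nonempty_face Q K -> pnc (E K)) /\
  (forall G, pnc G -> exists K, nonempty_face Q K /\ E K = G) /\
  (forall K1 K2, nonempty_face Q K1 -> nonempty_face Q K2 ->
     ((forall x, K1 x -> K2 x) <-> E K2 \subset E K1)) /\
  (forall K, nonempty_face Q K -> (affdim K 0 <-> ppt p (E K))) /\
  (forall K, nonempty_face Q K ->
     (affdim K 1 /\ bounded_set_M K <->
      exists T e, ppt p T /\ e \in T /\ ~ hull_edge p e.1 e.2 /\ E K = T :\ e)) /\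
  (forall K, nonempty_face Q K ->
     (affdim K 1 /\ ~ bounded_set_M K <->
      exists T e, ppt p T /\ e \in T /\ hull_edge p e.1 e.2 /\ E K = T :\ e)) /\
  nonempty_face Q X /\ bounded_set_M X /\
  (forall v, is_vertex Q v -> X v) /\
  (forall K, nonempty_face Q K -> bounded_set_M K -> forall x, K x -> X x) /\
  (exists phi : 'M[R]_(n, 2) -> {set 'I_n * 'I_n},
     (forall v, is_vertex X v -> ppt p (phi v)) /\
     (forall T, ppt p T -> exists v, is_vertex X v /\ phi v = T) /\
     (forall u v, is_vertex X u -> is_vertex X v -> phi u = phi v -> u = v) /\
     (forall u v, is_vertex X u -> is_vertex X v ->
        (skel_adj X u v <-> flip p (phi u) (phi v)))).
Proof.
move=> E X; have gh : graph_on hull_edges by move=> e /hull_edgesP[].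
have d_3 := d3.
have EP K e : (e \in E K) <-> ((e.1 < e.2)%N /\ forall v, K v -> im v e = f e.1 e.2).
  by rewrite /E inE; split => /asboolP.
have XE : X = face hull_edges := Xhull_face.
have E0 : E Q = finset.set0.
  by have [_ h _] := face_of_pnc pnc0; rewrite face0 in h.
have hullD T e : ppt p T -> e \in T -> hull_edges \subset T :\ e <-> ~ hull_edge p e.1 e.2.
  move=> /pptP[pT Td] eT; have sT := fintype.subsetP (hull_sub_maximal pT Td).
  split=> [/fintype.subsetP s h|nh].
    have /s : e \in hull_edges by apply/hull_edgesP; split => //; exact: pT.1.
    by rewrite !inE eqxx.
  apply/fintype.subsetP => e' h'; rewrite !inE sT // andbT; apply: contra_notN nh => /eqP<-.
  by have /hull_edgesP[] := h'.
have vX v : is_vertex X v <-> [/\ Q v, hull_edges \subset tight v & #|tight v| = d].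
  by rewrite XE; exact: vertexP.
have pptT v : Q v -> #|tight v| = d -> ppt p (tight v).
  by move=> Qv tv; apply/pptP; split => //; exact: (tight_pnc n3 gp valid).
split; [split|split; [|split; [|split; [|split; [|split; [|split; [|split; [|split; [|split; [|split]]]]]]]]]].
- have [[Qf Qn] _ _] := face_of_pnc pnc0; rewrite face0 in Qf Qn.
  by apply/affdim_nonempty_face; [split|rewrite -/E E0 cards0 subn0].
(* The facets through a vertex are the faces of its single tight edges, and there are 2n - 3 of
   these. *)
- move=> v /vertexQP[Qv tv]; exists [seq face [set e]%SET | e <- enum (tight v)].
  have p1 e : e \in tight v -> pnc [set e]%SET.
    by move=> et; apply: (pnc_sub n3 gp) (tight_pnc n3 gp valid Qv); rewrite finset.sub1set.
  split; last split; last 1 first.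
  + move=> F; split=> [[Ff [Fd Fv]]|/List.in_map_iff[e [<- /In_mem]]].
      have Fn : nonempty_face Q F by split => //; exists v.
      have /(affdim_nonempty_face _ Fn) := Fd; have [pF cF] := card_Etight Fn => Ed.
      have /eqP/cards1P[e Ee] : #|E F| = 1%N.
        move: Ed; rewrite /E; move: (#|_|) cF => m; clear -d_3; case: d d_3 => // q _ mq /= Eq.
        by apply/eqP; rewrite -(eqn_add2l q) addn1 {1}Eq subnK.
      have [v' [Qv' FE]] := faceP Fn; rewrite -/E Ee => tE; rewrite FE -tE.
      apply/List.in_map_iff; exists e; split => //; apply/In_mem; rewrite mem_enum.
      have : e \in tight v' by rewrite -tE set11.
      by case/tightP => e12 _; apply/tightP; split => //; move: Fv; rewrite FE -tE => -[_]; apply; rewrite set11.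
    rewrite mem_enum => et; have [Ff EF _] := face_of_pnc (p1 e et).
    split; [exact: Ff.1|split; last by split => // e'; rewrite inE => /eqP->; have /tightP[] := et].
    by apply/(affdim_nonempty_face _ Ff); rewrite EF cards1 subn1.
  + apply: NoDup_map; first exact: enum_uniq.
    move=> e e'; rewrite !mem_enum => et e't FE; have [_ E1 _] := face_of_pnc (p1 e et).
    have [_ E2 _] := face_of_pnc (p1 e' e't); apply/set1P; rewrite -E2 -FE E1 set11 //.
  by rewrite size_map -cardE.
- by move=> K /card_Etight[].
- by move=> G /face_of_pnc[h1 h2 _]; exists (face G).
- move=> K1 K2 /faceP[v1 [Q1 K1E E1]] /faceP[v2 [Q2 K2E E2]]; split=> [s|/fintype.subsetP s x].
    apply/fintype.subsetP => e /EP[e12 h]; apply/EP; split => // x /s; exact: h.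
  rewrite K1E K2E => -[Qx h]; split => // e et; apply: h; rewrite -E1; apply: s; rewrite /E E2 //.
- move=> K Kf; rewrite affdim_nonempty_face // pptP; have [pK cK] := card_Etight Kf.
  split=> [/esym/eqP|[_ ->]]; last by rewrite subnn.
  by rewrite subn_eq0 => h; split => //; apply/eqP; rewrite eqn_leq cK.
- move=> K Kf; rewrite edge_faceP // bounded_faceP //; split=> [[[T [e [pT eT KE]]]]|[T [e [pT [eT [nh KE]]]]]].
    by rewrite KE => /(hullD T e pT eT) nh; exists T, e.
  by split; [exists T, e|rewrite -/(E K) KE; apply/(hullD T e pT eT)].
- move=> K Kf; rewrite edge_faceP // bounded_faceP //; split=> [[[T [e [pT eT KE]]]]|[T [e [pT [eT [nh KE]]]]]].
    by rewrite KE => nb; exists T, e; do 3 (split => //); apply: contrapT => /(hullD T e pT eT).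
  by split; [exists T, e|rewrite -/(E K) KE => /(hullD T e pT eT)].
- by rewrite XE; have [] := face_of_pnc hull_pnc.
- rewrite XE; exact: Xhull_bounded.
- move=> v /vertexQP[Qv tv]; rewrite XE; split => // e eh.
  by have /tightP[] := fintype.subsetP (hull_sub_maximal (tight_pnc n3 gp valid Qv) tv) e eh.
- move=> K Kf /(bounded_faceP Kf); have [v [Qv -> ->]] := faceP Kf.
  by move=> /fintype.subsetP s x [Qx tx]; rewrite XE; split => // e /s; exact: tx.
exists tight; split; [|split; [|split]].
- by move=> v /vX[Qv _ tv]; exact: pptT.
- move=> T /pptP[pT Td]; have [v Qv tv] := tight_exists n3 gp lab valid pT.
  by exists v; split => //; apply/vX; rewrite tv; split => //; exact: hull_sub_maximal.
- move=> u v /vX[Qu _ tu] /vX[Qv _ tv] E1.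
  by have := face_tight Qu; rewrite E1 face_set1.
move=> u v /vX[Qu hu tu] /vX[Qv hv tv]; split=> [[uv [F [Ff [Fd [Fu Fv]]]]]|[e [e' [eu [nh [e'u vE]]]]]].
  (* A relative interior point [x] of the common edge has one tight constraint less than [u] and
     [v]; each of them adds one edge to its graph. The hull edges are already tight at [x], so the
     exchanged edge is interior. *)
  rewrite XE in Ff; have [x [_ Qx hx FE]] := face_repr n3 gh Ff (ex_intro _ u Fu).
  have px := tight_pnc n3 gp valid Qx.
  have cx : (#|tight x|.+1)%N = d.
    have := affdim_uniq Fd (_ : affdim F (d - #|tight x|)); rewrite {1}FE => /(_ (affdim_face Qx)) Eq.
    by rewrite -add1n {1}Eq subnK // card_pnc.
  have su : tight x \subset tight u.
    apply/fintype.subsetP => e ex; have /tightP[e12 _] := ex; apply/tightP; split => //.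
    by move: Fu; rewrite FE => -[_]; apply.
  have sv : tight x \subset tight v.
    apply/fintype.subsetP => e ex; have /tightP[e12 _] := ex; apply/tightP; split => //.
    by move: Fv; rewrite FE => -[_]; apply.
  have one y : tight x \subset tight y -> #|tight y| = d -> exists e, e \notin tight x /\ tight y = e |: tight x.
    move=> sy ty; have : #|tight y :\: tight x| = 1%N by rewrite cardsD (finset.setIidPr sy) ty -cx subSnn.
    move/eqP/cards1P => [e eE]; exists e.
    have : e \in tight y :\: tight x by rewrite eE finset.set11.
    rewrite finset.in_setD => /andP[nx ey]; split => //; apply/esym/eqP.
    rewrite eqEcard cardsU1 nx ty add1n cx leqnn andbT; apply/fintype.subsetP => z.
    by rewrite in_setU1 => /predU1P[->//|]; exact: (fintype.subsetP sy).
  have [e [ex uE]] := one u su tu; have [e' [e'x vE]] := one v sv tv.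
  have ee' : e' != e.
    by apply/eqP => ee; apply: uv; have := face_tight Qu; rewrite uE -ee -vE face_set1.
  exists e, e'; rewrite uE vE; split; [exact: finset.setU11|split; last split].
  - move=> h; have eh : e \in hull_edges.
      by apply/hull_edgesP; split => //; apply: (@graph_on_tight _ _ p f u); rewrite uE finset.setU11.
    by move: ex; rewrite (fintype.subsetP hx).
  - by rewrite in_setU1 negb_or ee'.
  by rewrite finset.setU1K.
split.
  by move=> uv; move: e'u; rewrite uv vE !inE eqxx.
have pG : pnc (tight u :\ e) by apply: (pnc_sub n3 gp) (tight_pnc n3 gp valid Qu); exact: finset.subD1set.
have sh : hull_edges \subset tight u :\ e by apply/(hullD _ _ (pptT u Qu tu) eu).
(* The graph common to both sides of the flip has 2n - 4 edges and contains all hull edges, so its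
   face is an edge of the bounded face. *)
exists (face (tight u :\ e)); split; [|split; [|split]].
- by rewrite XE; apply: is_face_face => //; exact: pG.1.
- have [Ff EF _] := face_of_pnc pG; apply/(affdim_nonempty_face _ Ff); rewrite EF.
  by move: tu; rewrite (cardsD1 e) eu => <-; rewrite addnK.
- by split => // e2; rewrite !inE => /andP[_ /andP[_ /eqP]].
split => // e2 h; have : e2 \in tight v by rewrite vE in_setU1 h orbT.
by case/tightP.
Qed.

End Polyhedron.

(** * Jordan curve theorem for cycles of a plane graph *)

Section PlaneComponents.
Variable R : realType.
Implicit Types (x y z w : (R * R)%type) (A : set (R * R)).

Lemma component_near A x y : (\forall w \near y, A w) ->
  connected_component A x y -> \forall w \near y, connected_component A x w.
Proof.
case/near_planeP => e e0 eA xy; apply/near_planeP; exists e => // w h1 h2.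
apply: connected_component_trans xy _; apply: seg_component => z [t [/andP[t0 t1] ->]].
apply: eA => /=; rewrite addrAC subrr add0r normrM (ger0_norm t0).
  by apply: le_lt_trans h1; rewrite -[leRHS]mul1r ler_wpM2r.
by apply: le_lt_trans h2; rewrite -[leRHS]mul1r ler_wpM2r.
Qed.

Lemma closure_component_near A x y : (\forall w \near y, A w) ->
  closure (connected_component A x) y -> connected_component A x y.
Proof.
case/near_planeP => e e0 eA cl.
have [w [xw [h1 h2]]] : connected_component A x `&` [set w | `|w.1 - y.1| < e /\ `|w.2 - y.2| < e] !=set0.
  by apply: cl; apply/near_planeP; exists e.
apply: (connected_component_trans xw); apply: connected_component_sym; apply: seg_component => z [t [/andP[t0 t1] ->]].
apply: eA => /=; rewrite addrAC subrr add0r normrM (ger0_norm t0).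
  by apply: le_lt_trans h1; rewrite -[leRHS]mul1r ler_wpM2r.
by apply: le_lt_trans h2; rewrite -[leRHS]mul1r ler_wpM2r.
Qed.

Lemma visible_closure A x w y : connected_component A x w ->
  (forall s, 0 < s <= 1 -> A (step y s (vec y w))) -> closure (connected_component A x) y.
Proof.
move=> xw H B By.
have [s [s0 [s1 [Bs _]]]] := @filter_ex _ _ (at_right_proper_filter (0 : R)) _
  (filterI (nbhs_right_gt (0 : R)) (filterI (nbhs_right_lt (ltr01 : 0 < (1 : R))) (near_step (vec y w) By))).
exists (step y s (vec y w)); split => //.
apply: (connected_component_trans xw); apply: connected_component_sym; apply: seg_component => z [t [/andP[t0 t1] ->]].
rewrite (_ : (_, _) = step y (s + t * (1 - s)) (vec y w)); last first.
  by rewrite /step /vec /=; congr pair; ring.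
by apply: H; apply/andP; split; nra.
Qed.

(** Otherwise the component of [x] would cut out a subset of the segment that is both open and
    closed, hence all of it. *)
Lemma seg_meets_boundary A x y : (forall z, A z -> \forall w \near z, A w) -> A x -> ~ A y ->
  exists2 z, in_seg x y z & closure (connected_component A x) z /\ ~ A z.
Proof.
move=> Ao Ax nAy; apply: contrapT => N.
pose U := connected_component A x; pose S : set (R * R) := in_seg x y.
have Uo z : U z -> \forall w \near z, U w.
  by move=> Uz; apply: component_near => //; apply: Ao; exact: (connected_component_sub Uz).
suff E : S `&` U = S.
  have : (S `&` U) y by rewrite E; exact: in_seg_r.
  by case=> _ /connected_component_sub.
apply: (@connected_in_seg R x y).
- by exists x; split; [exact: in_seg_l|exact: connected_component_refl].
- exists (interior U); first exact: open_interior.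
  by apply/seteqP; split=> z [h1 h2]; split => //; [exact: Uo|exact: interior_subset].
exists (closure U); first exact: closed_closure.
apply/seteqP; split=> z [h1 h2]; split => //; first exact: subset_closure.
have [Az|nAz] := pselect (A z); first by apply: closure_component_near => //; exact: Ao.
by case: N; exists z.
Qed.

End PlaneComponents.

(** * Simple cycles and their local shape *)

Section Cycles.
Variables (R : realType) (n : nat) (p : 'I_n -> (R * R)%type).
Hypotheses (n3 : (3 <= n)%N) (gp : general_position p).
Implicit Types (x y z : (R * R)%type) (t : seq 'I_n) (k l : 'I_n) (e : 'I_n * 'I_n).
Local Notation segm e := (in_seg (p e.1) (p e.2)).

Definition darts t : seq ('I_n * 'I_n) := [seq (k, next t k) | k <- t].

Definition simple_cycle t : Prop := [/\ uniq t, (3 <= size t)%N &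
  forall e e', e \in darts t -> e' \in darts t -> e != e' -> forall x, segm e x -> segm e' x ->
    exists k, ((k == e.1) || (k == e.2)) && ((k == e'.1) || (k == e'.2)) /\ x = p k].

Definition cycle_flow t e : R := (count_mem e (darts t))%:R.

Definition boundary t x : Prop := exists2 e, e \in darts t & segm e x.

Lemma mem_darts t e : (e \in darts t) = (e.1 \in t) && (e.2 == next t e.1).
Proof.
apply/mapP/andP => [[k kt ->]|[h /eqP E]]; first by rewrite eqxx.
by exists e.1 => //; rewrite -E -surjective_pairing.
Qed.

Lemma sum_cycle_flow t (F : 'I_n * 'I_n -> R) :
  \sum_e cycle_flow t e * F e = \sum_(k <- t) F (k, next t k).
Proof.
rewrite -(big_map (fun k => (k, next t k)) xpredT F) -/(darts t) /cycle_flow.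
elim: (darts t) => [|e s IH] /=; first by rewrite big_nil big1 // => e _; rewrite mul0r.
rewrite big_cons -IH; transitivity (\sum_e' ((e == e')%:R * F e' + (count_mem e' s)%:R * F e')).
  by apply: eq_bigr => e' _; rewrite natrD mulrDl.
rewrite big_split /= (bigD1 e) //= eqxx mul1r big1 ?addr0 // => e' /negbTE h.
by rewrite eq_sym h mul0r.
Qed.

Lemma cycle_flow_circ t : uniq t -> circ (cycle_flow t).
Proof.
move=> ut g; rewrite (sum_cycle_flow t (fun e => g e.1 - g e.2)) sumrB /=.
have E : perm_eq [seq next t k | k <- t] t.
  apply: uniq_perm => //; first by rewrite map_inj_in_uniq // => k l kt lt /(congr1 (prev t)); rewrite !prev_next.
  move=> k; apply/mapP/idP => [[l lt ->]|kt]; first by rewrite mem_next.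
  by exists (prev t k); rewrite ?mem_prev // next_prev.
by rewrite -[X in _ - X](big_map (next t) xpredT g) (perm_big _ E) subrr.
Qed.

Lemma off_cycle_flow t x : off p (cycle_flow t) x <-> ~ boundary t x.
Proof.
split=> [H [e et s]|H e en s].
  by apply: (H e) s; rewrite /cycle_flow pnatr_eq0 -lt0n -has_count has_pred1.
by apply: H; exists e => //; rewrite -has_pred1 has_count lt0n; move: en; rewrite /cycle_flow pnatr_eq0.
Qed.

Lemma complement_near t x : ~ boundary t x -> \forall y \near x, ~ boundary t y.
Proof. by move/off_cycle_flow/near_off; apply: filterS => y /off_cycle_flow. Qed.

Definition winding (c : 'I_n * 'I_n -> R) x : R := wind p (1, 0) c x.

Lemma dir10 : ((1, 0) : R * R) != 0.
Proof. by apply/eqP => -[] /eqP; rewrite oner_eq0. Qed.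

Lemma next_neighbours t k : uniq t -> (3 <= size t)%N -> k \in t -> [/\ next t k != k, prev t k != k & next t k != prev t k].
Proof.
move=> ut s3t kt; have [i t' tE] := rot_to kt.
have ut' : uniq (k :: t') by rewrite -tE rot_uniq.
have s3 : (3 <= size (k :: t'))%N by rewrite -tE size_rot.
suff [h1 h2] : next t k != k /\ next t (next t k) != k.
  split=> //; first by apply: contra_neq h1 => /(congr1 (next t)); rewrite next_prev.
  by apply: contra_neq h2 => ->; rewrite next_prev.
rewrite -!(next_rot i ut) tE.
case: t' ut' s3 {tE} => [|a [|b s]] //=; rewrite !inE !negb_or -!andbA => /and4P[ka kb _ _] _.
by rewrite eqxx [a == k]eq_sym (negbTE ka) eqxx [b == k]eq_sym kb.
Qed.

Section SimpleCycle.
Variable t : seq 'I_n.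
Hypothesis st : simple_cycle t.
Let ut : uniq t. Proof. by case: st. Qed.

Let cycle_neighbours k : k \in t -> [/\ next t k != k, prev t k != k & next t k != prev t k].
Proof. by case: st => ut' s3 _; exact: next_neighbours. Qed.

Lemma dart_neq e : e \in darts t -> e.1 != e.2.
Proof. by rewrite mem_darts => /andP[/cycle_neighbours[h _ _] /eqP->]; rewrite eq_sym. Qed.

Lemma darts_at_vertex k e : k \in t -> e \in darts t -> segm e (p k) ->
  e = (k, next t k) \/ e = (prev t k, k).
Proof.
move=> kt et s; have := et; rewrite mem_darts => /andP[e1 /eqP e2].
case: (gp_in_seg gp (dart_neq et) s) => kE; [left|right]; rewrite [e]surjective_pairing.
  by rewrite kE e2.
by rewrite kE {2}e2 prev_next.
Qed.

(** [P w] and [Q w] are the coordinates of w - z in the basis [a], [b], multiplied by the square of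
    [D]; this avoids divisions and makes their signs independent of the orientation. Near [z] the
    boundary is the union of the two half-axes. *)
Lemma vertex_local k : k \in t -> let z := p k in
  let a := vec z (p (next t k)) in let b := vec z (p (prev t k)) in let D := cross a b in
  let P w := cross (vec z w) b * D in let Q w := cross a (vec z w) * D in
  D != 0 /\ exists2 eps : R, 0 < eps & forall w, `|w.1 - z.1| < eps -> `|w.2 - z.2| < eps ->
    (boundary t w <-> (Q w = 0 /\ 0 <= P w) \/ (P w = 0 /\ 0 <= Q w)).
Proof.
move=> kt z a b D P Q; have [nk pk npk] := cycle_neighbours kt.
have Dn : D != 0.
  rewrite (_ : D = orient (p k) (p (next t k)) (p (prev t k))); last by rewrite /D /cross /orient /a /b /vec /z /=; ring.
  by apply: (orient_neq0 gp); rewrite // eq_sym.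
split=> //; have D2 : 0 < D * D by rewrite lt_neqAle eq_sym mulf_neq0 // -expr2 sqr_ge0.
have N1 : \forall w \near z, forall e, e \in darts t -> ~ segm e z -> ~ segm e w.
  apply: (@near_forall_dart n _ (nbhs z) (fun e w => e \in darts t -> ~ segm e z -> ~ segm e w)) => e.
  have [s|ns] := pselect (segm e z); first by apply: nearW.
  by apply: filterS (near_not_in_seg ns).
have N2 : \forall w \near z, 0 < D * D - P w.
  apply: (@near_affine_gt0 _ z (fun w => D * D - P w) (D * D - (- z.1 * b.2 + z.2 * b.1) * D) (- b.2 * D) (b.1 * D)).
    by move=> w; rewrite /P /cross /vec /=; ring.
  by rewrite /P /cross /vec !subrr !mul0r subrr mul0r subr0.
have N3 : \forall w \near z, 0 < D * D - Q w.
  apply: (@near_affine_gt0 _ z (fun w => D * D - Q w) (D * D - (a.2 * z.1 - a.1 * z.2) * D) (a.2 * D) (- a.1 * D)).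
    by move=> w; rewrite /Q /cross /vec /=; ring.
  by rewrite /Q /cross /vec !subrr !mulr0 subrr mul0r subr0.
have [eps e0 H] := (near_planeP _ _).1 (filterI N1 (filterI N2 N3)).
exists eps => // w h1 h2; have [{}N1 [{}N2 {}N3]] := H w h1 h2.
have dec u : u * D * D = u * (D * D) by rewrite mulrA.
have W1 : (D * D) * (w.1 - z.1) = P w * a.1 + Q w * b.1.
  by rewrite /P /Q /D /cross /vec /=; ring.
have W2 : (D * D) * (w.2 - z.2) = P w * a.2 + Q w * b.2.
  by rewrite /P /Q /D /cross /vec /=; ring.
have D2n := lt0r_neq0 D2.
split=> [[e et se]|].
  have ez : segm e z by apply: contrapT => h; exact: (N1 e et h).
  case: (darts_at_vertex kt et ez) => E; rewrite E in se.
    left; case: se => s [/andP[s0 _] wE].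
    have -> : Q w = 0 by rewrite wE /Q /cross /vec /a /z /=; ring.
    have -> : P w = s * (D * D) by rewrite wE /P /D /cross /vec /a /z /=; ring.
    by rewrite mulr_ge0 // ltW.
  right; move/in_segC: se => -[s [/andP[s0 _] wE]].
  have -> : P w = 0 by rewrite wE /P /cross /vec /b /z /=; ring.
  have -> : Q w = s * (D * D) by rewrite wE /Q /D /cross /vec /b /z /=; ring.
  by rewrite mulr_ge0 // ltW.
case=> -[z0 pos].
  exists (k, next t k); first by rewrite mem_darts kt eqxx.
  exists (P w / (D * D)); split.
    by apply/andP; split; [rewrite divr_ge0 // ltW|rewrite ler_pdivrMr // mul1r; lra].
  rewrite z0 !mul0r !addr0 -[P w](divfK D2n) in W1 W2.
  by apply: injective_projections => /=; apply: (mulfI D2n); [rewrite -[w.1](subrK z.1) addrC mulrDr W1|rewrite -[w.2](subrK z.2) addrC mulrDr W2];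
    move: (P w / _) => q; rewrite /a /vec /=; ring.
exists (prev t k, k); first by rewrite mem_darts /= mem_prev kt (next_prev ut) eqxx.
apply/in_segC; exists (Q w / (D * D)); split.
  by apply/andP; split; [rewrite divr_ge0 // ltW|rewrite ler_pdivrMr // mul1r; lra].
rewrite z0 !mul0r !add0r -[Q w](divfK D2n) in W1 W2.
by apply: injective_projections => /=; apply: (mulfI D2n); [rewrite -[w.1](subrK z.1) addrC mulrDr W1|rewrite -[w.2](subrK z.2) addrC mulrDr W2];
  move: (Q w / _) => q; rewrite /b /vec /=; ring.
Qed.

Lemma side_local e z : e \in darts t -> segm e z -> (forall k, z <> p k) ->
  exists2 eps : R, 0 < eps & forall w, `|w.1 - z.1| < eps -> `|w.2 - z.2| < eps ->
    (boundary t w <-> cross (vec (p e.1) (p e.2)) (vec z w) = 0).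
Proof.
move=> et sz zp; have e12 := dart_neq et.
have vn := vec_neq0 n3 gp e12; set v := vec _ _ in vn *.
have vv := dot_gt0 vn.
have zN : cross v (vec (p e.1) z) = 0.
  by have := orient_in_seg sz; rewrite /orient /cross /v /vec /=; lra.
have N1 : \forall w \near z, forall e', e' \in darts t -> ~ segm e' z -> ~ segm e' w.
  apply: (@near_forall_dart n _ (nbhs z) (fun e' w => e' \in darts t -> ~ segm e' z -> ~ segm e' w)) => e'.
  have [s|ns] := pselect (segm e' z); first by apply: nearW.
  by apply: filterS (near_not_in_seg ns).
have [s [/andP[s0 s1] zE]] := sz.
have s00 : 0 < s.
  rewrite lt_neqAle s0 andbT; apply/eqP => s_0; apply: (zp e.1).
  by rewrite zE -s_0 !mul0r !addr0 -surjective_pairing.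
have s11 : s < 1.
  rewrite lt_neqAle s1 andbT; apply/eqP => s_1; apply: (zp e.2).
  by rewrite zE s_1 !mul1r; apply: injective_projections => /=; ring.
have dz : dot v (vec (p e.1) z) = s * dot v v by rewrite zE /dot /v /vec /=; ring.
have N2 : \forall w \near z, 0 < dot v (vec (p e.1) w).
  apply: (@near_affine_gt0 _ z (fun w => dot v (vec (p e.1) w)) (- (v.1 * (p e.1).1 + v.2 * (p e.1).2)) v.1 v.2).
    by move=> w; rewrite /dot /vec /=; ring.
  by rewrite dz mulr_gt0.
have N3 : \forall w \near z, 0 < dot v v - dot v (vec (p e.1) w).
  apply: (@near_affine_gt0 _ z (fun w => dot v v - dot v (vec (p e.1) w)) (dot v v + (v.1 * (p e.1).1 + v.2 * (p e.1).2)) (- v.1) (- v.2)).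
    by move=> w; rewrite /dot /vec /=; ring.
  by rewrite dz; nra.
have [eps e0 H] := (near_planeP _ _).1 (filterI N1 (filterI N2 N3)).
exists eps => // w h1 h2; have [{}N1 [{}N2 {}N3]] := H w h1 h2.
have NE : cross v (vec z w) = cross v (vec (p e.1) w) by rewrite -[RHS]subr0 -zN /cross /vec /=; ring.
rewrite NE; split=> [[e' e't se']|N0].
  have ez : segm e' z by apply: contrapT => h; exact: (N1 e' e't h).
  have [E|ne] := eqVneq e' e; last first.
    by case: st => _ _ /(_ e' e e't et ne z ez sz)[k [_ zk]]; case: (zp k).
  by rewrite E in se'; have := orient_in_seg se'; rewrite /orient /cross /v /vec /=; lra.
exists e => //; exists (dot v (vec (p e.1) w) / dot v v); split.
  by apply/andP; split; [rewrite divr_ge0 // ltW|rewrite ler_pdivrMr // mul1r; lra].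
have vvn := lt0r_neq0 vv.
have E1 : dot v v * (w.1 - (p e.1).1) = dot v (vec (p e.1) w) * v.1 - cross v (vec (p e.1) w) * v.2.
  by rewrite /dot /cross /vec /=; ring.
have E2 : dot v v * (w.2 - (p e.1).2) = dot v (vec (p e.1) w) * v.2 + cross v (vec (p e.1) w) * v.1.
  by rewrite /dot /cross /vec /=; ring.
set q := dot v (vec (p e.1) w) in E1 E2 *.
rewrite N0 !mul0r subr0 -[q](divfK vvn) in E1; rewrite N0 !mul0r addr0 -[q](divfK vvn) in E2.
by apply: injective_projections => /=; apply: (mulfI vvn);
  [rewrite -[w.1](subrK (p e.1).1) addrC mulrDr E1|rewrite -[w.2](subrK (p e.1).2) addrC mulrDr E2];
  move: (q / _) => r; rewrite /v /vec /=; ring.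
Qed.

End SimpleCycle.

End Cycles.

(** * Pairs of points on both sides of an edge *)

Section Samples.
Variables (R : realType) (n : nat) (p : 'I_n -> (R * R)%type).
Hypotheses (n3 : (3 <= n)%N) (gp : general_position p).
Implicit Types (x y z m u v : (R * R)%type) (k l a b : 'I_n) (e f : 'I_n * 'I_n) (c : 'I_n * 'I_n -> R).
Local Notation segm e := (in_seg (p e.1) (p e.2)).
Local Notation W := (winding p).

(** The degenerate pairs (k, k) are included, which keeps [z] away from all points of the set as
    well. *)
Definition apart a b z : Prop := forall f, segm f z -> f = (a, b) \/ f = (b, a).

Lemma apart_vertex a b z k : a != b -> apart a b z -> z <> p k.
Proof.
move=> ab az zk; have [||] := az (k, k); first by rewrite /= zk; exact: in_seg_l.
  by case=> ka kb; rewrite -ka -kb eqxx in ab.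
by case=> kb ka; rewrite -ka -kb eqxx in ab.
Qed.

Lemma side_interior_point a b : a != b -> exists2 m, in_seg (p a) (p b) m & apart a b m.
Proof.
have lt_case k l : (k < l)%N -> exists2 m, in_seg (p k) (p l) m & apart k l m.
  move=> kl; have [m [ms mp mo]] := @edge_interior_point _ _ p n3 gp (k, l) kl.
  exists m => // -[i j] /= s; have [ij|ji|ij] := ltngtP i j.
  - have [->|ne] := eqVneq (i, j) (k, l); first by left.
    by case: (mo (i, j) ij ne s).
  - have [E|ne] := eqVneq (j, i) (k, l); first by case: E => -> ->; right.
    by case: (mo (j, i) ji ne); exact: in_segC.
  move: s (mp i); rewrite (val_inj ij) => -[t [_ ->]] /eqP[]; rewrite !subrr !mulr0 !addr0.
  by case: (p j).
rewrite neq_ltn => /orP[|/lt_case[m ms ma]]; first exact: lt_case.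
by exists m; [exact: in_segC|move=> f /ma[]; [right|left]].
Qed.

Lemma crN d x y z : cr d x z y = - cr d x y z.
Proof.
rewrite /cr orient_swap oppr_gt0 oppr_lt0; by have [] := ltP (side d x y) 0; have [] := ltP (side d x z) 0 => //= _ _; try case: ifP; rewrite ?opprK ?oppr0.
Qed.

(* Two points just to the left and right of the dart (a, b), uniformly good for all flows. *)
Definition sample a b m u v : Prop :=
  [/\ in_seg (p a) (p b) m, in_seg u v m, 0 < orient (p a) (p b) u /\ orient (p a) (p b) v < 0,
      forall z, in_seg u v z -> apart a b z &
      forall c, circ c -> W c u - W c v = c (a, b) - c (b, a)].

Lemma apart_off a b z c : apart a b z -> orient (p a) (p b) z != 0 -> off p c z.
Proof.
move=> az oz f _ s; have := s; case: (az f s) => -> /orient_in_seg /= h; move/eqP: oz; apply.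
  by rewrite orient_rot.
by move: h; rewrite /orient; lra.
Qed.

(** Uniformity comes from finiteness: one small t serves the indicator flows of all pairs, and the
    jump of an arbitrary circulation follows by linearity. *)
Lemma sample_exists a b : a != b -> exists m u v, sample a b m u v.
Proof.
move=> ab; have [m ms ma] := side_interior_point ab.
have mp i : p i != m by apply/eqP => E; exact: (apart_vertex (k := i) ab ma).
have [d [gd dn D0]] := left_direction n3 gp m ab.
have NA : \forall z \near m, apart a b z.
  apply: (@near_forall_dart n _ (nbhs m) (fun f z => segm f z -> f = (a, b) \/ f = (b, a))) => f.
  have [s|ns] := pselect (segm f m); first by apply: nearW => z _; exact: ma.
  by apply: filterS (near_not_in_seg ns).
have [eps eps0 A] := (near_planeP _ _).1 NA.
(* The reversed pair (b, a) also passes through [m]; its jump is minus that of (a, b) and is added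
   in [J']. *)
have NJ : \forall t \near (0 : R)^'+, forall f, f != (b, a) ->
    cr d (step m (- t) d) (p f.1) (p f.2) - cr d (step m t d) (p f.1) (p f.2) = (f == (a, b))%:R.
  apply: (@near_forall_dart n _ _ (fun f t => f != (b, a) ->
    cr d (step m (- t) d) (p f.1) (p f.2) - cr d (step m t d) (p f.1) (p f.2) = (f == (a, b))%:R)) => f.
  have [->|fb] := eqVneq f (b, a); first by apply: nearW.
  have oc : only p (fun g => (g == f)%:R : R) (a, b) m.
    move=> g ga; have [gf _|] := eqVneq g f; last by rewrite eqxx.
    by rewrite gf in ga *; move=> /ma[] E; [move: ga|move: fb]; rewrite E eqxx.
  have JJ := @wind_jump _ _ p _ (a, b) m d gd mp ms oc D0; apply: filterS JJ => t [_ _]; rewrite /wind eq_sym.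
  have S x : \sum_e (e == f)%:R * cr d x (p e.1) (p e.2) = cr d x (p f.1) (p f.2).
    rewrite (bigD1 f) //= eqxx mul1r big1 ?addr0 // => e /negbTE ->.
    by rewrite mul0r.
  by rewrite !S.
have [t [t0 [J [e1 e2]]]] := @filter_ex _ _ (at_right_proper_filter (0 : R)) _
  (filterI (nbhs_right_gt (0 : R)) (filterI NJ (near_step d ((near_planeP _ _).2
    (ex_intro2 _ _ eps eps0 (fun y (h1 : `|y.1 - m.1| < eps) (h2 : `|y.2 - m.2| < eps) => conj h1 h2)))))).
exists m, (step m (- t) d), (step m t d).
have LR z : in_seg (step m (- t) d) (step m t d) z -> apart a b z.
  case=> s [/andP[s0 s1] ->]; move: e2 e1 => /= [u1 u2] [v1 v2].
  have E (q v : R) : `|q + t * v - q| < eps -> `|q + - t * v + s * (q + t * v - (q + - t * v)) - q| < eps.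
    rewrite addrAC subrr add0r => h.
    rewrite (_ : _ - q = (2 * s - 1) * (t * v)); last by ring.
    rewrite normrM; apply: le_lt_trans h; rewrite -[leRHS]mul1r ler_wpM2r //.
    by rewrite ler_norml; apply/andP; split; lra.
  by apply: A; rewrite /step /=; apply: E.
have o0 := orient_in_seg ms.
have oE s : orient (p a) (p b) (step m s d) = - s * cross d (vec (p a) (p b)).
  by rewrite -[RHS]add0r -o0 /orient /step /cross /vec /=; ring.
have oL : 0 < orient (p a) (p b) (step m (- t) d) by rewrite oE opprK mulr_gt0.
have oR : orient (p a) (p b) (step m t d) < 0 by rewrite oE mulNr oppr_lt0 mulr_gt0.
split=> // [|c cc].
  exists 2^-1; split; first by rewrite invr_ge0 ler0n invf_le1 ?ltr0n // ler1n.
  by rewrite /step /=; apply: injective_projections => /=; field.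
have fl : off p c (step m (- t) d) by apply: (@apart_off a b); [apply/LR/in_seg_l|rewrite gt_eqF].
have fr : off p c (step m t d) by apply: (@apart_off a b); [apply/LR/in_seg_r|rewrite lt_eqF].
rewrite /winding (wind_dir cc fl dn (dir10 R)) (wind_dir cc fr dn (dir10 R)) /wind -sumrB.
have J' f : cr d (step m (- t) d) (p f.1) (p f.2) - cr d (step m t d) (p f.1) (p f.2)
    = (f == (a, b))%:R - (f == (b, a))%:R.
  have abn : ((a, b) == (b, a)) = false by apply/eqP => -[E]; rewrite E eqxx in ab.
  have [->|fb] := eqVneq f (b, a); last by rewrite subr0; exact: J.
  rewrite eq_sym abn sub0r /= crN [in X in _ - X]crN -opprD; congr (- _).
  by have := J (a, b); rewrite abn eqxx /=; apply.
under eq_bigr do rewrite -mulrBr J' mulrBr.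
have S f : \sum_e c e * (e == f)%:R = c f.
  rewrite (bigD1 f) //= eqxx mulr1 big1 ?addr0 // => e /negbTE ->.
  by rewrite mulr0.
by rewrite sumrB !S.
Qed.

Lemma sample_off a b m u v c z : sample a b m u v -> in_seg u v z ->
  orient (p a) (p b) z != 0 -> off p c z.
Proof. by case=> _ _ _ H _ /H; exact: apart_off. Qed.

Lemma sample_off_l a b m u v c : sample a b m u v -> off p c u.
Proof. by move=> s; apply: (sample_off s (in_seg_l _ _)); case: s => _ _ [h _] _ _; rewrite gt_eqF. Qed.

Lemma sample_off_r a b m u v c : sample a b m u v -> off p c v.
Proof. by move=> s; apply: (sample_off s (in_seg_r _ _)); case: s => _ _ [_ h] _ _; rewrite lt_eqF. Qed.

End Samples.

(** * The Jordan curve theorem for a simple cycle *)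

Section Jordan.
Variables (R : realType) (n : nat) (p : 'I_n -> (R * R)%type).
Hypotheses (n3 : (3 <= n)%N) (gp : general_position p).
Implicit Types (x y z w : (R * R)%type) (k l : 'I_n) (e : 'I_n * 'I_n).
Variable t : seq 'I_n.
Hypothesis st : simple_cycle p t.
Let ut : uniq t. Proof. by case: st. Qed.
Let s3 : (3 <= size t)%N. Proof. by case: st. Qed.
Local Notation bd := (boundary p t).
Local Notation comp := (connected_component (fun y => ~ bd y)).
Local Notation W := (winding p (cycle_flow R t)).

Lemma seg_comp x y : (forall s, 0 <= s <= 1 -> ~ bd (step x s (vec x y))) -> comp x y.
Proof.
move=> H; apply: seg_component => z [s [s01 ->]].
by have := H s s01; rewrite /step /vec.
Qed.

Lemma crossP x y w s a : cross a (vec w (step x s (vec x y))) =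
  (1 - s) * cross a (vec w x) + s * cross a (vec w y).
Proof. by rewrite /cross /vec /step /=; ring. Qed.

Lemma step_box x y z s (eps : R) : 0 <= s <= 1 -> `|x.1 - z.1| < eps -> `|x.2 - z.2| < eps ->
  `|y.1 - z.1| < eps -> `|y.2 - z.2| < eps ->
  `|(step x s (vec x y)).1 - z.1| < eps /\ `|(step x s (vec x y)).2 - z.2| < eps.
Proof.
case/andP=> s0 s1.
have E (u v w : R) : `|u - w| < eps -> `|v - w| < eps -> `|u + s * (v - u) - w| < eps.
  rewrite !ltr_norml => /andP[h1 h2] /andP[h3 h4].
  have -> : u + s * (v - u) - w = (1 - s) * (u - w) + s * (v - w) by ring.
  have [->|sn] := eqVneq s 0; first by rewrite subr0 !mul1r mul0r addr0 h1.
  have sp : 0 < s by rewrite lt_neqAle eq_sym sn.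
  by apply/andP; split; nra.
by move=> *; split; apply: E.
Qed.

Lemma in_seg_convex (a b : R * R) x y s : 0 <= s <= 1 -> in_seg a b x -> in_seg a b y ->
  in_seg a b (step x s (vec x y)).
Proof.
case/andP=> s0 s1 [i [/andP[i0 i1] ->]] [j [/andP[j0 j1] ->]].
exists ((1 - s) * i + s * j); split; last by rewrite /step /vec /=; congr pair; ring.
by apply/andP; split; nra.
Qed.

Lemma mix_neq0 (s a b : R) : 0 <= s <= 1 -> 0 < a * b -> (1 - s) * a + s * b != 0.
Proof.
case/andP=> s0 s1 ab; apply/eqP => E.
have : (1 - s) * (a * a) + s * (a * b) = 0 by rewrite -[RHS](mulr0 a) -E; ring.
have : 0 < a * a by rewrite -expr2 lt_neqAle sqr_ge0 eq_sym expf_neq0 //; apply: contraTneq ab => ->; rewrite mul0r ltxx.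
by have [->|sn] := eqVneq s 0; nra.
Qed.

(* Near z the complement of the cycle consists of two pieces, each connected and containing
   a point that sees all nearby boundary points. *)
Lemma closure_boundary_near x z : ~ bd x -> closure (comp x) z -> bd z ->
  \forall w \near z, bd w -> closure (comp x) w.
Proof.
move=> bx clz bz.
have box (eps : R) : 0 < eps -> exists u, [/\ comp x u, `|u.1 - z.1| < eps & `|u.2 - z.2| < eps].
  move=> e0; have [u [xu [h1 h2]]] : comp x `&` [set w | `|w.1 - z.1| < eps /\ `|w.2 - z.2| < eps] !=set0.
    by apply: clz; apply/near_planeP; exists eps.
  by exists u.
have [[k zk]|nv] := pselect (exists k, z = p k); last first.
  have [e et sz] := bz.
  have [eps e0 H] := side_local n3 gp st et sz (fun k zk => nv (ex_intro _ k zk)).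
  have [u [xu u1 u2]] := box eps e0; set v := vec _ _ in H.
  have Nu : cross v (vec z u) != 0.
    by apply/eqP => /(H u u1 u2); exact: connected_component_sub xu.
  apply/near_planeP; exists eps => // w w1 w2 /(H w w1 w2) Nw.
  apply: visible_closure xu _ => s /andP[s0 s1].
  have [|h1 h2] := step_box (s := s) _ w1 w2 u1 u2; first by rewrite ltW.
  move/(H _ h1 h2); rewrite crossP Nw mulr0 add0r => /eqP.
  by rewrite mulf_eq0 gt_eqF //= (negbTE Nu).
have kt : k \in t.
  have [e et] := bz; rewrite zk => s; move: et (et); rewrite {1}mem_darts => /andP[e1 /eqP e2] et.
  have [->|->] := gp_in_seg gp (dart_neq st et) s; rewrite // e2 mem_next //.
have [Dn [eps e0]] := vertex_local gp st kt; rewrite -zk => H; rewrite -zk in Dn; move: H.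
set a := vec z _ in Dn *; set b := vec z _ in Dn *; set D := cross a b in Dn * => H.
have D2 : 0 < D * D by rewrite -expr2 lt_neqAle sqr_ge0 eq_sym expf_neq0.
pose P w := cross (vec z w) b * D; pose Q w := cross a (vec z w) * D.
have {}H w : `|w.1 - z.1| < eps -> `|w.2 - z.2| < eps ->
    (bd w <-> (Q w = 0 /\ 0 <= P w) \/ (P w = 0 /\ 0 <= Q w)) by exact: H.
have PE s w w' : P (step w s (vec w w')) = (1 - s) * P w + s * P w' by rewrite /P /cross /vec /step /=; ring.
have QE s w w' : Q (step w s (vec w w')) = (1 - s) * Q w + s * Q w' by rewrite /Q /cross /vec /step /=; ring.
have [u [xu u1 u2]] := box eps e0.
have nu : ~ bd u := connected_component_sub xu.
have NB : \forall w \near z, `|w.1 - z.1| < eps /\ `|w.2 - z.2| < eps by apply/near_planeP; exists eps.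
have [r [r0 [_ [q1 q2]]]] := @filter_ex _ _ (at_right_proper_filter (0 : R)) _
  (filterI (nbhs_right_gt (0 : R)) (near_step (a.1 + b.1, a.2 + b.2) NB)).
(* The point opposite to the sum of the two side vectors sees the whole sector where [P] or [Q] is
   negative; the other sector is convex. *)
set q := step z (- r) _ in q1 q2.
have Pq : P q < 0.
  rewrite (_ : P q = - (r * (D * D))); last by rewrite /P /q /D /cross /vec /step /=; ring.
  by rewrite oppr_lt0 mulr_gt0.
have Qq : Q q < 0.
  rewrite (_ : Q q = - (r * (D * D))); last by rewrite /Q /q /D /cross /vec /step /=; ring.
  by rewrite oppr_lt0 mulr_gt0.
have far : P u < 0 \/ Q u < 0 -> comp x q.
  move=> h; apply: connected_component_trans xu _; apply: seg_comp => s s01.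
  have [h1 h2] := step_box s01 u1 u2 q1 q2.
  case/(H _ h1 h2); rewrite PE QE => -[]; case: h => h; case/andP: s01 => s0 s1; nra.
apply/near_planeP; exists eps => // w w1 w2 bw; have := (H w w1 w2).1 bw.
have K v : `|v.1 - z.1| < eps -> `|v.2 - z.2| < eps -> comp x v ->
    (forall s : R, 0 < s -> s <= 1 -> ~ ((Q (step w s (vec w v)) = 0 /\ 0 <= P (step w s (vec w v))) \/
      (P (step w s (vec w v)) = 0 /\ 0 <= Q (step w s (vec w v))))) -> closure (comp x) w.
  move=> v1 v2 xv Hv; apply: visible_closure xv _ => s /andP[s0 s1].
  have [|h1 h2] := step_box (s := s) _ w1 w2 v1 v2; first by rewrite ltW.
  by move/(H _ h1 h2); exact: Hv.
have [Pu|Pu] := ltP (P u) 0.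
  move=> h; apply: (K q) => //; first by apply: far; left.
  by move=> s s0 s1; rewrite PE QE; clear -h s0 s1 Pq Qq Pu; case: h => -[h1 h2] [] [h3 h4]; nra.
have [Qu|Qu] := ltP (Q u) 0.
  move=> h; apply: (K q) => //; first by apply: far; right.
  by move=> s s0 s1; rewrite PE QE; clear -h s0 s1 Pq Qq Pu Qu; case: h => -[h1 h2] [] [h3 h4]; nra.
have Pu0 : 0 < P u.
  by rewrite lt_neqAle Pu andbT; apply/eqP => h; apply: nu; apply/(H u u1 u2); right.
have Qu0 : 0 < Q u.
  by rewrite lt_neqAle Qu andbT; apply/eqP => h; apply: nu; apply/(H u u1 u2); left.
move=> h; apply: (K u) => // s s0 s1; rewrite PE QE; clear -h s0 s1 Pu0 Qu0; case: h => -[h1 h2] [] [h3 h4]; nra.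
Qed.

Lemma closure_side x k z w : ~ bd x -> k \in t -> in_seg (p k) (p (next t k)) z ->
  in_seg (p k) (p (next t k)) w -> closure (comp x) z -> closure (comp x) w.
Proof.
move=> bx kt sz sw clz; pose S : set (R * R) := in_seg (p k) (p (next t k)).
have Sbd y : S y -> bd y by exists (k, next t k) => //; rewrite mem_darts kt eqxx.
suff E : S `&` closure (comp x) = S by have [] : (S `&` closure (comp x)) w by rewrite E.
apply: (@connected_in_seg R (p k) (p (next t k))).
- by exists z.
- exists (interior [set y | bd y -> closure (comp x) y]); first exact: open_interior.
  apply/seteqP; split=> y [Sy h]; split => //; first by apply: closure_boundary_near => //; exact: Sbd.
  by apply: (interior_subset h); exact: Sbd.
by exists (closure (comp x)); [exact: closed_closure|].
Qed.

(** A segment to the boundary shows that the component touches the cycle somewhere. Touching spreads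
    over a side by connectedness, and from side to side around the cycle. *)
Lemma closure_component_boundary x z : ~ bd x -> bd z -> closure (comp x) z.
Proof.
move=> bx [e et sz]; have := et; rewrite mem_darts => /andP[e1 /eqP e2].
have nbz : ~ ~ bd z by move=> h; apply: h; exists e.
have [y _ [cly nby]] := seg_meets_boundary (@complement_near _ _ p t) bx nbz.
have /contrapT[f ft sy] := nby.
have := ft; rewrite mem_darts => /andP[f1 /eqP f2].
have nx k : k \in t -> closure (comp x) (p k) -> closure (comp x) (p (next t k)).
  by move=> kt; apply: (closure_side bx kt); [exact: in_seg_l|exact: in_seg_r].
have c1 : closure (comp x) (p f.1).
  by apply: (closure_side bx f1 _ (in_seg_l _ _) cly); rewrite -f2.
have it i : closure (comp x) (p (iter i (next t) f.1)) /\ iter i (next t) f.1 \in t.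
  by elim: i => //= i [h1 h2]; split; [exact: nx|rewrite mem_next].
have c2 : closure (comp x) (p e.1).
  have := fconnect_cycle (cycle_next ut) f1 e.1; rewrite e1 => /iter_findex <-.
  by case: (it (findex (next t) f.1 e.1)).
by rewrite e2 in sz; apply: (closure_side bx e1 _ sz c2); exact: in_seg_l.
Qed.

(** Every component comes arbitrarily close to the midpoint [m] of the sample and from there reaches
    [u] or [v]. So the complement has at most two components. *)
Lemma cycle_two_sides x k m u v : ~ bd x -> k \in t -> sample p k (next t k) m u v ->
  comp x u \/ comp x v.
Proof.
move=> bx kt sa; have [ms mlr [lu rv] ap _] := sa.
have [nk pk npk] := next_neighbours ut s3 kt.
have et : (k, next t k) \in darts t by rewrite mem_darts kt eqxx.
have bm : bd m by exists (k, next t k).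
have mp l : m <> p l by apply: (apart_vertex (a := k) (b := next t k)); [rewrite eq_sym|exact: ap].
have [eps e0 H] := side_local n3 gp st et ms mp; rewrite /= in H.
have [w [xw [w1 w2]]] : comp x `&` [set w | `|w.1 - m.1| < eps /\ `|w.2 - m.2| < eps] !=set0.
  by apply: (closure_component_boundary bx bm); apply/near_planeP; exists eps.
set a := vec _ _ in H.
have om := orient_in_seg ms.
have oE y : orient (p k) (p (next t k)) y = cross a (vec m y).
  by rewrite -[LHS]subr0 -[X in _ - X]om /a /orient /cross /vec /=; ring.
have side_comp y : in_seg u v y -> 0 < cross a (vec m y) * cross a (vec m w) -> comp x y.
  move=> yuv yw.
  have NB : \forall w \near m, `|w.1 - m.1| < eps /\ `|w.2 - m.2| < eps by apply/near_planeP; exists eps.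
  have [r [r0 [r1 [[q1 q2] _]]]] := @filter_ex _ _ (at_right_proper_filter (0 : R)) _
    (filterI (nbhs_right_gt (0 : R)) (filterI (nbhs_right_lt (ltr01 : 0 < (1 : R))) (near_step (vec m y) NB))).
  set q := step m r _ in q1 q2; have qN : cross a (vec m q) = r * cross a (vec m y).
    by rewrite /q crossP {1}/cross /vec !subrr !mulr0 subrr mulr0 add0r.
  apply: connected_component_trans xw _; apply: (@connected_component_trans _ _ q).
    apply: seg_comp => s /andP[s0 s1].
    have [|h1 h2] := step_box (s := s) _ w1 w2 q1 q2; first by rewrite s0.
    move/(H _ h1 h2)/eqP; apply/negP; rewrite crossP qN; apply: mix_neq0; first by rewrite s0.
    by rewrite mulrC -mulrA mulr_gt0.
  apply: seg_comp => s /andP[s0 s1]; apply/(@off_cycle_flow _ _ p t).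
  apply: (@apart_off _ _ p k (next t k)).
    apply: ap; apply: in_seg_convex => //; first by rewrite s0.
    by apply: in_seg_convex => //; rewrite !ltW.
  rewrite oE crossP qN; apply: mix_neq0; first by rewrite s0.
  rewrite -mulrA mulr_gt0 // -expr2 lt_neqAle sqr_ge0 eq_sym expf_neq0 //.
  by apply: contraTneq yw => ->; rewrite mul0r ltxx.
rewrite !oE in lu rv.
have Nw : cross a (vec m w) != 0.
  by apply/eqP => /(H w w1 w2); exact: connected_component_sub xw.
move: Nw; rewrite neq_lt => /orP[h|h]; [right; apply: side_comp (in_seg_r _ _) _|left; apply: side_comp (in_seg_l _ _) _].
  by rewrite nmulr_rgt0.
by rewrite mulr_gt0.
Qed.

Lemma cycle_wind_comp x y : ~ bd x -> comp x y -> W y = W x.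
Proof.
move=> bx [A [Ax sA cA] Ay].
apply: (@wind_connected _ _ p _ _ A x y (@cycle_flow_circ R _ _ ut) (dir10 R) cA) => //.
by move=> z /sA /off_cycle_flow.
Qed.

Definition far_bound : R := \sum_k (`|(p k).1| + `|(p k).2|) + 1.

Lemma far_vertex k : `|(p k).1| < far_bound /\ `|(p k).2| < far_bound.
Proof.
rewrite /far_bound (bigD1 k) //=; set S := \sum_(_ | _) _.
have : 0 <= S by apply: sumr_ge0 => i _; rewrite addr_ge0.
have := normr_ge0 (p k).1; have := normr_ge0 (p k).2; lra.
Qed.

Lemma wind_far c x : circ c -> off p c x -> winding p c x != 0 -> `|x.1| < far_bound /\ `|x.2| < far_bound.
Proof.
move=> cc oc wn.
have K (u : R * R) : u != 0 -> exists k, dot u (vec x (p k)) < 0.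
  move=> un; apply: contrapT => N; move/eqP: wn; apply.
  by apply: (wind_halfplane cc oc (dir10 R) un) => e _; split; rewrite leNgt; apply/negP => h; apply: N; [exists e.1|exists e.2].
have nz (a b : R) : a != 0 \/ b != 0 -> ((a, b) : R * R) != 0.
  by case=> h; apply: contra_neq h => -[].
have [k1 h1] := K (1, 0) (nz _ _ (or_introl (oner_neq0 R))).
have [k2 h2] := K (0, 1) (nz _ _ (or_intror (oner_neq0 R))).
have n1 : (-1 : R) != 0 by rewrite oppr_eq0 oner_eq0.
have [k3 h3] := K (-1, 0) (nz _ _ (or_introl n1)).
have [k4 h4] := K (0, -1) (nz _ _ (or_intror n1)).
have [f1 _] := far_vertex k1; have [_ f2] := far_vertex k2.
have [f3 _] := far_vertex k3; have [_ f4] := far_vertex k4.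
move: h1 h2 h3 h4 f1 f2 f3 f4; rewrite /dot /vec /= !ltr_norml => h1 h2 h3 h4.
by do 4!case/andP => ? ?; split; apply/andP; split; lra.
Qed.

Lemma boundary_bounded x : bd x -> `|x.1| < far_bound /\ `|x.2| < far_bound.
Proof.
case=> e _ s; have [h1 h2] := far_vertex e.1; have [h3 h4] := far_vertex e.2.
case: s => r [r01 ->]; have := @step_box (p e.1) (p e.2) (0, 0) r far_bound r01.
by rewrite /step /vec /= !subr0; apply.
Qed.

Lemma cycle_orientation : exists2 eps : R, eps = 1 \/ eps = -1 &
  (forall x, ~ bd x -> W x = 0 \/ W x = eps) /\
  (forall x y, ~ bd x -> ~ bd y -> W x = W y -> comp x y).
Proof.
have [k kt] : exists k, k \in t by case: st => _ + _; case: (t) => // k s _; exists k; rewrite inE eqxx.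
have [nk pk npk] := next_neighbours ut s3 kt.
have [m [u [v sa]]] : exists m u v, sample p k (next t k) m u v by apply: (sample_exists n3 gp); rewrite eq_sym.
have J : W u - W v = 1.
  case: sa => _ _ _ _ ->; last exact: cycle_flow_circ.
  have C e : cycle_flow R t e = (e \in darts t)%:R.
    by rewrite /cycle_flow count_uniq_mem // map_inj_in_uniq // => a b _ _ [].
  rewrite !C !mem_darts /= kt eqxx mem_next kt /= -[X in _ == X]/(next t (next t k)).
  by case: eqP => [E|]; rewrite ?subr0 //; move: npk; rewrite {2}E (prev_next ut) eqxx.
have bu : ~ bd u by apply/(@off_cycle_flow R _ p t); exact: sample_off_l sa.
have bv : ~ bd v by apply/(@off_cycle_flow R _ p t); exact: sample_off_r sa.
have T x : ~ bd x -> comp x u \/ comp x v by move=> bx; exact: cycle_two_sides sa.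
have Wuv x : ~ bd x -> W x = W u \/ W x = W v.
  by move=> bx; case: (T x bx) => /(cycle_wind_comp bx) ->; [left|right].
pose far : R * R := (far_bound, far_bound).
have fb0 : 0 < far_bound by have [h _] := far_vertex k; exact: le_lt_trans h.
have bf : ~ bd far by move=> /boundary_bounded[]; rewrite gtr0_norm // ltxx.
have Wf : W far = 0.
  apply/eqP/negPn/negP => h; have [] := wind_far (@cycle_flow_circ R _ _ ut) _ h; first by apply/off_cycle_flow.
  by rewrite gtr0_norm // ltxx.
have same x y : ~ bd x -> ~ bd y -> W x = W y -> comp x y.
  move=> bx byy E; case: (T x bx) => cx; case: (T y byy) => cy;
    try by apply: connected_component_trans cx _; exact: connected_component_sym.
    by have := cycle_wind_comp bx cx; have := cycle_wind_comp byy cy; lra.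
  by have := cycle_wind_comp bx cx; have := cycle_wind_comp byy cy; lra.
case: (Wuv far bf); rewrite Wf => E.
  exists (-1); first by right.
  by split=> // x /Wuv[] ->; [left|right]; lra.
exists 1; first by left.
by split=> // x /Wuv[] ->; [right|left]; lra.
Qed.

Lemma winding_interior x : ~ bd x -> (bounded_plane (comp x) <-> W x != 0).
Proof.
move=> bx; have [eps epsE [Weps same]] := cycle_orientation; split=> [[M HM]|wn].
  apply/eqP => w0; pose N := far_bound + `|M|; pose y : R * R := (N, N).
  have fb : 0 <= far_bound.
    by rewrite addr_ge0 // sumr_ge0 // => i _; rewrite addr_ge0.
  have N0 : 0 <= N by rewrite addr_ge0.
  have far_le : ~ (`|N| < far_bound) by rewrite ger0_norm // /N; have := normr_ge0 M; lra.
  have byy : ~ bd y by move=> /boundary_bounded[].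
  have Wy : W y = 0.
    by apply/eqP/negPn/negP => h; have [] := wind_far (@cycle_flow_circ R _ _ ut) ((off_cycle_flow _ _ _).2 byy) h.
  have [] := HM y (same x y bx byy (etrans w0 (esym Wy))).
  rewrite /= ger0_norm // /N => h _; have := ler_norm M.
  have : 0 < far_bound by rewrite ltr_wpDl // sumr_ge0 // => i _; rewrite addr_ge0.
  lra.
exists far_bound => y xy.
have byy : ~ bd y by exact: (connected_component_sub xy).
have [] := @wind_far _ y (@cycle_flow_circ R _ _ ut) ((off_cycle_flow _ _ _).2 byy) _; last by move=> /ltW h1 /ltW.
by rewrite (cycle_wind_comp bx xy).
Qed.

End Jordan.

(** * From polygons given by points to cycles of indices *)

Section Polygons.
Variables (R : realType) (n : nat) (p : 'I_n -> (R * R)%type).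
Hypotheses (n3 : (3 <= n)%N) (gp : general_position p).
Implicit Types (x y z w c : (R * R)%type) (k l : 'I_n) (e : 'I_n * 'I_n) (t : seq 'I_n).

Definition inside t x : Prop := ~ boundary p t x /\ winding p (cycle_flow R t) x != 0.

Definition convex_at t k : Prop := exists c (eps : R), 0 < eps /\
  forall x, inside t x -> `|x.1 - (p k).1| < eps -> `|x.2 - (p k).2| < eps -> 0 < dot c (vec (p k) x).

Lemma next_nth_mod t k0 i : uniq t -> (i < size t)%N ->
  next t (nth k0 t i) = nth k0 t (i.+1 %% size t).
Proof.
move=> ut it; rewrite next_nth mem_nth //; case: t ut it => // k t ut it.
rewrite index_uniq //; move: it; rewrite /= ltnS leq_eqVlt => /orP[/eqP ->|it].
  by rewrite modnn /= nth_default.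
by rewrite modn_small //=; apply: set_nth_default.
Qed.

Section Dictionary.
Variables (t : seq 'I_n) (k0 : 'I_n).
Hypothesis ut : uniq t.
Local Notation v := (nth k0 t).

Lemma pvtx_map i : (0 < size t)%N -> pvtx (map p t) i = p (v (i %% size t)).
Proof. by move=> t0; rewrite /pvtx size_map (nth_map k0) // ltn_mod. Qed.

Lemma on_side_map i x : (i < size t)%N -> on_side (map p t) i x <-> in_seg (p (v i)) (p (next t (v i))) x.
Proof.
move=> it; have t0 : (0 < size t)%N by exact: leq_ltn_trans it.
by rewrite /on_side !pvtx_map // modn_small // next_nth_mod.
Qed.

Lemma poly_boundary_map x : poly_boundary (map p t) x <-> boundary p t x.
Proof.
split=> [[i []]|[e]].
  rewrite size_map => it /(on_side_map _ it) s; exists (v i, next t (v i)) => //.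
  by rewrite mem_darts /= mem_nth // eqxx.
rewrite mem_darts => /andP[e1 /eqP e2] s; exists (index e.1 t).
rewrite size_map index_mem; split=> //; apply/on_side_map; first by rewrite index_mem.
by rewrite nth_index // -e2.
Qed.

Lemma simple_polygon_map : simple_polygon (map p t) <-> simple_cycle p t.
Proof.
have um : uniq (map p t) by rewrite map_inj_uniq //; exact: gp_inj n3 gp.
have nm i : (i < size t)%N -> next t (v i) = v (i.+1 %% size t) by exact: next_nth_mod.
split=> [[s3 [_ H]]|[_ s3 H]].
  rewrite size_map in s3 H; split=> // e e'; rewrite !mem_darts => /andP[e1 /eqP e2] /andP[e1' /eqP e2'] ne x s s'.
  have i1 : (index e.1 t < size t)%N by rewrite index_mem.
  have i2 : (index e'.1 t < size t)%N by rewrite index_mem.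
  have ij : index e.1 t <> index e'.1 t.
    move=> /(congr1 v); rewrite !nth_index // => E; move/eqP: ne; apply.
    by rewrite [e]surjective_pairing [e']surjective_pairing e2 e2' E.
  have o1 : on_side (map p t) (index e.1 t) x by apply/on_side_map => //; rewrite nth_index // -e2.
  have o2 : on_side (map p t) (index e'.1 t) x by apply/on_side_map => //; rewrite nth_index // -e2'.
  case: (H _ _ i1 i2 ij x o1 o2) => -[E xE].
    exists e'.1; rewrite eqxx /= andbT; split.
      by rewrite e2 -[X in next _ X](nth_index k0 e1) nm // -E nth_index // eqxx orbT.
    by rewrite xE pvtx_map ?modn_small ?nth_index // (leq_ltn_trans _ i1).
  exists e.1; rewrite eqxx /=; split.
    by rewrite e2' -[X in next _ X](nth_index k0 e1') nm // -E nth_index // eqxx orbT.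
  by rewrite xE pvtx_map ?modn_small ?nth_index // (leq_ltn_trans _ i1).
rewrite /simple_polygon size_map; split=> //; split=> // i j it jt ij x.
move=> /(on_side_map _ it) s /(on_side_map _ jt) s'.
have dt a : (a < size t)%N -> (v a, next t (v a)) \in darts t by move=> a_; rewrite mem_darts /= mem_nth // eqxx.
have [|k [kE ->]] := H _ _ (dt i it) (dt j jt) _ x s s'.
  by apply/eqP => -[/eqP]; rewrite nth_uniq // => /eqP.
have m1 : (i.+1 %% size t < size t)%N by rewrite ltn_mod (leq_trans _ s3).
have m2 : (j.+1 %% size t < size t)%N by rewrite ltn_mod (leq_trans _ s3).
have t0 : (0 < size t)%N by exact: leq_trans s3.
rewrite !pvtx_map // (modn_small it) (modn_small jt).
move: kE => /=; case/andP => /orP[]/eqP-> /orP[].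
- by rewrite nth_uniq // => /eqP.
- by rewrite nm // nth_uniq // => /eqP E; right; rewrite E.
- by rewrite eq_sym nm // nth_uniq // => /eqP E; left; rewrite E.
move=> /eqP /(congr1 (prev t)); rewrite !prev_next // => /eqP.
by rewrite nth_uniq // => /eqP.
Qed.

Lemma poly_interior_map x : simple_cycle p t -> poly_interior (map p t) x <-> inside t x.
Proof.
move=> st; have E : (fun y => ~ poly_boundary (map p t) y) = (fun y => ~ boundary p t y).
  by apply/funext => y; apply/propext; split=> h /poly_boundary_map.
rewrite /poly_interior /inside E; split=> -[h1 h2].
  have b : ~ boundary p t x by move/poly_boundary_map.
  by split=> //; apply/(winding_interior n3 gp st b).
by split; [move/poly_boundary_map|apply/(winding_interior n3 gp st h1)].
Qed.

End Dictionary.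

Lemma pseudo_triangle_map t : uniq t -> pseudo_triangle (map p t) <->
  simple_cycle p t /\ count (fun k => `[< convex_at t k >]) t = 3%N.
Proof.
move=> ut; case: (t) ut => [|k0 t'] ut.
  by split; [case=> -[]|case=> -[]].
set s := k0 :: t' in ut *.
rewrite /pseudo_triangle (simple_polygon_map k0 ut) size_map.
suff E : simple_cycle p s -> count (fun i => `[< convex_vertex (map p s) i >]) (iota 0 (size s)) =
    count (fun k => `[< convex_at s k >]) s.
  by split=> -[h1 h2]; split=> //; rewrite ?E // -?E.
move=> st; rewrite -{4}[s](mkseq_nth k0) /mkseq count_map; apply: eq_in_count => i.
rewrite mem_iota add0n /= => it; apply: asbool_equiv_eq.
rewrite -[p k0 :: _]/(map p s) /convex_vertex (pvtx_map k0) // modn_small //.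
by split=> -[c [eps [e0 H]]]; exists c, eps; split=> // x /(poly_interior_map k0 ut x st) h; exact: H.
Qed.

(** An interior point on the wrong side of the line through an extreme vertex would have the whole
    cycle in a half-plane, hence winding number 0. *)
Lemma extreme_convex t k : simple_cycle p t -> extreme p [set l in t] k -> convex_at t k.
Proof.
move=> st [kt [u un H]]; have [ut _ _] := st.
exists u, 1; split=> // x [bx wx] _ _; rewrite ltNge; apply/negP => ux.
move/eqP: wx; apply.
have ofx : off p (cycle_flow R t) x by apply/off_cycle_flow.
have Hd l : l \in t -> 0 <= dot u (vec x (p l)).
  move=> lt; have -> : dot u (vec x (p l)) = dot u (vec (p k) (p l)) - dot u (vec (p k) x).
    by rewrite /dot /vec /=; ring.
  rewrite subr_ge0; apply: le_trans ux _; have [->|lk] := eqVneq l k.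
    by rewrite /dot /vec !subrr !mulr0 addr0.
  by apply/ltW/H; rewrite !inE lk.
apply: (wind_halfplane (cycle_flow_circ ut) ofx (dir10 R) un) => e en.
have et : e \in darts t.
  by apply: contraTT isT => /count_memPn h; move: en; rewrite /cycle_flow h eqxx.
by move: et; rewrite mem_darts => /andP[e1 /eqP e2]; split; apply: Hd; rewrite // e2 mem_next.
Qed.

End Polygons.

(** * Interiors near sides and at convex vertices *)

Section Cones.
Variables (R : realType) (n : nat) (p : 'I_n -> (R * R)%type).
Hypotheses (n3 : (3 <= n)%N) (gp : general_position p).
Implicit Types (x y z w : (R * R)%type) (k l : 'I_n) (e : 'I_n * 'I_n).
Variable t : seq 'I_n.
Hypothesis st : simple_cycle p t.
Let ut : uniq t. Proof. by case: st. Qed.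
Let s3 : (3 <= size t)%N. Proof. by case: st. Qed.
Local Notation bd := (boundary p t).
Local Notation comp := (connected_component (fun y => ~ bd y)).
Local Notation W := (winding p (cycle_flow R t)).

Lemma inside_comp x y : inside p t x -> comp x y -> inside p t y.
Proof.
move=> [bx wx] xy; split; first exact: (connected_component_sub xy).
by rewrite (cycle_wind_comp st bx xy).
Qed.

Lemma inside_same x y : inside p t x -> inside p t y -> comp x y.
Proof.
have [eps epsE [We same]] := cycle_orientation n3 gp st.
move=> [bx wx] [byy wy]; apply: same => //.
by case: (We x bx) wx => ->; rewrite ?eqxx // => _; case: (We y byy) wy => ->; rewrite ?eqxx.
Qed.

Lemma inside_seg x y : inside p t x -> (forall z, in_seg x y z -> ~ bd z) -> inside p t y.
Proof. by move=> ix H; apply: (inside_comp ix); exact: seg_component. Qed.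

Lemma cycle_flowE e : cycle_flow R t e = (e \in darts t)%:R.
Proof. by rewrite /cycle_flow count_uniq_mem // map_inj_in_uniq // => a b _ _ []. Qed.

Lemma dart_rev a b : (a, b) \in darts t -> (b, a) \notin darts t.
Proof.
rewrite !mem_darts /= => /andP[at_ /eqP->]; rewrite mem_next at_ /=; apply/eqP => E.
by have [_ _] := next_neighbours ut s3 at_; rewrite {2}E (prev_next ut) eqxx.
Qed.

Lemma sample_jump a b m u v : sample p a b m u v ->
  W u - W v = ((a, b) \in darts t)%:R - ((b, a) \in darts t)%:R.
Proof. by case=> _ _ _ _ ->; rewrite ?cycle_flowE //; exact: cycle_flow_circ. Qed.

Lemma sample_off_boundary a b m u v : sample p a b m u v -> ~ bd u /\ ~ bd v.
Proof.
by move=> s; split; apply/(@off_cycle_flow R _ p t); [exact: sample_off_l s|exact: sample_off_r s].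
Qed.

Lemma dart_sample_inside a b m u v : sample p a b m u v -> (a, b) \in darts t ->
  (inside p t u /\ ~ inside p t v) \/ (inside p t v /\ ~ inside p t u).
Proof.
move=> sa abt; have J := sample_jump sa; rewrite abt (negbTE (dart_rev abt)) subr0 /= in J.
have [bu bv] := sample_off_boundary sa.
have [eps epsE [We same]] := cycle_orientation n3 gp st.
case: (We u bu) => wu; case: (We v bv) => wv.
- by move: J; rewrite wu wv; lra.
- right; split; last by case=> _; rewrite wu eqxx.
  by split=> //; rewrite wv; apply/eqP => e0; move: J; rewrite wu wv; lra.
- left; split; last by case=> _; rewrite wv eqxx.
  by split=> //; rewrite wu; apply/eqP => e0; move: J; rewrite wu wv; lra.
by move: J; rewrite wu wv; lra.
Qed.

Lemma first_dart : exists2 k, k \in t & (k, next t k) \in darts t.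
Proof.
have [k kt] : exists k, k \in t by case: (t) s3 => // k s _; exists k; rewrite inE eqxx.
by exists k => //; rewrite mem_darts kt eqxx.
Qed.

Lemma exists_in_out : exists x y, [/\ inside p t x, ~ bd y & ~ inside p t y].
Proof.
have [k kt kd] := first_dart; have [nk _ _] := next_neighbours ut s3 kt.
have [m [u [v sa]]] : exists m u v, sample p k (next t k) m u v by apply: (sample_exists n3 gp); rewrite eq_sym.
have [bu bv] := sample_off_boundary sa.
by case: (dart_sample_inside sa kd) => -[h1 h2]; [exists u, v|exists v, u].
Qed.

Lemma near_box z (eps : R) : 0 < eps -> \forall w \near z, `|w.1 - z.1| < eps /\ `|w.2 - z.2| < eps.
Proof. by move=> e0; apply/near_planeP; exists eps. Qed.

(* The complementary sector contains opposite directions, so it cannot be the interior of t at a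
   convex vertex. *)
Lemma convex_cone k : k \in t -> convex_at p t k -> let z := p k in
  let a := vec z (p (next t k)) in let b := vec z (p (prev t k)) in let D := cross a b in
  \forall w \near z, inside p t w <-> 0 < cross (vec z w) b * D /\ 0 < cross a (vec z w) * D.
Proof.
move=> kt [c [eps' [e0' Hc]]] z a b D.
have [Dn [eps e0]] := vertex_local gp st kt; rewrite -/z in Hc Dn *; rewrite -/a -/b -/D in Dn * => H.
have D2 : 0 < D * D by rewrite -expr2 lt_neqAle sqr_ge0 eq_sym expf_neq0.
pose P w := cross (vec z w) b * D; pose Q w := cross a (vec z w) * D.
have {}H w : `|w.1 - z.1| < eps -> `|w.2 - z.2| < eps ->
    (bd w <-> (Q w = 0 /\ 0 <= P w) \/ (P w = 0 /\ 0 <= Q w)) by exact: H.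
have PE s w w' : P (step w s (vec w w')) = (1 - s) * P w + s * P w' by rewrite /P /cross /vec /step /=; ring.
have QE s w w' : Q (step w s (vec w w')) = (1 - s) * Q w + s * Q w' by rewrite /Q /cross /vec /step /=; ring.
have PS (r s s' : R) : P (step z r (s * a.1 + s' * b.1, s * a.2 + s' * b.2)) = r * s * (D * D).
  by rewrite /P /D /cross /vec /step /=; ring.
have QS (r s s' : R) : Q (step z r (s * a.1 + s' * b.1, s * a.2 + s' * b.2)) = r * s' * (D * D).
  by rewrite /Q /D /cross /vec /step /=; ring.
pose B w := (`|w.1 - z.1| < eps /\ `|w.2 - z.2| < eps) /\ (`|w.1 - z.1| < eps' /\ `|w.2 - z.2| < eps').
have small d : exists r, [/\ 0 < r, B (step z r d) & B (step z (- r) d)].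
  have [r [r0 [h1 h2]]] := @filter_ex _ _ (at_right_proper_filter (0 : R)) _ (filterI (nbhs_right_gt (0 : R))
    (near_step d (filterI (near_box z e0) (near_box z e0')))).
  by exists r.
have mix (s f g : R) : 0 <= s <= 1 -> f < 0 -> g < 0 -> (1 - s) * f + s * g < 0.
  by case/andP=> *; nra.
have mixp (s f g : R) : 0 <= s <= 1 -> 0 < f -> 0 < g -> 0 < (1 - s) * f + s * g.
  by case/andP=> *; nra.
have far w : `|w.1 - z.1| < eps -> `|w.2 - z.2| < eps -> P w < 0 \/ Q w < 0 -> ~ inside p t w.
  move=> w1 w2 PQ iw.
  have [r [r0 _ [[q1 q2] _]]] := small (1 * a.1 + 1 * b.1, 1 * a.2 + 1 * b.2).
  (* The points z + r'(a - b) and z - r'(a - b) both lie in the complementary sector, so [c] would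
     be positive on two opposite vectors. *)
  have [r' [r0' [[z1 z2] [z1' z2']] [[u1 u2] [u1' u2']]]] := small (1 * a.1 + (-1) * b.1, 1 * a.2 + (-1) * b.2).
  set q := step z (- r) _ in q1 q2; set y := step z r' _ in z1 z2 z1' z2'; set y' := step z (- r') _ in u1 u2 u1' u2'.
  have Pq : P q < 0 by rewrite /q PS mulr1 mulNr oppr_lt0 mulr_gt0.
  have Qq : Q q < 0 by rewrite /q QS mulr1 mulNr oppr_lt0 mulr_gt0.
  have toq g : `|g.1 - z.1| < eps -> `|g.2 - z.2| < eps -> P g < 0 \/ Q g < 0 -> comp g q.
    move=> g1 g2 h; apply: seg_comp => s s01; have [h1 h2] := step_box s01 g1 g2 q1 q2.
    case/(H _ h1 h2); rewrite PE QE => -[E F]; case: h => h.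
    - by have := mix _ _ _ s01 h Pq; rewrite ltNge F.
    - by have := mix _ _ _ s01 h Qq; rewrite E ltxx.
    - by have := mix _ _ _ s01 h Pq; rewrite E ltxx.
    by have := mix _ _ _ s01 h Qq; rewrite ltNge F.
  have iq : inside p t q by apply: (inside_comp iw); exact: toq.
  have iy : inside p t y.
    apply: (inside_comp iq); apply: connected_component_sym; apply: toq => //; right.
    by rewrite /y QS mulrN1 mulNr oppr_lt0 mulr_gt0.
  have iy' : inside p t y'.
    apply: (inside_comp iq); apply: connected_component_sym; apply: toq => //; left.
    by rewrite /y' PS mulr1 mulNr oppr_lt0 mulr_gt0.
  have := Hc y iy z1' z2'; have := Hc y' iy' u1' u2'.
  by rewrite /y /y' /dot /vec /step /=; lra.
have zbd : bd z by exists (k, next t k); rewrite ?mem_darts ?kt ?eqxx //; exact: in_seg_l.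
have [x0 [_ [ix0 _ _]]] := exists_in_out.
have [y [xy [y1 y2]]] : comp x0 `&` [set w | `|w.1 - z.1| < eps /\ `|w.2 - z.2| < eps] !=set0.
  by apply: (closure_component_boundary n3 gp st _ zbd); [case: ix0|exact: near_box].
have iy := inside_comp ix0 xy.
have cone w : `|w.1 - z.1| < eps -> `|w.2 - z.2| < eps -> inside p t w -> 0 < P w /\ 0 < Q w.
  move=> w1 w2 iw; have nb : ~ bd w by case: iw.
  have Pw : 0 <= P w by rewrite leNgt; apply/negP => h; apply: (far w) => //; left.
  have Qw : 0 <= Q w by rewrite leNgt; apply/negP => h; apply: (far w) => //; right.
  split; rewrite lt_neqAle ?Pw ?Qw andbT; apply/eqP => E; apply: nb; apply/(H w w1 w2); [right|left]; split=> //.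
have [Py Qy] := cone y y1 y2 iy.
apply: filterS (near_box z e0) => w [w1 w2]; split; first exact: cone.
case=> Pw Qw; apply: (inside_comp iy); apply: seg_comp => s s01.
have [h1 h2] := step_box s01 y1 y2 w1 w2.
case/(H _ h1 h2); rewrite PE QE => -[E _].
  by have := mixp _ _ _ s01 Qy Qw; rewrite E ltxx.
by have := mixp _ _ _ s01 Py Pw; rewrite E ltxx.
Qed.

End Cones.

(** * Walks, ears and the splitting of a cycle by an ear *)

Section Walks.
Variable n : nat.
Implicit Types (k a b : 'I_n) (s A B g : seq 'I_n).

Definition walk k s : seq ('I_n * 'I_n) := pairmap pair k s.

Definition swap (e : 'I_n * 'I_n) := (e.2, e.1).

Lemma darts_walk k s : uniq (k :: s) -> darts (k :: s) = walk k (rcons s k).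
Proof.
move=> us; apply: (@eq_from_nth _ (k, k)) => [|i]; first by rewrite size_map size_pairmap size_rcons.
rewrite size_map => it; rewrite (nth_map k) // (next_nth_mod k us it) (nth_pairmap k) ?size_rcons //.
rewrite -rcons_cons nth_rcons it; congr pair.
move: it; rewrite nth_rcons /= ltnS leq_eqVlt => /orP[/eqP ->|it].
  by rewrite modnn ltnn eqxx.
by rewrite it modn_small.
Qed.

Lemma walk_rev k s : walk (last k s) (rev (belast k s)) = rev (map swap (walk k s)).
Proof.
elim: s k => //= x s IH k.
rewrite !rev_cons -IH -!cats1 /walk pairmap_cat; congr (_ ++ _) => /=.
by rewrite -[last _ (rev _)]/(last (last x s) (rev (belast x s))); case: s {IH} => //= y s; rewrite rev_cons last_rcons.
Qed.

Lemma walk_ear a b g : walk b (rcons (rev g) a) = rev (map swap (walk a (rcons g b))).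
Proof. by rewrite -walk_rev last_rcons belast_rcons rev_cons. Qed.

Lemma darts_theta a b A B : uniq (a :: A ++ b :: B) ->
  darts (a :: A ++ b :: B) = walk a (rcons A b) ++ walk b (rcons B a).
Proof. by move/darts_walk ->; rewrite rcons_cat rcons_cons -cat_rcons /walk pairmap_cat last_rcons. Qed.

End Walks.

Section Theta.
Variables (R : realType) (n : nat) (p : 'I_n -> (R * R)%type).
Hypotheses (n3 : (3 <= n)%N) (gp : general_position p).
Variables (a b : 'I_n) (A B g : seq 'I_n).
Local Notation segm e := (in_seg (p e.1) (p e.2)).
Local Notation t := (a :: A ++ b :: B).
Local Notation t1 := (a :: A ++ b :: rev g).
Local Notation t2 := (a :: g ++ b :: B).
Hypotheses (ut : uniq t) (ut1 : uniq t1) (ut2 : uniq t2).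

Definition on_ear x : Prop := exists2 e, e \in walk a (rcons g b) & segm e x.

Lemma ear_rev e : (swap e \in walk b (rcons (rev g) a)) = (e \in walk a (rcons g b)).
Proof.
rewrite walk_ear mem_rev; apply/mapP/idP => [[[f1 f2] h [E2 E1]]|h]; last by exists e.
by rewrite [e]surjective_pairing E1 E2.
Qed.

Lemma theta_boundary x : boundary p t1 x -> boundary p t x \/ on_ear x.
Proof.
case=> e; rewrite darts_theta // mem_cat => /orP[h|h] s.
  by left; exists e => //; rewrite darts_theta // mem_cat h.
right; exists (swap e); last exact: in_segC.
by rewrite -ear_rev /swap -surjective_pairing.
Qed.

Lemma theta_boundary' x : boundary p t2 x -> boundary p t x \/ on_ear x.
Proof.
case=> e; rewrite darts_theta // mem_cat => /orP[h|h] s; first by right; exists e.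
by left; exists e => //; rewrite darts_theta // mem_cat h orbT.
Qed.

(** The two smaller cycles run along the ear in opposite directions, and these crossings cancel. *)
Lemma theta_wind x : winding p (cycle_flow R t) x =
  winding p (cycle_flow R t1) x + winding p (cycle_flow R t2) x.
Proof.
have WE s : winding p (cycle_flow R s) x = \sum_(e <- darts s) cr (1, 0) x (p e.1) (p e.2).
  by rewrite /winding /wind (sum_cycle_flow s (fun e => cr (1, 0) x (p e.1) (p e.2))) big_map.
rewrite !WE !darts_theta // !big_cat /= walk_ear.
suff -> (s : seq ('I_n * 'I_n)) : \sum_(e <- rev (map (@swap n) s)) cr (1, 0) x (p e.1) (p e.2) =
    - \sum_(e <- s) cr (1, 0) x (p e.1) (p e.2) by rewrite addrA addrNK.
rewrite (perm_big (map (@swap n) s)); last by rewrite perm_rev.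
by rewrite big_map -sumrN; apply: eq_bigr => e _; rewrite /= crN.
Qed.

Hypotheses (st : simple_cycle p t) (st1 : simple_cycle p t1) (st2 : simple_cycle p t2).
Variables (c d : 'I_n) (m u v : R * R).
Hypotheses (cd : (c, d) \in walk a (rcons g b)) (sa : sample p c d m u v).
Hypotheses (iu : inside p t u) (iv : inside p t v).

Let d2 : (c, d) \in darts t2.
Proof. by rewrite darts_theta // mem_cat cd. Qed.

Let d1 : (d, c) \in darts t1.
Proof. by rewrite darts_theta // mem_cat -[(d, c)]/(swap (c, d)) ear_rev cd orbT. Qed.

Let jump1 : winding p (cycle_flow R t1) v - winding p (cycle_flow R t1) u = 1.
Proof. by have := sample_jump st1 sa; rewrite d1 (negbTE (dart_rev st1 d1)) /=; lra. Qed.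

Let jump2 : winding p (cycle_flow R t2) u - winding p (cycle_flow R t2) v = 1.
Proof. by have := sample_jump st2 sa; rewrite d2 (negbTE (dart_rev st2 d2)) /=; lra. Qed.

(** The winding number changes by one across the ear but is the same at all interior points of the
    cycle. This makes the descent in [shrink_cycle] strict. *)
Lemma theta_loses_sample : ~ (inside p t1 u /\ inside p t1 v).
Proof.
have [e1 _ [W1 _]] := cycle_orientation n3 gp st1; move=> [[bu wu] [bv wv]].
case: (W1 u bu) wu (W1 v bv) wv jump1 => ->; rewrite ?eqxx // => _ [] ->; rewrite ?eqxx // => _.
by rewrite subrr => /eqP; rewrite eq_sym oner_eq0.
Qed.

Lemma theta_loses_sample' : ~ (inside p t2 u /\ inside p t2 v).
Proof.
have [e1 _ [W1 _]] := cycle_orientation n3 gp st2; move=> [[bu wu] [bv wv]].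
case: (W1 u bu) wu (W1 v bv) wv jump2 => ->; rewrite ?eqxx // => _ [] ->; rewrite ?eqxx // => _.
by rewrite subrr => /eqP; rewrite eq_sym oner_eq0.
Qed.

(** Evaluating the additivity of winding numbers at the two flanks of an ear edge inside [t] shows
    that the three cycles have the same orientation. Hence nothing cancels, and a common interior
    point of both parts would have winding number 2 or -2. *)
Lemma theta_inside x : ~ boundary p t x -> ~ on_ear x ->
  (inside p t x <-> inside p t1 x \/ inside p t2 x) /\ ~ (inside p t1 x /\ inside p t2 x).
Proof.
move=> bx ex; have b1 : ~ boundary p t1 x by move/theta_boundary => -[].
have b2 : ~ boundary p t2 x by move/theta_boundary' => -[].
have [e eE [W0 _]] := cycle_orientation n3 gp st.
have [e1 eE1 [W1 _]] := cycle_orientation n3 gp st1.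
have [e2 eE2 [W2 _]] := cycle_orientation n3 gp st2.
have [bu1 bv1] := sample_off_boundary t1 sa.
have [bu2 bv2] := sample_off_boundary t2 sa.
have Wu : winding p (cycle_flow R t) u = e by case: iu => bu; case: (W0 u bu) => ->; rewrite ?eqxx.
have Wv : winding p (cycle_flow R t) v = e by case: iv => bv; case: (W0 v bv) => ->; rewrite ?eqxx.
have [E1 E2] : e1 = e /\ e2 = e.
  have := theta_wind u; have := theta_wind v; rewrite Wu Wv; move: jump1 jump2.
  case: (W1 u bu1) => ->; case: (W1 v bv1) => ->; case: (W2 u bu2) => ->; case: (W2 v bv2) => ->;
  by case: eE => ->; case: eE1 => ->; case: eE2 => ->; lra.
rewrite E1 in W1; rewrite E2 in W2; rewrite /inside (theta_wind x).
have en : e != 0 by case: eE => ->; rewrite ?oppr_eq0 oner_eq0.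
have e2n : e + e != 0 by rewrite -mulr2n mulrn_eq0.
have := W0 x bx; rewrite (theta_wind x).
case: (W1 x b1) => ->; case: (W2 x b2) => ->; rewrite ?addr0 ?add0r ?eqxx => h; split.
- by split=> [[] //|[[]|[]]] //.
- by move=> [[]].
- by split=> [[]|_]; [right|].
- by move=> [[]].
- by split=> [[]|_]; [left|].
- by move=> [_ []].
- by case: h => /eqP; rewrite ?(negbTE e2n) // -subr_eq0 addrK (negbTE en).
by case: h => /eqP; rewrite ?(negbTE e2n) // -subr_eq0 addrK (negbTE en).
Qed.

End Theta.

Section GraphCycles.
Variables (R : realType) (n : nat) (p : 'I_n -> (R * R)%type).
Hypotheses (n3 : (3 <= n)%N) (gp : general_position p).
Variable G : {set 'I_n * 'I_n}.
Hypotheses (gG : graph_on G) (nG : non_crossing p G).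
Implicit Types (t : seq 'I_n) (a b c d k : 'I_n).

Lemma adj_neq a b : adj G a b -> a != b.
Proof.
move=> h; apply/eqP => E; move: h; rewrite E /adj orbb => /gG /=.
by rewrite ltnn.
Qed.

Lemma adj_cross a b c d x : adj G a b -> adj G c d -> in_seg (p a) (p b) x -> in_seg (p c) (p d) x ->
  (a, b) = (c, d) \/ (a, b) = (d, c) \/
  exists k, [/\ (k == a) || (k == b), (k == c) || (k == d) & x = p k].
Proof.
have H (e e' : 'I_n * 'I_n) : e \in G -> e' \in G -> in_seg (p e.1) (p e.2) x -> in_seg (p e'.1) (p e'.2) x ->
    e = e' \/ exists k, [/\ (k == e.1) || (k == e.2), (k == e'.1) || (k == e'.2) & x = p k].
  move=> eG eG' s s'; have [->|ne] := eqVneq e e'; first by left.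
  by right; have [k [/andP[h1 h2] h3]] := nG eG eG' ne s s'; exists k.
case/orP=> h1 /orP[] h2 s s'.
- by case: (H _ _ h1 h2 s s') => [|]; [left|right; right].
- case: (H _ _ h1 h2 s (in_segC s')) => [[-> ->]|[k [k1 k2 k3]]]; first by right; left.
  by right; right; exists k; rewrite orbC in k2.
- case: (H _ _ h1 h2 (in_segC s) s') => [[-> ->]|[k [k1 k2 k3]]]; first by right; left.
  by right; right; exists k; split=> //; rewrite orbC.
case: (H _ _ h1 h2 (in_segC s) (in_segC s')) => [[-> ->]|[k [k1 k2 k3]]]; first by left.
by right; right; exists k; split=> //; rewrite orbC.
Qed.

Definition graph_cycle t : Prop := [/\ uniq t, (3 <= size t)%N & cycle (adj G) t].

Lemma dart_adj t e : graph_cycle t -> e \in darts t -> adj G e.1 e.2.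
Proof. by case=> _ _ ct; rewrite mem_darts => /andP[h /eqP->]; exact: next_cycle. Qed.

Lemma graph_cycle_simple t : graph_cycle t -> simple_cycle p t.
Proof.
move=> gt; have [ut s3 ct] := gt; split=> // e e' et et' ne x s s'.
case: (adj_cross (dart_adj gt et) (dart_adj gt et') s s') => [E|[E|[k [h1 h2 h3]]]].
- by case/eqP: ne; rewrite [e]surjective_pairing [e']surjective_pairing.
- move: et et' E; rewrite !mem_darts => /andP[h1 /eqP h2] /andP[h3 /eqP h4] [E1 E2].
  have [_ _] := next_neighbours ut s3 h3.
  have -> : prev t e'.1 = e.1 by rewrite -E2 h2 prev_next.
  by rewrite E1 h4 eqxx.
by exists k; rewrite h1 h2.
Qed.

Lemma boundary_edge t x : graph_cycle t -> boundary p t x -> exists2 e, e \in G & in_seg (p e.1) (p e.2) x.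
Proof.
move=> gt [e /(dart_adj gt) /orP[] h s]; [exists (e.1, e.2)|exists (e.2, e.1)] => //.
exact: in_segC.
Qed.

Lemma edge_meets_boundary t a b x : graph_cycle t -> adj G a b ->
  (a, b) \notin darts t -> (b, a) \notin darts t -> in_seg (p a) (p b) x -> boundary p t x ->
  exists k, [/\ (k == a) || (k == b), k \in t & x = p k].
Proof.
move=> gt ab n1 n2 s [e et se]; have [ut _ _] := gt.
case: (adj_cross ab (dart_adj gt et) s se) => [E|[[E1 E2]|[k [h1 h2 h3]]]].
- by case/negP: n1; rewrite E -surjective_pairing.
- by case/negP: n2; rewrite E1 E2 -surjective_pairing.
exists k; split=> //; move: et; rewrite mem_darts => /andP[e1 /eqP e2].
by case/orP: h2 => /eqP->; rewrite // e2 mem_next.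
Qed.

End GraphCycles.

(** * Pseudo-triangulations are maximal *)

Section Chord.
Variables (R : realType) (n : nat) (p : 'I_n -> (R * R)%type).
Hypotheses (n3 : (3 <= n)%N) (gp : general_position p).
Implicit Types (t : seq 'I_n) (x y u v m : (R * R)%type).

Lemma convex_at_near t k c : (\forall x \near p k, inside p t x -> 0 < dot c (vec (p k) x)) -> convex_at p t k.
Proof. by case/near_planeP => eps e0 H; exists c, eps; split=> // x ix h1 h2; exact: H. Qed.

Lemma near_convex_at t k : convex_at p t k -> exists c,
  \forall x \near p k, inside p t x -> 0 < dot c (vec (p k) x).
Proof.
by case=> c [eps [e0 H]]; exists c; apply: filterS (near_box (p k) e0) => x [h1 h2] ix; exact: H.
Qed.

(** The vertex is off [t'']. It cannot be inside it, since then all points near the vertex and off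
    [t] and [E] would be inside [t], while the exterior of [t] also reaches the vertex. So near it
    the interiors of [t] and [t'] agree off [E]. *)
Lemma convex_transfer t t' t'' (E : set (R * R)) i : simple_cycle p t -> i \in t ->
  (\forall x \near p i, ~ E x) -> ~ boundary p t'' (p i) -> simple_cycle p t'' ->
  (forall x, ~ boundary p t x -> ~ E x -> (inside p t x <-> inside p t' x \/ inside p t'' x)) ->
  convex_at p t' i -> convex_at p t i.
Proof.
move=> st it nE bi st'' H /near_convex_at[c Hc]; apply: (convex_at_near (c := c)).
have nI : \forall y \near p i, inside p t'' y <-> inside p t'' (p i).
  have := component_near (complement_near bi) (connected_component_refl bi).
  apply: filterS => y cy; split=> h; last exact: (inside_comp st'' h cy).
  by apply: (inside_comp st'' h); exact: connected_component_sym.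
have no : ~ inside p t'' (p i).
  move=> h; have [_ [y0 [_ by0 ny0]]] := exists_in_out n3 gp st.
  have bdi : boundary p t (p i).
    by exists (i, next t i); [rewrite mem_darts it eqxx|exact: in_seg_l].
  have [y [cy [Ey Iy]]] := closure_component_boundary n3 gp st by0 bdi (filterI nE nI).
  apply: ny0; apply: (inside_comp st _ (connected_component_sym cy)).
  by apply/H => //; [exact: (connected_component_sub cy)|right; apply/Iy].
apply: filterS3 nE nI Hc => x Ex Ix cx ix.
by case: ((H x ix.1 Ex).1 ix) => [/cx|/Ix] //.
Qed.

Lemma cone_dot t u k : simple_cycle p t -> k \in t -> convex_at p t k ->
  0 < dot u (vec (p k) (p (next t k))) -> 0 < dot u (vec (p k) (p (prev t k))) ->
  \forall w \near p k, inside p t w -> 0 < dot u (vec (p k) w).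
Proof.
move=> st kt ck; set a := vec _ (p (next _ _)); set b := vec _ _ => ua ub.
apply: filterS (convex_cone n3 gp st kt ck) => w /= Hw /Hw; rewrite -/a -/b; set D := cross a b => -[h1 h2].
have : (D * D) * dot u (vec (p k) w) = cross (vec (p k) w) b * D * dot u a + cross a (vec (p k) w) * D * dot u b.
  by rewrite /D /dot /cross /vec /=; ring.
have h3 := mulr_gt0 h1 ua; have h4 := mulr_gt0 h2 ub => E.
have D2 : 0 <= D * D by rewrite -expr2 sqr_ge0.
have : 0 < D * D * dot u (vec (p k) w) by rewrite E addr_gt0.
by rewrite ltNge => /negP h; rewrite ltNge; apply/negP => h'; apply: h; rewrite mulr_ge0_le0.
Qed.

Lemma count_card t (P : pred 'I_n) : uniq t -> count P t = #|[pred i | (i \in t) && P i]|.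
Proof.
move=> ut; rewrite -size_filter -(card_uniqP (filter_uniq P ut)).
by apply: eq_card => i; rewrite !inE mem_filter andbC.
Qed.

Variables (G : {set 'I_n * 'I_n}) (k l : 'I_n) (A B : seq 'I_n) (m u v : R * R).
Local Notation t := (k :: A ++ l :: B).
Local Notation t1 := (k :: A ++ l :: rev [::]).
Local Notation t2 := (k :: [::] ++ l :: B).
Hypotheses (pG : pointed_noncrossing p G) (kl : adj G k l) (ut : uniq t) (ct : cycle (adj G) t).
Hypotheses (A0 : A != [::]) (B0 : B != [::]).
Hypotheses (sa : sample p k l m u v) (iu : inside p t u) (iv : inside p t v).

Let gG : graph_on G. Proof. by case: pG. Qed.
Let nG : non_crossing p G. Proof. by case: pG => _ []. Qed.

Let uA : uniq A /\ uniq B /\ k \notin A /\ k \notin B /\ l \notin A /\ l \notin B /\ k != l.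
Proof.
move: ut; rewrite /= mem_cat inE !negb_or cat_uniq /= negb_or => /andP[/and3P[-> -> ->]] /and3P[-> /andP[-> _]].
by case/andP=> -> ->.
Qed.

Let disj i : i \in A -> i \notin B.
Proof.
move: ut; rewrite /= cat_uniq /= negb_or => /andP[_] /and3P[_ /andP[_ /hasPn h] _] iA.
by apply/negP => /h; rewrite /= iA.
Qed.

Let gt : graph_cycle G t.
Proof. by split=> //=; rewrite size_cat /= addnS !ltnS; case: (A) A0. Qed.

Let cA : path (adj G) k (rcons A l) /\ path (adj G) l (rcons B k).
Proof. by move: ct; rewrite /= rcons_cat rcons_cons -cat_rcons cat_path last_rcons => /andP[]. Qed.

Let gt1 : graph_cycle G t1.
Proof.
have [h1 [_ [h2 [_ [h3 [_ h4]]]]]] := uA; split.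
- by rewrite /= cats1 mem_rcons inE negb_or rcons_uniq h1 h2 h3 h4.
- by rewrite /= size_cat addn1 !ltnS; case: (A) A0.
by rewrite /= rcons_cat /= -cat_rcons cat_path last_rcons cA.1 /= adjC kl.
Qed.

Let gt2 : graph_cycle G t2.
Proof.
have [_ [h1 [_ [h2 [_ [h3 h4]]]]]] := uA; split.
- by rewrite /= inE negb_or h1 h2 h3 h4.
- by rewrite /= !ltnS; case: (B) B0.
by rewrite /= kl cA.2.
Qed.

Let st := graph_cycle_simple nG gt.
Let st1 := graph_cycle_simple nG gt1.
Let st2 := graph_cycle_simple nG gt2.
Let ut1 : uniq t1. Proof. by case: st1. Qed.
Let ut2 : uniq t2. Proof. by case: st2. Qed.

Let ear x : on_ear p k l [::] x <-> in_seg (p k) (p l) x.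
Proof.
split=> [[e]|s]; first by rewrite inE => /eqP ->.
by exists (k, l) => //; rewrite inE.
Qed.

Let th x : ~ boundary p t x -> ~ in_seg (p k) (p l) x ->
  (inside p t x <-> inside p t1 x \/ inside p t2 x).
Proof.
move=> bx ex; have cd : (k, l) \in walk k (rcons [::] l) by rewrite inE.
have nx : ~ on_ear p k l [::] x by move/ear.
by case: (theta_inside n3 gp ut ut1 ut2 st st1 st2 cd sa iu iv bx nx).
Qed.

Let near_ear i : i != k -> i != l -> \forall x \near p i, ~ in_seg (p k) (p l) x.
Proof.
move=> ik il; apply: near_not_in_seg => s; have [_ [_ [_ [_ [_ [_ h]]]]]] := uA.
by case: (gp_in_seg gp h s) => E; [rewrite E eqxx in ik|rewrite E eqxx in il].
Qed.

Let off_bd s i : graph_cycle G s -> i \notin s -> ~ boundary p s (p i).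
Proof.
move=> [us ss cs] ins [e et s']; have se := graph_cycle_simple nG (And3 us ss cs).
move: et (et); rewrite {1}mem_darts => /andP[e1 /eqP e2] et.
by case: (gp_in_seg gp (dart_neq se et) s') => E; move: ins; rewrite E ?e1 // e2 mem_next e1.
Qed.

Lemma convex_chord1 i : i \in t1 -> i != k -> i != l -> convex_at p t1 i -> convex_at p t i.
Proof.
move=> i1 ik il; apply: (@convex_transfer _ _ t2 (in_seg (p k) (p l))) => //.
- by move: i1; rewrite /= !inE !mem_cat !inE (negbTE ik) (negbTE il) /= orbF => ->.
- exact: near_ear.
- apply: off_bd => //; move: i1; rewrite /= !inE !mem_cat !inE (negbTE ik) (negbTE il) /= orbF; exact: disj.
Qed.

Lemma convex_chord2 i : i \in t2 -> i != k -> i != l -> convex_at p t2 i -> convex_at p t i.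
Proof.
move=> i1 ik il; apply: (@convex_transfer _ _ t1 (in_seg (p k) (p l))) => //.
- by move: i1; rewrite /= !inE !mem_cat !inE (negbTE ik) (negbTE il) /= => ->; rewrite orbT.
- exact: near_ear.
- apply: off_bd => //; move: i1; rewrite /= !inE !mem_cat !inE (negbTE ik) (negbTE il) /= orbF => iB.
  by apply/negP => /disj; rewrite iB.
by move=> x bx ex; rewrite th // or_comm.
Qed.

(** The half-plane given by pointedness at [i] contains the cones of both parts and the chord that
    separates them. *)
Lemma convex_chord12 i j : ((i == k) && (j == l)) || ((i == l) && (j == k)) ->
  convex_at p t1 i -> convex_at p t2 i -> convex_at p t i.
Proof.
move=> ij c1 c2; have it1 : i \in t1.
  by case/orP: ij => /andP[/eqP-> _]; rewrite /= !inE ?mem_cat ?inE eqxx ?orbT.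
have it2 : i \in t2 by case/orP: ij => /andP[/eqP-> _]; rewrite /= !inE eqxx ?orbT.
have [w wn Hw] := (pointed_atP n3 gp i gG).1 (pG.2.2 i).
have {}Hw a : adj G i a -> 0 < dot w (vec (p i) (p a)) by move=> h; apply: Hw; rewrite inE.
have nx s : graph_cycle G s -> i \in s -> adj G i (next s i) /\ adj G i (prev s i).
  by move=> [_ _ cs] ins; split; [exact: next_cycle cs ins|rewrite adjC; exact: prev_cycle cs ins].
have [n1 p1] := nx _ gt1 it1; have [n2 p2] := nx _ gt2 it2.
apply: (convex_at_near (c := w)).
apply: filterS2 (cone_dot st1 it1 c1 (Hw _ n1) (Hw _ p1)) (cone_dot st2 it2 c2 (Hw _ n2) (Hw _ p2)).
move=> x h1 h2 ix; have [s|ns] := pselect (in_seg (p k) (p l) x); last first.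
  by case: ((th ix.1 ns).1 ix).
have aij : adj G i j by case/orP: ij => /andP[/eqP-> /eqP->] //; rewrite adjC.
have {s} [r [/andP[r0 _] xE]] : in_seg (p i) (p j) x.
  by case/orP: ij => /andP[/eqP-> /eqP->] //; exact: in_segC.
have xi : x <> p i.
  move=> E; apply: ix.1; exists (i, next t i); last by rewrite E; exact: in_seg_l.
  by rewrite mem_darts eqxx andbT; case/orP: ij => /andP[/eqP-> _]; rewrite /= !inE ?mem_cat ?inE eqxx ?orbT.
have -> : dot w (vec (p i) x) = r * dot w (vec (p i) (p j)) by rewrite xE /dot /vec /=; ring.
rewrite mulr_gt0 ?Hw // lt_neqAle r0 andbT; apply/eqP => r_0; apply: xi.
by rewrite xE -r_0 !mul0r !addr0 -surjective_pairing.
Qed.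

(* Corners of the two parts away from the chord are corners of t, and by pointedness so is an end
   of the chord that is a corner of both parts. *)
Lemma chord_convex_count : (4 <= count (fun i => `[< convex_at p t i >]) t)%N.
Proof.
have three s : graph_cycle G s -> exists2 E : {set 'I_n}, #|E| = 3%N & forall i, i \in E -> i \in s /\ convex_at p s i.
  move=> gs; have ss := graph_cycle_simple nG gs; have [us s3 _] := gs.
  have [|a [b [c [ea eb ec [ab bc ac]]]]] := @three_extremes _ _ p n3 gp [set i in s].
    by rewrite cardsE (card_uniqP us).
  exists [set a; b; c]%SET; first by rewrite finset.setUC cardsU1 cards2 !inE ![c == _]eq_sym negb_or ab bc ac.
  by move=> i; rewrite !inE -orbA => /or3P[] /eqP->; split; try (exact: extreme_convex); [case: ea|case: eb|case: ec]; rewrite inE.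
have [E1 card1 H1] := three _ gt1; have [E2 card2 H2] := three _ gt2.
rewrite count_card //; set C := [pred i | _ & _].
pose K : {set 'I_n} := [set k; l]%SET.
have sub : (E1 :\: K) :|: (E2 :\: K) :|: (E1 :&: E2 :&: K) \subset C.
  have inC i : i \in t -> convex_at p t i -> i \in C by move=> it ci; rewrite inE it; apply/asboolP.
  apply/fintype.subsetP => i; rewrite !inE negb_or -!andbA -orbA => /or3P[/and3P[ik il iE]|/and3P[ik il iE]|/and3P[iE1 iE2 iK]].
  - have [i1 ci] := H1 i iE; apply: inC; last exact: convex_chord1.
    by move: i1; rewrite /= !inE !mem_cat !inE (negbTE ik) (negbTE il) /= orbF => ->.
  - have [i1 ci] := H2 i iE; apply: inC; last exact: convex_chord2.
    by move: i1; rewrite /= !inE !mem_cat !inE (negbTE ik) (negbTE il) /= => ->; rewrite orbT.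
  have [i1 c1] := H1 i iE1; have [i2 c2] := H2 i iE2; apply: inC.
    by case/orP: iK => /eqP ->; rewrite /= !inE ?mem_cat ?inE eqxx ?orbT.
  case/orP: iK => /eqP E; [apply: (@convex_chord12 i l)|apply: (@convex_chord12 i k)];
    by rewrite // E !eqxx ?orbT.
apply: leq_trans (subset_leq_card sub).
have d1 : (E1 :\: K) :&: (E2 :\: K) = finset.set0.
  apply/finset.setP => i; rewrite !inE !negb_or; apply/negP => /andP[/andP[/andP[ik il] /H1[i1 _]] /andP[_ /H2[i2 _]]].
  by move: i1 i2; rewrite /= !inE !mem_cat !inE (negbTE ik) (negbTE il) /= !orbF => /disj/negP h /h.
have d2 : ((E1 :\: K) :|: (E2 :\: K)) :&: (E1 :&: E2 :&: K) = finset.set0.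
  by apply/finset.setP => i; rewrite !inE; case: (i == k); case: (i == l); rewrite /= ?andbF ?orbF ?andbF.
have := cardsUI ((E1 :\: K) :|: (E2 :\: K)) (E1 :&: E2 :&: K); rewrite d2 cards0 addn0 => ->.
have := cardsUI (E1 :\: K) (E2 :\: K); rewrite d1 cards0 addn0 => ->.
have := cardsID K E1; have := cardsID K E2; rewrite card1 card2.
(* By inclusion and exclusion the three disjoint parts have 6 minus the number of ends of the chord
   in E1 or E2, and the chord has two ends. *)
have := cardsUI (E1 :&: K) (E2 :&: K); rewrite -finset.setIIl.
have : (#|(E1 :&: K) :|: (E2 :&: K)| <= 2)%N.
  rewrite -finset.setIUl; apply: leq_trans (subset_leq_card (finset.subsetIr _ _)) _.
  by rewrite cards2; case: (k != l).
move: #|(E1 :&: K) :|: (E2 :&: K)| #|E1 :&: E2 :&: K| #|E1 :&: K| #|E2 :&: K| #|E1 :\: K| #|E2 :\: K|.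
clear; lia.
Qed.

End Chord.

(** * Separation from the convex hull *)

Section ConvexHull.
Variables (R : realType) (n : nat) (p : 'I_n -> (R * R)%type) (i0 : 'I_n).
Implicit Types (x y : (R * R)%type).

Lemma conv_hull_vertex i : conv_hull p (p i).
Proof.
exists (fun j => (j == i)%:R); split=> [j|]; first exact: ler0n.
have E (F : 'I_n -> R) : \sum_j (j == i)%:R * F j = F i.
  by rewrite (bigD1 i) //= eqxx mul1r big1 ?addr0 // => j /negbTE ->; rewrite mul0r.
split; last by rewrite !E -surjective_pairing.
by rewrite -[RHS](E (fun=> 1)); apply: eq_bigr => j _; rewrite mulr1.
Qed.

Lemma conv_hull_convex x y z : conv_hull p x -> conv_hull p y -> in_seg x y z -> conv_hull p z.
Proof.
move=> [w [w0 [w1 ->]]] [w' [w0' [w1' ->]]] [s [/andP[s0 s1] ->]].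
have E (F : 'I_n -> R) : \sum_i w i * F i + s * (\sum_i w' i * F i - \sum_i w i * F i) =
    \sum_i ((1 - s) * w i + s * w' i) * F i.
  by rewrite -sumrB mulr_sumr -big_split; apply: eq_bigr => i _ /=; ring.
exists (fun i => (1 - s) * w i + s * w' i); split=> [i|].
  by rewrite addr_ge0 // mulr_ge0 // subr_ge0.
split; last by rewrite /= !E.
by rewrite big_split -!mulr_sumr /= w1 w1' !mulr1 subrK.
Qed.

(** Farkas for the barycentric weights of [y]: a certificate is an affine function that is positive
    at [y] and at most zero at all points, and its negated gradient is the direction [u]. *)
Lemma conv_hull_separation y : conv_hull p y \/ exists2 u, u != 0 & forall i, 0 <= dot u (vec y (p i)).
Proof.
(* The constant 1 and the two coordinates, so that the equations state that the weights sum to 1 and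
   represent [y]. The sign [s] writes each equation as two inequalities. *)
pose h (c : (bool + bool)%type) (q : R * R) : R := if c is inr b then (if b then q.1 else q.2) else 1.
pose s (b : bool) : R := if b then 1 else -1.
pose a (j : 'I_n + bool * (bool + bool)%type) i := match j with inl k => (k == i)%:R | inr (b, c) => s b * h c (p i) end.
pose b (j : 'I_n + bool * (bool + bool)%type) := match j with inl k => 0 | inr (b, c) => s b * h c y end.
have [[w H]|[mu [mu0 H]]] := farkas a b.
  left; exists w; split=> [i|].
    have := H (inl i); rewrite /= (bigD1 i) //= eqxx mul1r big1 ?addr0 // => j /negbTE.
    by rewrite eq_sym => ->; rewrite mul0r.
  have E c : \sum_i w i * h c (p i) = h c y.
    have F b' : s b' * h c y <= s b' * \sum_i w i * h c (p i).
      apply: le_trans (H (inr (b', c))) _; rewrite mulr_sumr le_eqVlt; apply/orP; left; apply/eqP.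
      by apply: eq_bigr => i _; rewrite /a /= -mulrA; congr (_ * _); rewrite mulrC.
    by have := F true; have := F false; rewrite /s; lra.
  have := E (inl true); rewrite /= => E1; split.
    by rewrite -[RHS]E1; apply: eq_bigr => i _; rewrite mulr1.
  by rewrite (E (inr true)) (E (inr false)) -surjective_pairing.
rewrite big_sumType /= big1 ?add0r => [|i _]; last by rewrite mulr0.
pose g c := \sum_(b' : bool) mu (inr (b', c)) * s b'.
have G (q : R * R) : \sum_(e : bool * (bool + bool)%type) mu (inr e) * (s e.1 * h e.2 q) =
    (g (inl true) + g (inl false)) + g (inr true) * q.1 + g (inr false) * q.2.
  have -> : \sum_(e : bool * (bool + bool)%type) mu (inr e) * (s e.1 * h e.2 q) = \sum_c g c * h c q.
    transitivity (\sum_b' \sum_c mu (inr (b', c)) * (s b' * h c q)).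
      by rewrite pair_bigA; apply: eq_bigr => -[].
    rewrite exchange_big /=.
    by apply: eq_bigr => c _; rewrite /g mulr_suml; apply: eq_bigr => b' _; rewrite mulrA.
  by rewrite big_sumType !big_bool /= !mulr1 !addrA.
have Gb : \sum_(e : bool * (bool + bool)%type) mu (inr e) * b (inr e) = (g (inl true) + g (inl false)) + g (inr true) * y.1 + g (inr false) * y.2.
  by rewrite -G; apply: eq_bigr => -[].
rewrite Gb => pos.
have Gi i : (g (inl true) + g (inl false)) + g (inr true) * (p i).1 + g (inr false) * (p i).2 <= 0.
  have := H i; rewrite big_sumType /= (bigD1 i) //= eqxx mulr1 big1 ?addr0 => [|j /negbTE ->]; last by rewrite mulr0.
  have -> : \sum_(e : bool * (bool + bool)%type) mu (inr e) * a (inr e) i = (g (inl true) + g (inl false)) + g (inr true) * (p i).1 + g (inr false) * (p i).2.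
    by rewrite -G; apply: eq_bigr => -[].
  by have := mu0 (inl i); lra.
right; exists (- g (inr true), - g (inr false)) => [|i].
  apply: contraTneq pos => -[] /eqP; rewrite oppr_eq0 => /eqP e1 /eqP; rewrite oppr_eq0 => /eqP e2.
  by have := Gi i0; rewrite e1 e2 !mul0r !addr0 leNgt.
by have := Gi i; rewrite /dot /vec /=; lra.
Qed.

Lemma wind_outside_hull c y : circ c -> off p c y -> ~ conv_hull p y -> winding p c y = 0.
Proof.
move=> cc oc ny; case: (conv_hull_separation y) => // -[u un H].
by apply: (wind_halfplane cc oc (dir10 R) un) => e _; split.
Qed.

End ConvexHull.

Section Rotation.
Variables (R : realType) (n : nat) (p : 'I_n -> (R * R)%type) (t : seq 'I_n) (i : nat).
Hypothesis ut : uniq t.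

Lemma darts_rot : darts (rot i t) = rot i (darts t).
Proof.
rewrite /darts -map_rot; apply/eq_in_map => k; rewrite mem_rot => kt.
by rewrite next_rot.
Qed.

Lemma inside_rot x : inside p (rot i t) x <-> inside p t x.
Proof.
have E : cycle_flow R (rot i t) = cycle_flow R t.
  by apply/funext => e; rewrite /cycle_flow darts_rot /rot count_cat addnC -count_cat cat_take_drop.
by rewrite /inside E; split=> -[h1 h2]; split=> // -[e et s]; apply: h1; exists e => //;
  move: et; rewrite darts_rot mem_rot.
Qed.

Lemma convex_at_rot k : convex_at p (rot i t) k <-> convex_at p t k.
Proof.
by split=> -[c [eps [e0 H]]]; exists c, eps; split=> // x /inside_rot; exact: H.
Qed.

End Rotation.

(** * No edge can be added to a pseudo-triangulation *)

Section PseudoTriangulationsAreMaximal.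
Variables (R : realType) (n : nat) (p : 'I_n -> (R * R)%type).
Hypotheses (n3 : (3 <= n)%N) (gp : general_position p).
Implicit Types (t : seq 'I_n) (x y z u v m : (R * R)%type) (a b k l : 'I_n) (e : 'I_n * 'I_n).
Variable T : {set 'I_n * 'I_n}.
Hypotheses (gT : graph_on T) (nT : non_crossing p T).

Lemma adj_sorted e : e \notin T -> (e.1 < e.2)%N -> ~~ adj T e.1 e.2.
Proof.
move=> eT lt; rewrite /adj -surjective_pairing (negbTE eT) /=; apply/negP => /gT /=.
by rewrite ltnNge ltnW.
Qed.

Lemma edge_adj e : e \in T -> adj T e.1 e.2.
Proof. by move=> eT; rewrite /adj -surjective_pairing eT. Qed.

Lemma sample_region a b m u v z : a != b -> ~~ adj T a b -> sample p a b m u v ->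
  in_seg u v z -> conv_hull p z -> regions p T z.
Proof.
move=> ab nab [_ _ _ ap _] /ap az hz; split=> //; split=> [k|e eT]; first exact: apart_vertex az.
by case/az => E; move: nab; rewrite /adj; rewrite E in eT; rewrite eT ?orbT.
Qed.

Lemma sample_inside_seg t a b m u v z : simple_cycle p t -> sample p a b m u v -> in_seg u v z ->
  (a, b) \notin darts t -> (b, a) \notin darts t -> inside p t m -> inside p t z.
Proof.
move=> st [_ mu _ ap _] zuv n1 n2 im; apply: (inside_seg st im) => y.
case=> r [r01 yE] [f ft sf]; have yuv : in_seg u v y.
  have := in_seg_convex r01 mu zuv; rewrite /step /vec /= -yE; exact.
by case: (ap y yuv f sf) => E; rewrite E in ft; [rewrite ft in n1|rewrite ft in n2].
Qed.

Lemma in_seg_open x y z : in_seg x y z -> z <> x -> z <> y ->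
  exists2 r : R, 0 < r < 1 & z = step x r (vec x y).
Proof.
case=> r [/andP[r0 r1] zE] zx zy; exists r => //; rewrite !lt_neqAle r0 r1 !andbT; apply/andP; split.
  by apply/eqP => E; apply: zx; rewrite zE -E !mul0r !addr0 -surjective_pairing.
by apply/eqP => E; apply: zy; rewrite zE E !mul1r; apply: injective_projections => /=; ring.
Qed.

Lemma new_edge_region e r : non_crossing p (e |: T) -> e \notin T -> e.1 != e.2 -> 0 < r < 1 ->
  regions p T (step (p e.1) r (vec (p e.1) (p e.2))).
Proof.
set z := step _ _ _ => nG eT e12 /andP[r0 r1].
have s : in_seg (p e.1) (p e.2) z by exists r; rewrite !ltW.
have zv k : z <> p k.
  have vn := vec_neq0 n3 gp e12; move=> E; have := s; rewrite E => /(gp_in_seg gp e12) kE.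
  have : vec (p e.1) z = (0, 0) \/ vec (p e.2) z = (0, 0).
    by case: kE => kE; [left|right]; rewrite E kE /vec !subrr.
  move/eqP: vn; rewrite /z /vec /step /= => vn [[h1 h2]|[h1 h2]]; apply: vn; congr pair.
  - by apply: (mulfI (lt0r_neq0 r0)); lra.
  - by apply: (mulfI (lt0r_neq0 r0)); lra.
  - have r1' : 1 - r != 0 by rewrite subr_eq0 gt_eqF.
    by apply: (mulfI r1'); lra.
  have r1' : 1 - r != 0 by rewrite subr_eq0 gt_eqF.
  by apply: (mulfI r1'); lra.
split; first by apply: conv_hull_convex s; exact: conv_hull_vertex.
split=> // f fT sf.
have fe : f != e by apply: contraNneq eT => <-.
have fG : f \in e |: T by rewrite !inE fT orbT.
by have [|k [_ /zv]] := nG f e fG _ fe z sf s; rewrite ?inE ?eqxx.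
Qed.

Lemma region_comp_seg x y : (forall z, in_seg x y z -> regions p T z) ->
  connected_component (regions p T) x y.
Proof. exact: seg_component. Qed.

Section Face.
Variables (t : seq 'I_n) (x0 : R * R).
Hypotheses (st : simple_cycle p t) (rx0 : regions p T x0)
  (face_t : connected_component (regions p T) x0 = inside p t).

Lemma face_regions x : inside p t x -> regions p T x.
Proof. by rewrite -face_t => /connected_component_sub. Qed.

Lemma face_comp x y : inside p t x -> connected_component (regions p T) x y -> inside p t y.
Proof. by rewrite -face_t => h1 h2; apply: connected_component_trans h1 h2. Qed.

(** If a side of the polygon were not an edge of the graph, the region would reach across it and
    contain a boundary point of its own polygon. *)
Lemma face_dart_adj e : e \in darts t -> adj T e.1 e.2.
Proof.
move=> et; apply/negPn/negP => nab; have ab := dart_neq st et.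
have [m [u [v sa]]] := sample_exists n3 gp ab.
have et' : (e.1, e.2) \in darts t by rewrite -surjective_pairing.
have [ms mu [_ _] _ _] := sa.
have hm : conv_hull p m by apply: conv_hull_convex ms; exact: conv_hull_vertex.
have bm : boundary p t m by exists e.
suff H w : in_seg u v w -> inside p t w -> False.
  by case: (dart_sample_inside n3 gp st sa et') => -[h _]; [apply: (H u)|apply: (H v)] => //;
    [exact: in_seg_l|exact: in_seg_r].
move=> wuv iw; have [] := face_comp (y := m) iw; last by [].
apply: region_comp_seg => z zs; apply: (sample_region ab nab sa); last first.
  exact: conv_hull_convex (face_regions iw).1 hm zs.
by case: zs => r [r01 ->]; exact: (in_seg_convex r01 wuv mu).
Qed.

End Face.

Lemma points_seq (s : seq (R * R)) : (forall y, y \in s -> exists k, y = p k) -> exists t, s = map p t.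
Proof.
elim: s => [|y s IH] H; first by exists [::].
have [k ->] := H y (mem_head _ _); have [z zs|t ->] := IH; first by apply: H; rewrite inE zs orbT.
by exists (k :: t).
Qed.

Lemma pseudo_triangulation_face x : pseudo_triangulation p T -> regions p T x -> exists t,
  [/\ simple_cycle p t, count (fun k => `[< convex_at p t k >]) t = 3%N &
      connected_component (regions p T) x = inside p t].
Proof.
move=> [_ [_ H]] /H[s [/points_seq[t ->] [pt E]]]; exists t.
have ut : uniq t by case: pt => -[_ [/map_uniq]].
have [st c3] := (pseudo_triangle_map n3 gp ut).1 pt.
split=> //; rewrite E; apply/seteqP; split=> y.
  by move/(poly_interior_map n3 gp (Ordinal (ltnW (ltnW n3))) ut y st).
by move/(poly_interior_map n3 gp (Ordinal (ltnW (ltnW n3))) ut y st).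
Qed.

Lemma ppt_no_extension e : pseudo_triangulation p T -> e \notin T -> ~ pointed_noncrossing p (e |: T).
Proof.
move=> pT eT pG; have [gG [nG _]] := pG.
have e12 : (e.1 < e.2)%N by apply: gG; rewrite !inE eqxx.
have kl : e.1 != e.2 by rewrite neq_ltn e12.
have nkl := adj_sorted eT e12; have nlk : ~~ adj T e.2 e.1 by rewrite adjC.
set k := e.1 in kl nkl nlk *; set l := e.2 in kl nkl nlk *.
have [m [u [v sa]]] := sample_exists n3 gp kl; have [ms mu _ ap _] := sa.
have rm : regions p T m.
  apply: (sample_region kl nkl sa mu).
  by apply: conv_hull_convex ms; exact: conv_hull_vertex.
have [t [st c3 face_t]] := pseudo_triangulation_face pT rm; have [ut s3 _] := st.
have im : inside p t m by rewrite -face_t; exact: connected_component_refl.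
have fadj := face_dart_adj st face_t.
have iopen r : 0 < r < 1 -> inside p t (step (p k) r (vec (p k) (p l))).
  move=> r01; have [||q /andP[q0 q1] mE] := in_seg_open ms; try exact: (apart_vertex kl (ap m mu)).
  apply: (face_comp face_t im); apply: region_comp_seg => z [s [/andP[s0 s1] zE]].
  have -> : z = step (p k) ((1 - s) * q + s * r) (vec (p k) (p l)).
    by rewrite zE mE /step /vec /=; congr pair; ring.
  apply: (new_edge_region nG eT kl); case/andP: r01 => r0 r1.
  have [->|sn] := eqVneq s 0; first by rewrite subr0 mul1r mul0r addr0 q0 q1.
  have sp : 0 < s by rewrite lt_neqAle eq_sym sn.
  by apply/andP; split; nra.
(* The ends of the new edge lie on the cycle: an end is a limit of interior points, and it is not
   interior itself because regions contain no vertex. *)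
have vt i j : (i, j) = (k, l) \/ (i, j) = (l, k) -> i \in t.
  move=> ij; have ji : i != j by case: ij => -[-> ->]; rewrite // eq_sym.
  have iop r : 0 < r < 1 -> inside p t (step (p i) r (vec (p i) (p j))).
    case: ij => -[-> ->]; first exact: iopen.
    move=> /andP[r0 r1]; have -> : step (p l) r (vec (p l) (p k)) = step (p k) (1 - r) (vec (p k) (p l)).
      by rewrite /step /vec /=; congr pair; ring.
    by apply: iopen; rewrite subr_gt0 r1 /= -subr_gt0 subKr.
  have ni : ~ inside p t (p i) by move/(face_regions face_t) => -[_ [/(_ i)]].
  have [[f ft sf]|nb] := pselect (boundary p t (p i)).
    move: ft (ft); rewrite {1}mem_darts => /andP[f1 /eqP f2] ft.
    by case: (gp_in_seg gp (dart_neq st ft) sf) => ->; rewrite // f2 mem_next.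
  case: ni; have := component_near (complement_near nb) (connected_component_refl nb).
  case/near_planeP => eps e0 He.
  have [r [r0 [r1 [[q1 q2] _]]]] := @filter_ex _ _ (at_right_proper_filter (0 : R)) _
    (filterI (nbhs_right_gt (0 : R)) (filterI (nbhs_right_lt (ltr01 : 0 < (1 : R)))
      (near_step (vec (p i) (p j)) (near_box (p i) e0)))).
  have r01 : 0 < r < 1 by apply/andP.
  apply: (inside_comp st (iop r r01)); apply: connected_component_sym; exact: He.
have kt : k \in t by apply: (vt k l); left.
have lt : l \in t by apply: (vt l k); right.
have [i t' tE] := rot_to kt.
have lt' : l \in t'.
  by move: lt; rewrite -(mem_rot i) tE inE eq_sym (negbTE kl).
have [A [B t'E]] : exists A B, t' = A ++ l :: B by case/splitPr: lt' => A B; exists A, B.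
rewrite t'E in tE.
have ur : uniq (k :: A ++ l :: B) by rewrite -tE rot_uniq.
have dr f : f \in darts (k :: A ++ l :: B) -> adj T f.1 f.2.
  by rewrite -tE darts_rot // mem_rot; exact: fadj.
have sub a b : adj T a b -> adj (e |: T) a b.
  by rewrite /adj !inE => /orP[] ->; rewrite ?orbT.
have cyc : cycle (adj (e |: T)) (k :: A ++ l :: B).
  rewrite -tE rot_cycle; apply: cycle_from_next => // j jt; apply: sub.
  by have := fadj (j, next t j); apply; rewrite mem_darts jt eqxx.
have A0 : A != [::].
  apply/eqP => A0; have := dr (k, l); rewrite A0 /= (negbTE nkl) mem_darts !inE /= !eqxx /=.
  by move=> /(_ isT).
have B0 : B != [::].
  apply/eqP => B0; have := dr (l, k); rewrite darts_theta // B0 /= mem_cat !inE eqxx orbT.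
  by move/(_ isT); rewrite (negbTE nlk).
have klG : adj (e |: T) k l by rewrite /adj !inE -surjective_pairing eqxx.
have n1 : (k, l) \notin darts t by apply: contra nkl => /fadj.
have n2 : (l, k) \notin darts t by apply: contra nlk => /fadj.
have iu := sample_inside_seg st sa (in_seg_l u v) n1 n2 im.
have iv := sample_inside_seg st sa (in_seg_r u v) n1 n2 im.
have iu' : inside p (k :: A ++ l :: B) u by rewrite -tE; apply/inside_rot.
have iv' : inside p (k :: A ++ l :: B) v by rewrite -tE; apply/inside_rot.
have := chord_convex_count n3 gp pG klG ur cyc A0 B0 sa iu' iv'.
have pr : perm_eq (rot i t) t by rewrite perm_rot.
rewrite -tE (seq.permP pr) (eq_count (a2 := fun j => `[< convex_at p t j >])) ?c3 // => j.
by apply: asbool_equiv_eq; exact: convex_at_rot.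
Qed.

End PseudoTriangulationsAreMaximal.

(** * Maximal pointed graphs are pseudo-triangulations *)

Section Laman.
Variables (R : realType) (n : nat) (p : 'I_n -> (R * R)%type).
Hypotheses (n3 : (3 <= n)%N) (gp : general_position p) (lab : labeled_y p).
Implicit Types (a b k l : 'I_n) (e : 'I_n * 'I_n) (U H S : {set 'I_n}).
Variable T : {set 'I_n * 'I_n}.
Hypotheses (gT : graph_on T) (sfT : stress_free p T).

Definition sorted_pair k l : 'I_n * 'I_n := if (k < l)%N then (k, l) else (l, k).

Lemma sorted_pairP k l : sorted_pair k l = (k, l) \/ sorted_pair k l = (l, k).
Proof. by rewrite /sorted_pair; case: ifP; [left|right]. Qed.

Definition within U : {set 'I_n * 'I_n} := [set e in T | (e.1 \in U) && (e.2 \in U)].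

(* Every vertex outside U is attached to U by two bars, which keeps the framework stress-free. *)
Lemma laman_count U : (2 <= #|U|)%N -> (#|within U| + 3 <= 2 * #|U|)%N.
Proof.
move=> U2; have [a aU] : exists a, a \in U by apply/card_gt0P; apply: ltnW.
have [b] : exists b, b \in U :\ a by apply/card_gt0P; move: U2; rewrite (cardsD1 a) aU ltnS.
rewrite !inE => /andP[ba bU].
pose arm c : {set 'I_n * 'I_n} := [set sorted_pair k c | k in ~: U]%SET.
have armP c e : c \in U -> e \in arm c -> exists2 k, k \notin U & e = (k, c) \/ e = (c, k).
  by move=> cU /imsetP[k]; rewrite inE => kU ->; exists k => //; exact: sorted_pairP.
have cardarm c : c \in U -> #|arm c| = (n - #|U|)%N.
  move=> cU; rewrite card_in_imset; last first.
    move=> k k'; rewrite !inE => kU kU'.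
    have kc : k <> c by move=> E; rewrite E cU in kU.
    have kc' : k' <> c by move=> E; rewrite E cU in kU'.
    by case: (sorted_pairP k c) => ->; case: (sorted_pairP k' c) => -> [] // E1 E2; rewrite ?E1 ?E2 // -?E1 -?E2.
  have := cardsC U; rewrite card_ord; move: #|U| #|~: U| => x y; clear; lia.
pose G := within U :|: arm a :|: arm b.
have dis c : c \in U -> within U :&: arm c = finset.set0.
  move=> cU; apply/finset.setP => e; rewrite finset.in_set0; apply/negP; rewrite finset.in_setI inE => /andP[/andP[_ /andP[h1 h2]]].
  by case/(armP c e cU) => k kU [] E; rewrite E in h1 h2; [rewrite h1 in kU|rewrite h2 in kU].
have dab : arm a :&: arm b = finset.set0.
  apply/finset.setP => e; rewrite finset.in_set0; apply/negP; rewrite finset.in_setI => /andP[/(armP a e aU)[k kU E] /(armP b e bU)[k' kU' E']].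
  case: E E' => -> [] [] E1 E2.
  - by rewrite E2 eqxx in ba.
  - by rewrite E1 bU in kU.
  - by rewrite E2 bU in kU.
  - by rewrite E1 eqxx in ba.
have cardG : #|G| = (#|within U| + 2 * (n - #|U|))%N.
  have I0 (X Y : {set 'I_n * 'I_n}) : X :&: Y = finset.set0 -> #|X :|: Y| = (#|X| + #|Y|)%N.
    by move=> d; rewrite -(cardsUI X Y) d cards0 addn0.
  rewrite I0; last by rewrite finset.setIUl dis // dab finset.setU0.
  by rewrite I0 ?dis // !cardarm //; move: #|within U| (n - #|U|)%N => x y; clear; lia.
have sfG : stress_free p G.
  move=> w sw wG.
  (* Equilibrium at the vertex [k], obtained from the motion that moves only [k], with velocity
     [q]. *)
  have van k : k \notin U -> forall q : R * R,
      \sum_e w e * (((p e.1).1 - (p e.2).1) * (((e.1 == k)%:R - (e.2 == k)%:R) * q.1) +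
                    ((p e.1).2 - (p e.2).2) * (((e.1 == k)%:R - (e.2 == k)%:R) * q.2)) = 0.
    move=> kU q; pose v : 'M[R]_(n, 2) := \matrix_(i, j) ((i == k)%:R * (if j == ord0 then q.1 else q.2)).
    by apply: etrans (sw v); apply: eq_bigr => e _; rewrite /ipm !mxE /= !mulrBl.
  have inc k e : k \notin U -> w e != 0 -> e.1 = k \/ e.2 = k -> e = sorted_pair k a \/ e = sorted_pair k b.
    move=> kU wn ek; have := wG e wn; rewrite /G finset.in_setU finset.in_setU -orbA => /or3P[].
    - by rewrite inE => /andP[_ /andP[h1 h2]]; case: ek => E; [rewrite E in h1; rewrite h1 in kU|rewrite E in h2; rewrite h2 in kU].
    - move=> /imsetP[k']; rewrite inE => kU' E; left; have -> : k = k'; last by [].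
      by case: (sorted_pairP k' a) => S; rewrite S in E; case: ek; rewrite E /= // => ck; rewrite -ck aU in kU.
    - move=> /imsetP[k']; rewrite inE => kU' E; right; have -> : k = k'; last by [].
      by case: (sorted_pairP k' b) => S; rewrite S in E; case: ek; rewrite E /= // => ck; rewrite -ck bU in kU.
  have zero k c c' : k \notin U -> c \in U -> c' \in U -> c != c' -> (forall e, w e != 0 -> e.1 = k \/ e.2 = k ->
      e = sorted_pair k c \/ e = sorted_pair k c') -> w (sorted_pair k c) = 0.
    move=> kU cU cU' cc H.
    have kc : k != c by apply: contraNneq kU => ->.
    have kc' : k != c' by apply: contraNneq kU => ->.
    have ne : sorted_pair k c != sorted_pair k c'.
      apply/eqP; case: (sorted_pairP k c) => ->; case: (sorted_pairP k c') => ->.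
      - by case=> E; rewrite E eqxx in cc.
      - by case=> E _; rewrite E eqxx in kc'.
      - by case=> E _; rewrite E eqxx in kc.
      - by case=> E; rewrite E eqxx in cc.
    (* Moving [k] orthogonally to one of its two bars isolates the stress of the other bar. *)
    pose q : R * R := perp (vec (p k) (p c')).
    have := van k kU q; rewrite (bigD1 (sorted_pair k c)) //= (bigD1 (sorted_pair k c')) ?(eq_sym _ (sorted_pair k c)) //=.
    rewrite [X in _ + (_ + X)]big1 => [|e /andP[ne1 ne2]]; last first.
      have [->|wn] := eqVneq (w e) 0; first by rewrite mul0r.
      have [e1|e1] := eqVneq e.1 k.
        by case: (H e wn (or_introl e1)) => E; [rewrite E eqxx in ne1|rewrite E eqxx in ne2].
      have [e2|e2] := eqVneq e.2 k.
        by case: (H e wn (or_intror e2)) => E; [rewrite E eqxx in ne1|rewrite E eqxx in ne2].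
      by rewrite subrr !mul0r !mulr0 addr0 mulr0.
    have val c0 : k != c0 -> (((p (sorted_pair k c0).1).1 - (p (sorted_pair k c0).2).1) *
        ((((sorted_pair k c0).1 == k)%:R - ((sorted_pair k c0).2 == k)%:R) * q.1) +
        ((p (sorted_pair k c0).1).2 - (p (sorted_pair k c0).2).2) *
        ((((sorted_pair k c0).1 == k)%:R - ((sorted_pair k c0).2 == k)%:R) * q.2)) = - dot q (vec (p k) (p c0)).
      by move=> kc0; case: (sorted_pairP k c0) => -> /=; rewrite eqxx eq_sym (negbTE kc0) /dot /vec /=; ring.
    rewrite !val // addr0 (_ : dot q (vec (p k) (p c')) = 0); last by rewrite /q /dot /perp /=; ring.
    rewrite oppr0 mulr0 addr0 mulrN => /eqP; rewrite oppr_eq0 mulf_eq0 => /orP[/eqP //|/eqP d0].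
    have := orient_neq0 gp kc kc' cc; rewrite (_ : orient _ _ _ = - dot q (vec (p k) (p c))); last by rewrite /q /orient /dot /perp /vec /=; ring.
    by rewrite d0 oppr0 eqxx.
  apply: (sfT sw) => e wn; have := wG e wn; rewrite !inE -orbA => /or3P[/andP[] //|ea|eb]; exfalso.
    have := ea => /imsetP[k]; rewrite inE => kU E; move/eqP: wn; apply; rewrite E.
    by apply: (zero k a b) => //; [rewrite eq_sym|move=> f; exact: inc].
  have := eb => /imsetP[k]; rewrite inE => kU E; move/eqP: wn; apply; rewrite E.
  by apply: (zero k b a) => // f wf fk; rewrite or_comm; exact: inc.
have := dim_motion_space n3 lab sfG; rewrite cardG.
have := max_card (mem U); rewrite card_ord; move: (\dim _) #|within U| #|U| U2 => x y z; clear; lia.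
Qed.

Hypothesis cT : #|T| = (2 * n - 3)%N.

(** Without edges at [k], all 2n - 3 edges would lie on n - 1 points, which carry at most 2n - 5. *)
Lemma laman_degree k : exists l, adj T k l.
Proof.
apply: contrapT => N; have := @laman_count (~: [set k]%SET).
have -> : within (~: [set k]%SET) = T.
  apply/finset.setP => e; rewrite !inE; case: (boolP (e \in T)) => //= eT; apply/andP; split; apply/eqP => E; apply: N.
    by exists e.2; rewrite /adj -E -surjective_pairing eT.
  by exists e.1; rewrite /adj -E -surjective_pairing eT orbT.
have := cardsC [set k]%SET; rewrite cards1 card_ord cT; move: #|~: _| n3 => x; clear => n3 E H; have := H; lia.
Qed.

Definition avoid S : rel 'I_n := fun x y => [&& adj T x y, x \notin S & y \notin S].

Lemma avoid_sym S : connect_sym (avoid S).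
Proof. by apply: sym_connect_sym => x y; rewrite /avoid adjC; case: (x \notin S); rewrite ?andbT ?andbF. Qed.

Lemma connect_avoid S b k : b \notin S -> connect (avoid S) b k -> k \notin S.
Proof.
move=> bS /connectP[s]; elim: s b bS => [|x s IH] b bS /=; first by move=> _ ->.
by case/andP=> /and3P[_ _ xS]; exact: IH.
Qed.

(* Otherwise the component of b and its complement would share at most one vertex while covering
   all edges, which Laman's count forbids. *)
Lemma two_attachments S b : (2 <= #|S|)%N -> b \notin S -> exists a1 a2 h1 h2,
  [/\ a1 \in S, a2 \in S, a1 != a2, adj T a1 h1 & adj T a2 h2] /\
  connect (avoid S) b h1 /\ connect (avoid S) b h2.
Proof.
move=> S2 bS; apply: contrapT => N.
pose H : {set 'I_n} := [set k | connect (avoid S) b k]%SET.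
have HS k : k \in H -> k \notin S by rewrite inE; exact: connect_avoid.
pose att a := [exists h in H, adj T a h].
have [a0 [a0S a0P]] : exists a0, a0 \in S /\ forall a, a \in S -> att a -> a = a0.
  have [a1 /andP[a1S t1]|none] := pickP (fun a => (a \in S) && att a).
    exists a1; split=> // a aS ta; apply/eqP/negPn/negP => ne; apply: N.
    have /existsP[h1 /andP[]] := ta; have /existsP[h2 /andP[]] := t1; rewrite !inE => h2H ah2 h1H ah1.
    by exists a, a1, h1, h2.
  have /card_gt0P[a1 a1S] : (0 < #|S|)%N by exact: ltnW.
  by exists a1; split=> // a aS ta; have := none a; rewrite aS ta.
have HE e : e \in T -> (e \in within (a0 |: H)) || (e \in within (~: H)).
  have K k l : adj T k l -> k \in H -> l \in a0 |: H.
    move=> kl kH; have [lS|lS] := boolP (l \in S).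
      by rewrite (a0P l lS) ?setU11 //; apply/existsP; exists k; rewrite kH adjC.
    rewrite !inE; apply/orP; right; move: (kH); rewrite inE => h; apply: connect_trans h _.
    by apply: connect1; rewrite /avoid kl (HS k kH).
  move=> eT; have e12 : adj T e.1 e.2 by rewrite /adj -surjective_pairing eT.
  rewrite /within ![e \in finset _]inE eT /=.
  have [h1|h1] := boolP (e.1 \in H); first by rewrite (K _ _ e12 h1) finset.in_setU h1 orbT.
  have [h2|h2] := boolP (e.2 \in H); last by rewrite !finset.in_setC h1 h2 orbT.
  by rewrite adjC in e12; rewrite (K _ _ e12 h2) finset.in_setU h2 orbT.
have bH : b \in H by rewrite inE connect0.
have a0H : a0 \notin H by apply/negP => /HS; rewrite a0S.
have cle : (#|T| <= #|within (a0 |: H)| + #|within (~: H)|)%N.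
  apply: leq_trans (subset_leq_card (B := within (a0 |: H) :|: within (~: H)) _) (leq_card_setU _ _).
  by apply/fintype.subsetP => e /HE; rewrite finset.in_setU.
have c1 : (0 < #|H|)%N by apply/card_gt0P; exists b.
have c2 : (2 <= #|~: H|)%N.
  apply: leq_trans S2 (subset_leq_card _); apply/fintype.subsetP => k kS.
  by rewrite finset.in_setC; apply/negP => /HS; rewrite kS.
(* The two bounds are 2 (|H| + 1) - 3 and 2 (n - |H|) - 3, which add up to 2n - 4, one less than the
   number of edges. *)
have := @laman_count (a0 |: H); rewrite cardsU1 a0H add1n ltnS => /(_ c1).
have := laman_count c2; have := cardsC H; rewrite card_ord; rewrite cT in cle.
move: cle n3; move: #|H| #|~: H| #|within _| #|within _| => x y z w; clear; lia.
Qed.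

End Laman.

(** * Ears inside a cycle and the shrinking of enclosing cycles *)

Section EnclosingCycles.
Variables (R : realType) (n : nat) (p : 'I_n -> (R * R)%type).
Hypotheses (n3 : (3 <= n)%N) (gp : general_position p) (lab : labeled_y p).
Implicit Types (t s g A B : seq 'I_n) (x y z u v m q : (R * R)%type) (a b k l : 'I_n) (e : 'I_n * 'I_n).
Variable T : {set 'I_n * 'I_n}.
Hypotheses (gT : graph_on T) (nT : non_crossing p T) (sfT : stress_free p T) (cT : #|T| = (2 * n - 3)%N).

Lemma in_seg_avoid_end a b x y z : in_seg (p a) (p b) x -> in_seg (p a) (p b) y -> x <> p a -> y <> p a ->
  a != b -> in_seg x y z -> z <> p a.
Proof.
move=> [r [/andP[r0 r1] xE]] [r' [/andP[r0' r1'] yE]] xa ya ab [s [/andP[s0 s1] zE]] za.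
have pos (w : R * R) (c : R) : 0 <= c -> w = ((p a).1 + c * ((p b).1 - (p a).1), (p a).2 + c * ((p b).2 - (p a).2)) ->
    w <> p a -> 0 < c.
  move=> c0 wE wa; rewrite lt_neqAle c0 andbT; apply/eqP => E; apply: wa.
  by rewrite wE -E !mul0r !addr0 -surjective_pairing.
have {}r0 := pos x r r0 xE xa; have {}r0' := pos y r' r0' yE ya.
have vn := vec_neq0 n3 gp ab.
have c0 : 0 < (1 - s) * r + s * r'.
  have [->|sn] := eqVneq s 0; first by rewrite subr0 mul1r mul0r addr0.
  have sp : 0 < s by rewrite lt_neqAle eq_sym sn.
  by nra.
move/eqP: vn; apply; rewrite /vec; move: za; rewrite zE xE yE /= [p a]surjective_pairing => -[h1 h2].
congr pair; apply: (mulfI (lt0r_neq0 c0)); rewrite mulr0 /=; move: h1 h2; lra.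
Qed.

(** An edge that is no side of [t] can meet it only at an end of that edge, and the part between [x]
    and [y] contains no end that lies on [t]. *)
Lemma edge_inside t a b x y : graph_cycle T t -> adj T a b -> (a, b) \notin darts t -> (b, a) \notin darts t ->
  in_seg (p a) (p b) x -> in_seg (p a) (p b) y -> (y = p a -> a \notin t) -> (y = p b -> b \notin t) ->
  inside p t x -> inside p t y.
Proof.
move=> gt ab n1 n2 sx sy ya yb ix; have st := graph_cycle_simple nT gt.
have nab := adj_neq gT ab; have nba : b != a by rewrite eq_sym.
apply: (inside_seg st ix) => z zs bz.
have bdv k : k \in t -> boundary p t (p k).
  by move=> kt; exists (k, next t k); [rewrite mem_darts kt eqxx|exact: in_seg_l].
have xv k : k \in t -> x <> p k by move=> kt E; apply: ix.1; rewrite E; exact: bdv.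
have sz : in_seg (p a) (p b) z by case: zs => r [r01 ->]; exact: (in_seg_convex r01 sx sy).
have [k [kab kt zk]] := edge_meets_boundary nT gt ab n1 n2 sz bz.
case/orP: kab => /eqP E; rewrite E in kt zk.
  by apply: (in_seg_avoid_end sx sy (xv a kt) _ nab zs zk) => /ya; rewrite kt.
by apply: (in_seg_avoid_end (in_segC sx) (in_segC sy) (xv b kt) _ nba zs zk) => /yb; rewrite kt.
Qed.

Lemma edge_vertex_inside t a b x : graph_cycle T t -> adj T a b -> in_seg (p a) (p b) x -> inside p t x ->
  b \notin t -> inside p t (p b).
Proof.
move=> gt ab sx ix bt; have nab := adj_neq gT ab.
have nd1 : (a, b) \notin darts t.
  by rewrite mem_darts /=; apply/andP => -[at_ /eqP E]; rewrite E mem_next at_ in bt.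
have nd2 : (b, a) \notin darts t by rewrite mem_darts /= (negbTE bt).
apply: (edge_inside gt ab nd1 nd2 sx (in_seg_r _ _) _ _ ix) => // E.
by move: nab; rewrite (gp_inj n3 gp E) eqxx.
Qed.

Variable smp : 'I_n * 'I_n -> (R * R) * (R * R) * (R * R).
Hypothesis smpP : forall e, e.1 != e.2 -> sample p e.1 e.2 (smp e).1.1 (smp e).1.2 (smp e).2.

Definition flank (j : 'I_n * 'I_n * bool) : R * R := if j.2 then (smp j.1).1.2 else (smp j.1).2.

(** Its cardinality is the measure that decreases while an enclosing cycle is shrunk towards a
    face. *)
Definition flanks t : {set 'I_n * 'I_n * bool} := [set j | (j.1 \in T) && `[< inside p t (flank j) >]].

Lemma edge_neq e : e \in T -> e.1 != e.2.
Proof. by move/gT; rewrite neq_ltn => ->. Qed.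

Lemma flank_off e f (b : bool) : e \in T -> in_seg (p f.1) (p f.2) (flank (e, b)) -> f \in T -> False.
Proof.
move=> eT sf fT; have := @sample_off_l _ _ p _ _ _ _ _ (fun=> 1) (smpP (edge_neq eT)).
have := @sample_off_r _ _ p _ _ _ _ _ (fun=> 1) (smpP (edge_neq eT)).
by case: b sf => sf h1 h2; [apply: (h2 f)|apply: (h1 f)] => //; rewrite oner_neq0.
Qed.

Definition ear t a b g : Prop := [/\ a \in t, b \in t, a != b & uniq g /\ {in g, forall k, k \notin t}] /\
  path (adj T) a (rcons g b).

(** If both ends of [e] are on [t], the edge is the ear and [g] is empty. Otherwise an end off [t]
    is inside [t], and so is its component in the graph without [t]. By [two_attachments] this
    component is attached to [t] at two different vertices, and a simple path through it joins
    them. *)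
Lemma find_ear t e q : graph_cycle T t -> e \in T -> (e.1, e.2) \notin darts t -> (e.2, e.1) \notin darts t ->
  in_seg (p e.1) (p e.2) q -> inside p t q ->
  exists a b g c, [/\ ear t a b g, c = head b g, (a, c) \notin darts t, (c, a) \notin darts t &
    exists2 x, in_seg (p a) (p c) x & inside p t x].
Proof.
move=> gt eT n1 n2 sq iq; have [ut s3 ct] := gt.
have eadj := edge_adj eT.
have [[e1 e2]|H] : (e.1 \in t /\ e.2 \in t) \/ exists a b, [/\ b \notin t, adj T a b & in_seg (p a) (p b) q].
  have [e1|e1] := boolP (e.1 \in t); last first.
    by right; exists e.2, e.1; split=> //; [rewrite adjC|exact: in_segC].
  have [e2|e2] := boolP (e.2 \in t); first by left.
  by right; exists e.1, e.2.
  exists e.1, e.2, [::], e.2; split=> //; last by exists q.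
  by split; [split=> //; exact: edge_neq|rewrite /= eadj].
have [a [b [bt ab sb]]] := H.
have ib := edge_vertex_inside gt ab sb iq bt.
pose S := [set k in t]%SET.
have S2 : (2 <= #|S|)%N by rewrite cardsE (card_uniqP ut); exact: ltnW.
have bS : b \notin S by rewrite inE.
have [a1 [a2 [h1 [h2 [[a1S a2S a12 ah1 ah2] [c1 c2]]]]]] := two_attachments n3 gp lab sfT cT S2 bS.
rewrite !inE in a1S a2S.
have ih k : connect (avoid T S) b k -> inside p t (p k).
  case/connectP => s; elim: s (b) ib => [|y s IH] c ic /=; first by move=> _ ->.
  case/andP=> /and3P[cy _ yS]; rewrite inE in yS; apply: IH.
  exact: edge_vertex_inside gt cy (in_seg_l _ _) ic yS.
have c12 : connect (avoid T S) h1 h2.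
  by apply: connect_trans c2; rewrite (avoid_sym T S).
have h1S : h1 \notin t by have := connect_avoid bS c1; rewrite inE.
case/connectP: c12 => s0 ps0 ls0; case/shortenP: ps0 ls0 => s ps us _ h2E.
exists a1, a2, (h1 :: s), h1; split=> //.
- have pT : forall h s', path (avoid T S) h s' -> path (adj T) h s' /\ {in s', forall k, k \notin t}.
    move=> h s'; elim: s' h => //= y s' IH h /andP[/and3P[hy _ yS] /IH[-> h']]; rewrite hy; split=> // k.
    by rewrite inE => /orP[/eqP->|/h'//]; rewrite inE in yS.
  have [pa ns] := pT _ _ ps; split; first split=> //.
    by split=> // k; rewrite inE => /orP[/eqP->|/ns].
  by rewrite /= ah1 rcons_path pa -h2E adjC.
- by rewrite mem_darts /= a1S; apply/eqP => E; rewrite E mem_next a1S in h1S.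
- by rewrite mem_darts /= (negbTE h1S).
by exists (p h1); [exact: in_seg_r|exact: ih].
Qed.

Lemma sample_swap a b m u v : sample p a b m u v -> sample p b a m v u.
Proof.
case=> h1 h2 [h3 h4] h5 h6; split.
- exact: in_segC.
- exact: in_segC.
- by rewrite (_ : orient (p b) (p a) v = - orient (p a) (p b) v) 1?(_ : orient (p b) (p a) u = - orient (p a) (p b) u)
    ?oppr_gt0 ?oppr_lt0 //; rewrite /orient; ring.
- by move=> z /in_segC/h5 ap f /ap[]; [right|left].
by move=> c cc; rewrite -opprB h6 // opprB.
Qed.

Lemma adj_sample c d : adj T c d -> exists m u v j1 j2, [/\ sample p c d m u v, j1.1 \in T, j2.1 \in T,
  u = flank j1 & v = flank j2].
Proof.
case/orP=> eT; have := smpP (edge_neq eT).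
  by exists (smp (c, d)).1.1, (smp (c, d)).1.2, (smp (c, d)).2, ((c, d), true), ((c, d), false).
move/sample_swap => /= ?.
by exists (smp (d, c)).1.1, (smp (d, c)).2, (smp (d, c)).1.2, ((d, c), false), ((d, c), true).
Qed.

(* An edge inside t extends to an ear inside t. Whichever of the two smaller cycles encloses x, it
   does not enclose both flanks of the ear. *)
Lemma shrink_cycle t x e q : regions p T x -> graph_cycle T t -> inside p t x -> e \in T ->
  (e.1, e.2) \notin darts t -> (e.2, e.1) \notin darts t ->
  in_seg (p e.1) (p e.2) q -> inside p t q ->
  exists t', [/\ graph_cycle T t', inside p t' x & (#|flanks t'| < #|flanks t|)%N].
Proof.
move=> rx gt ix eT n1 n2 sq iq.
have [a [b [g [c [[[at_ bt ab [ug ng]] pg] cE nac nca [y sy iy]]]]]] := find_ear gt eT n1 n2 sq iq.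
have [ut s3 ct] := gt.
have [i t0 tE] := rot_to at_.
have bt0 : b \in t0 by move: bt; rewrite -(mem_rot i) tE inE eq_sym (negbTE ab).
have [A [B t0E]] : exists A B, t0 = A ++ b :: B by case/splitPr: bt0 => A B; exists A, B.
rewrite t0E in tE.
have inr_ z : inside p (a :: A ++ b :: B) z <-> inside p t z by rewrite -tE; exact: inside_rot.
have dr f : (f \in darts (a :: A ++ b :: B)) = (f \in darts t) by rewrite -tE darts_rot // mem_rot.
have memr k : (k \in a :: A ++ b :: B) = (k \in t) by rewrite -tE mem_rot.
have gr : graph_cycle T (a :: A ++ b :: B).
  by rewrite -tE; split; [rewrite rot_uniq|rewrite size_rot|rewrite rot_cycle].
have [ur r3 cr_] := gr.
have [pA pB] : path (adj T) a (rcons A b) /\ path (adj T) b (rcons B a).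
  by move: cr_; rewrite /= rcons_cat rcons_cons -cat_rcons cat_path last_rcons => /andP[].
have acadj : adj T a c by move: pg; rewrite cE; case: (g) => [|h g'] /= /andP[].
have A0 : g = [::] -> A != [::].
  move=> g0; apply: contraNneq nac => A0; rewrite cE g0 /= -dr darts_theta // A0 mem_cat inE eqxx.
  by [].
have B0 : g = [::] -> B != [::].
  move=> g0; apply: contraNneq nca => B0; rewrite cE g0 /= -dr darts_theta // B0 mem_cat !inE eqxx orbT.
  by [].
have pgr : path (adj T) b (rcons (rev g) a).
  have := pg; rewrite -rev_path belast_rcons last_rcons rev_cons.
  by rewrite (eq_path (e' := adj T)) // => k l; rewrite /= adjC.
have dis k : k \in g -> k \notin a :: A ++ b :: B by rewrite memr; exact: ng.
have gr1 : graph_cycle T (a :: A ++ b :: rev g).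
  split; last by rewrite /= rcons_cat rcons_cons -cat_rcons cat_path last_rcons pA.
    have : uniq ((a :: A ++ [:: b]) ++ rev g).
      rewrite cat_uniq rev_uniq ug andbT; apply/andP; split.
        by move: ur; rewrite -cat_cons -[b :: B]cat1s catA cat_uniq => /andP[].
      apply/hasPn => k; rewrite mem_rev => /dis; apply: contra; rewrite !(inE, mem_cat) -?orbA.
      by case/or3P=> ->; rewrite ?orbT.
    by rewrite -cat_cons -cat_cons -catA.
  by rewrite /= size_cat /= size_rev addnS !ltnS; move: A0; case: (g) => [/(_ erefl)|]; case: (A) => //= *; rewrite addnS.
have gr2 : graph_cycle T (a :: g ++ b :: B).
  split; last by rewrite /= rcons_cat rcons_cons -cat_rcons cat_path last_rcons pg.
    have : uniq (g ++ (a :: b :: B)).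
      rewrite cat_uniq ug andTb; apply/andP; split.
        apply/hasPn => k kabB; apply/negP => /dis/negP; apply; move: kabB.
        by rewrite !(inE, mem_cat) => /or3P[] ->; rewrite ?orbT.
      move: ur => /=; rewrite !mem_cat !inE !negb_or cat_uniq /= => /andP[/and3P[_ -> ->]] /and3P[_ _ ->].
      by [].
    by rewrite -[a :: b :: B]cat1s uniq_catCA /= mem_cat negb_or => /andP[-> ->].
  by rewrite /= size_cat /= addnS !ltnS; move: B0; case: (g) => [/(_ erefl)|]; case: (B) => //= *; rewrite ?addnS.
have [st st1 st2] := And3 (graph_cycle_simple nT gr) (graph_cycle_simple nT gr1) (graph_cycle_simple nT gr2).
have [ut1 _ _] := gr1; have [ut2 _ _] := gr2.
have cd : (a, c) \in walk a (rcons g b) by rewrite cE; case: (g) => [|h g'] /=; rewrite inE eqxx.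
have [m [u [v [j1 [j2 [sa j1T j2T uE vE]]]]]] := adj_sample acadj; have [ms mu _ ap _] := sa.
have ac := adj_neq gT acadj.
have im : inside p t m.
  apply: (edge_inside gt acadj nac nca sy ms _ _ iy) => E; by case: (apart_vertex ac (ap m mu) E).
have iu := sample_inside_seg (graph_cycle_simple nT gt) sa (in_seg_l u v) nac nca im.
have iv := sample_inside_seg (graph_cycle_simple nT gt) sa (in_seg_r u v) nac nca im.
have iur := (inr_ u).2 iu; have ivr := (inr_ v).2 iv.
have th := theta_inside n3 gp ur ut1 ut2 st st1 st2 cd sa iur ivr.
have walk_adj f : f \in walk a (rcons g b) -> adj T f.1 f.2.
  move=> fw; have : f \in darts (a :: g ++ b :: B) by rewrite darts_theta // mem_cat fw.
  exact: dart_adj.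
have free z : (forall f, f \in T -> ~ in_seg (p f.1) (p f.2) z) -> 
    inside p t z <-> inside p (a :: A ++ b :: rev g) z \/ inside p (a :: g ++ b :: B) z.
  move=> fz; rewrite -inr_; apply: (th z _ _).1.
    by case/(boundary_edge gr) => f fT s; exact: (fz f fT s).
  by case=> f /walk_adj /orP[] fT s; [exact: (fz (f.1, f.2) fT s)|exact: (fz (f.2, f.1) fT (in_segC s))].
have mono t' : graph_cycle T t' -> (forall z, (forall f, f \in T -> ~ in_seg (p f.1) (p f.2) z) -> inside p t' z -> inside p t z) ->
    ~ (inside p t' u /\ inside p t' v) -> (#|flanks t'| < #|flanks t|)%N.
  move=> gt' sub nuv; apply: proper_card; apply/fintype.properP; split.
    apply/fintype.subsetP => -[f d]; rewrite !inE => /andP[fT /asboolP i']; rewrite fT; apply/asboolP.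
    by apply: sub i' => f' f'T s'; exact: (flank_off fT s' f'T).
  have [iu'|niu'] := pselect (inside p t' u).
    exists j2; rewrite inE j2T -vE; first by apply/asboolP.
    by apply/asboolP => iv'; apply: nuv.
  by exists j1; rewrite inE j1T -uE; apply/asboolP.
have [_ [_ xf]] := rx.
case: ((free x xf).1 ix) => ix'.
  exists (a :: A ++ b :: rev g); split=> //; apply: mono => // [z fz iz|]; first by apply/(free z fz); left.
  exact: (theta_loses_sample n3 gp ut1 st1 cd sa).
exists (a :: g ++ b :: B); split=> //; apply: mono => // [z fz iz|]; first by apply/(free z fz); right.
exact: (theta_loses_sample' n3 gp ut2 st2 cd sa).
Qed.

End EnclosingCycles.

(** * Regions of a maximal graph are interiors of cycles *)

Section Faces.
Variables (R : realType) (n : nat) (p : 'I_n -> (R * R)%type).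
Hypotheses (n3 : (3 <= n)%N) (gp : general_position p) (lab : labeled_y p).
Implicit Types (t : seq 'I_n) (x y z u v m q : (R * R)%type) (a b i j k l : 'I_n) (e : 'I_n * 'I_n).
Variable T : {set 'I_n * 'I_n}.
Hypotheses (gT : graph_on T) (nT : non_crossing p T) (sfT : stress_free p T) (cT : #|T| = (2 * n - 3)%N).
Hypothesis hullT : forall i j, ccw_side p finset.setT i j -> adj T i j.

(** A convex combination lies on the line of a hull edge only if it lies on the edge itself, and
    hull edges belong to the graph. *)
Lemma region_left_of_hull x i j : regions p T x -> ccw_side p finset.setT i j ->
  0 < orient (p i) (p j) x.
Proof.
move=> [[w [w0 [w1 xE]]] [xp xT]] ij; have /ccw_sideP[_ _ nij H] := ij.
have oE : orient (p i) (p j) x = \sum_k w k * orient (p i) (p j) (p k).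
  have S (c0 c1 c2 : R) : \sum_k w k * (c0 + c1 * (p k).1 + c2 * (p k).2) = c0 + c1 * x.1 + c2 * x.2.
    rewrite xE /= !mulr_sumr -[c0 in RHS]mulr1 -w1 mulr_sumr -!big_split /=.
    by apply: eq_bigr => k _; ring.
  have oA z : orient (p i) (p j) z = ((p j).2 - (p i).2) * (p i).1 - ((p j).1 - (p i).1) * (p i).2
      + ((p i).2 - (p j).2) * z.1 + ((p j).1 - (p i).1) * z.2 by rewrite /orient; ring.
  by rewrite oA -S; apply: eq_bigr => k _; rewrite oA.
have nn k : 0 <= w k * orient (p i) (p j) (p k).
  apply: mulr_ge0 => //; have [->|ki] := eqVneq k i; first by rewrite /orient !subrr !mulr0 subrr.
  have [->|kj] := eqVneq k j; first by rewrite /orient (mulrC ((p j).2 - _)) subrr.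
  by apply/ltW/H; rewrite ?inE.
rewrite lt_neqAle oE sumr_ge0 // andbT eq_sym; apply/eqP => S0.
have wz k : k != i -> k != j -> w k = 0.
  move=> ki kj; have h := psumr_eq0P (fun k _ => nn k) S0; have /eqP := h k isT.
  by rewrite mulf_eq0 [X in _ || X]gt_eqF ?orbF ?H ?inE // => /eqP.
have two (F : 'I_n -> R) : \sum_k w k * F k = w i * F i + w j * F j.
  rewrite (bigD1 i) //= (bigD1 j) 1?eq_sym //= big1 ?addr0 // => k /andP[ki kj].
  by rewrite wz ?mul0r.
have w2 : w i + w j = 1.
  by have := two (fun=> 1); rewrite !mulr1 => <-; rewrite -[RHS]w1; apply: eq_bigr => k _; rewrite mulr1.
have s : in_seg (p i) (p j) x.
  exists (w j); split; first by rewrite w0 /= -w2 lerDr.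
  by rewrite xE !two (_ : w i = 1 - w j); [congr pair; ring|rewrite -w2 addrK].
by case/orP: (hullT ij) => eT; [exact: (xT _ eT)|exact: (xT _ eT (in_segC s))].
Qed.

(** Since [x] is left of all hull edges, all crossings count non-negatively. Were the winding number
    0, no side would cross the ray; starting from a vertex below the ray, all vertices would then be
    below it, although some vertex is above. *)
Lemma hull_cycle x : regions p T x -> exists2 t, graph_cycle T t & inside p t x.
Proof.
move=> rx; have [i0 ext0] : exists i, extreme p finset.setT i.
  apply: extreme_exists => //; apply/set0Pn; exists (Ordinal (ltnW (ltnW n3))); exact: finset.in_setT.
set t := orbit (hull_next p) i0.
have sd := hull_orbit_side n3 gp ext0; rewrite -/t in sd.
have it i : i \in t -> hull_next p i \in t by exact: hull_orbit_next.
have fc : fcycle (hull_next p) t := cycle_orbit (hull_next_inj n3 gp) i0.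
have nx i : i \in t -> next t i = hull_next p i by move=> /(next_cycle fc)/eqP.
have ut : uniq t := orbit_uniq _ _.
have i0t : i0 \in t by rewrite -fconnect_orbit connect0.
have gt : graph_cycle T t.
  split=> //; last by apply: cycle_from_next => // k kt; rewrite nx //; apply/hullT/sd.
  have s1 := sd _ i0t; have s2 := sd _ (it _ i0t).
  have /ccw_sideP[_ _ d1 _] := s1; have /ccw_sideP[_ _ d2 _] := s2.
  have d3 : i0 != hull_next p (hull_next p i0).
    by apply/eqP => E; have := ccw_side_asym (card_setT3 n3) s1; rewrite -E in s2; rewrite s2.
  apply: (@uniq_leq_size _ [:: i0; hull_next p i0; hull_next p (hull_next p i0)]).
    by rewrite /= !inE negb_or d1 d3 d2.
  by move=> k; rewrite !inE => /or3P[] /eqP->; rewrite ?it.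
exists t => //; have nb : ~ boundary p t x.
  by case/(boundary_edge gt) => e eT s; case: rx => _ [_ /(_ e eT)].
split=> //; rewrite /winding /wind (sum_cycle_flow t (fun e => cr (1, 0) x (p e.1) (p e.2))) /=.
have left i : i \in t -> 0 < orient x (p i) (p (next t i)).
  by move=> ti; rewrite -orient_rot nx //; apply: region_left_of_hull => //; exact: sd.
have ge0 i : i \in t -> 0 <= cr (1, 0) x (p i) (p (next t i)).
  by move=> ti; rewrite /cr left // [orient _ _ _ < 0]ltNge (ltW (left i ti)) !andbF; case: ifP.
apply/eqP => W0; have surr u : u != 0 -> exists2 i, i \in t & dot u (vec x (p i)) < 0.
  move=> un; apply: (left_of_hull_surrounded n3 gp ext0 un) => i ti.
  by apply: region_left_of_hull => //; exact: sd.
have neq (c : R) : c != 0 -> ((0, c) : R * R) != 0 by move=> cn; apply: contra_neq cn => -[].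
have [i ti si] := surr _ (neq 1 (oner_neq0 _)).
have [|j tj sj] := surr _ (neq (-1) _); first by rewrite oppr_eq0 oner_eq0.
have step_neg k : k \in t -> side (1, 0) x (p k) < 0 -> side (1, 0) x (p (next t k)) < 0.
  move=> kt sk; rewrite ltNge; apply/negP => sn.
  have : cr (1, 0) x (p k) (p (next t k)) = 1 by rewrite /cr sk sn left.
  move: W0; rewrite (big_uniq _ ut) /= => W0.
  by have h := psumr_eq0P ge0 W0; rewrite (h k kt) => /eqP; rewrite eq_sym oner_eq0.
have := fconnect_cycle (cycle_next ut) ti j; rewrite tj => /iter_findex E.
have : side (1, 0) x (p j) < 0.
  have N c : iter c (next t) i \in t /\ side (1, 0) x (p (iter c (next t) i)) < 0.
    elim: c => [|c [h1 h2]] /=; last by rewrite mem_next; split=> //; exact: step_neg.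
    by split=> //; move: si; rewrite /dot /side /vec /=; lra.
  by rewrite -E; case: (N (findex (next t) i j)).
by move: sj; rewrite /dot /side /vec /=; lra.
Qed.

(** The hull cycle is shrunk around [x] until no edge has a point inside. Points inside the final
    cycle avoid the vertices too, because every vertex has an edge by [laman_degree]. *)
Lemma maximal_face x : regions p T x -> exists2 t, graph_cycle T t &
  connected_component (regions p T) x = inside p t.
Proof.
move=> rx.
have [smp smpP] : {smp : 'I_n * 'I_n -> (R * R) * (R * R) * (R * R) &
    forall e, e.1 != e.2 -> sample p e.1 e.2 (smp e).1.1 (smp e).1.2 (smp e).2}.
  apply: (@choice _ _ (fun e (s : (R * R) * (R * R) * (R * R)) => e.1 != e.2 -> sample p e.1 e.2 s.1.1 s.1.2 s.2)) => e.
  have [E|ne] := eqVneq e.1 e.2; first by exists (0, 0, 0).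
  by have [m [u [v sa]]] := sample_exists n3 gp ne; exists (m, u, v).
have [t gt [ix empty]] : exists2 t, graph_cycle T t & inside p t x /\
    forall e q, e \in T -> in_seg (p e.1) (p e.2) q -> ~ inside p t q.
  have [t0 gt0 ix0] := hull_cycle rx.
  have [N] := ubnP #|flanks p T smp t0|; elim: N t0 gt0 ix0 => // N IH t gt ix tN.
  have [[e [q [eT sq iq]]]|none] := pselect (exists e q, [/\ e \in T, in_seg (p e.1) (p e.2) q & inside p t q]); last first.
    by exists t => //; split=> // e q eT sq iq; apply: none; exists e, q.
  have n1 : (e.1, e.2) \notin darts t by apply/negP => h; apply: iq.1; exists (e.1, e.2).
  have n2 : (e.2, e.1) \notin darts t by apply/negP => h; apply: iq.1; exists (e.2, e.1) => //; exact: in_segC.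
  have [t' [gt' ix' lt]] := shrink_cycle n3 gp lab gT nT sfT cT smpP rx gt ix eT n1 n2 sq iq.
  by apply: (IH t') => //; exact: leq_trans lt tN.
exists t => //; have st := graph_cycle_simple nT gt; have [ut _ _] := gt.
have ireg y : inside p t y -> regions p T y.
  move=> iy; split.
    apply: contrapT => ny; case: iy => nb /eqP; apply.
    by apply: (wind_outside_hull (Ordinal (ltnW (ltnW n3))) (cycle_flow_circ ut)) ny; apply/off_cycle_flow.
  split=> [k yk|e eT s]; last exact: (empty e y eT s).
  have [l /orP[] eT] := laman_degree n3 gp lab sfT cT k.
    by apply: (empty _ y eT) => //=; rewrite yk; exact: in_seg_l.
  by apply: (empty _ y eT) => //=; rewrite yk; exact: in_seg_r.
apply/seteqP; split=> y.
  case=> A [Ax sA cA] Ay; apply: (inside_comp st ix); exists A => //; split=> // z /sA rz.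
  by case/(boundary_edge gt) => e eT s; case: rz => _ [_ /(_ e eT)].
move=> iy; have [A [Ax sA cA] Ay] := inside_same n3 gp st ix iy.
exists A => //; split=> // z Az; apply: ireg; apply: (inside_comp st ix).
by exists A.
Qed.

End Faces.

Lemma homogeneous_solution (F : fieldType) (I J : finType) (U : {set I}) (Y : {set J}) (A : I -> J -> F) :
  (#|Y| < #|U|)%N -> exists c : I -> F, [/\ exists i, c i != 0, forall i, i \notin U -> c i = 0 &
    forall j, j \in Y -> \sum_i c i * A i j = 0].
Proof.
move=> YU; pose M := \matrix_(i < #|U|, j < #|Y|) A (enum_val i) (enum_val j).
have kn : kermx M != 0.
  by rewrite -mxrank_eq0 mxrank_ker -lt0n subn_gt0; apply: leq_ltn_trans YU; exact: rank_leq_col.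
pose v := nz_row (kermx M).
have vM : v *m M = 0 by apply/sub_kermxP; exact: nz_row_sub.
have [a va] : exists a, v ord0 a != 0.
  have : v != 0 by rewrite nz_row_eq0.
  apply: contra_neqP => N; apply/rowP => a; rewrite mxE; apply/eqP/negPn/negP => h; apply: N.
  by exists a.
pose c i := \sum_(b < #|U|) (enum_val b == i)%:R * v ord0 b.
have cE (G : I -> F) : \sum_i c i * G i = \sum_(b < #|U|) v ord0 b * G (enum_val b).
  rewrite /c; under eq_bigr do rewrite mulr_suml.
  rewrite exchange_big; apply: eq_bigr => b _ /=.
  rewrite (bigD1 (enum_val b)) //= eqxx mul1r big1 ?addr0 // => i ib.
  by rewrite eq_sym (negbTE ib) !mul0r.
exists c; split=> [|i iU|j jY].
- exists (enum_val a); rewrite /c (bigD1 a) //= eqxx mul1r big1 ?addr0 // => b ba.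
  by rewrite (inj_eq enum_val_inj) (negbTE ba) mul0r.
- by apply: big1 => b _; case: eqP => [E|]; [rewrite -E enum_valP in iU|rewrite mul0r].
rewrite cE; have := congr1 (fun N : 'rV_ _ => N ord0 (enum_rank_in jY j)) vM.
rewrite /= mxE [in RHS]mxE => E; apply: etrans E.
by apply: eq_bigr => b _; rewrite mxE enum_rankK_in.
Qed.

(** * The angle of a cycle at a convex vertex *)

Section Wedges.
Variables (R : realType) (n : nat) (p : 'I_n -> (R * R)%type).
Hypotheses (n3 : (3 <= n)%N) (gp : general_position p).
Implicit Types (t : seq 'I_n) (w : (R * R)%type) (a b k : 'I_n).

(* The side of the interior angle of t at k from which one turns counterclockwise into it. *)
Definition wedge_start t k : 'I_n :=
  if 0 < orient (p k) (p (next t k)) (p (prev t k)) then next t k else prev t k.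

Lemma convex_wedge t k : simple_cycle p t -> k \in t -> convex_at p t k ->
  exists b, [/\ (b == next t k) || (b == prev t k), 0 < orient (p k) (p (wedge_start t k)) (p b) &
    \forall w \near p k, 0 < cross (vec (p k) (p (wedge_start t k))) (vec (p k) w) ->
       0 < cross (vec (p k) w) (vec (p k) (p b)) -> inside p t w].
Proof.
move=> st kt ck; have [ut s3 _] := st; have [nk pk npk] := next_neighbours ut s3 kt.
have on : orient (p k) (p (next t k)) (p (prev t k)) != 0 by apply: (orient_neq0 gp); rewrite // eq_sym.
have DE : cross (vec (p k) (p (next t k))) (vec (p k) (p (prev t k))) = orient (p k) (p (next t k)) (p (prev t k)).
  by rewrite /cross /vec /orient /=; ring.
have := convex_cone n3 gp st kt ck; rewrite /= DE /wedge_start.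
case: ifPn => o0 N.
  exists (prev t k); split; rewrite ?eqxx ?orbT //.
  by apply: filterS N => w H h1 h2; apply/H; rewrite !mulr_gt0.
have {}o0 : orient (p k) (p (next t k)) (p (prev t k)) < 0 by rewrite lt_neqAle on leNgt.
exists (next t k); split; rewrite ?eqxx //; first by rewrite orient_swap oppr_gt0.
have crossC (x y : R * R) : cross x y = - cross y x by rewrite /cross; ring.
apply: filterS N => w H h1 h2; apply/H.
by split; rewrite [X in 0 < X * _]crossC nmulr_lgt0 // oppr_lt0.
Qed.

(** Both interior angles open to the left of the same edge, so a short vector obtained by turning
    this edge slightly to the left points into both. *)
Lemma wedge_common_point t t' k : simple_cycle p t -> simple_cycle p t' -> k \in t -> k \in t' ->
  convex_at p t k -> convex_at p t' k -> wedge_start t k = wedge_start t' k ->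
  exists2 w, inside p t w & inside p t' w.
Proof.
move=> st st' kt kt' ck ck' E.
have [b [_ ob nb]] := convex_wedge st kt ck; have [b' [_ ob' nb']] := convex_wedge st' kt' ck'.
rewrite -E in ob' nb'; set a := wedge_start t k in ob nb ob' nb' *.
pose va := vec (p k) (p a).
have va0 : va != 0.
  by apply: contraTneq ob => -[h1 h2]; rewrite (_ : orient _ _ _ = 0) ?ltxx // /orient h1 h2 !mul0r subrr.
have wb c : 0 < orient (p k) (p a) (p c) -> \forall y \near va, 0 < cross y (vec (p k) (p c)).
  move=> oc; apply: (@near_affine_gt0 _ va _ 0 (vec (p k) (p c)).2 (- (vec (p k) (p c)).1)).
    by move=> y; rewrite /cross; ring.
  by move: oc; rewrite /orient /cross /va /vec /=; lra.
have [s [s0 [[h1 h2] _]]] := @filter_ex _ _ (at_right_proper_filter (0 : R)) _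
  (filterI (nbhs_right_gt (0 : R)) (near_step (perp va) (filterI (wb b ob) (wb b' ob')))).
set y := step va s (perp va) in h1 h2.
have [r [r0 [[g1 g2] _]]] := @filter_ex _ _ (at_right_proper_filter (0 : R)) _
  (filterI (nbhs_right_gt (0 : R)) (near_step y (filterI nb nb'))).
have vE : vec (p k) (step (p k) r y) = (r * y.1, r * y.2) by rewrite /vec /step /=; congr pair; ring.
have c1 : 0 < cross va (vec (p k) (step (p k) r y)).
  rewrite vE (_ : cross _ _ = r * s * dot va va); last by rewrite /cross /y /perp /step /dot /=; ring.
  by rewrite !mulr_gt0 ?dot_gt0.
have c2 c : 0 < cross y (vec (p k) (p c)) -> 0 < cross (vec (p k) (step (p k) r y)) (vec (p k) (p c)).
  move=> h; rewrite vE (_ : cross _ _ = r * cross y (vec (p k) (p c))); last by rewrite /cross /=; ring.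
  by rewrite mulr_gt0.
by exists (step (p k) r y); [apply: g1 => //; exact: c2|apply: g2 => //; exact: c2].
Qed.

End Wedges.

(** * Counting convex angles at pointed vertices *)

Section AngleCount.
Variables (R : realType) (n : nat) (p : 'I_n -> (R * R)%type).
Hypotheses (n3 : (3 <= n)%N) (gp : general_position p).
Variable T : {set 'I_n * 'I_n}.
Hypotheses (gT : graph_on T) (pT : pointed p T) (degT : forall k, exists l, adj T k l).
Implicit Types (a b k l : 'I_n) (e : 'I_n * 'I_n).

(** A pair (k, a) stands for the angle at [k] that starts at the edge to [a] and extends
    counterclockwise; some other edge follows within less than pi. *)
Definition convex_angles : {set 'I_n * 'I_n} :=
  [set e | adj T e.1 e.2 && [exists b, adj T e.1 b && (0 < orient (p e.1) (p e.2) (p b))]].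

Lemma sum_degrees : (\sum_k #|nbr T k| = 2 * #|T|)%N.
Proof.
have -> : (\sum_k #|nbr T k| = \sum_(e : 'I_n * 'I_n) adj T e.1 e.2)%N.
  rewrite -(pair_bigA _ (fun k l => (adj T k l : nat))) /=; apply: eq_bigr => k _.
  by rewrite -sum1_card big_mkcond /=; apply: eq_bigr => l _; rewrite inE; case: adj.
transitivity (\sum_(e : 'I_n * 'I_n) ((e \in T) + (swap e \in T)))%N.
  apply: eq_bigr => -[k l] _; rewrite /adj /swap /=.
  have [h|] := boolP ((k, l) \in T); have [h'|] := boolP ((l, k) \in T) => //.
  by have := gT h; have := gT h'; rewrite /= => /ltnW; rewrite leqNgt => /negP.
rewrite big_split /= [X in (_ + X)%N](reindex_inj (h := @swap n)) /=; last by case=> [a b] [c d] [-> ->].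
have -> : (\sum_(e : 'I_n * 'I_n) (swap (swap e) \in T) = \sum_(e : 'I_n * 'I_n) (e \in T))%N.
  by apply: eq_bigr => -[].
by rewrite mul2n -addnn -!sum1_card !(big_mkcond (mem T)) /=; congr (_ + _)%N; apply: eq_bigr => e _; case: (e \in T).
Qed.

(* At each vertex the last edge before the reflex angle starts no convex angle. *)
Lemma card_convex_angles : (#|convex_angles| + n <= 2 * #|T|)%N.
Proof.
have -> : #|convex_angles| = (\sum_k #|[pred a | (k, a) \in convex_angles]|)%N.
  under eq_bigr do rewrite -sum1_card.
  by rewrite pair_big_dep /= -sum1_card; apply: eq_bigl => -[].
rewrite -sum_degrees -[n in (_ + n)%N]card_ord -sum1_card -big_split /=; apply: leq_sum => k _.
have kN := nbr_irr k gT; have hk := (pointed_atP n3 gp k gT).1 (pT k).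
have N0 : nbr T k != finset.set0 by have [l kl] := degT k; apply/set0Pn; exists l; rewrite inE.
have [_ [b bN bsink]] := no_triple_source gp kN N0 (halfplane_no_triple hk).
rewrite addn1 (cardsD1 b) bN ltnS; apply: subset_leq_card; apply/fintype.subsetP => a.
rewrite !inE /= => /andP[ka /existsP[c /andP[kc o0]]]; rewrite ka andbT.
apply: contraTneq o0 => E; rewrite E -leNgt; have [->|cb] := eqVneq c b.
  by rewrite (_ : orient _ _ _ = 0) // /orient; ring.
by rewrite orient_swap oppr_le0; apply/ltW/bsink; rewrite ?inE.
Qed.

End AngleCount.

(** * Counting faces and their corners *)

Section FaceCount.
Variables (R : realType) (n : nat) (p : 'I_n -> (R * R)%type).
Hypotheses (n3 : (3 <= n)%N) (gp : general_position p) (lab : labeled_y p).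
Variable T : {set 'I_n * 'I_n}.
Hypotheses (pT : pointed_noncrossing p T) (sfT : stress_free p T) (cT : #|T| = (2 * n - 3)%N).
Hypothesis hullT : forall i j, ccw_side p finset.setT i j -> adj T i j.
Implicit Types (t : seq 'I_n) (x y z : (R * R)%type) (k l : 'I_n) (e : 'I_n * 'I_n) (j : 'I_n * 'I_n * bool).

Let gT : graph_on T. Proof. by case: pT. Qed.
Let nT : non_crossing p T. Proof. by case: pT => _ []. Qed.
Let degT k : exists l, adj T k l. Proof. by have [l h] := laman_degree n3 gp lab sfT cT k; exists l. Qed.

Variable smp : 'I_n * 'I_n -> (R * R) * (R * R) * (R * R).
Hypothesis smpP : forall e, e.1 != e.2 -> sample p e.1 e.2 (smp e).1.1 (smp e).1.2 (smp e).2.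
Local Notation pt := (flank smp).
Local Notation comp := (connected_component (regions p T)).

Definition inner j : bool := (j.1 \in T) && `[< regions p T (pt j) >].

Definition same_face j j' : bool := `[< comp (pt j) (pt j') >].

(** [pick] depends only on the values of its predicate, so all sample points of one face get the
    same representative. Faces are thereby counted by finitely many indices; the default value
    occurs only for points outside all regions. *)
Definition face_repr_index j := odflt j [pick j' | inner j' && same_face j j'].

Definition face_indices : {set 'I_n * 'I_n * bool} := [set face_repr_index j | j in [pred j | inner j]]%SET.

Lemma innerP j : reflect (j.1 \in T /\ regions p T (pt j)) (inner j).
Proof. by apply: (iffP andP) => -[h /asboolP]. Qed.

Lemma face_repr_indexP j : inner j -> inner (face_repr_index j) /\ comp (pt j) (pt (face_repr_index j)).
Proof.
move=> ij; rewrite /face_repr_index; case: pickP => /= [j' /andP[h1 /asboolP h2] //|/(_ j)].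
by rewrite ij /= => /negP[]; apply/asboolP/connected_component_refl; case/innerP: ij.
Qed.

Lemma face_repr_index_eq j j' : inner j -> comp (pt j) (pt j') -> face_repr_index j = face_repr_index j'.
Proof.
move=> ij jj'; rewrite /face_repr_index; have E : (fun i => inner i && same_face j i) =1 (fun i => inner i && same_face j' i).
  move=> i /=; congr (_ && _); apply: asbool_equiv_eq; split; apply: connected_component_trans => //.
  exact: connected_component_sym.
rewrite (eq_pick E); case: pickP => //= /(_ j); rewrite ij /= => /negP[].
by apply/asboolP; exact: connected_component_sym.
Qed.

Lemma face_indicesP j : j \in face_indices -> inner j /\ face_repr_index j = j.
Proof.
case/imsetP => i; rewrite inE => ii ->; have [h1 h2] := face_repr_indexP ii; split=> //.
by rewrite -(face_repr_index_eq ii h2).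
Qed.

Lemma face_indices_inj j j' : j \in face_indices -> j' \in face_indices -> comp (pt j) (pt j') -> j = j'.
Proof.
move=> h h' c; have [ij E] := face_indicesP h; have [_ E'] := face_indicesP h'.
by rewrite -E -E'; exact: face_repr_index_eq.
Qed.

(* A circulation on T that winds zero times around every bounded face vanishes. *)
Lemma card_faces_ge : (#|T| <= n.-1 + #|face_indices|)%N.
Proof.
rewrite leqNgt; apply/negP => lt.
pose k0 : 'I_n := Ordinal (ltnW (ltnW n3)).
(* The equations for an unknown circulation: Kirchhoff's law at all vertices but one, and winding
   number 0 at one sample point of each face. Fewer equations than edges would leave a nonzero
   solution. *)
pose Y : {set 'I_n + 'I_n * 'I_n * bool} :=
  [set y | match y with inl k => k != k0 | inr j => j \in face_indices end]%SET.
pose A e (y : 'I_n + 'I_n * 'I_n * bool) : R := match y with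
  | inl k => (e.1 == k)%:R - (e.2 == k)%:R
  | inr j => cr (1, 0) (pt j) (p e.1) (p e.2) end.
have cY : #|Y| = (n.-1 + #|face_indices|)%N.
  rewrite -sum1_card big_mkcond big_sumType /= -!big_mkcond /=; congr (_ + _)%N.
    under eq_bigl do rewrite inE.
    rewrite sum1_card -[n in RHS]card_ord -(cardC1 k0).
    by apply: eq_card => k; rewrite !inE.
  under eq_bigl do rewrite inE.
  by rewrite sum1_card.
have [|c [[e0 ce0] cT0 cA]] := homogeneous_solution (U := T) (Y := Y) A; first by rewrite cY.
have cc : circ c.
  (* The law at the omitted vertex follows, since the laws of all vertices sum to zero. *)
  have V k : \sum_e c e * ((e.1 == k)%:R - (e.2 == k)%:R) = 0.
    have V' l : l != k0 -> \sum_e c e * ((e.1 == l)%:R - (e.2 == l)%:R) = 0.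
      by move=> lk; have := cA (inl l); rewrite inE => /(_ lk).
    have [->|/V' //] := eqVneq k k0.
    have : \sum_l \sum_e c e * ((e.1 == l)%:R - (e.2 == l)%:R) = 0.
      rewrite exchange_big big1 // => e _ /=; rewrite -mulr_sumr sumrB.
      have one (i : 'I_n) : \sum_l (i == l)%:R = 1 :> R.
        by rewrite (bigD1 i) //= eqxx big1 ?addr0 // => l /negbTE; rewrite eq_sym => ->.
      by rewrite !one subrr mulr0.
    by rewrite (bigD1 k0) //= [X in _ + X]big1 ?addr0 // => l /V'.
  move=> g; transitivity (\sum_k g k * \sum_e c e * ((e.1 == k)%:R - (e.2 == k)%:R)); last first.
    by apply: big1 => k _; rewrite V mulr0.
  under [RHS]eq_bigr do rewrite mulr_sumr.
  rewrite exchange_big; apply: eq_bigr => e _ /=.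
  have pick (i : 'I_n) : \sum_k g k * (i == k)%:R = g i.
    rewrite (bigD1 i) //= eqxx mulr1 big1 ?addr0 // => k /negbTE; rewrite eq_sym => ->.
    by rewrite mulr0.
  rewrite -(pick e.1) -(pick e.2) -sumrB mulr_sumr; apply: eq_bigr => k _.
  by rewrite mulrCA -mulrBr.
have offr x : regions p T x -> off p c x.
  move=> [_ [_ H]] e ce; apply: H; apply: contraNT ce => /cT0 ->.
  by rewrite eqxx.
(* Sample points of a face inherit the value at its representative, and those outside the convex
   hull have winding number 0 anyway. So the jump across every edge, which is its flow, vanishes. *)
have W0 j : j.1 \in T -> winding p c (pt j) = 0.
  move=> jT; have [ij|nij] := boolP (inner j).
    have [_ [B [Bj sB cB] Bj']] := face_repr_indexP ij.
    have := cA (inr (face_repr_index j)); rewrite inE imset_f ?inE // => /(_ isT) <-.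
    rewrite -/(winding p c (pt (face_repr_index j))).
    by apply/esym/(wind_connected cc (dir10 R) cB) => // z /sB; exact: offr.
  have fo f : f \in T -> ~ in_seg (p f.1) (p f.2) (pt j).
    by move=> fT s; apply: (flank_off gT smpP (b := j.2) jT _ fT); rewrite -surjective_pairing.
  have oj : off p c (pt j).
    by move=> e ce; apply: fo; apply: contraNT ce => /cT0 ->; rewrite eqxx.
  apply: (wind_outside_hull k0 cc oj) => hj; move/negP: nij; apply; apply/innerP; split=> //.
  split=> //; split=> // k E; have [l /orP[] kl] := degT k; apply: (fo _ kl) => /=; rewrite E.
    exact: in_seg_l.
  exact: in_seg_r.
have e0T : e0 \in T by apply: contraNT ce0 => /cT0 ->; rewrite eqxx.
have [_ _ _ _ J] := smpP (edge_neq gT e0T); have := J c cc.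
have := W0 (e0, true) e0T; have := W0 (e0, false) e0T; rewrite /flank /= => -> ->.
rewrite (cT0 (e0.2, e0.1)) ?subr0 ?subrr -?surjective_pairing; first by move=> E; rewrite -E eqxx in ce0.
by apply/negP => /gT /=; rewrite ltnNge ltnW // gT.
Qed.

Variable cyc : 'I_n * 'I_n * bool -> seq 'I_n.
Hypothesis cycP : forall j, inner j -> graph_cycle T (cyc j) /\ comp (pt j) = inside p (cyc j).

Definition corners j : {set 'I_n} := [set k | (k \in cyc j) && `[< convex_at p (cyc j) k >]]%SET.

Lemma corners_ge3 j : inner j -> (3 <= #|corners j|)%N.
Proof.
move=> /cycP[gc _]; have st := graph_cycle_simple nT gc; have [ut s3 _] := gc.
have [|a [b [c [ea eb ec [ab bc ac]]]]] := @three_extremes _ _ p n3 gp [set i in cyc j]%SET.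
  by rewrite cardsE (card_uniqP ut).
have <- : #|[set a; b; c]%SET| = 3%N.
  by rewrite finset.setUC cardsU1 cards2 !inE ![c == _]eq_sym negb_or ab bc ac.
apply: subset_leq_card; apply/fintype.subsetP => k; rewrite !inE -orbA.
have K i : extreme p [set i in cyc j]%SET i -> (i \in cyc j) && `[< convex_at p (cyc j) i >].
  by move=> ei; have [ic _] := ei; rewrite inE in ic; rewrite ic; apply/asboolP/extreme_convex.
by case/or3P => /eqP->; apply: K.
Qed.

(** A corner is sent to its vertex and the edge where its angle starts. This is injective: two
    corners with the same image have a common interior point, hence belong to the same face. *)
Lemma sum_corners : (\sum_(j in face_indices) #|corners j| + n <= 2 * #|T|)%N.
Proof.
apply: leq_trans (card_convex_angles n3 gp gT pT.2.2 degT); rewrite leq_add2r.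
pose F (y : ('I_n * 'I_n * bool) * 'I_n) := (y.2, wedge_start p (cyc y.1) y.2).
pose D := [pred y : ('I_n * 'I_n * bool) * 'I_n | (y.1 \in face_indices) && (y.2 \in corners y.1)].
have -> : (\sum_(j in face_indices) #|corners j| = #|D|)%N.
  under eq_bigr do rewrite -sum1_card.
  by rewrite pair_big_dep /= -sum1_card; apply: eq_bigl.
have cy j k : j \in face_indices -> k \in corners j -> [/\ graph_cycle T (cyc j), simple_cycle p (cyc j), k \in cyc j,
    convex_at p (cyc j) k & comp (pt j) = inside p (cyc j)].
  move=> /face_indicesP[/cycP[gc cE] _]; rewrite inE => /andP[kc /asboolP ck].
  by have st := graph_cycle_simple nT gc.
rewrite -(card_in_imset (f := F) (D := D)); last first.
  move=> [j k] [j' k'] /andP[/= h1 h2] /andP[/= h1' h2']; rewrite /F /= => -[kk E].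
  rewrite -kk in h2' E *; have [gc st kc ck cE] := cy _ _ h1 h2; have [gc' st' kc' ck' cE'] := cy _ _ h1' h2'.
  have [w wi wi'] := wedge_common_point n3 gp st st' kc kc' ck ck' E.
  congr pair; apply: (face_indices_inj h1 h1'); rewrite -cE in wi; rewrite -cE' in wi'.
  exact: connected_component_trans wi (connected_component_sym wi').
apply: subset_leq_card; apply/fintype.subsetP => e /imsetP[[j k] /andP[/= h1 h2] ->].
have [gc st kc ck _] := cy _ _ h1 h2; have [_ _ cc] := gc.
have an : adj T k (next (cyc j) k) by exact: next_cycle.
have ap : adj T k (prev (cyc j) k) by rewrite adjC; exact: prev_cycle.
have [b [bE ob _]] := convex_wedge n3 gp st kc ck.
rewrite inE /F /=; apply/andP; split; first by rewrite /wedge_start; case: ifP.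
by apply/existsP; exists b; rewrite ob andbT; case/orP: bE => /eqP->.
Qed.

(** With F faces, F >= n - 2, the other faces use at least 3 (F - 1) of the at most 3n - 6 corners,
    which leaves at most three for this one. *)
Lemma corners_eq3 j : j \in face_indices -> #|corners j| = 3%N.
Proof.
move=> jX; apply/eqP; rewrite eqn_leq corners_ge3 ?(face_indicesP jX).1 // andbT.
have ge : (3 * (#|face_indices| - 1) + #|corners j| <= \sum_(i in face_indices) #|corners i|)%N.
  rewrite (bigD1 j) //= addnC leq_add2l.
  have -> : (#|face_indices| - 1 = #|face_indices :\ j|)%N by rewrite [in LHS](cardsD1 j) jX add1n subn1.
  rewrite mulnC -sum_nat_const; under eq_bigl do rewrite !inE.
  rewrite (eq_bigl (fun i => (i \in face_indices) && (i != j))); last by move=> i; rewrite andbC.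
  by apply: leq_sum => i /andP[/face_indicesP[ii _] _]; exact: corners_ge3.
have F0 : (0 < #|face_indices|)%N by apply/card_gt0P; exists j.
have := sum_corners; have := card_faces_ge; rewrite cT; move: ge F0 n3.
move: #|face_indices| #|corners j| (\sum_(i in face_indices) _)%N => a b c; clear; lia.
Qed.

End FaceCount.

(** * Pointed pseudo-triangulations are the maximal pointed non-crossing graphs *)

Section PointedPseudoTriangulations.
Variables (R : realType) (n : nat) (p : 'I_n -> (R * R)%type).
Hypotheses (n3 : (3 <= n)%N) (gp : general_position p) (lab : labeled_y p).
Variable f : 'I_n -> 'I_n -> R.
Hypothesis valid : forall (w : 'I_n * 'I_n -> R) G, stress p w -> sorted_support w ->
  pointed_noncrossing p G -> (forall e, w e < 0 -> e \in G) -> (exists e, w e != 0) ->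
  \sum_e w e * f e.1 e.2 < 0.
Variable T : {set 'I_n * 'I_n}.
Hypothesis pT : pointed_noncrossing p T.

Lemma maximal_hull_adj i j : #|T| = (2 * n - 3)%N -> ccw_side p finset.setT i j -> adj T i j.
Proof.
move=> cT ij; have /fintype.subsetP H := hull_sub_maximal n3 gp lab valid pT cT.
have /ccw_sideP[_ _ ne _] := ij.
have := ne; rewrite neq_ltn => /orP[] lt; rewrite /adj.
  by rewrite (H (i, j)) //; apply/hull_edgesP; split=> //; apply/hull_edgeP => //; left.
by rewrite (H (j, i)) ?orbT //; apply/hull_edgesP; split=> //; apply/hull_edgeP => //; right.
Qed.

Lemma maximal_pseudo_triangulation : #|T| = (2 * n - 3)%N -> pseudo_triangulation p T.
Proof.
move=> cT; have [gT [nT _]] := pT; have sfT := pnc_stress_free valid pT.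
have hullT i j := @maximal_hull_adj i j cT.
have face := maximal_face n3 gp lab gT nT sfT cT hullT.
split=> //; split=> // x rx.
have [smp smpP] : {smp : 'I_n * 'I_n -> (R * R) * (R * R) * (R * R) &
    forall e, e.1 != e.2 -> sample p e.1 e.2 (smp e).1.1 (smp e).1.2 (smp e).2}.
  apply: (@choice _ _ (fun e (s : (R * R) * (R * R) * (R * R)) => e.1 != e.2 -> sample p e.1 e.2 s.1.1 s.1.2 s.2)) => e.
  have [E|ne] := eqVneq e.1 e.2; first by exists (0, 0, 0).
  by have [m [u [v sa]]] := sample_exists n3 gp ne; exists (m, u, v).
pose comp := connected_component (regions p T).
have [cyc cycP] : {cyc : 'I_n * 'I_n * bool -> seq 'I_n & forall j, inner p T smp j ->
    graph_cycle T (cyc j) /\ comp (flank smp j) = inside p (cyc j)}.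
  apply: (@choice _ _ (fun j t => inner p T smp j -> graph_cycle T t /\ comp (flank smp j) = inside p t)) => j.
  have [/innerP[_ rj]|nj] := boolP (inner p T smp j); last by exists [::].
  by have [t gt cE] := face _ rj; exists t.
have [t gt cE] := face _ rx; have st := graph_cycle_simple nT gt.
have [k kt kd] := first_dart st.
have [m [u [v [j1 [j2 [sa j1T j2T uE vE]]]]]] := adj_sample gT smpP (dart_adj gt kd).
(* One flank of any side of the cycle around [x] is inside it, so the region of [x] is one of the
   counted faces. *)
have [j [jT ij]] : exists j, j.1 \in T /\ inside p t (flank smp j).
  by case: (dart_sample_inside n3 gp st sa kd) => -[h _]; [exists j1|exists j2]; rewrite -?uE -?vE.
have xj : comp x (flank smp j) by rewrite /comp cE.
have inj : inner p T smp j by apply/innerP; split=> //; exact: (connected_component_sub xj).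
have [in0 c0] := face_repr_indexP inj; set j0 := face_repr_index p T smp j in in0 c0.
have [gc0 cE0] := cycP _ in0; have st0 := graph_cycle_simple nT gc0; have [ut0 _ _] := gc0.
have j0X : j0 \in face_indices p T smp by apply: imset_f; rewrite inE.
exists (map p (cyc j0)); split; first by move=> y /mapP[i _ ->]; exists i.
split.
  apply/(pseudo_triangle_map n3 gp ut0); split=> //; rewrite count_card //.
  by rewrite -[RHS](corners_eq3 n3 gp lab pT sfT cT smpP cycP j0X) cardsE.
transitivity (inside p (cyc j0)).
  rewrite -cE0; apply: same_connected_component; exact: connected_component_trans xj c0.
by apply/seteqP; split=> y /(poly_interior_map n3 gp k ut0 y st0).
Qed.

End PointedPseudoTriangulations.

(** A pointed pseudo-triangulation lies in a graph with 2n - 3 edges; if the inclusion were proper,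
    adding one of the missing edges would contradict [ppt_no_extension]. *)
Lemma pptP (R : realType) (n : nat) (p : 'I_n -> (R * R)%type) (f : 'I_n -> 'I_n -> R) :
  (3 <= n)%N -> general_position p -> labeled_y p ->
  (forall (w : 'I_n * 'I_n -> R) G, stress p w -> sorted_support w ->
    pointed_noncrossing p G -> (forall e, w e < 0 -> e \in G) -> (exists e, w e != 0) ->
    \sum_e w e * f e.1 e.2 < 0) ->
  forall T, ppt p T <-> pointed_noncrossing p T /\ #|T| = (2 * n - 3)%N.
Proof.
move=> n3 gp lab valid T; split=> [[tT pT]|[pT cT]]; last first.
  by split; [exact: maximal_pseudo_triangulation lab f valid T pT cT|case: pT => _ []].
have [gT [nT _]] := tT; have pncT : pointed_noncrossing p T by [].
split=> //; have [T' [sub pT' cT']] := extend_to_maximal n3 gp lab valid pncT.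
have [-> //|ne] := eqVneq T T'.
have /fintype.subsetPn[e eT' eT] : ~~ (T' \subset T).
  by apply: contra ne => h; rewrite finset.eqEsubset sub.
have sub' : e |: T \subset T'.
  by apply/fintype.subsetP => i; rewrite !inE => /orP[/eqP->|/(fintype.subsetP sub)].
by case: (ppt_no_extension n3 gp gT tT eT (pnc_sub n3 gp sub' pT')).
Qed.

Theorem theorem3p1 (R : realType) (n : nat) (p : 'I_n -> (R * R)%type) :
  (3 <= n)%N -> general_position p -> labeled_y p ->
  exists f : 'I_n -> 'I_n -> R,
    let Q := Xbar p f in
    let E := Etight p f in
    let X := Xhull p f in
    (* part 1 *)
    simple_polyhedron Q (2 * n - 3) /\
    (forall K, nonempty_face Q K -> pointed_noncrossing p (E K)) /\
    (forall G, pointed_noncrossing p G -> exists K, nonempty_face Q K /\ E K = G) /\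
    (forall K1 K2, nonempty_face Q K1 -> nonempty_face Q K2 ->
       ((forall x, K1 x -> K2 x) <-> E K2 \subset E K1)) /\
    (* (a) vertices <-> pointed pseudo-triangulations *)
    (forall K, nonempty_face Q K -> (affdim K 0 <-> ppt p (E K))) /\
    (* (b) bounded edges <-> ppt minus an interior edge *)
    (forall K, nonempty_face Q K ->
       (affdim K 1 /\ bounded_set_M K <->
        exists T e, ppt p T /\ e \in T /\ ~ hull_edge p e.1 e.2 /\ E K = T :\ e)) /\
    (* (c) extreme rays <-> ppt minus a convex hull edge *)
    (forall K, nonempty_face Q K ->
       (affdim K 1 /\ ~ bounded_set_M K <->
        exists T e, ppt p T /\ e \in T /\ hull_edge p e.1 e.2 /\ E K = T :\ e)) /\
    (* part 2 *)
    nonempty_face Q X /\ bounded_set_M X /\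
    (forall v, is_vertex Q v -> X v) /\
    (forall K, nonempty_face Q K -> bounded_set_M K -> forall x, K x -> X x) /\
    (exists phi : 'M[R]_(n, 2) -> {set 'I_n * 'I_n},
       (forall v, is_vertex X v -> ppt p (phi v)) /\
       (forall T, ppt p T -> exists v, is_vertex X v /\ phi v = T) /\
       (forall u v, is_vertex X u -> is_vertex X v -> phi u = phi v -> u = v) /\
       (forall u v, is_vertex X u -> is_vertex X v ->
          (skel_adj X u v <-> flip p (phi u) (phi v)))).
Proof.
move=> n3 gp lab; have [f valid] := valid_weights n3 gp; exists f.
exact: (polyhedron_structure n3 gp lab valid (pptP n3 gp lab valid)).
Qed.
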